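(* There exists a constant $a_0>0$ such that the following holds. Let $a>0$, $b\in\mathbb{R}$ and let $p>2$ be a real number. In the focusing case assume in addition that $p\le 6$, and, when $p=6$ in the focusing case, assume that $a$ is sufficiently small, namely $a<a_0$. Let $\mu_0=\mu_{a,b}$ be the Gibbs measure conditioned on mass and momentum, $$d\mu_0=Z_0^{-1}e^{\mp\frac1p\int_{\mathbb{T}}|u|^p\,dx}\,dP_0,\qquad Z_0=\int e^{\mp\frac1p\int_{\mathbb{T}}|u|^p\,dx}\,dP_0,$$ where $P_0=P_{0,a,b}$ is the Wiener measure conditioned on mass $a$ and momentum $b$ (the sign $-$ is the defocusing case, the sign $+$ is the focusing case). Then $\mu_0$ is a well-defined probability measure (that is, the limits defining $P_0$ determine a probability measure, and $0<Z_0<\infty$), absolutely continuous with respect to $P_0$. Moreover, $\mu_\varepsilon$ converges weakly to $\mu_0$ as $\varepsilon\to0$, where $$d\mu_\varepsilon=Z_\varepsilon^{-1}e^{\mp\frac1p\int_{\mathbb{T}}|u|^p\,dx}\,dP_\varepsilon,\qquad Z_\varepsilon=\int e^{\mp\frac1p\int_{\mathbb{T}}|u|^p\,dx}\,dP_\varepsilon .$$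
   Context: Notation: $\mathbb{T}=\mathbb{R}/\mathbb{Z}$, $\tilde n=2\pi n$, $\langle\tilde n\rangle=\sqrt{1+\tilde n^2}$. Wiener measure. Let $\{g_n\}_{n\in\mathbb{Z}}$ be independent standard complex Gaussian random variables, meaning that the real and imaginary parts of each $g_n$ are independent real Gaussians with mean $0$ and variance $1$. $P$ denotes the law of the random complex-valued function $$u(x)=\sum_{n\in\mathbb{Z}}\frac{g_n}{\langle\tilde n\rangle}e^{2\pi inx},\qquad x\in\mathbb{T},$$ which is almost surely in $C(\mathbb{T})$ and in $H^s(\mathbb{T})$ for every $s<\frac12$. (Formally $dP=Z^{-1}e^{-\frac12\int_{\mathbb{T}}|u|^2-\frac12\int_{\mathbb{T}}|u_x|^2}\,du$.) Mass and momentum. Under $P$, the mass is $\int_{\mathbb{T}}|u|^2dx=\sum_{n}\langle\tilde n\rangle^{-2}|g_n|^2$ and the momentum is $i\int_{\mathbb{T}}u\overline{u}_x\,dx=\sum_{n}\langle\tilde n\rangle^{-2}\tilde n|g_n|^2$, the latter being understood as the (almost sure and $L^2$) limit of the symmetric partial sums $\sum_{|n|\le K}$ as $K\to\infty$. Conditioned Wiener measures. Fix Borel sets $A_\varepsilon(a)\subset(a-\varepsilon,a+\varepsilon)$ and $B_\varepsilon(b)\subset(b-\varepsilon,b+\varepsilon)$, $\varepsilon>0$, shrinking nicely to $a$ and $b$: there is $\alpha>0$ independent of $\varepsilon$ with $|A_\varepsilon(a)|>\alpha\varepsilon$ and $|B_\varepsilon(b)|>\alpha\varepsilon$ (Lebesgue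 measure). For small $\varepsilon>0$, $P_\varepsilon=P_{\varepsilon,a,b}$ is the elementary conditional probability $$P_\varepsilon(E)=P\Big(E\,\Big|\,\int_{\mathbb{T}}|u|^2\in A_\varepsilon(a),\ i\int_{\mathbb{T}}u\overline{u}_x\in B_\varepsilon(b)\Big).$$ The conditioned Wiener measure $P_0=P_{0,a,b}$ is the probability measure determined by $P_0(E)=\lim_{\varepsilon\to0}P_\varepsilon(E)$ for all events $E$ of the form $\{(g_n)_{|n|\le N}\in F\}$, with $N\ge0$ an integer and $F\subset\mathbb{C}^{2N+1}$ Borel (here $g_n=\langle\tilde n\rangle\hat u_n$). Weak convergence of $\mu_\varepsilon$ to $\mu_0$ means convergence of $\int f\,d\mu_\varepsilon$ to $\int f\,d\mu_0$ for every bounded continuous function $f$ on $H^{\frac12-\gamma}(\mathbb{T})$, where $\gamma>0$ is a small number ($0<\gamma<1/p$); $\mu_\varepsilon$ is considered for sufficiently small $\varepsilon>0$. *)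

(* Defs.v *)
From HB Require Import structures.
From mathcomp Require Import all_boot all_order all_algebra.
From mathcomp Require Import finmap complex.
From mathcomp Require Import all_classical all_reals all_analysis.
From mathcomp Require Import measurable_realfun ring lra.
Set Implicit Arguments.
Unset Strict Implicit.
Unset Printing Implicit Defensive.
Import Order.TTheory GRing.Theory Num.Theory.
Import numFieldNormedType.Exports.
Import ComplexField.Normc.
Local Open Scope classical_set_scope.
Local Open Scope complex_scope.
Local Open Scope ring_scope.

Section torus.
Variable R : realType.
Implicit Types (f : R -> R[i]) (n : int) (s x : R).

(* [freq n] is 2 pi n, written with a tilde over n in the literature. *)
Definition freq n : R := 2 * pi * n%:~R.
Definition japanese n : R := Num.sqrt (1 + freq n ^+ 2).

Definition expi n x : R[i] := cos (freq n * x) +i* sin (freq n * x).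

Definition cintegral f : R[i] :=
  (\int[lebesgue_measure]_(x in `[0, 1]) complex.Re (f x)) +i*
  (\int[lebesgue_measure]_(x in `[0, 1]) complex.Im (f x)).

Definition fourier f n : R[i] := cintegral (fun x => f x * expi (- n) x).

Definition Lp_int (p : R) f : \bar R :=
  (\int[lebesgue_measure]_(x in `[0%R, 1%R]) (normc (f x) `^ p)%:E)%E.

Definition Hs_norm s f : \bar R :=
  sqrte (\esum_(n in [set: int])
    (japanese n `^ (2 * s) * normc (fourier f n) ^+ 2)%:E)%E.

(* H^s(T) for s >= 0, where T = R/Z: square integrable 1-periodic functions of
   finite H^s norm.  Functions are not quotiented by a.e. equality, so the H^s
   distance below is only a pseudometric. *)
Record Hs s := MkHs {
  Hs_fun :> R -> R[i];
  Hs_periodic : forall x, Hs_fun (x + 1) = Hs_fun x;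
  Hs_measurable_Re : measurable_fun [set: R] (fun x => complex.Re (Hs_fun x));
  Hs_measurable_Im : measurable_fun [set: R] (fun x => complex.Im (Hs_fun x));
  Hs_L2 : (Lp_int 2 Hs_fun < +oo)%E;
  Hs_fin : (Hs_norm s Hs_fun < +oo)%E }.

Definition Hs_ball s (u : Hs s) (e : R) : set (Hs s) :=
  [set v | (Hs_norm s (fun x => u x - v x)%R < e%:E)%E].

End torus.

Section Hs_topology.
Variable R : realType.
Local Notation leb := (@lebesgue_measure R).
Implicit Types (n : int) (s : R).

Lemma normc_sqr (z : R[i]) : normc z ^+ 2 = complex.Re z ^+ 2 + complex.Im z ^+ 2.
Proof. by case: z => a b /=; rewrite sqr_sqrtr// addr_ge0// sqr_ge0. Qed.

Lemma normc_ge0 (z : R[i]) : 0 <= normc z.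
Proof. by case: z => a b; rewrite sqrtr_ge0. Qed.

Lemma Hs_sqr_integrable s (u : Hs s) :
  leb.-integrable `[0, 1] (EFin \o (fun x => 1 + normc (u x) ^+ 2)).
Proof.
have h := Hs_L2 u.
have mR : measurable_fun `[(0:R), 1] (fun x => complex.Re (u x)).
  by apply: measurable_funTS; exact: Hs_measurable_Re.
have mI : measurable_fun `[(0:R), 1] (fun x => complex.Im (u x)).
  by apply: measurable_funTS; exact: Hs_measurable_Im.
have mN : measurable_fun `[(0:R), 1] (fun x => normc (u x) ^+ 2).
  rewrite (_ : (fun x => _) =
    (fun x => complex.Re (u x) ^+ 2 + complex.Im (u x) ^+ 2)); last first.
    by apply/funext => x; rewrite normc_sqr.
  by apply: measurable_funD; exact: measurable_funX.
have i2 : leb.-integrable `[0, 1] (EFin \o (fun x => normc (u x) ^+ 2)).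
  apply/integrableP; split; first exact/measurable_EFinP.
  apply: le_lt_trans h; apply: ge0_le_integral => //=.
  - by do 2 apply: measurableT_comp => //.
  - apply/measurable_EFinP; rewrite (_ : (fun x => _) =
      (fun x => normc (u x) ^+ 2)) //.
    by apply/funext => x; rewrite powR_mulrn ?normc_ge0.
  - by move=> x _; rewrite powR_mulrn ?normc_ge0// ger0_norm// sqr_ge0.
rewrite (_ : _ \o _ = (EFin \o cst 1) \+ (EFin \o (fun x => normc (u x) ^+ 2)))//.
apply: integrableD => //.
apply: (@continuous_compact_integrable R) => //; first exact: segment_compact.
by move=> x; exact: cvg_cst.
Qed.

Lemma fourierB s (u v : Hs s) n :
  fourier (fun x => u x - v x) n = fourier u n - fourier v n.
Proof.
have mc (m : int) : measurable_fun [set: R] (fun x => cos (freq R m * x)).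
  apply: measurableT_comp; last exact: measurable_funM.
  by apply: continuous_measurable_fun => x; exact: continuous_cos.
have ms (m : int) : measurable_fun [set: R] (fun x => sin (freq R m * x)).
  apply: measurableT_comp; last exact: measurable_funM.
  by apply: continuous_measurable_fun => x; exact: continuous_sin.
have bnd (a b c d : R) : c ^+ 2 + d ^+ 2 = 1 ->
    `|a * c - b * d| <= 1 + (a ^+ 2 + b ^+ 2).
  move=> cd; suff : (a * c - b * d) ^+ 2 <= a ^+ 2 + b ^+ 2.
    move: (a * c - b * d) => t ht; rewrite ler_norml; apply/andP; split; nra.
  have -> : a ^+ 2 + b ^+ 2 = (a ^+ 2 + b ^+ 2) * (c ^+ 2 + d ^+ 2) by rewrite cd mulr1.
  have := sqr_ge0 (a * d + b * c); nra.
have iR (w : Hs s) : leb.-integrable `[0, 1]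
    (EFin \o (fun x => complex.Re (w x * expi (- n) x))).
  apply: le_integrable (Hs_sqr_integrable w) => //.
    apply: measurable_funTS; apply/measurable_EFinP.
    rewrite (_ : (fun x => _) = (fun x => complex.Re (w x) * cos (freq R (- n) * x)
        - complex.Im (w x) * sin (freq R (- n) * x))); last first.
      by apply/funext => x; case: (w x).
    apply: measurable_funB; apply: measurable_funM.
    - exact: (Hs_measurable_Re w).
    - exact: mc.
    - exact: (Hs_measurable_Im w).
    - exact: ms.
  move=> x _ /=; rewrite lee_fin normc_sqr [leRHS]ger0_norm; last first.
    by rewrite !addr_ge0 ?sqr_ge0.
  by case: (w x) => a b /=; apply: bnd; rewrite cos2Dsin2.
have iI (w : Hs s) : leb.-integrable `[0, 1]
    (EFin \o (fun x => complex.Im (w x * expi (- n) x))).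
  apply: le_integrable (Hs_sqr_integrable w) => //.
    apply: measurable_funTS; apply/measurable_EFinP.
    rewrite (_ : (fun x => _) = (fun x => complex.Re (w x) * sin (freq R (- n) * x)
        + complex.Im (w x) * cos (freq R (- n) * x))); last first.
      by apply/funext => x; case: (w x).
    apply: measurable_funD; apply: measurable_funM.
    - exact: (Hs_measurable_Re w).
    - exact: ms.
    - exact: (Hs_measurable_Im w).
    - exact: mc.
  move=> x _ /=; rewrite lee_fin normc_sqr [leRHS]ger0_norm; last first.
    by rewrite !addr_ge0 ?sqr_ge0.
  case: (w x) => a b /=; rewrite -[b * _]opprK -mulrN.
  by apply: bnd; rewrite sqrrN addrC cos2Dsin2.
rewrite /fourier /cintegral.
have -> : forall a b c d : R, (a +i* b) - (c +i* d) = (a - c) +i* (b - d) by [].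
congr (_ +i* _).
- rewrite -RintegralB//; apply: eq_Rintegral => x _.
  by rewrite mulrBl; case: (u x * _) (v x * _) => [? ?] [? ?].
- rewrite -RintegralB//; apply: eq_Rintegral => x _.
  by rewrite mulrBl; case: (u x * _) (v x * _) => [? ?] [? ?].
Qed.

Lemma sqrte_lt (x : \bar R) (e : R) : (0 <= x)%E ->
  (sqrte x < e%:E)%E <-> 0 < e /\ (x < (e ^+ 2)%:E)%E.
Proof.
move=> x0; have key : 0 < e -> (sqrte x < e%:E)%E = (x < (e ^+ 2)%:E)%E.
  move=> e0; have -> : e%:E = sqrte ((e ^+ 2)%:E).
    by rewrite /= sqrtr_sqr gtr0_norm.
  by rewrite !ltNge lee_sqrt.
split => [h|[e0]]; last by rewrite key.
have e0 : 0 < e by rewrite -lte_fin (le_lt_trans _ h)// sqrte_ge0.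
by rewrite -key.
Qed.

Lemma esumZ_le (T : choiceType) (S : set T) (c : R) (a : T -> \bar R) :
  0 <= c -> (forall i, 0 <= a i)%E ->
  (\esum_(i in S) (c%:E * a i) <= c%:E * \esum_(i in S) a i)%E.
Proof.
move=> c0 a0; apply: ge_ereal_sup => _ [F FS <-].
rewrite -ge0_mule_fsumr// lee_wpmul2l//.
by apply: ereal_sup_ubound; exists F.
Qed.

Lemma normc_sqrD (a b : R[i]) (t : R) : 0 < t ->
  normc (a + b) ^+ 2 <= (1 + t) * normc a ^+ 2 + (1 + t^-1) * normc b ^+ 2.
Proof.
move=> t0; rewrite !normc_sqr.
case: a b => [a1 a2] [b1 b2] /=.
have key (x y : R) : (x + y) ^+ 2 <= (1 + t) * x ^+ 2 + (1 + t^-1) * y ^+ 2.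
  rewrite -subr_ge0.
  have -> : (1 + t) * x ^+ 2 + (1 + t^-1) * y ^+ 2 - (x + y) ^+ 2 =
      t^-1 * (t * x - y) ^+ 2 by field; rewrite gt_eqF.
  by rewrite mulr_ge0 ?sqr_ge0// invr_ge0 ltW.
have := key a1 b1; have := key a2 b2; lra.
Qed.

Lemma Hs_ball_center s (u : Hs s) (e : R) : 0 < e -> Hs_ball u e u.
Proof.
move=> e0; rewrite /Hs_ball /= /Hs_norm esum1 ?sqrte0// => n _.
by rewrite fourierB subrr normc0 expr0n mulr0.
Qed.

Lemma Hs_ball_sym s (u v : Hs s) (e : R) : Hs_ball u e v -> Hs_ball v e u.
Proof.
rewrite /Hs_ball /= /Hs_norm; congr (sqrte _ < _)%E.
apply: eq_esum => n _; rewrite !fourierB; congr (_ * _)%:E.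
by rewrite !normc_sqr; case: (fourier u n) (fourier v n) => [a b] [c d] /=; ring.
Qed.

Lemma Hs_ball_triangle s (u v z : Hs s) (e1 e2 : R) :
  Hs_ball u e1 v -> Hs_ball v e2 z -> Hs_ball u (e1 + e2) z.
Proof.
have term_ge0 (f : R -> R[i]) n :
    (0 <= (japanese R n `^ (2 * s) * normc (fourier f n) ^+ 2)%:E)%E.
  by rewrite lee_fin mulr_ge0 ?powR_ge0 ?sqr_ge0.
rewrite /Hs_ball /= /Hs_norm => h1 h2.
have [e1_gt0 {}h1] := (sqrte_lt e1 (esum_ge0 (fun n _ => term_ge0 _ n))).1 h1.
have [e2_gt0 {}h2] := (sqrte_lt e2 (esum_ge0 (fun n _ => term_ge0 _ n))).1 h2.
apply/sqrte_lt; first exact: esum_ge0.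
split; first exact: addr_gt0.
pose t := e2 / e1; have t0 : 0 < t by rewrite divr_gt0.
pose F (f : R -> R[i]) n := (japanese R n `^ (2 * s) * normc (fourier f n) ^+ 2)%:E.
have F0 f n : (0 <= F f n)%E by exact: term_ge0.
have le1 : (\esum_(n in [set: int]) F (fun x => (u x - z x)%R) n <=
    \esum_(n in [set: int]) ((1 + t)%:E * F (fun x => (u x - v x)%R) n +
                 (1 + t^-1)%:E * F (fun x => (v x - z x)%R) n))%E.
  apply: le_esum => n _; rewrite /F -!EFinM -EFinD lee_fin !fourierB.
  rewrite (_ : fourier u n - fourier z n =
    (fourier u n - fourier v n) + (fourier v n - fourier z n)); last first.
    by rewrite addrA subrK.
  rewrite [in leRHS](mulrCA (1 + t)) [in leRHS](mulrCA (1 + t^-1)) -mulrDr.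
  by rewrite ler_wpM2l ?powR_ge0//; exact: normc_sqrD.
apply: le_lt_trans le1 _; rewrite esumD; last 2 first.
- by move=> n _; rewrite mule_ge0// lee_fin addr_ge0// ltW.
- by move=> n _; rewrite mule_ge0// lee_fin addr_ge0// invr_ge0 ltW.
rewrite (_ : (e1 + e2) ^+ 2 = (1 + t) * e1 ^+ 2 + (1 + t^-1) * e2 ^+ 2); last first.
  by rewrite /t; field; rewrite !gt_eqF.
rewrite [ltRHS]EFinD; apply: lteD.
- apply: (@le_lt_trans _ _ ((1 + t)%:E * \esum_(n in [set: int])
      F (fun x => (u x - v x)%R) n)%E).
    by apply: esumZ_le => //; rewrite addr_ge0// ltW.
  by rewrite [ltRHS]EFinM lte_pmul2l// lte_fin addr_gt0.
- apply: (@le_lt_trans _ _ ((1 + t^-1)%:E * \esum_(n in [set: int])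
      F (fun x => (v x - z x)%R) n)%E).
    by apply: esumZ_le => //; rewrite addr_ge0// invr_ge0 ltW.
  by rewrite [ltRHS]EFinM lte_pmul2l// lte_fin addr_gt0// invr_gt0.
Qed.

End Hs_topology.

Section Hs_instances.
Variables (R : realType) (s : R).

Let zero : R -> R[i] := fun=> 0.

Let fourier_zero n : fourier zero n = 0.
Proof.
rewrite /fourier /cintegral /zero; under eq_Rintegral do rewrite mul0r.
under [X in _ +i* X]eq_Rintegral do rewrite mul0r.
by rewrite /= !Rintegral_cst//= !mul0r.
Qed.

Let zero_L2 : (Lp_int 2 zero < +oo)%E.
Proof.
rewrite /Lp_int integral0_eq// => x _.
by rewrite /zero normc0 powR0// pnatr_eq0.
Qed.

Let zero_fin : (Hs_norm s zero < +oo)%E.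
Proof.
rewrite /Hs_norm esum1 ?sqrte0// => n _.
by rewrite fourier_zero normc0 expr0n mulr0.
Qed.

Definition Hs0 : Hs s := @MkHs R s zero (fun=> erefl)
  (measurable_cst _) (measurable_cst _) zero_L2 zero_fin.

HB.instance Definition _ := gen_eqMixin (Hs s).
HB.instance Definition _ := gen_choiceMixin (Hs s).
HB.instance Definition _ := isPointed.Build (Hs s) Hs0.
HB.instance Definition _ := hasNbhs.Build (Hs s)
  (nbhs_ (entourage_ (@Hs_ball R s))).
HB.instance Definition _ := @Nbhs_isPseudoMetric.Build R (Hs s)
  (entourage_ (@Hs_ball R s)) erefl (@Hs_ball R s)
  (@Hs_ball_center R s) (@Hs_ball_sym R s) (@Hs_ball_triangle R s) erefl.

End Hs_instances.

Definition borelHs (R : realType) (s : R) : Type :=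
  g_sigma_algebraType (@open (Hs s)).
HB.instance Definition _ (R : realType) (s : R) :=
  Measurable.on (@borelHs R s).

Section gaussian_series.
Variables (R : realType) (d : measure_display) (Omega : measurableType d).
Variable Pr : probability Omega R.
Local Open Scope ereal_scope.

Definition independent_RVs (I : choiceType) (d' : measure_display)
    (T : measurableType d') (X : I -> {RV Pr >-> T}) :=
  forall (J : {fset I}) (E : I -> set T), (forall i, measurable (E i)) ->
    Pr (\bigcap_(i in [set` J]) (X i @^-1` E i)) =
    \prod_(i <- J) Pr (X i @^-1` E i).

(* A complex random variable is given as the pair (real part, imaginary part),
   so that R * R carries the Borel sets of the complex plane. *)
Definition standard_complex_gaussian (Z : {RV Pr >-> (R * R)%type}) :=
  [/\ forall A : set R, measurable A ->
        Pr [set w | A (Z w).1] = normal_prob 0 1 A,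
      forall B : set R, measurable B ->
        Pr [set w | B (Z w).2] = normal_prob 0 1 B &
      forall A B : set R, measurable A -> measurable B ->
        Pr [set w | A (Z w).1 /\ B (Z w).2] =
        Pr [set w | A (Z w).1] * Pr [set w | B (Z w).2]].

End gaussian_series.

(* The frequencies -K, ..., K. *)
Definition symfreq (K : nat) (i : 'I_(K.*2.+1)) : int := i%:Z - K%:Z.

Definition gauss_partial_sum (R : realType) (g : int -> R * R) (K : nat)
    (x : R) : R[i] :=
  \sum_(i < K.*2.+1) let n := symfreq i in
    ((g n).1 +i* (g n).2) / (japanese R n)%:C * expi n x.

Definition gauss_fourier_series (R : realType) (s : R) (d : measure_display)
    (Omega : measurableType d) (Pr : probability Omega R)
    (g : int -> {RV Pr >-> (R * R)%type}) (u : {RV Pr >-> borelHs s}) :=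
  {ae Pr, forall w,
    Hs_norm s (fun x => (u w : Hs s) x - gauss_partial_sum (fun n => g n w) K x)
      @[K --> \oo] --> 0%E}.

Section conditioned.
Variables (R : realType) (s : R).
Implicit Types (u : Hs s) (A B : set R) (P Q mu : probability (borelHs s) R).

Definition mass u : R :=
  \int[lebesgue_measure]_(x in `[0, 1]) (normc (u x) ^+ 2).

(* The momentum i \int u \bar u_x dx is \sum_n 2 pi n |u_n|^2, with u_n the
   Fourier coefficients; this series need not converge absolutely, and its value
   is the limit of its symmetric partial sums. *)
Definition momentum_partial_sum u (K : nat) : R :=
  \sum_(i < K.*2.+1) let n := symfreq i in
    freq R n * normc (fourier u n) ^+ 2.

Definition mass_momentum_event A B : set (borelHs s) :=
  [set u | A (mass u) /\ cvgn (momentum_partial_sum u) /\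
           B (limn (momentum_partial_sum u))].

Definition shrinks_nicely (A : R -> set R) (a : R) :=
  exists2 alpha, 0 < alpha & forall e, 0 < e ->
    [/\ measurable (A e), A e `<=` `]a - e, a + e[ &
        ((alpha * e)%:E < lebesgue_measure (A e))%E].

Definition elementary_conditional P (C : set (borelHs s)) Q :=
  (0 < P C)%E /\
  forall E, measurable E -> Q E = (fine (P (E `&` C)) / fine (P C))%:E.

(* The event {(g_n)_{|n| <= N} in F}, where g_n is <2 pi n> times the n-th
   Fourier coefficient. *)
Definition cylinder (N : nat) (F : set ((N.*2.+1).-tuple (R * R))) :
    set (borelHs s) :=
  [set u | F [tuple
     let z := (japanese R (symfreq i))%:C * fourier (u : Hs s) (symfreq i) in
     (complex.Re z, complex.Im z) | i < N.*2.+1]].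

Definition cylinder_limit (Pe : R -> probability (borelHs s) R) Q :=
  forall (N : nat) (F : set ((N.*2.+1).-tuple (R * R))), measurable F ->
    Pe e (cylinder F) @[e --> 0^'+] --> Q (cylinder F).

(* The exponent is extended real valued, so the weight is +oo (focusing) or 0
   (defocusing) at a function outside L^p. *)
Definition gibbs_weight (focusing : bool) (p : R) (u : borelHs s) : \bar R :=
  expeR (((if focusing then 1 else -1) / p)%:E * Lp_int p (u : Hs s))%E.

Definition partition_function (focusing : bool) (p : R) Q : \bar R :=
  (\int[Q]_u gibbs_weight focusing p u)%E.

Definition gibbs (focusing : bool) (p : R) Q mu :=
  [/\ (0 < partition_function focusing p Q)%E,
      (partition_function focusing p Q < +oo)%E &
      forall E, measurable E ->
        mu E = ((fine (partition_function focusing p Q))^-1%:E *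
                \int[Q]_(u in E) gibbs_weight focusing p u)%E].

Definition weak_limit (mue : R -> probability (borelHs s) R) mu :=
  forall f : Hs s -> R, continuous f -> (exists M, forall u, `|f u| <= M) ->
    (\int[mue e]_u (f u)%:E)%E @[e --> 0^'+] --> (\int[mu]_u (f u)%:E)%E.

End conditioned.

(* Main.v *)
(** Two modes m <> n of the Gaussian series can be resampled given all the others:
    |g_m|^2 and |g_n|^2 are independent exponential variables, so, given the other
    modes, (mass, momentum) is an invertible affine image of (|u_m|^2, |u_n|^2) and
    has an explicit density.  Hence
      E[Psi; mass in A, momentum in B] = int_A int_B G_Psi,
    where G_Psi(y) is the expectation of this density at y times Psi(u_y), and u_y is
    u with the moduli of modes m and n readjusted so that (mass, momentum) = y.
    P_0 is the normalised functional Psi |-> G_Psi(a, b), and everything follows from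
    the continuity of G_Psi at (a, b), by dominated convergence, and from G_1(a, b) > 0:
    cylinder functions Psi are independent of modes m, n that lie outside their range,
    bounded continuous Psi and the Gibbs weight are continuous along u_y.

    The domination of the focusing weight is an exponential integrability statement for
    int |u|^p on {mass <= M}.  With B = sum_k 4^-k sum_j exp(2^k |d_(k,j) u|^2 / 64),
    d_(k,j) u the increment of u over the j-th dyadic interval of length 2^-k, E[B] is
    bounded, and chaining combined with the mass bound gives
    sup |u|^4 <= C M log B + C_M.  So exp(c int |u|^p) <= C' B for every c if p < 6, and
    for c M^2 small if p = 6. *)
From HB Require Import structures.
From mathcomp Require Import all_boot all_order all_algebra.
From mathcomp Require Import finmap complex.
From mathcomp Require Import all_classical all_reals all_analysis.
From mathcomp Require Import measurable_realfun ring lra zify.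
Require Import Defs.
Set Implicit Arguments.
Unset Strict Implicit.
Unset Printing Implicit Defensive.
Import Order.TTheory GRing.Theory Num.Theory.
Import numFieldNormedType.Exports.
Import ComplexField.Normc.
Local Open Scope classical_set_scope.
Local Open Scope complex_scope.
Local Open Scope ring_scope.

(** P_0 is carried by a [P]-null set, so a property that holds [P]-almost surely need not survive
    the conditioning, and the momentum is only an almost sure limit of partial sums; explicit
    densities take the place of a soft limit argument. Three obstacles shape them. The density of an
    exponential variable jumps at 0, so continuity of G_Psi at (a, b) requires the two readjusted
    masses at (a, b) to be almost surely nonzero; the density of a third mode gives this. Positivity
    of G_1(a, b) is accessible for a pair of large opposite frequencies; it passes to every other
    pair because the quotients that converge to G_1(a, b) do not mention the pair. The same
    uniqueness of limits lets each cylinder event choose a pair outside its range. In the focusing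
    case the dominating function must not depend on y, so exponential integrability is proved for u
    with modes m and n removed, at mass at most 2a. Finally gamma < 1/p is the condition of the
    Sobolev embedding, which makes the L^p norm finite and continuous on the whole of H^s. *)

#[global] Arguments normc : simpl never.
#[global] Arguments fourier : simpl never.

(** * Fourier modes and Parseval's identity *)

Section trigonometric.
Variable R : realType.
Implicit Types (n m k : int) (x y : R) (c : R[i]).
Local Notation leb := (@lebesgue_measure R).
Local Notation D := (`[0%R, 1%R]%classic : set R).

Lemma ReD (a b : R[i]) : complex.Re (a + b) = complex.Re a + complex.Re b.
Proof. by case: a b => [? ?] [? ?]. Qed.

Lemma ImD (a b : R[i]) : complex.Im (a + b) = complex.Im a + complex.Im b.
Proof. by case: a b => [? ?] [? ?]. Qed.

Lemma freqD n m : freq R (n + m) = freq R n + freq R m.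
Proof. by rewrite /freq rmorphD /= mulrDr. Qed.

Lemma freqN n : freq R (- n) = - freq R n.
Proof. by rewrite /freq rmorphN /= mulrN. Qed.

Lemma freq0 : freq R 0 = 0.
Proof. by rewrite /freq mulr0. Qed.

Lemma freq_eq0 n : (freq R n == 0) = (n == 0).
Proof. by rewrite /freq !mulf_eq0 pnatr_eq0 /= intr_eq0 (gt_eqF (pi_gt0 R)). Qed.

Lemma expiD n m x : expi (n + m) x = expi n x * expi m x.
Proof.
have mulE (a b c d : R) : (a +i* b) * (c +i* d) = (a * c - b * d) +i* (a * d + b * c).
  by [].
by rewrite /expi mulE freqD mulrDl cosD sinD [X in _ +i* X]addrC.
Qed.

Lemma normc_expi n x : normc (expi n x) = 1.
Proof. by rewrite /normc /expi cos2Dsin2 sqrtr1. Qed.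

Lemma cos_freq_period n : cos (freq R n) = 1 /\ sin (freq R n) = 0.
Proof.
suff H (k : nat) : cos (freq R k%:Z) = 1 /\ sin (freq R k%:Z) = 0.
  case: n => k; first exact: H.
  by rewrite NegzE freqN cosN sinN; have [-> ->] := H k.+1; rewrite oppr0.
elim: k => [|k [IHc IHs]]; first by rewrite freq0 cos0 sin0.
rewrite -addn1 PoszD freqD; have -> : freq R 1 = pi *+ 2 by rewrite /freq mulr1 mulr_natl.
by rewrite cosD sinD cos2pi sin2pi IHc IHs; split; ring.
Qed.

Lemma expi_periodic n x : expi n (x + 1) = expi n x.
Proof.
have [hc hs] := cos_freq_period n.
rewrite /expi mulrDr mulr1 cosD sinD hc hs; congr (_ +i* _); ring.
Qed.

Lemma continuous_cosM (a : R) : continuous (fun x => cos (a * x)).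
Proof.
move=> x; apply: continuous_comp; last exact: continuous_cos.
by apply: cvgM; [exact: cvg_cst|exact: cvg_id].
Qed.

Lemma continuous_sinM (a : R) : continuous (fun x => sin (a * x)).
Proof.
move=> x; apply: continuous_comp; last exact: continuous_sin.
by apply: cvgM; [exact: cvg_cst|exact: cvg_id].
Qed.

Lemma measurable_cosM (a : R) (E : set R) : measurable_fun E (fun x => cos (a * x)).
Proof. apply: measurable_funTS; apply: continuous_measurable_fun; exact: continuous_cosM. Qed.

Lemma measurable_sinM (a : R) (E : set R) : measurable_fun E (fun x => sin (a * x)).
Proof. apply: measurable_funTS; apply: continuous_measurable_fun; exact: continuous_sinM. Qed.

Lemma integrable_continuous01 (h : R -> R) : continuous h ->
  leb.-integrable D (EFin \o h).
Proof.
move=> hc; apply: continuous_compact_integrable; first exact: segment_compact.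
exact: continuous_subspaceT.
Qed.

Lemma Rintegral_FTC01 (f F : R -> R) : continuous f ->
  (forall x, is_derive x 1 F (f x)) -> \int[leb]_(x in D) f x = F 1 - F 0.
Proof.
move=> fc dF; rewrite /Rintegral (@continuous_FTC2 _ f F 0 1) //=.
- exact: continuous_subspaceT.
- have cF x : {for x, continuous F}.
    by apply/differentiable_continuous/derivable1_diffP; have [] := dF x.
  split; first by move=> x _; have [] := dF x.
    by apply: cvg_at_right_filter; exact: cF.
  by apply: cvg_at_left_filter; exact: cF.
- by move=> x _; rewrite derive1E; have [_ ->] := dF x.
Qed.

Lemma is_derive_sinM (a x : R) : is_derive x 1 (fun y => sin (a * y)) (a * cos (a * x)).
Proof.
have d : is_derive x 1 ( *%R a) a.
  have h := is_deriveZ a (is_derive_id x (1 : R)).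
  have -> : *%R a = a \*: @id R by [].
  by apply: (is_derive_eq h); rewrite /GRing.scale /= mulr1.
by apply: (is_derive_eq (is_derive1_comp (is_derive_sin (a * x)) d)); rewrite mulrC.
Qed.

Lemma is_derive_cosM (a x : R) : is_derive x 1 (fun y => cos (a * y)) (- a * sin (a * x)).
Proof.
have d : is_derive x 1 ( *%R a) a.
  have h := is_deriveZ a (is_derive_id x (1 : R)).
  have -> : *%R a = a \*: @id R by [].
  by apply: (is_derive_eq h); rewrite /GRing.scale /= mulr1.
by apply: (is_derive_eq (is_derive1_comp (is_derive_cos (a * x)) d)); ring.
Qed.

Lemma Rintegral_cos_freq n : \int[leb]_(x in D) cos (freq R n * x) = (n == 0)%:R.
Proof.
have [->|n0] := eqVneq n 0.
  rewrite freq0; under eq_Rintegral do rewrite mul0r cos0.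
  by rewrite Rintegral_cst//= lebesgue_measure_itv /= lte01 -EFinD subr0 mul1r.
have f0 : freq R n != 0 by rewrite freq_eq0.
have d x : is_derive x 1 (fun x => (freq R n)^-1 * sin (freq R n * x)) (cos (freq R n * x)).
  apply: (is_derive_eq (is_deriveZ (freq R n)^-1 (is_derive_sinM (freq R n) x))).
  by rewrite /GRing.scale /= mulKf.
rewrite (Rintegral_FTC01 _ d); last exact: continuous_cosM.
rewrite mulr1 mulr0 sin0 mulr0 subr0.
by have [_ ->] := cos_freq_period n; rewrite mulr0.
Qed.

Lemma Rintegral_sin_freq n : \int[leb]_(x in D) sin (freq R n * x) = 0.
Proof.
have [->|n0] := eqVneq n 0.
  rewrite freq0; under eq_Rintegral do rewrite mul0r sin0.
  by rewrite Rintegral_cst//= mul0r.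
have f0 : freq R n != 0 by rewrite freq_eq0.
have d x : is_derive x 1 (fun x => (- freq R n)^-1 * cos (freq R n * x)) (sin (freq R n * x)).
  apply: (is_derive_eq (is_deriveZ (- freq R n)^-1 (is_derive_cosM (freq R n) x))).
  by rewrite /GRing.scale /= mulKf // oppr_eq0.
rewrite (Rintegral_FTC01 _ d); last exact: continuous_sinM.
rewrite mulr1 mulr0 cos0.
by have [-> _] := cos_freq_period n; rewrite subrr.
Qed.

Lemma cintegralD (f g : R -> R[i]) :
  leb.-integrable D (EFin \o (fun x => complex.Re (f x))) ->
  leb.-integrable D (EFin \o (fun x => complex.Im (f x))) ->
  leb.-integrable D (EFin \o (fun x => complex.Re (g x))) ->
  leb.-integrable D (EFin \o (fun x => complex.Im (g x))) ->
  cintegral (fun x => f x + g x) = cintegral f + cintegral g.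
Proof.
move=> fr fi gr gi; rewrite /cintegral.
have -> : forall a b c d : R, (a +i* b) + (c +i* d) = (a + c) +i* (b + d) by [].
by rewrite -!RintegralD//; congr (_ +i* _);
  apply: eq_Rintegral => x _; case: (f x) (g x) => [? ?] [? ?].
Qed.

Lemma integrable_Zexpi c n :
  leb.-integrable D (EFin \o (fun x => complex.Re (c * expi n x))) /\
  leb.-integrable D (EFin \o (fun x => complex.Im (c * expi n x))).
Proof.
case: c => a b; split; apply: integrable_continuous01 => x /=.
  by apply: cvgB; apply: cvgM; [exact: cvg_cst|exact: continuous_cosM|exact: cvg_cst|exact: continuous_sinM].
by apply: cvgD; apply: cvgM; [exact: cvg_cst|exact: continuous_sinM|exact: cvg_cst|exact: continuous_cosM].
Qed.

Lemma cintegral_Zexpi c n : cintegral (fun x => c * expi n x) = if n == 0 then c else 0.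
Proof.
have iC := integrable_continuous01 (@continuous_cosM (freq R n)).
have iS := integrable_continuous01 (@continuous_sinM (freq R n)).
have iZ (a : R) (h : R -> R) : leb.-integrable D (EFin \o h) ->
    leb.-integrable D (EFin \o (fun x => a * h x)).
  move=> ih; rewrite (_ : EFin \o _ = (fun x => a%:E * (EFin \o h) x)%E); last first.
    by apply/funext => x; rewrite /= EFinM.
  exact: integrableZl.
case: c => a b; rewrite /cintegral /=.
rewrite RintegralB ?RintegralD//; do ?exact: iZ.
rewrite !RintegralZl// Rintegral_cos_freq Rintegral_sin_freq.
by case: eqP => _ /=; congr (_ +i* _); ring.
Qed.

End trigonometric.

(** * Changing finitely many Fourier modes of a function *)

Section fourier_modes.
Variables (R : realType) (s : R).
Implicit Types (n m k : int) (x y : R) (c : R[i]) (u v : Hs s) (f : R -> R[i]).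
Local Notation leb := (@lebesgue_measure R).
Local Notation D := (`[0%R, 1%R]%classic : set R).

Lemma normr_Re_le (z : R[i]) : `|complex.Re z| <= normc z.
Proof.
by case: z => a b /=; rewrite -(sqrtr_sqr a) ler_wsqrtr// lerDl sqr_ge0.
Qed.

Lemma normr_Im_le (z : R[i]) : `|complex.Im z| <= normc z.
Proof.
by case: z => a b /=; rewrite -(sqrtr_sqr b) ler_wsqrtr// lerDr sqr_ge0.
Qed.

Definition measurableC f :=
  measurable_fun [set: R] (fun x => complex.Re (f x)) /\
  measurable_fun [set: R] (fun x => complex.Im (f x)).

Lemma measurableC_Hs u : measurableC u.
Proof. by split; [exact: Hs_measurable_Re|exact: Hs_measurable_Im]. Qed.

Lemma measurableC_Zexpi c n : measurableC (fun x => c * expi n x).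
Proof.
have mc := @measurable_cosM R (freq R n) setT.
have ms := @measurable_sinM R (freq R n) setT.
by case: c => a b; split => /=; [apply: measurable_funB|apply: measurable_funD];
  exact: measurable_funM.
Qed.

Lemma measurableC_add f (g : R -> R[i]) : measurableC f -> measurableC g ->
  measurableC (fun x => f x + g x).
Proof.
move=> [fr fi] [gr gi]; split.
  by under eq_fun do rewrite ReD; exact: measurable_funD.
by under eq_fun do rewrite ImD; exact: measurable_funD.
Qed.

Lemma measurableC_mul f (g : R -> R[i]) : measurableC f -> measurableC g ->
  measurableC (fun x => f x * g x).
Proof.
have mulE (a b c d : R) : (a +i* b) * (c +i* d) = (a * c - b * d) +i* (a * d + b * c).
  by [].
move=> [fr fi] [gr gi]; split.
  rewrite (_ : (fun x => _) = (fun x => complex.Re (f x) * complex.Re (g x)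
      - complex.Im (f x) * complex.Im (g x))).
    by apply: measurable_funB; exact: measurable_funM.
  by apply/funext => x; case: (f x) (g x) => [? ?] [? ?].
rewrite (_ : (fun x => _) = (fun x => complex.Re (f x) * complex.Im (g x)
      + complex.Im (f x) * complex.Re (g x))).
  by apply: measurable_funD; exact: measurable_funM.
by apply/funext => x; case: (f x) (g x) => [? ?] [? ?].
Qed.

Lemma measurable_normc f : measurableC f -> measurable_fun [set: R] (fun x => normc (f x)).
Proof.
move=> [fr fi]; rewrite (_ : (fun x => _) =
   (fun x => Num.sqrt (complex.Re (f x) ^+ 2 + complex.Im (f x) ^+ 2))); last first.
  by apply/funext => x; case: (f x).
apply: measurableT_comp; first exact: (continuous_measurable_fun (@sqrt_continuous R)).
by apply: measurable_funD; exact: measurable_funX.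
Qed.

Lemma measurable_normcX f (k : nat) : measurableC f ->
  measurable_fun [set: R] (fun x => normc (f x) ^+ k).
Proof. by move=> mf; apply: measurable_funX; exact: measurable_normc. Qed.

Lemma Lp_int2E f : Lp_int 2 f = (\int[leb]_(x in D) (normc (f x) ^+ 2)%:E)%E.
Proof. by apply: eq_integral => x _; rewrite -powR_mulrn ?normc_ge0. Qed.

Lemma integrable_normc2 f : measurableC f -> (Lp_int 2 f < +oo)%E ->
  leb.-integrable D (EFin \o (fun x => normc (f x) ^+ 2)).
Proof.
move=> mf; rewrite Lp_int2E => h; apply/integrableP; split.
  by apply: measurable_funTS; apply/measurable_EFinP; exact: measurable_normcX.
by under eq_integral do rewrite /= ger0_norm ?sqr_ge0//.
Qed.

Lemma Lp_int2_mass u : Lp_int 2 u = (mass u)%:E.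
Proof.
rewrite Lp_int2E /mass /Rintegral fineK//; apply: integrable_fin_num => //.
by apply: integrable_normc2; [exact: measurableC_Hs|exact: Hs_L2].
Qed.

Lemma mass_ge0 u : 0 <= mass u.
Proof. by apply: Rintegral_ge0 => x _; exact: sqr_ge0. Qed.

Lemma integrable01_cst (a : R) : leb.-integrable D (EFin \o cst a).
Proof. by apply: integrable_continuous01 => x; exact: cvg_cst. Qed.

Lemma integrable01D (h1 h2 : R -> R) :
  leb.-integrable D (EFin \o h1) -> leb.-integrable D (EFin \o h2) ->
  leb.-integrable D (EFin \o (fun x => h1 x + h2 x)).
Proof. by move=> i1 i2; exact: (integrableD _ i1 i2). Qed.

Lemma integrable01Z (a : R) (h : R -> R) : leb.-integrable D (EFin \o h) ->
  leb.-integrable D (EFin \o (fun x => a * h x)).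
Proof.
move=> ih; rewrite (_ : EFin \o _ = (fun x => a%:E * (EFin \o h) x)%E); last first.
  by apply/funext => x; rewrite /= EFinM.
exact: integrableZl.
Qed.

Lemma integrable_le_normc2 f (h : R -> R) : measurableC f -> (Lp_int 2 f < +oo)%E ->
  measurable_fun [set: R] h -> (forall x, `|h x| <= normc (f x)) ->
  leb.-integrable D (EFin \o h).
Proof.
move=> mf f2 mh hf.
have i2 : leb.-integrable D (EFin \o (fun x => 1 + normc (f x) ^+ 2)).
  exact: (integrable01D (integrable01_cst 1) (integrable_normc2 mf f2)).
apply: le_integrable i2 => //; first exact/measurable_EFinP/measurable_funTS.
move=> x _ /=; rewrite lee_fin [leRHS]ger0_norm; last by rewrite addr_ge0// sqr_ge0.
by apply: le_trans (hf x) _; have := normc_ge0 (f x); nra.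
Qed.

Lemma integrable_Hs_expi u n :
  leb.-integrable D (EFin \o (fun x => complex.Re (u x * expi n x))) /\
  leb.-integrable D (EFin \o (fun x => complex.Im (u x * expi n x))).
Proof.
have [mr mi] : measurableC (fun x => u x * expi n x).
  apply: measurableC_mul; first exact: measurableC_Hs.
  by have := measurableC_Zexpi 1 n; under eq_fun do rewrite mul1r.
have N x : normc (u x * expi n x) = normc (u x) by rewrite normcM normc_expi mulr1.
by split; apply: (integrable_le_normc2 (measurableC_Hs u) (Hs_L2 u)) => // x;
  rewrite -N; [exact: normr_Re_le|exact: normr_Im_le].
Qed.

Lemma fourier_add_mode u n c k :
  fourier (fun x => u x + c * expi n x) k = fourier u k + (if n == k then c else 0).
Proof.
have -> : (n == k) = (n - k == 0) by rewrite subr_eq0.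
rewrite /fourier -(cintegral_Zexpi c (n - k)).
have [ur ui] := integrable_Hs_expi u (- k).
have [er ei] := integrable_Zexpi c (n - k).
rewrite -cintegralD//; congr cintegral; apply/funext => x.
by rewrite mulrDl -mulrA -expiD.
Qed.

Lemma add_mode_L2 u n c : (Lp_int 2 (fun x => u x + c * expi n x)%R < +oo)%E.
Proof.
have mu := measurableC_Hs u.
have iu := integrable_normc2 mu (Hs_L2 u).
have i2 := integrable01D (integrable01D iu iu) (integrable01_cst (2 * normc c ^+ 2)).
rewrite Lp_int2E; apply: le_lt_trans (integral_fune_lt_pinfty _ i2); last exact: measurable_itv.
apply: ge0_le_integral => //=.
- by move=> x _; rewrite lee_fin sqr_ge0.
- apply/measurable_EFinP; apply: measurable_funTS; apply: measurable_normcX.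
  exact: (measurableC_add mu (measurableC_Zexpi c n)).
- exact: measurable_int i2.
- move=> x _; rewrite lee_fin.
  have := normc_sqrD (u x) (c * expi n x) ltr01.
  rewrite normcM normc_expi mulr1 invr1; lra.
Qed.

Lemma esum_lt_pinfty_off1 (T : choiceType) (a b : T -> \bar R) (t : T) :
  (forall i, 0 <= a i)%E -> (forall i, 0 <= b i)%E -> (a t < +oo)%E ->
  (forall i, i != t -> a i = b i) -> (\esum_(i in [set: T]) b i < +oo)%E ->
  (\esum_(i in [set: T]) a i < +oo)%E.
Proof.
move=> a0 b0 at_fin ab h.
rewrite (esumID [set t]) ?setTI ?esum_set1//.
apply: lte_add_pinfty => //; apply: le_lt_trans h.
rewrite [leRHS](esumID [set t]) ?setTI// -[leLHS]add0e; apply: leeD.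
  by apply: esum_ge0.
by rewrite le_eqVlt; apply/orP; left; apply/eqP/eq_esum => i /eqP it; rewrite ab.
Qed.

Lemma add_mode_fin u n c : (Hs_norm s (fun x => u x + c * expi n x)%R < +oo)%E.
Proof.
have sqrte_fin (a : \bar R) : (sqrte a < +oo)%E = (a < +oo)%E.
  by case: a => //= [r|]; rewrite ?ltry ?ltNyr.
have := Hs_fin u; rewrite /Hs_norm (sqrte_fin (esum _ _)) (sqrte_fin (esum _ _)).
apply: (@esum_lt_pinfty_off1 _ _ _ n).
- by move=> k; rewrite lee_fin mulr_ge0 ?powR_ge0 ?sqr_ge0.
- by move=> k; rewrite lee_fin mulr_ge0 ?powR_ge0 ?sqr_ge0.
- exact: ltry.
- by move=> k kn; rewrite fourier_add_mode eq_sym (negbTE kn) addr0.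
Qed.

Lemma add_mode_periodic u n c x : u (x + 1) + c * expi n (x + 1) = u x + c * expi n x.
Proof. by rewrite Hs_periodic expi_periodic. Qed.

(** The elementary surgery behind resampling, cutting and truncating. It stays in [Hs s] because a
    single Fourier coefficient changes. *)
Definition add_mode u n c : Hs s :=
  let m := measurableC_add (measurableC_Hs u) (measurableC_Zexpi c n) in
  MkHs (add_mode_periodic u n c) m.1 m.2 (add_mode_L2 u n c) (add_mode_fin u n c).

Lemma fourier_add_modeE u n c k :
  fourier (add_mode u n c) k = fourier u k + (if n == k then c else 0).
Proof. exact: fourier_add_mode. Qed.

(** The square |u + c e_n|^2 is expanded pointwise; the cross term integrates to a multiple of the
    n-th coefficient. Parseval's identity is deduced from this formula and does not enter here. *)
Lemma mass_add_mode u n c : mass (add_mode u n c) =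
  mass u + (normc (fourier u n + c) ^+ 2 - normc (fourier u n) ^+ 2).
Proof.
have [ur ui] := integrable_Hs_expi u (- n).
have iu := integrable_normc2 (measurableC_Hs u) (Hs_L2 u).
pose a := complex.Re c; pose b := complex.Im c.
transitivity (\int[leb]_(x in D) (normc (u x) ^+ 2 + ((2 * a) * complex.Re (u x * expi (- n) x)
  + ((2 * b) * complex.Im (u x * expi (- n) x) + (a ^+ 2 + b ^+ 2))))).
  apply: eq_Rintegral => x _; rewrite !normc_sqr /expi freqN mulNr cosN sinN /=.
  have := cos2Dsin2 (freq R n * x).
  rewrite {}/a {}/b; case: (u x) => p q; case: c => p' q' /=; set C := cos _; set S := sin _ => CS.
  have -> : (p + (p' * C - q' * S)) ^+ 2 + (q + (p' * S + q' * C)) ^+ 2 =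
    p ^+ 2 + q ^+ 2 + (2 * p' * (p * C - q * - S) + (2 * q' * (p * - S + q * C)
    + (p' ^+ 2 + q' ^+ 2) * (C ^+ 2 + S ^+ 2))) by ring.
  by rewrite CS mulr1.
rewrite RintegralD//; last first.
  by apply: integrable01D; [exact: integrable01Z|
    apply: integrable01D; [exact: integrable01Z|exact: integrable01_cst]].
rewrite RintegralD//; [|exact: integrable01Z|
  by apply: integrable01D; [exact: integrable01Z|exact: integrable01_cst]].
rewrite RintegralD//; [|exact: integrable01Z|exact: integrable01_cst].
rewrite !RintegralZl// Rintegral_cst//= lebesgue_measure_itv /= lte01 -EFinD subr0 mulr1.
rewrite -/(mass u) !normc_sqr ReD ImD -/(fourier u n).
have -> : complex.Re (fourier u n) =
  \int[leb]_(x in D) complex.Re (u x * expi (- n) x) by [].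
have -> : complex.Im (fourier u n) =
  \int[leb]_(x in D) complex.Im (u x * expi (- n) x) by [].
by rewrite -/a -/b; ring.
Qed.

Definition add_modes u (L : seq int) (c : int -> R[i]) : Hs s :=
  foldr (fun n v => add_mode v n (c n)) u L.

Lemma fourier_add_modes u L (c : int -> R[i]) k : uniq L ->
  fourier (add_modes u L c) k = fourier u k + (if k \in L then c k else 0).
Proof.
elim: L => [|n L IH] /=; first by rewrite addr0.
move=> /andP[nL uL]; rewrite fourier_add_modeE IH// in_cons -addrA; congr (_ + _).
by have [<-|nk] := eqVneq n k; rewrite ?(negbTE nL) ?add0r// addr0.
Qed.

Lemma add_modesE u L (c : int -> R[i]) x : add_modes u L c x = u x + \sum_(n <- L) c n * expi n x.
Proof.
elim: L => [|n L IH]; first by rewrite big_nil addr0.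
by rewrite /= IH big_cons -addrA [X in _ + X]addrC.
Qed.

Lemma mass_add_modes u L (c : int -> R[i]) : uniq L -> mass (add_modes u L c) =
  mass u + \sum_(n <- L) (normc (fourier u n + c n) ^+ 2 - normc (fourier u n) ^+ 2).
Proof.
elim: L => [|n L IH]; first by rewrite big_nil addr0.
move=> /= /andP[nL uL].
by rewrite mass_add_mode IH// big_cons fourier_add_modes// (negbTE nL) addr0; ring.
Qed.

End fourier_modes.

Section symmetric_frequencies.

(** The frequencies of [symfreq] as a list, so that membership, inclusion and removal of modes can
    be used. *)
Definition freqs (K : nat) : seq int := [seq symfreq i | i <- enum 'I_(K.*2.+1)].

Lemma big_freqs (V : nmodType) (F : int -> V) K :
  \sum_(n <- freqs K) F n = \sum_(i < K.*2.+1) F (symfreq i).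
Proof. by rewrite big_map big_enum. Qed.

Lemma mem_freqs K n : (n \in freqs K) = (`|n| <= K)%N.
Proof.
apply/mapP/idP => [[i _ ->]|nK].
  by rewrite /symfreq; have := ltn_ord i; lia.
have h : (absz (n + K%:Z)%R < K.*2.+1)%N by lia.
by exists (Ordinal h); rewrite ?mem_enum// /symfreq /=; lia.
Qed.

Lemma freqs_uniq K : uniq (freqs K).
Proof.
rewrite map_inj_uniq ?enum_uniq// => i j; rewrite /symfreq => /addIr [] /val_inj.
exact.
Qed.

End symmetric_frequencies.

(** * Approximation in L^2 by Fejer means *)

Section fejer.
Variable R : realType.
Implicit Types (x y : R) (g : R -> R).
Local Notation leb := (@lebesgue_measure R).
Local Notation D := (`[0%R, 1%R]%classic : set R).

Lemma cvg_sumr (T I : Type) (F : set_system T) {FF : Filter F} (r : seq I)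
    (h : I -> T -> R) (l : I -> R) : (forall i, h i x @[x --> F] --> l i) ->
  (\sum_(i <- r) h i x) @[x --> F] --> \sum_(i <- r) l i.
Proof.
move=> hl; elim: r => [|i r IH].
  by rewrite big_nil; under eq_fun do rewrite big_nil; exact: cvg_cst.
by rewrite big_cons; under eq_fun do rewrite big_cons; exact: cvgD.
Qed.

Lemma continuous_cosMB (a x : R) : continuous (fun y => cos (a * (x - y))).
Proof.
move=> y; apply: (@continuous_comp _ _ _ (fun y => a * (x - y)) cos).
  by apply: cvgM; [exact: cvg_cst|apply: cvgB; [exact: cvg_cst|exact: cvg_id]].
exact: continuous_cos.
Qed.

Lemma Rintegral_sum01 (I : Type) (r : seq I) (h : I -> R -> R) :
  (forall i, leb.-integrable D (EFin \o h i)) ->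
  leb.-integrable D (EFin \o (fun y => \sum_(i <- r) h i y)) /\
  \int[leb]_(y in D) (\sum_(i <- r) h i y) = \sum_(i <- r) \int[leb]_(y in D) h i y.
Proof.
move=> ih; elim: r => [|i r [IH1 IH2]].
  rewrite big_nil (_ : (fun y => _) = cst 0); last by apply/funext => y; rewrite big_nil.
  by split; [exact: (integrable01_cst 0)|rewrite Rintegral_cst//= mul0r].
rewrite big_cons (_ : (fun y => _) = (fun y => h i y + \sum_(j <- r) h j y)); last first.
  by apply/funext => y; rewrite big_cons.
by split; [exact: integrable01D|rewrite RintegralD// IH2].
Qed.

(** The double sum is |sum_(j < N) e_j(x)|^2, so positivity is immediate; grouping by j - k gives
    the usual triangular weights. *)
Definition fejer_kernel (N : nat) x : R :=
  N%:R^-1 * \sum_(j < N) \sum_(k < N) cos (freq R (j%:Z - k%:Z) * x).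

(** The convolution with [fejer_kernel], written so that it is visibly a trigonometric polynomial:
    [trig_dense_L2] reads its coefficients off this form. *)
Definition fejer_mean (N : nat) g x : R := N%:R^-1 * \sum_(j < N) \sum_(k < N)
  (cos (freq R (j%:Z - k%:Z) * x) * (\int[leb]_(y in D) (g y * cos (freq R (j%:Z - k%:Z) * y))) +
   sin (freq R (j%:Z - k%:Z) * x) * (\int[leb]_(y in D) (g y * sin (freq R (j%:Z - k%:Z) * y)))).

Lemma fejer_kernel_ge0 N x : 0 <= fejer_kernel N x.
Proof.
rewrite mulr_ge0 ?invr_ge0 ?ler0n//.
rewrite (_ : \sum_(j < N) _ = (\sum_(j < N) cos (freq R j%:Z * x)) ^+ 2 +
  (\sum_(j < N) sin (freq R j%:Z * x)) ^+ 2) ?addr_ge0 ?sqr_ge0//.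
rewrite !expr2 !mulr_suml -big_split /=; apply: eq_bigr => j _.
rewrite !mulr_sumr -big_split /=; apply: eq_bigr => k _.
by rewrite freqD freqN mulrDl mulNr cosB.
Qed.

Lemma continuous_fejer_kernel N x : continuous (fun y => fejer_kernel N (x - y)).
Proof.
move=> y; apply: cvgM; first exact: cvg_cst.
apply: cvg_sumr => j; apply: cvg_sumr => k; exact: continuous_cosMB.
Qed.

Lemma integrable_mul_continuous01 g (h : R -> R) : leb.-integrable D (EFin \o g) ->
  continuous h -> leb.-integrable D (EFin \o (fun y => g y * h y)).
Proof.
move=> ig ch.
have [c _ hc] : exists2 c, c \in `[0, 1]%R & forall t, t \in `[0, 1]%R -> `|h t| <= `|h c|.
  apply: (@EVT_max R (fun t => `|h t|) 0 1 ler01); apply: continuous_subspaceT => t.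
  by apply: cvg_norm; exact: ch.
apply: (integrableMl _ ig) => //.
  by apply: measurable_funTS; exact: continuous_measurable_fun.
exists `|h c|; split; first exact: num_real.
by move=> M cM t tD; apply: le_trans (ltW cM); apply: hc; exact: tD.
Qed.

Lemma fejer_meanE N g x : leb.-integrable D (EFin \o g) ->
  fejer_mean N g x = \int[leb]_(y in D) (g y * fejer_kernel N (x - y)).
Proof.
move=> ig.
have iC m := integrable_mul_continuous01 ig (@continuous_cosM R (freq R m)).
have iS m := integrable_mul_continuous01 ig (@continuous_sinM R (freq R m)).
pose F (j k : nat) y := cos (freq R (j%:Z - k%:Z) * x) * (g y * cos (freq R (j%:Z - k%:Z) * y)) +
   sin (freq R (j%:Z - k%:Z) * x) * (g y * sin (freq R (j%:Z - k%:Z) * y)).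
have iF j k : leb.-integrable D (EFin \o F j k).
  by apply: integrable01D; exact: integrable01Z.
have iF1 (j : nat) := Rintegral_sum01 (enum 'I_N) (fun k : 'I_N => iF j k).
have [iF2 eF2] := Rintegral_sum01 (enum 'I_N) (fun j : 'I_N => (iF1 j).1).
rewrite /fejer_mean; transitivity (N%:R^-1 * \int[leb]_(y in D)
   \sum_(j <- enum 'I_N) \sum_(k <- enum 'I_N) F j k y).
  rewrite eF2 big_enum /=; congr (_ * _); apply: eq_bigr => j _.
  rewrite (iF1 j).2 big_enum /=; apply: eq_bigr => k _.
  by rewrite RintegralD ?RintegralZl//; exact: integrable01Z.
rewrite -RintegralZl//; apply: eq_Rintegral => y _.
rewrite /fejer_kernel mulrCA; congr (_ * _).
rewrite big_enum /= mulr_sumr; apply: eq_bigr => j _.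
rewrite big_enum /= mulr_sumr; apply: eq_bigr => k _.
by rewrite mulrBr cosB /F; ring.
Qed.

Lemma Rintegral_cos_shift (n : int) x :
  \int[leb]_(y in D) cos (freq R n * (x - y)) = (n == 0)%:R.
Proof.
have iC := integrable_continuous01 (@continuous_cosM R (freq R n)).
have iS := integrable_continuous01 (@continuous_sinM R (freq R n)).
under eq_Rintegral do rewrite mulrBr cosB.
rewrite RintegralD//; [|exact: integrable01Z..].
rewrite !RintegralZl// Rintegral_cos_freq Rintegral_sin_freq mulr0 addr0.
by case: eqP => [->|_]; rewrite ?mulr0// freq0 mul0r cos0 mulr1.
Qed.

Lemma Rintegral_fejer_kernel_cos N (n : int) x : (0 < N)%N ->
  \int[leb]_(y in D) (fejer_kernel N (x - y) * cos (freq R n * (x - y))) =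
  N%:R^-1 * \sum_(j < N) \sum_(k < N) 2^-1 *
    ((j%:Z - k%:Z + n == 0)%:R + (j%:Z - k%:Z - n == 0)%:R).
Proof.
move=> N0.
have iC m := integrable_continuous01 (@continuous_cosMB (freq R m) x).
pose F (j k : nat) y := 2^-1 * (cos (freq R (j%:Z - k%:Z + n) * (x - y)) +
  cos (freq R (j%:Z - k%:Z - n) * (x - y))).
have iF j k : leb.-integrable D (EFin \o F j k).
  by apply: integrable01Z; exact: integrable01D.
have iF1 (j : nat) := Rintegral_sum01 (enum 'I_N) (fun k : 'I_N => iF j k).
have [iF2 eF2] := Rintegral_sum01 (enum 'I_N) (fun j : 'I_N => (iF1 j).1).
transitivity (N%:R^-1 * \int[leb]_(y in D)
   \sum_(j <- enum 'I_N) \sum_(k <- enum 'I_N) F j k y); last first.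
  rewrite eF2 big_enum /=; congr (_ * _); apply: eq_bigr => j _.
  rewrite (iF1 j).2 big_enum /=; apply: eq_bigr => k _.
  by rewrite RintegralZl//; [rewrite RintegralD// !Rintegral_cos_shift|exact: integrable01D].
rewrite -RintegralZl//; apply: eq_Rintegral => y _.
rewrite /fejer_kernel -mulrA; congr (_ * _).
rewrite big_enum /= mulr_suml; apply: eq_bigr => j _.
rewrite big_enum /= mulr_suml; apply: eq_bigr => k _.
rewrite /F; set p := (j%:Z - k%:Z).
by rewrite (freqD _ p n) (freqD _ p (- n)) freqN !mulrDl mulNr cosB cosD; field.
Qed.

Lemma Rintegral_fejer_kernel N x : (0 < N)%N ->
  \int[leb]_(y in D) fejer_kernel N (x - y) = 1.
Proof.
move=> N0; have := Rintegral_fejer_kernel_cos 0 x N0.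
under eq_Rintegral do rewrite freq0 mul0r cos0 mulr1.
move=> ->; rewrite (_ : \sum_(j < N) _ = N%:R) ?mulVf ?pnatr_eq0 -?lt0n//.
transitivity (\sum_(j < N) (1 : R)); last by rewrite sumr_const card_ord.
apply: eq_bigr => j _; rewrite (bigD1 j)//= big1 => [|k kj].
  by rewrite subrr oppr0 addr0 eqxx/=; field.
rewrite oppr0 addr0 subr_eq0 eqz_nat; case: eqP => [/val_inj jk|_].
  by rewrite jk eqxx in kj.
by rewrite addr0 mulr0.
Qed.

(** Each off-diagonal j - k = 1 or -1 has N - 1 entries, so the first Fourier coefficient of the
    kernel is 1 - 1/N. The weaker bound 2/N is enough for Korovkin's argument. *)
Lemma Rintegral_fejer_kernel_1Bcos N x : (0 < N)%N ->
  \int[leb]_(y in D) (fejer_kernel N (x - y) * (1 - cos (freq R 1 * (x - y)))) <= 2 * N%:R^-1.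
Proof.
move=> N0.
have iF := integrable_continuous01 (@continuous_fejer_kernel N x).
have cc := @continuous_cosMB (freq R 1) x.
under eq_Rintegral do rewrite mulrBr mulr1.
rewrite RintegralB//; last exact: integrable_mul_continuous01.
rewrite Rintegral_fejer_kernel// Rintegral_fejer_kernel_cos//.
have N0' : 0 < N%:R :> R by rewrite ltr0n.
set S := \sum_(j < N) _; suff : N%:R - 2 <= S.
  rewrite lerBlDl -lerBlDr => h.
  have := ler_wpM2l (ltW (_ : 0 < N%:R^-1)) h; rewrite invr_gt0 mulrBr mulVf ?gt_eqF// mulrC => /(_ N0').
  by rewrite [_ * 2]mulrC.
rewrite {}/S.
case: N N0 N0' iF => // N _ N0' iF.
rewrite (_ : N.+1%:R - 2 = 2^-1 * N%:R + 2^-1 * N%:R - 1); last by rewrite -natr1; field.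
under eq_bigr do rewrite -mulr_sumr big_split /=.
rewrite -mulr_sumr big_split /= mulrDr -addrA.
apply: lerD.
- rewrite ler_wpM2l ?invr_ge0//.
  rewrite big_ord_recr /= -[leLHS]addr0; apply: lerD; last by apply: sumr_ge0.
  have -> : N%:R = \sum_(j < N) (1 : R) by rewrite sumr_const card_ord.
  apply: ler_sum => j _ /=.
  rewrite (bigD1 (lift ord0 j))//= -[leLHS]addr0; apply: lerD; last by apply: sumr_ge0.
  by rewrite (_ : _ == 0) ?lexx//; apply/eqP; rewrite /bump /=; lia.
- rewrite lerBlDr; apply: (@le_trans _ _ (2^-1 * \sum_(i < N.+1) \sum_(i0 < N.+1)
     (i%:Z - i0%:Z - 1 == 0)%:R)); last by rewrite lerDl.
  rewrite ler_wpM2l ?invr_ge0//.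
  rewrite big_ord_recl /= -[leLHS]add0r; apply: lerD; first by apply: sumr_ge0.
  have -> : N%:R = \sum_(j < N) (1 : R) by rewrite sumr_const card_ord.
  apply: ler_sum => j _ /=.
  rewrite (bigD1 (widen_ord (leqnSn N) j))//= -[leLHS]addr0; apply: lerD; last by apply: sumr_ge0.
  by rewrite (_ : _ == 0) ?lexx//; apply/eqP; rewrite /bump /=; lia.
Qed.

Lemma cos_freq1_le (d t : R) : 0 <= d -> d <= `|t| <= 1 - d ->
  cos (freq R 1 * t) <= cos (freq R 1 * d).
Proof.
move=> d0 /andP[dt td].
have f1 : freq R 1 = 2 * pi by rewrite /freq mulr1.
have pi0 := pi_gt0 R.
have mono (a b : R) : 0 <= a -> a <= b -> b <= 2^-1 -> cos (2 * pi * b) <= cos (2 * pi * a).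
  move=> a0 ab b1; rewrite leNgt; apply/negP.
  by rewrite ltr_cos ?in_itv /=; [nra|apply/andP; split; nra..].
rewrite f1 (_ : cos (2 * pi * t) = cos (2 * pi * `|t|)); last first.
  by have [t0|t0] := leP 0 t; [rewrite ger0_norm|rewrite ltr0_norm// mulrN cosN].
case: (lerP `|t| 2^-1) => h; first exact: mono.
rewrite (_ : cos (2 * pi * `|t|) = cos (2 * pi * (1 - `|t|))); first by apply: mono; lra.
by rewrite mulrBr mulr1 cosB mulr_natl cos2pi sin2pi mul1r mul0r addr0.
Qed.

(* 1 - cos vanishes to second order at the diagonal only, so it plays the role of
   (y - x)^2 in Korovkin's argument on the circle. *)
Lemma korovkin_bound g (G x e : R) : continuous g -> (forall y, `|g y| <= G) ->
  0 < x < 1 -> 0 < e -> exists2 C, 0 <= C & forall y, 0 <= y <= 1 ->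
    `|g y - g x| <= e + C * (1 - cos (freq R 1 * (x - y))).
Proof.
move=> cg gG /andP[x0 x1] e0.
have /cvgrPdist_lt /(_ _ e0) /nbhs_ballP[d0 /= d00 hd0] := cg x.
pose d := Num.min d0 (Num.min x (1 - x)).
have d_gt0 : 0 < d by rewrite !lt_min d00 x0 subr_gt0.
have dd0 : d <= d0 by rewrite ge_min lexx.
have dx : d <= x by rewrite !ge_min lexx orbT.
have dx1 : d <= 1 - x by rewrite !ge_min lexx !orbT.
have cd : cos (freq R 1 * d) < 1.
  rewrite -(cos0 R) ltr_cos ?in_itv /= /freq ?mulr1; have := pi_gt0 R;
    first by move=> *; nra.
    by move=> *; rewrite lexx ltW.
  by move=> *; apply/andP; split; nra.
have G0 : 0 <= G by exact: le_trans (normr_ge0 _) (gG x).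
exists (2 * G / (1 - cos (freq R 1 * d))); first by rewrite divr_ge0 ?mulr_ge0// subr_ge0 ltW.
move=> y /andP[y0 y1].
have [xyd|xyd] := ltP `|x - y| d.
  apply: (@le_trans _ _ e).
    by rewrite distrC ltW//; apply: hd0; rewrite /ball /= (lt_le_trans xyd).
  by rewrite lerDl mulr_ge0 ?divr_ge0 ?mulr_ge0// subr_ge0 ?cos_le1// ltW.
have xyd1 : `|x - y| <= 1 - d by rewrite ler_norml; apply/andP; split; lra.
have h : cos (freq R 1 * (x - y)) <= cos (freq R 1 * d).
  by apply: cos_freq1_le; rewrite ?xyd ?xyd1// ltW.
apply: (@le_trans _ _ (2 * G)).
  by apply: le_trans (ler_normB _ _) _; have := gG x; have := gG y; lra.
rewrite -[leLHS]add0r; apply: lerD; first exact: ltW.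
by rewrite mulrAC ler_pdivlMr ?subr_gt0// ler_wpM2l ?mulr_ge0// lerB.
Qed.

(** [g] is not assumed periodic, so convergence is claimed at interior points only; the endpoints
    have measure zero in [fejer_mean_L2]. *)
Lemma fejer_mean_cvg g (G x : R) : continuous g -> (forall y, `|g y| <= G) ->
  0 < x < 1 -> fejer_mean N.+1 g x @[N --> \oo] --> g x.
Proof.
move=> cg gG x01; apply/cvgrPdist_le => e e0.
have ig := integrable_continuous01 cg.
have e20 : 0 < e / 2 by rewrite divr_gt0.
have [C C0 hC] := korovkin_bound cg gG x01 e20.
near=> N; have N0 : (0 < N.+1)%N by [].
have ck := @continuous_fejer_kernel N.+1 x.
have ik := integrable_continuous01 ck.
have cc := @continuous_cosMB (freq R 1) x.
have c1 : continuous (fun y => g y - g x) by move=> y; apply: cvgB; [exact: cg|exact: cvg_cst].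
have c2 : continuous (fun y => 1 - cos (freq R 1 * (x - y))).
  by move=> y; apply: cvgB; [exact: cvg_cst|exact: cc].
have i1 := integrable_mul_continuous01 (integrable_continuous01 c1) ck.
have i2 := integrable_mul_continuous01 ik c2.
have -> : g x - fejer_mean N.+1 g x = - \int[leb]_(y in D) ((g y - g x) * fejer_kernel N.+1 (x - y)).
  rewrite fejer_meanE//; under [in RHS]eq_Rintegral do rewrite mulrBl.
  rewrite RintegralB//; [|exact: integrable_mul_continuous01|exact: integrable01Z].
  by rewrite RintegralZl// Rintegral_fejer_kernel//; ring.
rewrite normrN; apply: le_trans (le_normr_Rintegral _ i1) _ => //.
apply: (@le_trans _ _ (\int[leb]_(y in D) (e / 2 * fejer_kernel N.+1 (x - y) +
   C * (fejer_kernel N.+1 (x - y) * (1 - cos (freq R 1 * (x - y))))))).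
  apply: le_Rintegral => //.
  - exact: integrable_norm.
  - by apply: integrable01D; exact: integrable01Z.
  - move=> y; rewrite /= in_itv /= => yD; rewrite normrM (ger0_norm (fejer_kernel_ge0 _ _)).
    by have := hC y yD; have := fejer_kernel_ge0 N.+1 (x - y); nra.
rewrite RintegralD//; [|exact: integrable01Z..].
have -> : \int[leb]_(y in D) (e / 2 * fejer_kernel N.+1 (x - y)) = e / 2.
  by rewrite RintegralZl// Rintegral_fejer_kernel// mulr1.
rewrite (RintegralZl C _ i2)//.
have h := Rintegral_fejer_kernel_1Bcos x N0.
apply: (@le_trans _ _ (e / 2 + C * (2 * N.+1%:R^-1))); first by rewrite lerD2l ler_wpM2l.
rewrite [leRHS](splitr e) lerD2l mulrA ler_pdivrMr ?ltr0n//.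
rewrite [_ * N.+1%:R]mulrC -ler_pdivrMr//.
apply: (@le_trans _ _ N%:R); last by rewrite ler_nat.
near: N; exact: nbhs_infty_ger.
Unshelve. all: by end_near. Qed.

Lemma continuous_fejer_mean N g : continuous (fejer_mean N g).
Proof.
move=> x; apply: cvgM; first exact: cvg_cst.
apply: cvg_sumr => j; apply: cvg_sumr => k.
by apply: cvgD; apply: cvgM; [exact: continuous_cosM|exact: cvg_cst|
  exact: continuous_sinM|exact: cvg_cst].
Qed.

Lemma fejer_mean_bound N g (G x : R) : continuous g -> (forall y, `|g y| <= G) ->
  (0 < N)%N -> `|fejer_mean N g x| <= G.
Proof.
move=> cg gG N0; have ig := integrable_continuous01 cg.
have ck := @continuous_fejer_kernel N x; have ik := integrable_continuous01 ck.
have i1 := integrable_mul_continuous01 ig ck.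
rewrite fejer_meanE//; apply: le_trans (le_normr_Rintegral _ i1) _ => //.
apply: (@le_trans _ _ (\int[leb]_(y in D) (G * fejer_kernel N (x - y)))).
  apply: le_Rintegral => //; [exact: integrable_norm|exact: integrable01Z|].
  move=> y _; rewrite normrM (ger0_norm (fejer_kernel_ge0 _ _)).
  by rewrite ler_wpM2r ?fejer_kernel_ge0.
by rewrite RintegralZl// Rintegral_fejer_kernel// mulr1.
Qed.

Lemma cvg_sqr (T : Type) (F : set_system T) {FF : Filter F} (h : T -> R) (l : R) :
  h x @[x --> F] --> l -> h x ^+ 2 @[x --> F] --> l ^+ 2.
Proof. by move=> hl; rewrite expr2; under eq_fun do rewrite expr2; exact: cvgM. Qed.

Lemma fejer_mean_L2 g (G : R) : continuous g -> (forall y, `|g y| <= G) ->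
  \int[leb]_(x in D) ((g x - fejer_mean N.+1 g x) ^+ 2) @[N --> \oo] --> 0.
Proof.
move=> cg gG; have G0 : 0 <= G by exact: le_trans (normr_ge0 _) (gG 0).
pose E := (`]0%R, 1%R[%classic : set R).
have cf N : continuous (fun x => (g x - fejer_mean N.+1 g x) ^+ 2).
  by move=> x; apply: cvg_sqr; apply: cvgB; [exact: cg|exact: continuous_fejer_mean].
have iE (h : R -> R) : continuous h -> leb.-integrable E (EFin \o h).
  move=> ch; apply: integrableS (integrable_continuous01 ch) => //.
    exact: measurable_itv.
  exact: subset_itv_oo_cc.
have DE (h : R -> R) : continuous h -> \int[leb]_(x in D) h x = \int[leb]_(x in E) h x.
  move=> ch; rewrite -Rintegral_itv_obnd_cbnd; last first.
    apply: integrableS (integrable_continuous01 ch) => //.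
    by apply: subset_itvr; rewrite bnd_simp.
  by rewrite -Rintegral_itv_bndo_bndc//; exact: iE.
under eq_fun do rewrite DE//.
have := @dominated_cvg _ _ R leb E (measurable_itv _)
  (fun N x => ((g x - fejer_mean N.+1 g x) ^+ 2)%:E) (cst 0%E) (cst ((2 * G) ^+ 2)%:E).
have h1 N : measurable_fun E (fun x => ((g x - fejer_mean N.+1 g x) ^+ 2)%:E).
  by apply/measurable_EFinP; apply: measurable_funTS; exact: continuous_measurable_fun.
move=> /(_ h1); rewrite integral0 => h.
apply: (@fine_cvg R _ _ _ _ 0); apply: h => //.
- move=> x; rewrite /E /= in_itv /= => x01; apply: cvg_EFin; first by near=> N.
  suff : (g x - fejer_mean N.+1 g x) ^+ 2 @[N --> \oo] --> (0 : R) by [].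
  have -> : (0 : R) = (g x - g x) ^+ 2 by rewrite subrr expr0n.
  apply: cvg_sqr.
  by apply: cvgB; [exact: cvg_cst|exact: fejer_mean_cvg gG x01].
- by apply: iE => x; exact: cvg_cst.
- move=> N x _; rewrite lee_fin ger0_norm ?sqr_ge0//.
  rewrite -ler_sqrt ?sqr_ge0// !sqrtr_sqr (ger0_norm (_ : 0 <= 2 * G)) ?mulr_ge0//.
  apply: le_trans (ler_normB _ _) _; have := gG x; have := @fejer_mean_bound N.+1 g G x cg gG isT; lra.
Unshelve. all: by end_near. Qed.

Definition clip (M t : R) : R := Num.max (- M) (Num.min t M).

Lemma clip_bound (M t : R) : 0 <= M -> `|clip M t| <= M.
Proof.
move=> M0; rewrite /clip ler_norml le_max lexx /= ge_max ge_min lexx orbT andbT; lra.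
Qed.

Lemma clip_id (M t : R) : `|t| <= M -> clip M t = t.
Proof.
by rewrite ler_norml /clip => /andP[h1 h2]; rewrite (min_idPl h2) (max_idPr h1).
Qed.

Lemma clip_lip (M t t' : R) : `|clip M t - clip M t'| <= `|t - t'|.
Proof.
by rewrite /clip !maxEle !minEle; repeat case: ifPn; rewrite -?ltNge => *;
  rewrite ler_norml; have := ler_norm (t - t'); have := ler_norm (t' - t);
  rewrite (distrC t' t) => *; apply/andP; split; lra.
Qed.

Lemma continuous_clip (M : R) : continuous (clip M).
Proof.
move=> t; apply/cvgrPdist_le => e e0; near=> t'.
apply: le_trans (clip_lip _ _ _) _; near: t'.
by apply: cvgr_dist_le e0; exact: cvg_id.
Unshelve. all: by end_near. Qed.

(** [f] is first clipped at a height M, with small error in L^2 by dominated convergence. For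
    functions bounded by M the square of a difference is at most 2 M times its absolute value, so
    the density of continuous functions in L^1 applies to the clipped function. *)
Lemma continuous_dense_L2 (f : R -> R) (e : R) : measurable_fun [set: R] f ->
  leb.-integrable D (EFin \o (fun x => f x ^+ 2)) -> 0 < e ->
  exists g, [/\ continuous g, exists G : R, forall x, `|g x| <= G &
    \int[leb]_(x in D) ((f x - g x) ^+ 2) < e].
Proof.
move=> mf if2 e0.
have mclip (M : R) : measurable_fun [set: R] (fun x => clip M (f x)).
  by apply: measurableT_comp => //; apply: continuous_measurable_fun; exact: continuous_clip.
have i1 (M : R) : 0 <= M -> leb.-integrable D (EFin \o (fun x => (f x - clip M (f x)) ^+ 2)).
  move=> M0; apply: le_integrable if2 => //.
    apply/measurable_EFinP; apply: measurable_funTS; apply: measurable_funX.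
    exact: (measurable_funB mf (mclip M)).
  move=> x _ /=; rewrite lee_fin !ger0_norm ?sqr_ge0//.
  rewrite -ler_sqrt ?sqr_ge0// !sqrtr_sqr.
  have -> : clip M (f x) = clip M (f x) - clip M 0 by rewrite (@clip_id M 0) ?normr0// subr0.
  rewrite /clip !maxEle !minEle; repeat case: ifPn; rewrite -?ltNge => *;
    rewrite ler_norml; have := ler_norm (f x); have := ler_norm (- f x);
    rewrite normrN => *; apply/andP; split; lra.
have [M M0 hM] : exists2 M, 0 <= M & \int[leb]_(x in D) ((f x - clip M (f x)) ^+ 2) < e / 4.
  have := @dominated_cvg _ _ R leb D (measurable_itv _)
    (fun N x => ((f x - clip N%:R (f x)) ^+ 2)%:E) (cst 0%E) (EFin \o (fun x => f x ^+ 2)).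
  have h1 N : measurable_fun D (fun x => ((f x - clip N%:R (f x)) ^+ 2)%:E).
    exact: measurable_int (i1 _ (ler0n _ N)).
  move=> /(_ h1); rewrite integral0 => h.
  have {h} : \int[leb]_(x in D) ((f x - clip N%:R (f x)) ^+ 2) @[N --> \oo] --> 0.
    apply: (@fine_cvg R _ _ _ _ 0); apply: h => //.
      move=> x _; apply: cvg_near_cst; near=> N.
      rewrite clip_id ?subrr ?expr0n//.
      near: N; exact: nbhs_infty_ger.
    move=> N x _ /=; rewrite lee_fin ger0_norm ?sqr_ge0//.
    rewrite -ler_sqrt ?sqr_ge0// !sqrtr_sqr.
    rewrite /clip !maxEle !minEle; have N0 := ler0n R N.
    repeat case: ifPn; rewrite -?ltNge => *;
    rewrite ler_norml; have := ler_norm (f x); have := ler_norm (- f x);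
    rewrite normrN => *; apply/andP; split; lra.
  move=> /cvgrPdist_lt /(_ (e / 4)); rewrite divr_gt0// => /(_ isT) [N _ /(_ N (leqnn _))].
  rewrite /= sub0r normrN => hN; exists N%:R => //.
  exact: le_lt_trans (ler_norm _) hN.
pose fM x := clip M (f x).
have ifM : leb.-integrable D (EFin \o fM).
  apply: (le_integrable _ _ _ (integrable01_cst M)) => //.
    by apply/measurable_EFinP; apply: measurable_funTS; exact: mclip.
  by move=> x _ /=; rewrite lee_fin (ger0_norm M0) clip_bound.
have D_fin : (leb D < +oo)%E by rewrite lebesgue_measure_itv /= lte01 -EFinD ltry.
have [g_ [cg ig hg]] := approximation_continuous_integrable (measurable_itv _) D_fin ifM.
(* The tolerance in L^1 makes 4 M d less than e / 2; the summand 8 covers M = 0. *)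
pose d := e / (8 * M + 8).
have M8 : 0 < 8 * M + 8 by lra.
have d0 : 0 < d by rewrite divr_gt0.
have := hg; move=> /fine_cvgP [_ /cvgrPdist_lt /(_ _ d0) [N _ /(_ N (leqnn _))]].
rewrite /= sub0r normrN => hN.
have ifg : leb.-integrable D (EFin \o (fun x => fM x - g_ N x)).
  exact: (integrableB _ ifM (ig N)).
exists (fun x => clip M (g_ N x)); split.
- by move=> x; apply: continuous_comp; [exact: cg|exact: continuous_clip].
- by exists M => x; exact: clip_bound.
have mg : measurable_fun [set: R] (fun x => clip M (g_ N x)).
  apply: measurableT_comp; apply: continuous_measurable_fun; [exact: continuous_clip|exact: cg].
apply: (@le_lt_trans _ _ (\int[leb]_(x in D) (2 * (f x - clip M (f x)) ^+ 2 +
   4 * M * `|fM x - g_ N x|))).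
  have i3 : leb.-integrable D (EFin \o (fun x => 2 * (f x - clip M (f x)) ^+ 2 +
     4 * M * `|fM x - g_ N x|)).
    apply: integrable01D; apply: integrable01Z; first exact: i1.
    exact: (integrable_norm ifg).
  have pw x : (f x - clip M (g_ N x)) ^+ 2 <= 2 * (f x - clip M (f x)) ^+ 2 +
     4 * M * `|fM x - g_ N x|.
    have h1 := clip_lip M (f x) (g_ N x).
    have h1' : `|clip M (f x) - clip M (g_ N x)| <= `|fM x - g_ N x|.
      by have := clip_lip M (fM x) (g_ N x); rewrite /fM (clip_id (clip_bound _ M0)).
    have h2 : `|clip M (f x) - clip M (g_ N x)| <= 2 * M.
      apply: le_trans (ler_normB _ _) _.
      have := clip_bound (f x) M0; have := clip_bound (g_ N x) M0; lra.
    rewrite (_ : f x - clip M (g_ N x) = (f x - clip M (f x)) + (clip M (f x) - clip M (g_ N x))); last by ring.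
    set p := f x - _; set q := clip M (f x) - _ in h1' h2 *.
    have q2 : q ^+ 2 <= 2 * M * `|fM x - g_ N x|.
      rewrite -[q ^+ 2]ger0_norm ?sqr_ge0// normrX expr2.
      by apply: ler_pM.
    have := sqr_ge0 (p - q); nra.
  apply: le_Rintegral => //.
  apply: le_integrable i3 => //.
    apply/measurable_EFinP; apply: measurable_funTS; apply: measurable_funX.
    exact: (measurable_funB mf mg).
  move=> x _ /=; rewrite lee_fin ger0_norm ?sqr_ge0//; apply: le_trans (pw x) _; exact: ler_norm.
rewrite RintegralD//; [|by apply: integrable01Z; exact: i1|by apply: integrable01Z; exact: (integrable_norm ifg)].
rewrite !RintegralZl//; [|exact: (integrable_norm ifg)|exact: i1].
have hN' : \int[leb]_(x in D) `|fM x - g_ N x| < d by exact: le_lt_trans (ler_norm _) hN.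
apply: (@le_lt_trans _ _ (2 * (e / 4) + 4 * M * d)).
  by apply: lerD; apply: ler_wpM2l => //; rewrite ?mulr_ge0// ltW.
have : (8 * M + 8) * d = e by rewrite /d mulrC divfK// gt_eqF.
nra.
Unshelve. all: by end_near. Qed.

End fejer.

(** * Parseval's identity *)

Section parseval.
Variables (R : realType) (s : R).
Implicit Types (n m k : int) (x y : R) (c : R[i]) (u v : Hs s) (f : R -> R[i]).
Local Notation leb := (@lebesgue_measure R).
Local Notation D := (`[0%R, 1%R]%classic : set R).

Definition energy K u : R := \sum_(n <- freqs K) normc (fourier u n) ^+ 2.

(** The difference is the mass of u with its modes up to K removed. *)
Lemma bessel K u : energy K u <= mass u.
Proof.
have := mass_ge0 (add_modes u (freqs K) (fun n => - fourier u n)).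
rewrite mass_add_modes ?freqs_uniq// (eq_bigr (fun n => - normc (fourier u n) ^+ 2)).
  by rewrite sumrN subr_ge0.
by move=> n _; rewrite subrr normc0 expr0n sub0r.
Qed.

Lemma energy_add_mode K u n c : n \in freqs K ->
  mass (add_mode u n c) - energy K (add_mode u n c) = mass u - energy K u.
Proof.
move=> nK; rewrite mass_add_mode /energy.
rewrite (bigD1_seq n) ?freqs_uniq//= [in RHS](bigD1_seq n) ?freqs_uniq//=.
rewrite fourier_add_modeE eqxx (eq_bigr (fun m => normc (fourier u m) ^+ 2)); first by ring.
by move=> m mn; rewrite fourier_add_modeE eq_sym (negbTE mn) addr0.
Qed.

Lemma energy_add_modes K u (L : seq int) (c : int -> R[i]) : {subset L <= freqs K} ->
  mass (add_modes u L c) - energy K (add_modes u L c) = mass u - energy K u.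
Proof.
elim: L => // n L IH h; rewrite /= energy_add_mode; last by apply: h; rewrite mem_head.
by apply: IH => m mL; apply: h; rewrite in_cons mL orbT.
Qed.

(** Exchanging j and k changes the sign of the double sum. *)
Lemma sum_antisym (h : int -> R) N : (forall n, h (- n) = - h n) ->
  \sum_(j < N) \sum_(k < N) h (j%:Z - k%:Z) = 0.
Proof.
move=> hN; set S := \sum_(j < N) _.
suff : S = - S by move=> h1; lra.
rewrite {2}/S exchange_big -sumrN; apply: eq_bigr => j _.
by rewrite -sumrN; apply: eq_bigr => k _; rewrite -hN opprB.
Qed.

Lemma sqrB_le (a b : R) : (a - b) ^+ 2 <= 2 * a ^+ 2 + 2 * b ^+ 2.
Proof.
have -> : 2 * a ^+ 2 + 2 * b ^+ 2 = (a - b) ^+ 2 + (a + b) ^+ 2 by ring.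
by rewrite lerDl sqr_ge0.
Qed.

Lemma integrable_sqrB_continuous (f g : R -> R) : measurable_fun [set: R] f ->
  leb.-integrable D (EFin \o (fun x => f x ^+ 2)) -> continuous g ->
  leb.-integrable D (EFin \o (fun x => (f x - g x) ^+ 2)).
Proof.
move=> mf if2 cg.
have cg2 : continuous (fun x => g x ^+ 2) by move=> x; apply: cvg_sqr; exact: cg.
apply: le_integrable (integrable01D (integrable01Z 2 if2) (integrable01Z 2 (integrable_continuous01 cg2))) => //.
  apply/measurable_EFinP; apply: measurable_funTS; apply: measurable_funX.
  by apply: (measurable_funB mf); exact: continuous_measurable_fun.
move=> x _ /=; rewrite lee_fin ger0_norm ?sqr_ge0//.
exact: le_trans (sqrB_le _ _) (ler_norm _).
Qed.

(** Real and imaginary parts are approximated separately, by a continuous function and then by its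
    Fejer mean; the two means are merged into one list of complex coefficients. *)
Lemma trig_dense_L2 u (e : R) : 0 < e ->
  exists (L : seq int) (c : int -> R[i]), mass (add_modes u L c) < e.
Proof.
have aux (a b c d : R) : a < e / 8 -> b < e / 8 -> c < e / 8 -> d < e / 8 ->
  2 * a + 2 * b + (2 * c + 2 * d) < e by move=> *; lra.
move=> e0; have e4 : 0 < e / 8 by rewrite divr_gt0.
have iu := integrable_normc2 (measurableC_Hs u) (Hs_L2 u).
have i1 : leb.-integrable D (EFin \o (fun x => complex.Re (u x) ^+ 2)).
  apply: le_integrable iu => //.
    by apply/measurable_EFinP; apply: measurable_funTS; apply: measurable_funX; exact: Hs_measurable_Re.
  by move=> x _ /=; rewrite lee_fin !ger0_norm ?sqr_ge0// normc_sqr lerDl sqr_ge0.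
have i2 : leb.-integrable D (EFin \o (fun x => complex.Im (u x) ^+ 2)).
  apply: le_integrable iu => //.
    by apply/measurable_EFinP; apply: measurable_funTS; apply: measurable_funX; exact: Hs_measurable_Im.
  by move=> x _ /=; rewrite lee_fin !ger0_norm ?sqr_ge0// normc_sqr lerDr sqr_ge0.
have [g1 [cg1 [G1 hG1] hg1]] := continuous_dense_L2 (Hs_measurable_Re u) i1 e4.
have [g2 [cg2 [G2 hG2] hg2]] := continuous_dense_L2 (Hs_measurable_Im u) i2 e4.
have [N1 _ hN1] : \forall N \near \oo,
    \int[leb]_(x in D) ((g1 x - fejer_mean N.+1 g1 x) ^+ 2) < e / 8.
  move/cvgrPdist_lt: (fejer_mean_L2 cg1 hG1) => /(_ _ e4); apply: filterS => N.
  by rewrite sub0r normrN; apply: le_lt_trans; exact: ler_norm.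
have [N2 _ hN2] : \forall N \near \oo,
    \int[leb]_(x in D) ((g2 x - fejer_mean N.+1 g2 x) ^+ 2) < e / 8.
  move/cvgrPdist_lt: (fejer_mean_L2 cg2 hG2) => /(_ _ e4); apply: filterS => N.
  by rewrite sub0r normrN; apply: le_lt_trans; exact: ler_norm.
pose N := (maxn N1 N2).+1.
have {}hN1 := hN1 (maxn N1 N2) (leq_maxl _ _).
have {}hN2 := hN2 (maxn N1 N2) (leq_maxr _ _).
rewrite -/N in hN1 hN2; clearbody N.
pose A (g : R -> R) n := \int[leb]_(y in D) (g y * cos (freq R n * y)).
pose B (g : R -> R) n := \int[leb]_(y in D) (g y * sin (freq R n * y)).
have AN g n : A g (- n) = A g n.
  by rewrite /A freqN; under eq_Rintegral do rewrite mulNr cosN.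
have BN g n : continuous g -> B g (- n) = - B g n.
  move=> cg; rewrite /B freqN; under eq_Rintegral do rewrite mulNr sinN mulrN -mulN1r.
  rewrite RintegralZl ?mulN1r//; apply: integrable_mul_continuous01 => //.
    exact: integrable_continuous01.
  exact: continuous_sinM.
(* [L] repeats each difference j - k with its multiplicity. Since [add_modes] accumulates over
   repetitions, this reproduces the double sum of [fejer_mean]. *)
pose L := allpairs (fun j k : nat => j%:Z - k%:Z) (index_iota 0 N) (index_iota 0 N).
pose c (n : int) : R[i] := (- N%:R^-1 * (A g1 n + B g2 n)) +i* (- N%:R^-1 * (A g2 n - B g1 n)).
have sumL (F : int -> R) : \sum_(n <- L) F n = \sum_(j < N) \sum_(k < N) F (j%:Z - k%:Z).
  rewrite /L big_allpairs_dep big_mkord.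
  by apply: eq_bigr => j _; rewrite big_mkord.
have ReS (r : seq int) (F : int -> R[i]) :
    complex.Re (\sum_(n <- r) F n) = \sum_(n <- r) complex.Re (F n).
  by rewrite (big_morph _ (@ReD R) erefl).
have ImS (r : seq int) (F : int -> R[i]) :
    complex.Im (\sum_(n <- r) F n) = \sum_(n <- r) complex.Im (F n).
  by rewrite (big_morph _ (@ImD R) erefl).
exists L, c.
have reE x : complex.Re (add_modes u L c x) = complex.Re (u x) - fejer_mean N g1 x.
  rewrite add_modesE ReD ReS sumL; congr (_ + _).
  (* The contribution of [g2] to the real part is odd in n, hence cancels over the pairs (j, k). *)
  pose h n := B g2 n * cos (freq R n * x) - A g2 n * sin (freq R n * x).
  have h0 : \sum_(j < N) \sum_(k < N) h (j%:Z - k%:Z) = 0.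
    by apply: sum_antisym => n; rewrite /h AN BN// freqN (mulNr (freq R n)) cosN sinN; ring.
  transitivity (\sum_(j < N) \sum_(k < N) complex.Re (c (j%:Z - k%:Z) * expi (j%:Z - k%:Z) x)
    - (- N%:R^-1) * \sum_(j < N) \sum_(k < N) h (j%:Z - k%:Z)).
    by rewrite h0 mulr0 subr0.
  rewrite /fejer_mean -[RHS]mulNr !mulr_sumr -sumrB; apply: eq_bigr => j _.
  rewrite !mulr_sumr -sumrB; apply: eq_bigr => k _.
  by rewrite -/(A g1 _) -/(B g1 _) /h /c /expi /=; ring.
have imE x : complex.Im (add_modes u L c x) = complex.Im (u x) - fejer_mean N g2 x.
  rewrite add_modesE ImD ImS sumL; congr (_ + _).
  pose h n := A g1 n * sin (freq R n * x) - B g1 n * cos (freq R n * x).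
  have h0 : \sum_(j < N) \sum_(k < N) h (j%:Z - k%:Z) = 0.
    by apply: sum_antisym => n; rewrite /h AN BN// freqN (mulNr (freq R n)) cosN sinN; ring.
  transitivity (\sum_(j < N) \sum_(k < N) complex.Im (c (j%:Z - k%:Z) * expi (j%:Z - k%:Z) x)
    - (- N%:R^-1) * \sum_(j < N) \sum_(k < N) h (j%:Z - k%:Z)).
    by rewrite h0 mulr0 subr0.
  rewrite /fejer_mean -[RHS]mulNr !mulr_sumr -sumrB; apply: eq_bigr => j _.
  rewrite !mulr_sumr -sumrB; apply: eq_bigr => k _.
  by rewrite -/(A g2 _) -/(B g2 _) /h /c /expi /=; ring.
have bd := @integrable_sqrB_continuous.
have bd2 (g : R -> R) : continuous g -> leb.-integrable D (EFin \o (fun x => (g x - fejer_mean N g x) ^+ 2)).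
  move=> cg; apply: integrable_continuous01 => x; apply: cvg_sqr.
  by apply: cvgB; [exact: cg|exact: continuous_fejer_mean].
have j1 := bd _ _ (Hs_measurable_Re u) i1 cg1.
have j2 := bd _ _ (Hs_measurable_Im u) i2 cg2.
have k1 := bd2 _ cg1; have k2 := bd2 _ cg2.
have s1 := integrable01D (integrable01Z 2 j1) (integrable01Z 2 k1).
have s2 := integrable01D (integrable01Z 2 j2) (integrable01Z 2 k2).
apply: (@le_lt_trans _ _ (\int[leb]_(x in D) ((2 * (complex.Re (u x) - g1 x) ^+ 2 +
   2 * (g1 x - fejer_mean N g1 x) ^+ 2) + (2 * (complex.Im (u x) - g2 x) ^+ 2 +
   2 * (g2 x - fejer_mean N g2 x) ^+ 2)))).
  apply: le_Rintegral => //.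
  - by apply: integrable_normc2; [exact: measurableC_Hs|exact: Hs_L2].
  - exact: integrable01D.
  - move=> x _; rewrite normc_sqr reE imE.
    have q (a b d : R) : (a - d) ^+ 2 <= 2 * (a - b) ^+ 2 + 2 * (b - d) ^+ 2.
      by rewrite -[b - d]opprB sqrrN (_ : a - d = (a - b) - (d - b)) ?sqrB_le//; ring.
    by apply: lerD; exact: q.
rewrite RintegralD// (RintegralD _ (integrable01Z 2 j1) (integrable01Z 2 k1))//.
rewrite (RintegralD _ (integrable01Z 2 j2) (integrable01Z 2 k2))//.
rewrite (RintegralZl 2 _ j1)// (RintegralZl 2 _ j2)// (RintegralZl 2 _ k1)// (RintegralZl 2 _ k2)//.
exact: (aux _ _ _ _ hg1 hN1 hg2 hN2).
Qed.

(** The defect [mass u - energy K u] does not see modes below K, so it equals the defect of u plus a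
    trigonometric polynomial, whose mass can be made small. *)
Lemma energy_cvg u : energy K u @[K --> \oo] --> mass u.
Proof.
apply/cvgrPdist_lt => e e0; have [L [c hLc]] := trig_dense_L2 u e0.
pose K0 := \max_(n <- L) absz n.
exists K0 => // K /= K0K; rewrite ger0_norm ?subr_ge0 ?bessel//.
rewrite -(@energy_add_modes K u L c); last first.
  move=> n nL; rewrite mem_freqs; apply: leq_trans K0K.
  exact: (@leq_bigmax_seq _ _ _ (fun n => absz n)).
apply: le_lt_trans hLc; rewrite lerBlDr lerDl.
by apply: sumr_ge0 => n _; exact: sqr_ge0.
Qed.

End parseval.

Lemma esum_int_cvg (R : realType) (a : int -> \bar R) : (forall n, 0 <= a n)%E ->
  (\sum_(n <- freqs K) a n)%E @[K --> \oo] --> \esum_(n in [set: int]) a n.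
Proof.
move=> a0.
have sumE K : (\sum_(n <- freqs K) a n = \sum_(n \in [set` freqs K]) a n)%E.
  by rewrite fsbig_seq ?freqs_uniq.
have fin K : finite_set [set` freqs K] by exact: finite_seq.
have nd : nondecreasing_seq (fun K => \sum_(n <- freqs K) a n)%E.
  move=> K K' KK'; rewrite !sumE; apply: lee_fsum_nneg_subset => //.
  by move=> n; rewrite !inE /= !mem_freqs => /leq_trans; exact.
have -> : \esum_(n in [set: int]) a n = ereal_sup (range (fun K => \sum_(n <- freqs K) a n)%E).
  apply/eqP; rewrite eq_le; apply/andP; split.
    apply: ge_ereal_sup => _ [X [finX _] <-].
    pose K := \max_(n <- fset_set X) absz n.
    apply: (@le_trans _ _ (\sum_(n <- freqs K) a n)%E); last first.
      by apply: ereal_sup_ubound; exists K.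
    rewrite sumE; apply: lee_fsum_nneg_subset => //.
    move=> n; rewrite !inE /= mem_freqs => Xn.
    apply: (@leq_bigmax_seq _ _ _ (fun n => absz n)) => //.
    by rewrite in_fset_set// inE.
  apply: ge_ereal_sup => _ [K _ <-]; apply: esum_ge; exists [set` freqs K]; last by rewrite sumE.
  by split.
exact: ereal_nondecreasing_cvgn.
Qed.

(** * The Borel structure of the Sobolev space *)

Section Hs_measurability.
Variables (R : realType) (s : R).
Implicit Types (n : int) (u v : Hs s).

Definition Hs_dist2 u v : \bar R :=
  \esum_(n in [set: int]) (japanese R n `^ (2 * s) * normc (fourier u n - fourier v n) ^+ 2)%:E.

Lemma Hs_dist2_ge0 u v : (0 <= Hs_dist2 u v)%E.
Proof. by apply: esum_ge0 => n _; rewrite lee_fin mulr_ge0 ?powR_ge0 ?sqr_ge0. Qed.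

Lemma Hs_ballE u v (e : R) : 0 < e -> Hs_ball u e v <-> (Hs_dist2 u v < (e ^+ 2)%:E)%E.
Proof.
move=> e0; rewrite /Hs_ball /= /Hs_norm.
have -> : \esum_(n in [set: int]) (japanese R n `^ (2 * s) *
    normc (fourier (fun x => u x - v x) n) ^+ 2)%:E = Hs_dist2 u v.
  by apply: eq_esum => n _; rewrite fourierB.
by rewrite (sqrte_lt _ (Hs_dist2_ge0 u v)); split => [[]|].
Qed.

Lemma japanese_ge1 n : 1 <= japanese R n.
Proof. by rewrite -sqrtr1 ler_wsqrtr// lerDl sqr_ge0. Qed.

Lemma japanese_gt0 n : 0 < japanese R n.
Proof. exact: lt_le_trans ltr01 (japanese_ge1 n). Qed.

Lemma fourier_dist_le u v n :
  ((japanese R n `^ (2 * s) * normc (fourier u n - fourier v n) ^+ 2)%:E <= Hs_dist2 u v)%E.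
Proof.
apply: esum_ge; exists [set n]; first by split; [exact: finite_set1|].
by rewrite fsbig_set1.
Qed.

Lemma continuous_fourier n (e : R) u : 0 < e ->
  \forall v \near u, normc (fourier u n - fourier (v : Hs s) n) < e.
Proof.
move=> e0; pose r := japanese R n `^ s * e.
have j0 : 0 < japanese R n `^ s by rewrite powR_gt0// japanese_gt0.
have r0 : 0 < r by rewrite mulr_gt0.
have : nbhs u (Hs_ball u r) by apply/nbhs_ballP; exists r.
apply: filterS => v /(Hs_ballE _ _ r0) h.
have := le_lt_trans (fourier_dist_le u v n) h; rewrite lte_fin /r exprMn.
rewrite (_ : (_ `^ s) ^+ 2 = japanese R n `^ (2 * s)); last first.
  by rewrite -powR_mulrn ?powR_ge0// -powRrM mulrC.
rewrite ltr_pM2l ?powR_gt0 ?japanese_gt0// => h2.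
by rewrite -(ltr_pXn2r (n := 2))// ?nnegrE ?normc_ge0 ?ltW.
Qed.

Lemma continuous_Re_fourier n : continuous (fun u : Hs s => complex.Re (fourier u n)).
Proof.
move=> u; apply/(@cvgrPdist_lt _ _ _ (nbhs u) (nbhs_filter u)) => e e0.
apply: filterS (@continuous_fourier n e u e0) => v; apply: le_lt_trans.
apply: le_trans (normr_Re_le _).
by case: (fourier u n) (fourier v n) => [a b] [c d].
Qed.

Lemma continuous_Im_fourier n : continuous (fun u : Hs s => complex.Im (fourier u n)).
Proof.
move=> u; apply/(@cvgrPdist_lt _ _ _ (nbhs u) (nbhs_filter u)) => e e0.
apply: filterS (@continuous_fourier n e u e0) => v; apply: le_lt_trans.
apply: le_trans (normr_Im_le _).
by case: (fourier u n) (fourier v n) => [a b] [c d].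
Qed.

Lemma continuous_measurable_Hs (f : Hs s -> R) : continuous f ->
  measurable_fun [set: borelHs s] (f : borelHs s -> R).
Proof.
move=> cf; apply: (measurability _ (RGenOInfty.measurableE R)).
move=> _ [_ [x ->] <-]; rewrite setTI; apply: sub_sigma_algebra.
by move/continuousP : cf; apply; exact: interval_open.
Qed.

Lemma measurable_Re_fourier n :
  measurable_fun [set: borelHs s] (fun u : borelHs s => complex.Re (fourier (u : Hs s) n)).
Proof. exact: continuous_measurable_Hs (@continuous_Re_fourier n). Qed.

Lemma measurable_Im_fourier n :
  measurable_fun [set: borelHs s] (fun u : borelHs s => complex.Im (fourier (u : Hs s) n)).
Proof. exact: continuous_measurable_Hs (@continuous_Im_fourier n). Qed.

(** Trigonometric polynomials with rational coefficients, indexed by a countable type: the dense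
    sequence behind separability. *)
Definition rat_trig (q : seq (int * (rat * rat))) : Hs s :=
  foldr (fun t v => add_mode v t.1 (ratr t.2.1 +i* ratr t.2.2)) (@Hs0 R s) q.

Lemma fourier_Hs0 n : fourier (@Hs0 R s) n = 0.
Proof.
by rewrite /fourier (cintegral_Zexpi 0); case: ifP.
Qed.

Lemma fourier_rat_trig (L : seq int) (c : int -> rat * rat) n : uniq L ->
  fourier (rat_trig [seq (m, c m) | m <- L]) n =
  if n \in L then ratr (c n).1 +i* ratr (c n).2 else 0.
Proof.
elim: L => [|m L IH]; first by rewrite fourier_Hs0.
move=> /= /andP[mL uL]; rewrite fourier_add_modeE IH// in_cons.
by have [<-|nm] := eqVneq m n; rewrite ?(negbTE mL) ?add0r// addr0.
Qed.

Lemma rat_dense_complex (z : R[i]) (e : R) : 0 < e ->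
  exists c : rat * rat, normc (ratr c.1 +i* ratr c.2 - z) ^+ 2 <= e.
Proof.
move=> e0; have d0 : 0 < Num.min 1 (e / 2) by rewrite lt_min ltr01 divr_gt0.
set d := Num.min _ _ in d0.
have d1 : d <= 1 by rewrite ge_min lexx.
have de : d <= e / 2 by rewrite ge_min lexx orbT.
have h (a : R) : exists q : rat, (ratr q - a) ^+ 2 <= d.
  have [q] := @rat_in_itvoo R (a - d) (a + d) ltac:(lra).
  rewrite in_itv /= => /andP[q1 q2]; exists q; nra.
case: z => a b; have [q1 h1] := h a; have [q2 h2] := h b.
by exists (q1, q2); rewrite normc_sqr /=; lra.
Qed.

Lemma Hs_dist20_fin u : (\esum_(n in [set: int])
  (japanese R n `^ (2 * s) * normc (fourier u n) ^+ 2)%:E < +oo)%E.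
Proof. by have := Hs_fin u; rewrite /Hs_norm; case: (esum _ _) => //= r _; rewrite ltry. Qed.

Lemma esum_freqs (a : int -> \bar R) K : (forall n, 0 <= a n)%E ->
  \esum_(n in [set` freqs K]) a n = (\sum_(n <- freqs K) a n)%E.
Proof.
move=> a0; rewrite esum_fset; [|exact: finite_seq|by []].
exact/esym/fsbig_seq/freqs_uniq.
Qed.

Lemma Hs_separable u (e : R) : 0 < e -> exists q, Hs_ball (rat_trig q) e u.
Proof.
move=> e0; have e2 : 0 < e ^+ 2 by rewrite exprn_gt0.
pose a (n : int) : \bar R := (japanese R n `^ (2 * s) * normc (fourier u n) ^+ 2)%:E.
have a0 n : (0 <= a n)%E by rewrite lee_fin mulr_ge0 ?powR_ge0 ?sqr_ge0.
have afin : (\esum_(n in [set: int]) a n)%E \is a fin_num.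
  by rewrite ge0_fin_numE ?Hs_dist20_fin//; apply: esum_ge0.
have [K hK] : exists K, (\esum_(n in [set: int] `&` ~` [set` freqs K]) a n < (e ^+ 2 / 2)%:E)%E.
  have := esum_int_cvg a0; rewrite -(fineK afin) => /fine_cvgP [_ /cvgrPdist_lt].
  move=> /(_ (e ^+ 2 / 2)); rewrite divr_gt0// => /(_ isT) [K _ /(_ K (leqnn _)) /= hK].
  exists K; have h := esumID [set` freqs K] [set: int] a (fun i _ => a0 i).
  have hK1 : \esum_(i in [set: int] `&` [set` freqs K]) a i = (\sum_(n <- freqs K) a n)%E.
    by rewrite setTI esum_freqs.
  have fK : (\sum_(n <- freqs K) a n)%E \is a fin_num by rewrite /a sumEFin.
  have fT : (\esum_(n in [set: int] `&` ~` [set` freqs K]) a n)%E \is a fin_num.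
    rewrite ge0_fin_numE; last by apply: esum_ge0.
    apply: le_lt_trans (Hs_dist20_fin u); rewrite h leeDr//; exact: esum_ge0.
  rewrite -(fineK fT) lte_fin; apply: le_lt_trans hK; apply: le_trans (ler_norm _).
  by rewrite h hK1 fineD// addrAC subrr add0r.
have j0 n : 0 < japanese R n `^ (2 * s) by rewrite powR_gt0// japanese_gt0.
(* Each of the 2K + 1 retained coefficients may contribute e^2 / (4 (2K + 1)), which leaves e^2 / 2
   for the tail. *)
have /boolp.choice [c hc] n : exists c : rat * rat, normc (ratr c.1 +i* ratr c.2 - fourier u n) ^+ 2
    <= e ^+ 2 / (4 * K.*2.+1%:R) / japanese R n `^ (2 * s).
  by apply: rat_dense_complex; rewrite !divr_gt0// mulr_gt0 ?ltr0n.
exists [seq (n, c n) | n <- freqs K]; apply/Hs_ballE => //.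
rewrite /Hs_dist2 (esumID [set` freqs K]); last first.
  by move=> n _; rewrite lee_fin mulr_ge0 ?powR_ge0 ?sqr_ge0.
have -> : (e ^+ 2)%:E = ((e ^+ 2 / 2)%:E + (e ^+ 2 / 2)%:E)%E by rewrite -EFinD -splitr.
apply: lee_ltD => //; last first.
  congr (_ < _)%E: hK; apply: eq_esum => n [_ /= nK].
  rewrite fourier_rat_trig ?freqs_uniq//; case: ifPn => [nK'|_]; first by exfalso; exact: nK.
  by rewrite sub0r /a !normc_sqr; case: (fourier u n) => p q /=; rewrite !sqrrN.
rewrite setTI esum_freqs; last first.
  by move=> n; rewrite lee_fin mulr_ge0 ?powR_ge0 ?sqr_ge0.
rewrite sumEFin lee_fin.
apply: (@le_trans _ _ (\sum_(n <- freqs K) e ^+ 2 / (4 * K.*2.+1%:R))).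
  rewrite big_seq [leRHS]big_seq; apply: ler_sum => n nK.
  rewrite fourier_rat_trig ?freqs_uniq// nK.
  by have := hc n; rewrite ler_pdivlMr// mulrC.
rewrite big_freqs sumr_const card_ord -[leLHS]mulr_natr.
have -> : e ^+ 2 / (4 * K.*2.+1%:R) * K.*2.+1%:R = e ^+ 2 / 4 by field.
by move: (ltW e2); move: (e ^+ 2) => x x0; lra.
rewrite setTI esum_freqs ?sumEFin// => n.
by rewrite lee_fin mulr_ge0 ?powR_ge0 ?sqr_ge0.
Qed.

Lemma Hs_ball_le u v (e1 e2 : R) : e1 <= e2 -> Hs_ball u e1 v -> Hs_ball u e2 v.
Proof. by move=> e12; rewrite /Hs_ball /= => /lt_le_trans; apply; rewrite lee_fin. Qed.

(** By separability an open set is a countable union of balls with centre in [rat_trig], and the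
    distance to such a centre is a limit of finite sums in the coefficients. So the Borel sets are
    generated by the Fourier coefficients. *)
Lemma measurable_into_Hs d (T : measurableType d) (F : T -> borelHs s) :
  (forall n, measurable_fun [set: T] (fun t => complex.Re (fourier (F t : Hs s) n))) ->
  (forall n, measurable_fun [set: T] (fun t => complex.Im (fourier (F t : Hs s) n))) ->
  measurable_fun [set: T] F.
Proof.
move=> mR mI; have hG : open.-sigma.-measurable = <<s @open (Hs s) >> by [].
apply: (measurability _ hG).
move=> _ [U oU <-]; rewrite setTI.
have mball q (e : R) : 0 < e -> measurable (F @^-1` (Hs_ball (rat_trig q) e)).
  move=> e0; rewrite (_ : F @^-1` _ = [set: T] `&` [set t | Hs_dist2 (rat_trig q) (F t) < (e ^+ 2)%:E]%E); last first.
    by rewrite setTI; apply/seteqP; split => t /=; [move=> /(Hs_ballE _ _ e0)|move=> h; apply/(Hs_ballE _ _ e0)].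
  suff mD : measurable_fun [set: T] (fun t => Hs_dist2 (rat_trig q) (F t)).
    by apply: emeasurable_fun_infty_o.
  apply: (emeasurable_fun_cvg (fun K t => \sum_(n <- freqs K) (japanese R n `^ (2 * s) *
     normc (fourier (rat_trig q) n - fourier (F t : Hs s) n) ^+ 2)%:E)%E); last first.
    move=> t _; apply: (esum_int_cvg (a := fun n => (japanese R n `^ (2 * s) *
     normc (fourier (rat_trig q) n - fourier (F t : Hs s) n) ^+ 2)%:E)) => n.
    by rewrite lee_fin mulr_ge0 ?powR_ge0 ?sqr_ge0.
  move=> K; apply: emeasurable_sum => n; apply/measurable_EFinP; apply: measurable_funM => //.
  rewrite (_ : (fun t => _) = (fun t =>
    (complex.Re (fourier (rat_trig q) n) - complex.Re (fourier (F t : Hs s) n)) ^+ 2 +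
    (complex.Im (fourier (rat_trig q) n) - complex.Im (fourier (F t : Hs s) n)) ^+ 2)); last first.
    by apply/funext => t; rewrite normc_sqr; case: (fourier _ n) (fourier _ n) => [? ?] [? ?].
  by apply: measurable_funD; apply: measurable_funX; apply: measurable_funB.
(* The pairs (centre, radius) are enumerated by [unpickle], and those whose ball leaves U are
   replaced by the empty set. *)
pose I (i : seq (int * (rat * rat)) * nat) := Hs_ball (rat_trig i.1) i.2.+1%:R^-1 `<=` U.
pose G k := if @choice.unpickle (seq (int * (rat * rat)) * nat)%type k is Some i then
  (if `[< I i >] then Hs_ball (rat_trig i.1) i.2.+1%:R^-1 else set0) else set0.
have -> : U = \bigcup_k G k.
  apply/seteqP; split => [u Uu|u [k _]]; last first.
    by rewrite /G; case: (choice.unpickle k) => // i; case: asboolP => // Ii /Ii.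
  have /nbhs_ballP [e /= e0 he] : nbhs u U by apply: open_nbhs_nbhs.
  have [k hk] : exists k : nat, k.+1%:R^-1 < e / 2.
    have [k _ hk] := near_infty_natSinv_lt (PosNum (divr_gt0 e0 (ltr0Sn R 1))).
    by exists k; apply: hk => /=.
  have k0 : 0 < k.+1%:R^-1 :> R by rewrite invr_gt0.
  have [q hq] := Hs_separable u k0.
  exists (choice.pickle (q, k)) => //; rewrite /G choice.pickleK; case: asboolP => // -[] v /= hv.
  apply: he; suff : Hs_ball u e v by [].
  rewrite (splitr e); apply: (Hs_ball_triangle (v := rat_trig q)).
    by apply: Hs_ball_le (Hs_ball_sym hq); exact: ltW.
  by apply: Hs_ball_le hv; exact: ltW.
rewrite preimage_bigcup; apply: bigcupT_measurable => k.
rewrite /G; case: (choice.unpickle k) => [i|]; last by rewrite preimage_set0.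
by case: asboolP => _; [apply: mball; rewrite invr_gt0|rewrite preimage_set0].
Qed.

Definition fourier_coord (i : int * bool) (u : Hs s) : R :=
  if i.2 then complex.Re (fourier u i.1) else complex.Im (fourier u i.1).

Lemma measurable_fourier_coord i :
  measurable_fun [set: borelHs s] (fourier_coord i : borelHs s -> R).
Proof.
by case: i => n []; [exact: measurable_Re_fourier|exact: measurable_Im_fourier].
Qed.

(** A family stable under intersection that generates the Borel sets: probabilities are compared on
    it. The boolean selects the real or the imaginary part. *)
Definition half_box (J : seq (int * bool)) (t : int * bool -> R) : set (borelHs s) :=
  [set u | forall i, i \in J -> t i <= fourier_coord i u].

Lemma measurable_half_box J t : measurable (half_box J t).
Proof.
elim: J => [|i J IH].
  by rewrite (_ : half_box _ _ = setT)//; apply/seteqP; split.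
rewrite (_ : half_box _ _ = (fourier_coord i @^-1` `[t i, +oo[) `&` half_box J t).
  apply: measurableI => //; rewrite -[X in measurable X]setTI.
  exact: measurable_fourier_coord.
apply/seteqP; split => u /=.
  move=> h; split; first by rewrite in_itv /= andbT; apply: h; rewrite mem_head.
  by move=> j jJ; apply: h; rewrite in_cons jJ orbT.
rewrite in_itv /= andbT => -[h1 h2] j; rewrite in_cons => /orP[/eqP ->//|]; exact: h2.
Qed.

Lemma Hs_prob_eq (P Q : probability (borelHs s) R) :
  (forall J t, P (half_box J t) = Q (half_box J t)) ->
  forall E, measurable E -> P E = Q E.
Proof.
move=> PQ; pose G := [set E | exists J t, E = half_box J t].
have mG : (open.-sigma.-measurable : set (set (borelHs s))) = <<s G >>.
  apply/seteqP; split; last first.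
    apply: smallest_sub; first exact: sigma_algebra_measurable.
    by move=> _ [J [t ->]]; exact: measurable_half_box.
  have mc i : measurable_fun [set: g_sigma_algebraType G] (fourier_coord i : g_sigma_algebraType G -> R).
    apply: (measurability _ (RGenCInfty.measurableE R)) => _ [_ [x ->] <-].
    rewrite setTI; apply: sub_sigma_algebra; exists [:: i], (fun=> x).
    apply/seteqP; split => u /=; rewrite in_itv /= andbT.
      by move=> h j; rewrite inE => /eqP ->.
    by apply; rewrite mem_head.
  (* Measurability of the identity, from the sigma-algebra generated by half boxes to the Borel one,
     is the inclusion still to be proved. *)
  have mid : measurable_fun [set: g_sigma_algebraType G] (idfun : g_sigma_algebraType G -> borelHs s).
    by apply: measurable_into_Hs => n; [exact: (mc (n, true))|exact: (mc (n, false))].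
  by move=> E mE; have := mid measurableT E mE; rewrite setTI.
apply: (@measure_unique _ _ _ G (fun=> setT)) => //.
- move=> _ _ [J [t ->]] [J' [t' ->]].
  pose t2 i := if i \in J then (if i \in J' then Num.max (t i) (t' i) else t i) else t' i.
  exists (J ++ J'), t2; apply/seteqP; split => u /=.
    move=> [h h'] i; rewrite mem_cat /t2 => /orP[iJ|iJ].
      by rewrite iJ; case: ifPn => iJ'; rewrite ?ge_max ?h ?h'.
    by case: ifPn => iJ'; rewrite ?iJ ?ge_max ?h ?h'.
  move=> h; split => i iJ.
    apply: le_trans (h i _); last by rewrite mem_cat iJ.
    by rewrite /t2 iJ; case: ifPn => // _; rewrite le_max lexx.
  apply: le_trans (h i _); last by rewrite mem_cat iJ orbT.
  by rewrite /t2 iJ; case: ifPn => // _; rewrite le_max lexx orbT.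
- by move=> _; exists [::], (fun=> 0); apply/seteqP; split.
- by rewrite bigcup_const.
- by move=> _ [J [t ->]]; exact: PQ.
- by move=> _; apply: le_lt_trans (probability_le1 _ _) _; rewrite ?ltry.
Qed.

End Hs_measurability.

(** * Measurability of mass and momentum *)

Section Hs_functionals.
Variables (R : realType) (s : R).
Implicit Types (n : int) (u v : Hs s) (K : nat).

Lemma measurable_normc_fourier2 n :
  measurable_fun [set: borelHs s] (fun u : borelHs s => normc (fourier (u : Hs s) n) ^+ 2).
Proof.
under eq_fun do rewrite normc_sqr.
by apply: measurable_funD; apply: measurable_funX;
  [exact: measurable_Re_fourier|exact: measurable_Im_fourier].
Qed.

Lemma measurable_sum_freqs (F : int -> borelHs s -> R) K :
  (forall n, measurable_fun [set: borelHs s] (F n)) ->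
  measurable_fun [set: borelHs s] (fun u => \sum_(n <- freqs K) F n u).
Proof. by move=> mF; exact: measurable_sum. Qed.

Lemma measurable_mass : measurable_fun [set: borelHs s] (@mass R s : borelHs s -> R).
Proof.
apply: (@measurable_fun_cvg _ _ R _ (fun K (u : borelHs s) => energy K (u : Hs s))) => [K|u _].
  by apply: measurable_sum_freqs => n; exact: measurable_normc_fourier2.
exact: energy_cvg.
Qed.

Lemma momentum_partial_sumE u K :
  momentum_partial_sum u K = \sum_(n <- freqs K) freq R n * normc (fourier u n) ^+ 2.
Proof. by rewrite big_freqs. Qed.

Lemma measurable_momentum_partial_sum K :
  measurable_fun [set: borelHs s] (fun u : borelHs s => momentum_partial_sum (u : Hs s) K).
Proof.
under eq_fun do rewrite momentum_partial_sumE.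
apply: measurable_sum_freqs => n; apply: measurable_funM => //.
exact: measurable_normc_fourier2.
Qed.

Definition momentum_cvg : set (borelHs s) :=
  [set u | cvgn (momentum_partial_sum (u : Hs s))].

(** The upper limit is measurable and defined everywhere; on [momentum_cvg] it is the limit of the
    partial sums. *)
Definition momentum (u : borelHs s) : R :=
  fine (limn_esup (fun K => (momentum_partial_sum (u : Hs s) K)%:E)).

Lemma measurable_limn_esup_momentum : measurable_fun [set: borelHs s]
  (fun u : borelHs s => limn_esup (fun K => (momentum_partial_sum (u : Hs s) K)%:E)).
Proof.
apply: measurable_fun_limn_esup => K; apply/measurable_EFinP.
exact: measurable_momentum_partial_sum.
Qed.

Lemma measurable_momentum : measurable_fun [set: borelHs s] momentum.
Proof.
apply: measurableT_comp; first exact: fine_measurable.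
exact: measurable_limn_esup_momentum.
Qed.

Lemma momentumE (u : borelHs s) (l : R) :
  momentum_partial_sum (u : Hs s) @ \oo --> l -> momentum u = l.
Proof.
move=> h; have h2 : (fun K => (momentum_partial_sum (u : Hs s) K)%:E) @ \oo --> l%:E.
  by apply: cvg_EFin => //; near=> K.
by rewrite /momentum (cvg_limn_einf_sup h2).2.
Unshelve. all: by end_near. Qed.

Lemma momentum_lim (u : borelHs s) : momentum_cvg u ->
  momentum_partial_sum (u : Hs s) @ \oo --> momentum u.
Proof. by move=> cu; rewrite (momentumE cu). Qed.

(** Convergence is expressed by the Cauchy criterion with countably many quantifiers. *)
Lemma measurable_momentum_cvg : measurable momentum_cvg.
Proof.
pose S (u : borelHs s) K := momentum_partial_sum (u : Hs s) K.
rewrite (_ : momentum_cvg = \bigcap_k \bigcup_N \bigcap_m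
  ((fun u => S u (N + m)%N - S u N) @^-1` `[- k.+1%:R^-1, k.+1%:R^-1])).
  apply: bigcapT_measurable => k; apply: bigcupT_measurable => N.
  apply: bigcapT_measurable => m; rewrite -[X in measurable X]setTI.
  apply: measurable_funB => //; exact: measurable_momentum_partial_sum.
apply/seteqP; split => u /=.
  move=> /cvg_ex[l /cvgrPdist_le ul] k _.
  have k0 : 0 < k.+1%:R^-1 / 2 :> R by rewrite divr_gt0.
  have [N _ hN] := ul _ k0.
  exists N => // m _; rewrite /= in_itv /= -ler_norml.
  have h1 := hN (N + m)%N (leq_addr _ _); have h2 := hN N (leqnn _).
  rewrite (_ : _ - _ = (l - S u N) - (l - S u (N + m)%N)); last by ring.
  by apply: le_trans (ler_normB _ _) _; rewrite [leRHS]splitr; exact: lerD.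
move=> h; apply/cauchy_cvgP/cauchy_exP => e e0.
have [k _ hk] := near_infty_natSinv_lt (PosNum e0).
have [N _ hN] := h k I; exists (S u N); exists N => // m /= Nm.
rewrite /ball /= distrC; have := hN (m - N)%N I.
rewrite /= in_itv /= -ler_norml subnKC// => /le_lt_trans; apply.
exact: hk k (leqnn k).
Qed.

Lemma mass_momentum_eventE A B : mass_momentum_event A B =
  [set u : borelHs s | A (mass (u : Hs s)) /\ momentum_cvg u /\ B (momentum u)].
Proof.
apply/seteqP; split => u /= [hA [hc hB]]; split => //; split => //.
  by rewrite (momentumE hc).
by rewrite -(momentumE hc).
Qed.

Lemma measurable_mass_momentum_event A B : measurable A -> measurable B ->
  measurable (@mass_momentum_event R s A B).
Proof.
move=> mA mB; rewrite mass_momentum_eventE.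
rewrite (_ : [set u | _] = (@mass R s : borelHs s -> R) @^-1` A `&`
   (momentum_cvg `&` momentum @^-1` B)) //.
apply: measurableI; first by rewrite -[X in measurable X]setTI; exact: measurable_mass.
apply: measurableI; first exact: measurable_momentum_cvg.
by rewrite -[X in measurable X]setTI; exact: measurable_momentum.
Qed.

End Hs_functionals.

(** * Gaussian measures *)

Section lebesgue_affine.
Variable R : realType.
Local Notation leb := (@lebesgue_measure R).
Implicit Types (h : R -> \bar R) (a b c d x y : R).

Lemma measurable_affine c d :
  measurable_fun [set: R] ((fun x => c * x + d) : R -> measurableTypeR R).
Proof. by apply: measurable_funD => //; exact: measurable_funM. Qed.

Lemma lebesgue_measure_affine_gt0 c d (A : set R) : 0 < c -> measurable A ->
  leb A = (c%:E * leb ((fun x => c * x + d)%R @^-1` A))%E.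
Proof.
move=> c0 mA.
pose mu := mscale (NngNum (ltW c0)) (pushforward leb ((fun x => c * x + d) : R -> measurableTypeR R)).
rewrite -[RHS]/(mu (measurable_affine c d) A).
apply: lebesgue_measure_unique => // _ [[a b] /= _ <-]; rewrite /mscale /= /pushforward.
have -> : (fun x => c * x + d) @^-1` `]a, b]%classic = `](a - d) / c, (b - d) / c]%classic.
  by apply/seteqP; split => x /=; rewrite !in_itv /= ltr_pdivrMr// ler_pdivlMr//
    ltrBlDr lerBrDr mulrC.
rewrite !lebesgue_measure_itv /= !lte_fin ltr_pM2r ?invr_gt0// ltrD2r.
case: ifPn => _; last by rewrite mule0.
by rewrite -!EFinD -EFinM; congr EFin; field; rewrite gt_eqF.
Qed.

Lemma integral_affine_gt0 h c d : 0 < c -> measurable_fun [set: R] h ->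
  (forall x, 0 <= h x)%E -> (\int[leb]_x h x = c%:E * \int[leb]_x h (c * x + d)%R)%E.
Proof.
move=> c0 mh h0.
have mf := measurable_affine c d.
pose mu := mscale (NngNum (ltW c0)) (pushforward leb ((fun x => c * x + d) : R -> measurableTypeR R)).
transitivity (\int[mu mf]_x h x)%E.
  by apply: eq_measure_integral => //= A mA _; exact: lebesgue_measure_affine_gt0.
rewrite ge0_integral_mscale//; congr (_ * _)%E.
by rewrite ge0_integral_pushforward.
Qed.

Lemma integral_opp h : measurable_fun [set: R] h ->
  (forall x, 0 <= h x)%E -> (\int[leb]_x h x = \int[leb]_x h (- x)%R)%E.
Proof.
move=> mh h0.
pose mu := pushforward leb (-%R : R -> measurableTypeR R).
transitivity (\int[mu]_x h x)%E.
  by apply: eq_measure_integral => //= A mA _; rewrite /mu lebesgue_measureN.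
by rewrite ge0_integral_pushforward.
Qed.

Lemma integral_affine h c d : c != 0 -> measurable_fun [set: R] h ->
  (forall x, 0 <= h x)%E -> (\int[leb]_x h x = `|c|%:E * \int[leb]_x h (c * x + d)%R)%E.
Proof.
move=> c0 mh h0; case: (ltrgt0P c) c0 => // [cp _|cn _].
  exact: integral_affine_gt0.
rewrite (@integral_affine_gt0 h (- c) d) ?oppr_gt0//; congr (_ * _)%E.
rewrite [RHS]integral_opp//.
  by apply: eq_integral => x _; rewrite mulrN mulNr.
by apply: (measurableT_comp mh); exact: measurable_affine.
Qed.



End lebesgue_affine.

(** * Images of measures with density *)

Section density.
Context d1 d2 (T1 : measurableType d1) (T2 : measurableType d2) (R : realType).
Variables (mu : {measure set T1 -> \bar R}) (tau : T1 -> T2) (f : T1 -> R).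
Hypotheses (mtau : measurable_fun [set: T1] tau) (mf : measurable_fun [set: T1] f).
Hypothesis f0 : forall x, 0 <= f x.

Import HBNNSimple.

(** [nu] is the image under [tau] of the measure with density [f]; the formula extends from
    indicators to simple functions and, by monotone convergence, to nonnegative functions. *)
Lemma ge0_integral_density (nu : {measure set T2 -> \bar R}) (h : T2 -> \bar R) :
  (forall E, measurable E -> nu E = \int[mu]_x (f x * \1_E (tau x))%:E)%E ->
  measurable_fun [set: T2] h -> (forall y, 0 <= h y)%E ->
  (\int[nu]_y h y = \int[mu]_x ((f x)%:E * h (tau x)))%E.
Proof.
move=> nuE mh h0; pose g_ := nnsfun_approx measurableT mh.
have mgt (g : {nnsfun T2 >-> R}) : measurable_fun [set: T1] (g \o tau).
  exact: measurableT_comp.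
have simple (g : {nnsfun T2 >-> R}) :
    (\int[nu]_y (g y)%:E = \int[mu]_x ((f x)%:E * (g (tau x))%:E))%E.
  under [LHS]eq_integral do rewrite fimfunE -fsumEFin//.
  rewrite [LHS]ge0_integral_fsum//; last 2 first.
  - by move=> r; exact/measurable_EFinP/measurableT_comp.
  - by move=> n x _; rewrite EFinM nnfun_muleindic_ge0.
  under [RHS]eq_integral.
    move=> x xD; rewrite fimfunE -fsumEFin// ge0_mule_fsumr; last first.
      by move=> r; rewrite EFinM nnfun_muleindic_ge0.
    over.
  have mi r : measurable_fun [set: T1] (fun x => \1_(g @^-1` [set r]) (tau x) : R).
    have m1 : measurable_fun [set: T2] (\1_(g @^-1` [set r]) : T2 -> R) by exact: measurable_indic.
    exact: (measurableT_comp m1 mtau).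
  rewrite [RHS]ge0_integral_fsum//; last 2 first.
  - move=> r; apply: emeasurable_funM; apply/measurable_EFinP => //.
    by apply: measurable_funM => //; exact: mi.
  - by move=> n x _; rewrite mule_ge0 ?lee_fin// -lee_fin EFinM nnfun_muleindic_ge0.
  apply: eq_fsbigr => r _; rewrite integralZl_indic_nnsfun// integral_indic// setIT.
  have [r0|r0] := leP 0 r.
    rewrite nuE// -ge0_integralZl//.
    - by apply: eq_integral => x _; rewrite !EFinM muleCA.
    - by apply/measurable_EFinP; apply: measurable_funM.
    - by move=> x _; rewrite lee_fin mulr_ge0.
  have g0 : g @^-1` [set r] = set0.
    by rewrite -subset0 => y /= gy; have : 0 <= g y by []; rewrite gy leNgt r0.
  rewrite g0 measure0 mule0 integral0_eq// => x _.
  by rewrite indic0 mulr0 mule0.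
transitivity (limn (fun n => \int[nu]_y (g_ n y)%:E))%E.
  rewrite -monotone_convergence//=.
  - by apply: eq_integral => y _; apply/esym/cvg_lim => //=; exact: cvg_nnsfun_approx.
  - by move=> n; apply/measurable_EFinP.
  - by move=> n y _; rewrite lee_fin.
  - by move=> y _ a b ab; rewrite lee_fin//; exact/lefP/nd_nnsfun_approx.
rewrite [in RHS](_ : (fun x => _) = (fun x => limn (fun n => (f x)%:E * (g_ n (tau x))%:E)%E)); last first.
  apply/funext => x; apply/esym/cvg_lim => //=; apply: cvgeZl => //.
  exact: cvg_nnsfun_approx.
rewrite monotone_convergence//=.
- by congr (limn _); apply/funext => n; rewrite simple.
- by move=> n; apply: emeasurable_funM; apply/measurable_EFinP => //; exact: (mgt (g_ n)).
- by move=> n x _; rewrite mule_ge0// lee_fin.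
- move=> x _ a b ab; rewrite lee_wpmul2l ?lee_fin//; exact/lefP/nd_nnsfun_approx.
Qed.

Definition density_measure (E : set T2) : \bar R :=
  (\int[mu]_(x in tau @^-1` E) (f x)%:E)%E.

Let mpre E : measurable E -> measurable (tau @^-1` E).
Proof. by move=> mE; rewrite -[X in measurable X]setTI; exact: mtau. Qed.

Let density_measure0 : density_measure set0 = 0%E.
Proof. by rewrite /density_measure preimage_set0 integral_set0. Qed.

Let density_measure_ge0 E : (0 <= density_measure E)%E.
Proof. by apply: integral_ge0 => x _; rewrite lee_fin. Qed.

Let density_measure_sigma_additive : semi_sigma_additive density_measure.
Proof.
move=> F mF tF mUF; rewrite /density_measure preimage_bigcup.
rewrite ge0_integral_bigcup//.
- apply: is_cvg_ereal_nneg_natsum_cond => n _ _; exact: density_measure_ge0.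
- by move=> n; exact: mpre.
- apply/measurable_EFinP; exact: measurable_funTS.
- by move=> x _; rewrite lee_fin.
- apply/trivIsetP => /= i j _ _ ij; rewrite -preimage_setI.
  by move/trivIsetP : tF => /(_ _ _ _ _ ij) ->//; rewrite preimage_set0.
Qed.

HB.instance Definition _ := isMeasure.Build _ _ _ density_measure
  density_measure0 density_measure_ge0 density_measure_sigma_additive.

Lemma density_measureE E : measurable E ->
  density_measure E = (\int[mu]_x (f x * \1_E (tau x))%:E)%E.
Proof.
move=> mE; rewrite /density_measure integral_mkcond; apply: eq_integral => x _.
rewrite patchE; case: ifPn => xE; rewrite indicE.
  by move: xE; rewrite inE /= => xE; rewrite mem_set// mulr1.
by move: xE; rewrite notin_setE /= => xE; rewrite memNset// mulr0.
Qed.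

(** Common source of the elementary conditional laws, of P_0 and of the Gibbs measures. *)
Lemma density_probability (Z := (\int[mu]_x (f x)%:E)%E) : (0 < Z)%E -> (Z < +oo)%E ->
  exists Q : probability T2 R, forall E, measurable E ->
    Q E = ((fine Z)^-1%:E * \int[mu]_x (f x * \1_E (tau x))%:E)%E.
Proof.
move=> Z0 Zoo.
have Zf : 0 < fine Z by apply: fine_gt0; rewrite Z0.
have Zi0 : 0 <= (fine Z)^-1 by rewrite invr_ge0 ltW.
pose m := mscale (NngNum Zi0) density_measure.
have m1 : m setT = 1%E.
  rewrite /m /mscale /= density_measureE//.
  rewrite (_ : (\int[mu]_x _)%E = Z); last by apply: eq_integral => x _; rewrite indicT mulr1.
  by rewrite -[X in (_ * X)%E](@fineK _ Z) ?ge0_fin_numE 1?ltW// -EFinM mulVf// gt_eqF.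
pose pm := Measure_isProbability.Build _ _ _ m m1.
pose Q : probability T2 R := HB.pack m pm.
exists Q => E mE.
by rewrite -density_measureE.
Qed.

End density.

Section gaussian.
Variable R : realType.
Local Notation leb := (@lebesgue_measure R).
Local Notation phi := (normal_pdf (0 : R) 1).
Implicit Types (h : R -> \bar R) (t x y : R).

Lemma normal_pdf01E x : phi x = normal_peak 1 * expR (- x ^+ 2 / 2).
Proof. by rewrite normal_pdfE ?oner_neq0// /normal_fun subr0 expr1n. Qed.

Lemma integral_normal_prob01 h : measurable_fun [set: R] h -> (forall x, 0 <= h x)%E ->
  (\int[normal_prob (0 : R) 1]_x h x = \int[leb]_x (h x * (phi x)%:E))%E.
Proof.
move=> mh h0.
rewrite (@ge0_integral_density _ _ _ _ R leb idfun phi)//.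
- by apply: eq_integral => x _; rewrite muleC.
- exact: measurable_id.
- exact: measurable_normal_pdf.
- exact: normal_pdf_ge0.
- move=> E mE; transitivity (\int[leb]_(x in E) (phi x)%:E)%E; first by [].
  rewrite [LHS]integral_mkcond; apply: eq_integral => x _.
  by rewrite patchE EFinM /=; case: ifPn => xE;
    rewrite indicE ?xE ?mule1 // (negbTE xE) mule0.
Qed.

Lemma integral_expR_normal t :
  (\int[normal_prob (0 : R) 1]_x (expR (t * x))%:E = (expR (t ^+ 2 / 2))%:E)%E.
Proof.
rewrite integral_normal_prob01//; last first.
- apply/measurable_EFinP; apply: measurableT_comp => //; exact: measurable_funM.
transitivity (\int[leb]_x ((expR (t ^+ 2 / 2))%:E * (normal_pdf t 1 x)%:E))%E.
  apply: eq_integral => x _; rewrite -!EFinM normal_pdf01E normal_pdfE ?oner_neq0//.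
  rewrite /normal_fun expr1n; congr EFin.
  rewrite mulrCA [RHS]mulrCA -!expRD; congr (_ * expR _); by field.
rewrite ge0_integralZl//.
- by rewrite integral_normal_pdf mule1.
- by apply/measurable_EFinP; exact: measurable_normal_pdf.
- by move=> x _; rewrite lee_fin normal_pdf_ge0.
Qed.

(** The integrand times the standard normal density is sqrt 2 times the normal density of variance
    2. *)
Lemma integral_expR_sqr_normal :
  (\int[normal_prob (0 : R) 1]_x (expR (x ^+ 2 / 4))%:E = (Num.sqrt 2)%:E)%E.
Proof.
rewrite integral_normal_prob01//; last first.
- apply/measurable_EFinP; apply: measurableT_comp => //; apply: measurable_funM => //; exact: measurable_funX.
have s20 : Num.sqrt 2 != 0 :> R by rewrite sqrtr_eq0 -ltNge.
transitivity (\int[leb]_x ((Num.sqrt 2)%:E * (normal_pdf 0 (Num.sqrt 2) x)%:E))%E.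
  apply: eq_integral => x _; rewrite -!EFinM normal_pdf01E normal_pdfE//.
  rewrite /normal_fun subr0 sqr_sqrtr// /normal_peak sqr_sqrtr// expr1n.
  have hp : Num.sqrt 2 * (Num.sqrt (2 * pi *+ 2))^-1 = (Num.sqrt (1 * pi *+ 2))^-1 :> R.
    rewrite (_ : 2 * pi *+ 2 = 2 * (1 * pi *+ 2)); last by rewrite mul1r mulrnAr.
    by rewrite sqrtrM// invfM mulVKf.
  by congr EFin; rewrite [RHS]mulrA hp mulrCA -expRD; congr (_ * expR _); field.
rewrite ge0_integralZl//.
- by rewrite integral_normal_pdf mule1.
- by apply/measurable_EFinP; exact: measurable_normal_pdf.
- by move=> x _; rewrite lee_fin normal_pdf_ge0.
Qed.

End gaussian.

Definition gaussian1 (R : realType) : set R -> \bar R := normal_prob (0 : R) 1.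

Lemma gaussian1_sigma_additive (R : realType) : semi_sigma_additive (@gaussian1 R).
Proof. exact: (@measure_semi_sigma_additive _ _ _ (normal_prob (0 : R) 1)). Qed.

HB.instance Definition _ (R : realType) := @isMeasure.Build _ R R (@gaussian1 R)
  (measure0 (normal_prob (0 : R) 1)) (measure_ge0 (normal_prob (0 : R) 1))
  (@gaussian1_sigma_additive R).

HB.instance Definition _ (R : realType) := @Measure_isProbability.Build _ R R (@gaussian1 R)
  (probability_setT (normal_prob (0 : R) 1)).

Definition gaussian2 (R : realType) : probability (R * R)%type R := (@gaussian1 R \x @gaussian1 R)%E.

Lemma integral_gaussian1 (R : realType) (h : R -> \bar R) : measurable_fun [set: R] h ->
  (forall x, 0 <= h x)%E ->
  (\int[@gaussian1 R]_x h x = \int[lebesgue_measure]_x (h x * (normal_pdf (0 : R) 1 x)%:E))%E.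
Proof.
move=> mh h0.
rewrite (@ge0_integral_density _ _ _ _ R lebesgue_measure (fun x : measurableTypeR R => x : R)
  (normal_pdf (0 : R) 1) _ _ _ (@gaussian1 R) h) //.
- by apply: eq_integral => x _; rewrite muleC.
- exact: measurable_normal_pdf.
- by move=> x; exact: normal_pdf_ge0.
- move=> E mE; transitivity (\int[lebesgue_measure]_(x in E) (normal_pdf (0 : R) 1 x)%:E)%E; first by [].
  rewrite [LHS]integral_mkcond; apply: eq_integral => x _.
  by rewrite patchE indicE; case: ifPn => _; rewrite ?mulr1 ?mulr0.
Qed.

(** * Modulus and direction of a planar Gaussian vector *)

Section polar.
Variable R : realType.
Local Notation leb := (@lebesgue_measure R).
Local Notation phi := (normal_pdf (0 : R) 1).
Local Notation N1 := (normal_prob (0 : R) 1).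
Implicit Types (h : R * R -> \bar R) (t x y r : R) (z : R * R).

Definition sqnorm z : R := z.1 ^+ 2 + z.2 ^+ 2.

Lemma sqnorm_ge0 z : 0 <= sqnorm z.
Proof. by rewrite addr_ge0 ?sqr_ge0. Qed.

Lemma measurable_sqnorm : measurable_fun [set: R * R] sqnorm.
Proof. by apply: measurable_funD; apply: measurable_funX. Qed.

Definition dilate r z : R * R := (r * z.1, r * z.2).

Lemma measurable_dilate : measurable_fun [set: R * (R * R)] (fun w => dilate w.1 w.2).
Proof.
apply: measurable_fun_pair; apply: measurable_funM => //.
  by apply: measurableT_comp.
by apply: measurableT_comp.
Qed.

Lemma sqnorm_dilate r z : sqnorm (dilate r z) = r ^+ 2 * sqnorm z.
Proof. by rewrite /sqnorm /=; ring. Qed.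

Lemma integral_gaussian2 h : measurable_fun [set: R * R] h -> (forall z, 0 <= h z)%E ->
  (\int[@gaussian2 R]_z h z =
   \int[leb]_x \int[leb]_y ((phi x * phi y)%:E * h (x, y)))%E.
Proof.
move=> mh h0.
have mx x : measurable_fun [set: R] (fun y => h (x, y)).
  by apply: measurableT_comp => //; exact: measurable_pair1.
rewrite /gaussian2 [LHS]fubini_tonelli1// integral_gaussian1; last 2 first.
- exact: (@measurable_fun_fubini_tonelli_F _ _ _ _ _ (@gaussian1 R)).
- by move=> x; apply: integral_ge0.
apply: eq_integral => x _; rewrite /fubini_F integral_gaussian1//.
rewrite muleC -ge0_integralZl//.
- by apply: eq_integral => y _; rewrite EFinM -muleA [(h _ * _)%E]muleC.
- by apply: emeasurable_funM => //; apply: measurableT_comp => //; exact: measurable_normal_pdf.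
- by move=> y _; rewrite mule_ge0// lee_fin normal_pdf_ge0.
- by rewrite lee_fin normal_pdf_ge0.
Qed.

Lemma gaussian2_sqnorm0 : {ae @gaussian2 R, forall z, sqnorm z != 0}.
Proof.
have m0 : measurable [set z : R * R | sqnorm z = 0].
  rewrite (_ : [set z | _] = sqnorm @^-1` [set 0])// -[X in measurable X]setTI.
  exact: measurable_sqnorm.
exists [set z : R * R | sqnorm z = 0]; split => //; last by move=> z /= /negP; rewrite negbK => /eqP.
apply/eqP; rewrite eq_le measure_ge0 andbT.
apply: (@le_trans _ _ (@gaussian2 R ([set 0] `*` setT))).
  apply: le_measure; rewrite ?inE//; first exact: measurableX.
  move=> [x y] /= /eqP; rewrite /sqnorm /= paddr_eq0 ?sqr_ge0// sqrf_eq0 => /andP[/eqP -> _].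
  by [].
rewrite [X in (X <= _)%E](product_measure1E _ _)//.
have g0 : (@gaussian1 R [set 0%R] = 0)%E.
  apply: ((null_content_dominatesP _ _).1 (normal_prob_dominates (0 : R) 1)) => //.
  by rewrite [LHS](lebesgue_measure_set1 (0 : R)).
by rewrite [X in (X * _)%E]g0 mul0e.
Qed.

Lemma measurable_funV d (T : measurableType d) (f : T -> R) :
  measurable_fun [set: T] f -> measurable_fun [set: T] (fun w => (f w)^-1).
Proof.
move=> mf; rewrite (_ : (fun w => _) = fun w => f w * ((f w ^+ 2) `^ (-1))).
  apply: measurable_funM => //.
  apply: (@measurableT_comp _ _ _ _ _ _ (fun x : R => x `^ (-1))) => //.
  exact: measurable_funX.
apply/funext => w; rewrite powR_inv1 ?sqr_ge0//.
have [->|x0] := eqVneq (f w) 0; first by rewrite invr0 mul0r.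
by field.
Qed.

(** The antiderivative exp(- v / (2 t)) runs from 0 at 0+ to 1 at infinity. The fundamental theorem
    is applied on [1/(n+1), oo[ and the half-lines exhaust ]0, oo[. *)
Lemma integral_inverse_exp v : 0 < v ->
  (\int[leb]_(t in `]0%R, +oo[) (v / (2 * t ^+ 2) * expR (- (v / (2 * t))))%:E = 1)%E.
Proof.
move=> v0; pose a := v / 2; have a0 : 0 < a by rewrite divr_gt0.
pose f t := a * t ^- 2 * expR (- (a * t^-1)).
have -> : (fun t : R => (v / (2 * t ^+ 2) * expR (- (v / (2 * t))))%:E) = (fun t => (f t)%:E).
  by apply/funext => t; rewrite /f /a !invfM !mulrA.
pose F t := expR (- (a * t^-1)).
have Fd t : 0 < t -> is_derive t 1 F (f t).
  move=> t0; have tN0 : t != 0 by rewrite gt_eqF.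
  rewrite (_ : f t = (- a *: (- t ^- 2 *: (1 : R))) * expR (- (a * t^-1))); last first.
    by rewrite /f /GRing.scale /=; ring.
  rewrite (_ : F = expR \o ((- a) \*: (fun t : R => t^-1))); last first.
    by apply/funext => y; rewrite /F /= /GRing.scale /= mulNr.
  rewrite mulrC; apply: is_derive1_comp.
    by rewrite /= /GRing.scale /= mulNr; exact: is_derive_expR.
  apply: is_deriveZ; exact: (@is_deriveV R (fun t => t)).
have F0 : F n.+1%:R^-1 @[n --> \oo] --> (0 : R).
  apply/cvgrPdist_lt => e e0; have ae : 0 < a * e by rewrite mulr_gt0.
  near=> n; rewrite sub0r normrN ger0_norm ?expR_ge0// /F invrK expRN.
  have n0 : (0 : R) < n.+1%:R by [].
  have h1 : a * n.+1%:R <= expR (a * n.+1%:R).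
    by apply: le_trans (expR_ge1Dx _); rewrite lerDr.
  apply: (@le_lt_trans _ _ (a * n.+1%:R)^-1); first by rewrite lef_pV2 ?posrE ?expR_gt0 ?mulr_gt0.
  rewrite invfM mulrC ltr_pdivrMr// mulrC.
  by near: n; exact: (near_infty_natSinv_lt (PosNum ae)).
have F1 : F t @[t --> +oo] --> (1 : R).
  apply/cvgrPdist_le => e e0; near=> t.
  have t0 : 0 < t by near: t; exact: nbhs_pinfty_gt.
  have aet : a / e <= t by near: t; apply: nbhs_pinfty_ge; rewrite num_real.
  rewrite ger0_norm; last by rewrite subr_ge0 /F -expR0 ler_expR oppr_le0 divr_ge0// ltW.
  have := expR_ge1Dx (- (a * t^-1)); rewrite -/(F t) => h.
  apply: (@le_trans _ _ (a * t^-1)); first by rewrite lerBlDr; move: h; rewrite lerBlDr addrC.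
  by rewrite ler_pdivrMr// mulrC -ler_pdivrMr.
have I n : (\int[leb]_(t in `[(n.+1%:R^-1)%R, +oo[) (f t)%:E = 1%:E - (F (n.+1%:R^-1)%R)%:E)%E.
  have n0 : (0 : R) < n.+1%:R^-1 by rewrite invr_gt0.
  apply: ge0_continuous_FTC2y.
  - by move=> x hx; rewrite /f mulr_ge0 ?expR_ge0// mulr_ge0 ?invr_ge0 ?sqr_ge0// ltW.
  - apply: derivable_within_continuous => x; rewrite in_itv /= andbT => hx.
    have x0 : x != 0 by rewrite gt_eqF// (lt_le_trans n0).
    rewrite /f; apply: derivableM; [apply: derivableM; [exact: derivable_cst|]|].
      by apply: derivableV => //; rewrite expf_neq0.
    apply: (@ex_derive _ _ _ _ _ _ _ (Fd x (lt_le_trans n0 hx))).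
  - exact: F1.
  - by move=> x hx; apply: (@ex_derive _ _ _ _ _ _ _ (Fd x (lt_trans n0 hx))).
  - apply: cvg_at_right_filter; apply/differentiable_continuous/derivable1_diffP.
    exact: (@ex_derive _ _ _ _ _ _ _ (Fd _ n0)).
  - move=> x; rewrite in_itv /= andbT => hx.
    by rewrite derive1E (@derive_val _ _ _ _ _ _ _ (Fd x (lt_trans n0 hx))).
have mf : measurable_fun [set: R] f.
  apply: measurable_funM.
    apply: measurable_funM => //; apply: measurable_funV.
    exact: exprn_measurable.
  apply: measurableT_comp => //; apply: measurableT_comp => //; apply: measurable_funM => //; exact: measurable_funV.
pose A (n : nat) : set (measurableTypeR R) := `[(n.+1%:R^-1 : R), +oo[%classic.
have cv := @ge0_nondecreasing_set_cvg_integral _ _ R A (fun t => (f t)%:E) leb.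
have U : \bigcup_i A i = `]0, +oo[%classic :> set R.
  apply/seteqP; split => x /=.
    by move=> [i _]; rewrite /A /= !in_itv /= !andbT => h; apply: lt_le_trans h; rewrite invr_gt0.
  rewrite in_itv /= andbT => x0; have [n _ hn] := near_infty_natSinv_lt (PosNum x0).
  by exists n => //; rewrite /A /= in_itv /= andbT ltW// (hn n (leqnn n)).
rewrite -U; apply: (cvg_unique _ (cv _ _ _ _)) => //.
- move=> i j ij; apply/subsetPset => x; rewrite /A /= !in_itv /= !andbT; apply: le_trans.
  by rewrite lef_pV2 ?posrE// ler_nat.
- by move=> i; exact: measurable_itv.
- by move=> i; apply: measurable_funTS; exact/measurable_EFinP.
- move=> i x; rewrite /A /= in_itv /= andbT => hx; rewrite lee_fin /f mulr_ge0 ?expR_ge0//.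
  by rewrite mulr_ge0 ?invr_ge0 ?sqr_ge0 ?ltW.
- rewrite /= (_ : (fun n => _) = fun n => (1%:E - (F (n.+1%:R^-1)%R)%:E)%E); last by apply/funext => n; exact: I.
  rewrite -[X in _ --> X]sube0; apply: cvgeB => //; first exact: cvg_cst.
  by apply: cvg_EFin => //; near=> n.
Unshelve. all: by end_near. Qed.

(** The change of variables z -> c z has Jacobian c^2, and the exponential is the ratio of the
    Gaussian densities at c z and at z. *)
Lemma gaussian2_dilate c h : 0 < c -> measurable_fun [set: R * R] h -> (forall z, 0 <= h z)%E ->
  (\int[@gaussian2 R]_z h z = \int[@gaussian2 R]_z
    ((c ^+ 2 * expR (- (c ^+ 2 - 1) * sqnorm z / 2))%:E * h (dilate c z)))%E.
Proof.
move=> c0 mh h0.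
have mphi : measurable_fun [set: R] (fun x => phi x) by exact: measurable_normal_pdf.
have mc : measurable_fun [set: R * R] (fun z => dilate c z).
  apply: measurable_fun_pair; exact: measurable_funM.
rewrite integral_gaussian2// integral_gaussian2; last 2 first.
- apply: emeasurable_funM; last exact: (measurableT_comp mh).
  apply/measurable_EFinP; apply: measurable_funM => //.
  apply: measurableT_comp => //; apply: measurable_funM => //.
  by apply: measurable_funM => //; exact: measurable_sqnorm.
- by move=> z; rewrite mule_ge0// lee_fin mulr_ge0 ?expR_ge0// sqr_ge0.
have m2 : measurable_fun [set: R * R] (fun z => (phi z.1 * phi z.2)%:E * h z)%E.
  apply: emeasurable_funM => //; apply/measurable_EFinP; apply: measurable_funM.
    by apply: measurableT_comp.
  by apply: measurableT_comp.
have p20 z : (0 <= (phi z.1 * phi z.2)%:E * h z)%E.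
  by rewrite mule_ge0// lee_fin mulr_ge0 ?normal_pdf_ge0.
rewrite (@integral_affine R _ c 0) ?gt_eqF//; last 2 first.
- exact: (@measurable_fun_fubini_tonelli_F _ _ _ _ _ leb _ m2 p20).
- by move=> x; apply: integral_ge0 => y _; exact: p20 (x, y).
rewrite -ge0_integralZl//; last 2 first.
- rewrite -[X in measurable_fun _ X]/((fun x => \int[leb]_y ((phi x * phi y)%:E * h (x, y)))%E \o (fun x => c * x + 0)).
  apply: measurableT_comp; first exact: (@measurable_fun_fubini_tonelli_F _ _ _ _ _ leb _ m2 p20).
  exact: measurable_affine.
- by move=> x _; apply: integral_ge0 => y _; exact: (p20 (_, _)).
apply: eq_integral => x _.
have mx x' : measurable_fun [set: R] (fun y => (phi x' * phi y)%:E * h (x', y))%E.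
  exact: (measurableT_comp m2 (measurable_pair1 x')).
rewrite (@integral_affine R _ c 0) ?gt_eqF//; last by move=> y; exact: (p20 (_, _)).
rewrite muleA -EFinM -ge0_integralZl//; last 2 first.
- by apply: (measurableT_comp (mx _)); exact: measurable_affine.
- by move=> y _; exact: (p20 (_, _)).
apply: eq_integral => y _; rewrite !addr0 muleA [RHS]muleA -!EFinM /dilate /=; congr (_%:E * _)%E.
rewrite !gtr0_norm// !normal_pdf01E /sqnorm /=.
set k := normal_peak _; rewrite (_ : c * c * _ = c ^+ 2 * k ^+ 2 *
  (expR (- (c * x) ^+ 2 / 2) * expR (- (c * y) ^+ 2 / 2))); last by ring.
rewrite [RHS](_ : _ = c ^+ 2 * k ^+ 2 * (expR (- x ^+ 2 / 2) * expR (- y ^+ 2 / 2) *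
  expR (- (c ^+ 2 - 1) * (x ^+ 2 + y ^+ 2) / 2))); last by ring.
congr (_ * _); rewrite -!expRD; congr expR; by field.
Qed.

(* The law of w * |z|^2 for z of law gaussian2. *)
Definition expdens w r : R := (2 * w)^-1 * expR (- (r / (2 * w))) * \1_(`]0, +oo[%classic : set R) r.

Lemma expdens_ge0 w r : 0 < w -> 0 <= expdens w r.
Proof. by move=> w0; rewrite !mulr_ge0 ?expR_ge0// invr_ge0 mulr_ge0// ltW. Qed.

Lemma measurable_expdens w : measurable_fun [set: R] (expdens w).
Proof.
apply: measurable_funM; last exact: measurable_indic.
apply: measurable_funM => //; apply: measurableT_comp => //; apply: measurableT_comp => //.
exact: measurable_funM.
Qed.

(* The modulus of a Gaussian vector is independent of its direction, hence may be
   replaced by an independent copy. *)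
Lemma polar_resampling h : measurable_fun [set: R * R] h -> (forall z, 0 <= h z)%E ->
  (\int[@gaussian2 R]_z h z = \int[@gaussian2 R]_z \int[leb]_r
    ((expdens 1 r)%:E * h (dilate (Num.sqrt (r / sqnorm z)) z)))%E.
Proof.
move=> mh h0.
have msq : measurable_fun [set: R] (@Num.sqrt R).
  apply: continuous_measurable_fun; exact: sqrt_continuous.
(* The substitution r = |z|^2 t turns the readjustment of the modulus into a dilation by sqrt t,
   whose factor no longer depends on z. *)
pose Phi (w : (R * R) * R) := ((sqnorm w.1 * expdens 1 (sqnorm w.1 * w.2))%:E *
   h (dilate (Num.sqrt w.2) w.1))%E.
have mS : measurable_fun [set: (R * R) * R] (fun w => sqnorm w.1).
  exact: (measurableT_comp measurable_sqnorm).
have mPhi : measurable_fun [set: (R * R) * R] Phi.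
  apply: emeasurable_funM.
    apply/measurable_EFinP; apply: measurable_funM => //.
    by apply: (measurableT_comp (measurable_expdens _)); apply: measurable_funM.
  apply: (measurableT_comp mh).
  apply: (@measurableT_comp _ _ _ _ _ _ _ _ (fun w : (R * R) * R => (Num.sqrt w.2, w.1)) measurable_dilate).
  by apply: measurable_fun_pair => //; apply: measurableT_comp.
have Phi0 w : (0 <= Phi w)%E.
  by rewrite mule_ge0// lee_fin mulr_ge0 ?sqnorm_ge0// expdens_ge0.
have -> : (\int[@gaussian2 R]_z \int[leb]_r
    ((expdens 1 r)%:E * h (dilate (Num.sqrt (r / sqnorm z)) z)) =
    \int[@gaussian2 R]_z \int[leb]_t Phi (z, t))%E.
  apply: ae_eq_integral => //.
  - have mT : measurable_fun [set: (R * R) * R] (fun w => ((expdens 1 w.2)%:E * h (dilate (Num.sqrt (w.2 / sqnorm w.1)) w.1))%E).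
      apply: emeasurable_funM.
        apply/measurable_EFinP; apply: (measurableT_comp (measurable_expdens 1)); exact: measurable_snd.
      apply: (measurableT_comp mh).
      apply: (@measurableT_comp _ _ _ _ _ _ _ _ (fun w : (R * R) * R => (Num.sqrt (w.2 / sqnorm w.1), w.1)) measurable_dilate).
      apply: measurable_fun_pair => //; apply: measurableT_comp => //.
      apply: measurable_funM; [exact: measurable_snd|exact: measurable_funV].
    apply: (@measurable_fun_fubini_tonelli_F _ _ _ _ _ leb _ mT) => w.
    by rewrite mule_ge0// lee_fin expdens_ge0.
  - exact: (@measurable_fun_fubini_tonelli_F _ _ _ _ _ leb Phi mPhi Phi0).
  apply: filterS gaussian2_sqnorm0 => z zN0 _.
  have z0 : 0 < sqnorm z by rewrite lt_neqAle eq_sym zN0 sqnorm_ge0.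
  have mhd : measurable_fun [set: R] (fun r : R => h (dilate (Num.sqrt (r / sqnorm z)) z)).
    apply: (measurableT_comp mh).
    apply: (@measurableT_comp _ _ _ _ _ _ _ _ (fun r : R => (Num.sqrt (r / sqnorm z), z)) measurable_dilate).
    apply: measurable_fun_pair => //; apply: measurableT_comp => //; exact: measurable_funM.
  have mhh : measurable_fun [set: R] (fun r : R => (expdens 1 r)%:E * h (dilate (Num.sqrt (r / sqnorm z)) z))%E.
    apply: emeasurable_funM => //; apply/measurable_EFinP; exact: measurable_expdens.
  rewrite (@integral_affine R _ (sqnorm z) 0 zN0); last 2 first.
  - exact: mhh.
  - by move=> r; rewrite mule_ge0// lee_fin expdens_ge0.
  rewrite -ge0_integralZl//; last 2 first.
  - exact: (measurableT_comp mhh (measurable_affine (sqnorm z) 0)).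
  - by move=> r _; rewrite mule_ge0// lee_fin expdens_ge0.
  apply: eq_integral => r _; rewrite /Phi /= addr0 muleA -EFinM gtr0_norm//.
  by rewrite mulrAC divff// mul1r.
(* At fixed t, dilating z by t^(-1/2) frees the argument of [h] and leaves a kernel in |z|^2 and t,
   whose integral over t is 1 by [integral_inverse_exp]. *)
have key t : (\int[@gaussian2 R]_z Phi (z, t) = \int[@gaussian2 R]_z (h z *
   (sqnorm z / (2 * t ^+ 2) * expR (- (sqnorm z / (2 * t))) * \1_(`]0, +oo[%classic : set R) t)%:E))%E.
  have [t0|t0] := ltP 0 t; last first.
    have t1 : \1_(`]0, +oo[%classic : set R) t = 0 :> R.
      by rewrite indicE memNset//= in_itv /= andbT; apply/negP; rewrite -leNgt.
    under [RHS]eq_integral do rewrite t1 mulr0 mule0.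
    rewrite integral0 integral0_eq// => z _; rewrite /Phi /=.
    rewrite /expdens indicE memNset ?mulr0 ?mul0e//= in_itv /= andbT; apply/negP; rewrite -leNgt.
    by rewrite mulr_ge0_le0// sqnorm_ge0.
  have st0 : 0 < Num.sqrt t by rewrite sqrtr_gt0.
  have t1 : \1_(`]0, +oo[%classic : set R) t = 1 :> R.
    by rewrite indicE mem_set//= in_itv /= andbT.
  rewrite (@gaussian2_dilate (Num.sqrt t)^-1) ?invr_gt0//; last first.
    exact: (measurableT_comp mPhi (measurable_pair2 t)).
  apply: eq_integral => z _; rewrite /Phi /= t1 mulr1 sqnorm_dilate.
  rewrite exprVn sqr_sqrtr ?ltW//.
  have -> : dilate (Num.sqrt t) (dilate (Num.sqrt t)^-1 z) = z.
    by case: z => x y; rewrite /dilate /= !mulrA divff ?gt_eqF// !mul1r.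
  rewrite muleA muleC; congr (_ * _)%E; rewrite -EFinM; congr EFin.
  rewrite (_ : t^-1 * sqnorm z * t = sqnorm z); last by rewrite mulrAC mulVf ?gt_eqF// mul1r.
  have [->|zN0] := eqVneq (sqnorm z) 0; first by rewrite !(mul0r,mulr0).
  rewrite /expdens (_ : \1__ _ = 1); last first.
    by rewrite indicE mem_set//= in_itv /= andbT lt_neqAle eq_sym zN0 sqnorm_ge0.
  rewrite mulr1 mulr1 mulrA.
  rewrite (_ : expR (- (sqnorm z / (2 * t))) = expR (- (t^-1 - 1) * sqnorm z / 2) * expR (- (sqnorm z / 2))); last first.
    by rewrite -expRD; congr expR; field; rewrite gt_eqF.
  by field; rewrite gt_eqF.
rewrite (@fubini_tonelli _ _ _ _ _ (gaussian2 R) leb Phi mPhi Phi0).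
under [RHS]eq_integral do rewrite key.
pose psi (w : (R * R) * R) : R := sqnorm w.1 / (2 * w.2 ^+ 2) * expR (- (sqnorm w.1 / (2 * w.2))) * \1_(`]0, +oo[%classic : set R) w.2.
pose Psi w := (h w.1 * (psi w)%:E)%E.
have mw2 : measurable_fun [set: (R * R) * R] (fun w => w.2) by exact: measurable_snd.
have mpsi : measurable_fun [set: (R * R) * R] psi.
  apply: measurable_funM; last first.
    apply: (measurableT_comp _ mw2); exact: measurable_indic.
  have m2 (k : nat) : measurable_fun [set: (R * R) * R] (fun w => (2 * w.2 ^+ k)^-1).
    apply: measurable_funV; apply: measurable_funM => //; exact: measurable_funX.
  apply: measurable_funM; first exact: measurable_funM.
  apply: measurableT_comp => //; apply: measurableT_comp => //.
  apply: measurable_funM => //; exact: m2 1%N.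
have mPsi1 : measurable_fun [set: (R * R) * R] (EFin \o psi) by exact/measurable_EFinP.
have mPsi : measurable_fun [set: (R * R) * R] Psi.
  by apply: emeasurable_funM => //; exact: measurableT_comp.
have psi0 w : 0 <= psi w.
  rewrite /psi mulr_ge0// mulr_ge0 ?expR_ge0// divr_ge0 ?sqnorm_ge0//.
  by rewrite mulr_ge0// sqr_ge0.
have Psi0 w : (0 <= Psi w)%E by rewrite mule_ge0// lee_fin.
rewrite -(@fubini_tonelli _ _ _ _ _ (gaussian2 R) leb Psi mPsi Psi0).
apply: ae_eq_integral => //.
  exact: (@measurable_fun_fubini_tonelli_F _ _ _ _ _ leb Psi mPsi Psi0).
apply: filterS gaussian2_sqnorm0 => z zN0 _.
have z0 : 0 < sqnorm z by rewrite lt_neqAle eq_sym zN0 sqnorm_ge0.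
rewrite /Psi /= ge0_integralZl//; last 2 first.
- exact: (measurableT_comp mPsi1 (measurable_pair1 z)).
- by move=> t _; rewrite lee_fin; exact: psi0 (z, t).
rewrite -[LHS]mule1 -(integral_inverse_exp z0) [in LHS]integral_mkcond.
congr (_ * _)%E; apply: eq_integral => t _; rewrite patchE /psi indicE /=.
by case: ifPn; rewrite ?mulr1 ?mulr0.
Qed.

End polar.

Lemma sum_sub_uniq (T : eqType) (V : nmodType) (L1 L2 : seq T) (F : T -> V) :
  uniq L1 -> uniq L2 -> {subset L1 <= L2} ->
  \sum_(n <- L2) F n = \sum_(n <- L1) F n + \sum_(n <- L2 | n \notin L1) F n.
Proof.
move=> u1 u2 s12; rewrite (bigID (mem L1)) /=; congr (_ + _).
rewrite -big_filter; apply: perm_big; apply: uniq_perm => //; first exact: filter_uniq.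
by move=> n; rewrite mem_filter; apply/andP/idP => [[]//|h]; split => //; exact: s12.
Qed.

(** * The Sobolev embedding into L^p *)

Section cut_modes.
Variables (R : realType) (s : R).
Implicit Types (n k : int) (u v : Hs s) (L : seq int) (x : R).

Definition cut L u : Hs s := add_modes u L (fun n => - fourier u n).

Lemma fourier_cut L u n : uniq L -> fourier (cut L u) n = if n \in L then 0 else fourier u n.
Proof. by move=> uL; rewrite fourier_add_modes//; case: ifPn; rewrite ?subrr ?addr0. Qed.

Lemma cutE L u x : cut L u x = u x - \sum_(n <- L) fourier u n * expi n x.
Proof. by rewrite /cut add_modesE -sumrN; congr (_ + _); apply: eq_bigr => n _; rewrite mulNr. Qed.

Lemma mass_cut L u : uniq L ->
  mass (cut L u) = mass u - \sum_(n <- L) normc (fourier u n) ^+ 2.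
Proof.
move=> uL; rewrite mass_add_modes// -sumrN; congr (_ + _); apply: eq_bigr => n _.
by rewrite subrr normc0 expr0n /= sub0r.
Qed.

Lemma normc_le1sum L (c : int -> R[i]) x :
  normc (\sum_(n <- L) c n * expi n x) <= \sum_(n <- L) normc (c n).
Proof.
elim: L => [|n L ih]; first by rewrite !big_nil normc0.
rewrite !big_cons; apply: le_trans (le_normcD _ _) _.
by rewrite normcM normc_expi mulr1 lerD2l.
Qed.

Lemma Hs_sub_periodic u v x : u (x + 1) - v (x + 1) = u x - v x.
Proof. by rewrite !Hs_periodic. Qed.

Lemma measurableC_sub (f g : R -> R[i]) : measurableC f -> measurableC g ->
  measurableC (fun x => f x - g x).
Proof.
move=> [f1 f2] [g1 g2]; split.
  rewrite (_ : (fun x => _) = fun x => complex.Re (f x) - complex.Re (g x)).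
    exact: measurable_funB.
  by apply/funext => x; case: (f x) (g x) => [? ?] [? ?].
rewrite (_ : (fun x => _) = fun x => complex.Im (f x) - complex.Im (g x)).
  exact: measurable_funB.
by apply/funext => x; case: (f x) (g x) => [? ?] [? ?].
Qed.

Lemma normc_sqrB_le (a b : R[i]) : normc (a - b) ^+ 2 <= 2 * normc a ^+ 2 + 2 * normc b ^+ 2.
Proof.
have := @normc_sqrD R a (- b) 1 ltr01; rewrite invr1 normcN.
by rewrite (_ : 1 + 1 = 2 :> R)//; ring.
Qed.

Lemma Hs_sub_L2 u v : (Lp_int 2 (fun x => u x - v x)%R < +oo)%E.
Proof.
rewrite Lp_int2E; have i1 := integrable_normc2 (measurableC_Hs u) (Hs_L2 u).
have i2 := integrable_normc2 (measurableC_Hs v) (Hs_L2 v).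
have i3 := integrable01D (integrable01Z 2 i1) (integrable01Z 2 i2).
have /integrableP[_] := i3; apply: le_lt_trans; apply: ge0_le_integral => //=.
- by move=> x _; rewrite lee_fin sqr_ge0.
- apply/measurable_EFinP; apply: measurable_funTS; apply: measurable_normcX.
  by apply: measurableC_sub; exact: measurableC_Hs.
- by apply/measurable_EFinP; apply: measurableT_comp => //; case/integrableP: i3 => /measurable_EFinP.
- by move=> x _; rewrite lee_fin; apply: le_trans (normc_sqrB_le _ _) _; exact: ler_norm.
Qed.

Lemma Hs_dist2_fin u v : (Hs_dist2 u v < +oo)%E.
Proof.
pose F (w : Hs s) n := (japanese R n `^ (2 * s) * normc (fourier w n) ^+ 2)%:E.
have F0 w n : (0 <= F w n)%E by rewrite lee_fin mulr_ge0 ?powR_ge0 ?sqr_ge0.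
apply: (@le_lt_trans _ _ (\esum_(n in [set: int]) (2%:E * F u n + 2%:E * F v n))%E).
  apply: le_esum => n _; rewrite /= /F -!EFinM -EFinD lee_fin [X in _ <= X + _]mulrCA [X in _ <= _ + X]mulrCA -mulrDr.
  by rewrite ler_wpM2l ?powR_ge0 ?normc_sqrB_le.
rewrite esumD; last 2 first.
- by move=> n _; rewrite mule_ge0.
- by move=> n _; rewrite mule_ge0.
apply: lte_add_pinfty; apply: le_lt_trans (esumZ_le _ _ _) _ => //;
  apply: lte_mul_pinfty => //; exact: Hs_dist20_fin.
Qed.

Lemma Hs_sub_fin u v : (Hs_norm s (fun x => u x - v x)%R < +oo)%E.
Proof.
rewrite /Hs_norm (_ : (\esum_(n in _) _)%E = Hs_dist2 u v); last first.
  by apply: eq_esum => n _; rewrite fourierB.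
have := Hs_dist2_fin u v; have := Hs_dist2_ge0 u v.
by case: (Hs_dist2 u v) => [r||]//= _ _; rewrite ltry.
Qed.

Definition Hs_sub u v : Hs s :=
  let m := measurableC_sub (measurableC_Hs u) (measurableC_Hs v) in
  MkHs (Hs_sub_periodic u v) m.1 m.2 (Hs_sub_L2 u v) (Hs_sub_fin u v).

Lemma fourier_Hs_sub u v n : fourier (Hs_sub u v) n = fourier u n - fourier v n.
Proof. exact: fourierB. Qed.

End cut_modes.

Lemma freqs_sub K K' : (K <= K')%N -> {subset freqs K <= freqs K'}.
Proof. by move=> h n; rewrite !mem_freqs => /leq_trans; apply. Qed.

Lemma size_freqs K : size (freqs K) = K.*2.+1.
Proof. by rewrite size_map size_enum_ord. Qed.

Lemma count_freqs_shell k :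
  count (fun n => n \notin freqs (2 ^ k)) (freqs (2 ^ k.+1)) = (2 ^ k).*2.
Proof.
have h : {subset freqs (2 ^ k) <= freqs (2 ^ k.+1)} by apply: freqs_sub; rewrite leq_exp2l.
have := count_predC (mem (freqs (2 ^ k))) (freqs (2 ^ k.+1)).
rewrite -size_filter (perm_size (_ : perm_eq _ (freqs (2 ^ k)))).
  by rewrite !size_freqs expnS => e; apply: (@addnI (2 ^ k).*2.+1); rewrite [LHS]e; lia.
apply: uniq_perm; rewrite ?filter_uniq ?freqs_uniq//.
by move=> n; rewrite mem_filter; apply/andP/idP => [[]//|nk]; split => //; exact: h.
Qed.

Lemma powR_exprn (R : realType) (x a : R) k : 0 <= x -> (x `^ a) ^+ k = (x ^+ k) `^ a.
Proof. by move=> x0; rewrite -(powR_mulrn k (powR_ge0 x a)) -powRrM mulrC powRrM powR_mulrn. Qed.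

Section sobolev.
Variables (R : realType) (s p : R).
Hypotheses (s0 : 0 < s) (s12 : s < 2^-1) (p2 : 2 < p) (sp : (2^-1 - s) * p < 1).
Implicit Types (n : int) (u v : Hs s) (k K : nat) (x D : R).
Local Notation leb := (@lebesgue_measure R).
Local Notation D01 := (`[0%R, 1%R]%classic : set R).
Local Notation w n := (japanese R n `^ (2 * s)).

(** At level 2^k the partial sums are bounded by a multiple of [r ^+ k] and the mass of the tail by
    a multiple of [rho ^+ k]. [theta] is the ratio of the resulting geometric series; it is less
    than 1 exactly when (1/2 - s) p < 1. *)
Let sigma := 2^-1 - s.
Let r := (2 : R) `^ sigma.
Let rho := (2 : R) `^ (- (2 * s)).
Let theta := r `^ (p - 2) * rho.

Let sigma0 : 0 < sigma. Proof. by rewrite subr_gt0. Qed.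
Let r1 : 1 < r. Proof. by rewrite /r /powR pnatr_eq0 /= expR_gt1 mulr_gt0// ln_gt0// ltr1n. Qed.
Let r0 : 0 < r. Proof. exact: lt_trans r1. Qed.
Let rho0 : 0 < rho. Proof. by rewrite powR_gt0. Qed.
Let q1 : 1 < r ^+ 2. Proof. by rewrite exprn_egt1 ?r1. Qed.
Let theta0 : 0 <= theta. Proof. by rewrite mulr_ge0 ?powR_ge0. Qed.
Let theta1 : theta < 1.
Proof.
rewrite /theta /r /rho -powRrM -powRD; last by rewrite pnatr_eq0 implybT.
rewrite /powR pnatr_eq0 /= expR_lt1 pmulr_llt0 ?ln_gt0 ?ltr1n//.
rewrite /sigma (_ : _ + _ = (2^-1 - s) * p - 1); last by field.
by rewrite subr_lt0.
Qed.

Let rho_r2 : rho * 2 = r ^+ 2.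
Proof.
rewrite /rho /r -powR_mulrn ?powR_ge0// -powRrM -[X in _ * X]powRr1// -powRD; last by rewrite pnatr_eq0 implybT.
by congr (_ `^ _); rewrite /sigma; field.
Qed.

Lemma japanese_ge_abs n : (`|n|%:R : R) <= japanese R n.
Proof.
rewrite -[leLHS]ger0_norm// -sqrtr_sqr ler_wsqrtr//.
have -> : (`|n|%:R : R) ^+ 2 = n%:~R ^+ 2 by rewrite -[RHS]real_normK ?num_real// -intr_norm -abszE -pmulrn.
rewrite /freq exprMn; apply: ler_wpDl => //; rewrite ler_peMl ?sqr_ge0// exprn_ege1//.
have := @pi_ge2 R; lra.
Qed.

Lemma sobolev_weight_gt0 n : 0 < w n.
Proof. by rewrite powR_gt0// japanese_gt0. Qed.

Lemma sobolev_weight_inv_le n k : (2 ^ k < `|n|)%N -> (w n)^-1 <= rho ^+ k.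
Proof.
move=> nk; rewrite /rho powRN exprVn.
rewrite powR_exprn//.
rewrite lef_pV2 ?posrE ?powR_gt0 ?exprn_gt0 ?japanese_gt0//.
rewrite ge0_ler_powR ?nnegrE ?exprn_ge0 ?ltW ?japanese_gt0 ?mulr_gt0//.
by apply: lt_le_trans (japanese_ge_abs n); rewrite -natrX ltr_nat.
Qed.

(** The 3 counts the modes of level 0; the other term makes C1 + 2 <= C1 r^2, which closes the
    induction over dyadic shells. *)
Let C1 : R := 3 + 2 / (r ^+ 2 - 1).
Let C1_gt0 : 0 < C1.
Proof. by rewrite addr_gt0// divr_gt0// subr_gt0. Qed.

Lemma sum_sobolev_weight_le k : \sum_(n <- freqs (2 ^ k)) (w n)^-1 <= C1 * r ^+ 2 ^+ k.
Proof.
elim: k => [|k ih].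
  apply: (@le_trans _ _ (\sum_(n <- freqs 1) 1)); last first.
    rewrite expr0 mulr1 big_const_seq count_predT size_freqs iter_addr addr0 -/(3%:R : R).
    by rewrite lerDl divr_ge0// subr_ge0 ltW.
  apply: ler_sum => n _; rewrite invf_le1 ?sobolev_weight_gt0//.
  by rewrite -[leLHS](powRr0 (japanese R n)) ler_powR ?japanese_ge1// mulr_ge0// ltW.
rewrite (sum_sub_uniq _ (freqs_uniq (2 ^ k)) (freqs_uniq _)); last first.
  by apply: freqs_sub; rewrite leq_exp2l.
apply: (@le_trans _ _ (C1 * r ^+ 2 ^+ k + 2 * r ^+ 2 ^+ k)); last first.
  rewrite /C1 -mulrDl; set q := r ^+ 2; rewrite exprS mulrA; apply: ler_wpM2r; first by rewrite exprn_ge0// /q sqr_ge0.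
  have q0 : 0 < q - 1 by rewrite subr_gt0.
  rewrite -subr_ge0 [X in 0 <= X](_ : _ = 3 * (q - 1)); first by rewrite mulr_ge0// ltW.
  by field; rewrite gt_eqF.
apply: lerD => //.
apply: (@le_trans _ _ (\sum_(n <- freqs (2 ^ k.+1) | n \notin freqs (2 ^ k)) rho ^+ k)).
  by apply: ler_sum => n; rewrite mem_freqs -ltnNge => /sobolev_weight_inv_le.
rewrite big_const_seq iter_addr addr0 -[rho ^+ k *+ _]mulr_natr -rho_r2 exprMn mulrCA.
apply: ler_wpM2l; first by rewrite exprn_ge0// ltW.
by rewrite count_freqs_shell -muln2 natrM natrX mulrC.
Qed.

Lemma tail_mass_le u D k : (forall K, \sum_(n <- freqs K) w n * normc (fourier u n) ^+ 2 <= D ^+ 2) ->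
  mass (cut (freqs (2 ^ k)) u) <= D ^+ 2 * rho ^+ k.
Proof.
move=> uD; rewrite mass_cut ?freqs_uniq//.
rewrite lerBlDr; apply: (cvgr_to_le (@energy_cvg R s u)).
near=> K; have kK : (2 ^ k <= K)%N by near: K; exact: nbhs_infty_ge.
rewrite /energy (sum_sub_uniq _ (freqs_uniq (2 ^ k)) (freqs_uniq _)); last exact: freqs_sub.
rewrite addrC lerD2r; apply: le_trans (_ : rho ^+ k * \sum_(n <- freqs K) w n * normc (fourier u n) ^+ 2 <= _); last first.
  by rewrite mulrC ler_wpM2r// exprn_ge0// ltW.
rewrite mulr_sumr big_mkcond /=; apply: ler_sum => n _.
have z0 : 0 <= rho ^+ k * (w n * normc (fourier u n) ^+ 2).
  by apply: mulr_ge0; [exact: exprn_ge0 (ltW rho0)|rewrite mulr_ge0 ?powR_ge0 ?sqr_ge0].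
case: ifPn => //; rewrite mem_freqs -ltnNge => /sobolev_weight_inv_le h.
rewrite mulrA -[leLHS]mul1r ler_wpM2r ?sqr_ge0//.
by rewrite -ler_pdivrMr ?sobolev_weight_gt0// mul1r.
Unshelve. all: by end_near. Qed.

(** The Cauchy-Schwarz inequality against the weights, in the form a <= (l / 2) w^-1 + (2 l)^-1 w
    a^2, summed over the modes. *)
Lemma partial_sum_le u D k x : 0 < D ->
  (forall K, \sum_(n <- freqs K) w n * normc (fourier u n) ^+ 2 <= D ^+ 2) ->
  normc (\sum_(n <- freqs (2 ^ k)) fourier u n * expi n x) <= Num.sqrt C1 * D * r ^+ k.
Proof.
move=> D0 uD; apply: le_trans (normc_le1sum _ _ _) _.
set c := Num.sqrt C1; have c0 : 0 < c by rewrite sqrtr_gt0.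
have cc : c ^+ 2 = C1 by rewrite sqr_sqrtr// ltW.
(* This value balances the two sums. *)
pose l := D / (c * r ^+ k); have l0 : 0 < l by rewrite divr_gt0// mulr_gt0// exprn_gt0.
apply: (@le_trans _ _ (\sum_(n <- freqs (2 ^ k)) (l / 2 * (w n)^-1 + (2 * l)^-1 * (w n * normc (fourier u n) ^+ 2)))).
  apply: ler_sum => n _; have w0 := sobolev_weight_gt0 n; set a := normc _.
  rewrite -subr_ge0 (_ : _ - _ = (l / 2 / w n) * (1 - w n * a / l) ^+ 2).
    by rewrite mulr_ge0 ?sqr_ge0// divr_ge0 ?(ltW w0)// divr_ge0// ltW.
  by field; rewrite !gt_eqF.
rewrite big_split /= -!mulr_sumr.
apply: (@le_trans _ _ (l / 2 * (c ^+ 2 * r ^+ 2 ^+ k) + (2 * l)^-1 * D ^+ 2)).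
  apply: lerD; apply: ler_wpM2l; [by rewrite divr_ge0// ltW| |by rewrite invr_ge0 mulr_ge0// ltW|by []].
  by rewrite cc; exact: sum_sobolev_weight_le.
rewrite /l -exprM mulnC exprM; have : 0 < r ^+ k by rewrite exprn_gt0.
move: (r ^+ k) => z z0; rewrite le_eqVlt; apply/orP; left; apply/eqP.
by field; rewrite !gt_eqF.
Qed.

Let thr D k : R := 2 * (Num.sqrt C1 * D * r ^+ k).

Let thr_ge0 D k : 0 < D -> 0 < thr D k.
Proof. by move=> D0; rewrite !mulr_gt0 ?sqrtr_gt0 ?exprn_gt0. Qed.

Lemma bernoulli_expr (h : R) k : 0 <= h -> 1 + k%:R * h <= (1 + h) ^+ k.
Proof.
move=> h0; elim: k => [|k ih]; first by rewrite mul0r addr0 expr0.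
rewrite exprS; apply: le_trans (_ : (1 + h) * (1 + k%:R * h) <= _); last by rewrite ler_wpM2l ?addr_ge0.
rewrite -natr1; have : 0 <= k%:R * h ^+ 2 by rewrite mulr_ge0 ?sqr_ge0.
nra.
Qed.

(* If |u(x)| is larger than twice the Cauchy-Schwarz bound of its partial sum at level 2^k,
   the tail carries at least half of it; the tails are controlled in L^2 by tail_mass_le. *)
Lemma sobolev_pointwise u D x : 0 < D ->
  (forall K, \sum_(n <- freqs K) w n * normc (fourier u n) ^+ 2 <= D ^+ 2) ->
  ((normc (u x) `^ p)%:E <= (thr D 0 `^ p)%:E +
    \sum_(0 <= k <oo) (thr D k.+1 `^ (p - 2) * 4 * normc (cut (freqs (2 ^ k)) u x) ^+ 2)%:E)%E.
Proof.
move=> D0 uD; have [h|h] := leP (normc (u x)) (thr D 0).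
  rewrite -[leLHS]adde0 leeD//.
    rewrite lee_fin ge0_ler_powR// ?nnegrE ?normc_ge0//.
    + by rewrite ltW// (lt_trans _ p2).
    + by rewrite (le_trans (normc_ge0 _) h).
  by apply: nneseries_ge0 => k _ _; rewrite lee_fin mulr_ge0 ?sqr_ge0// mulr_ge0 ?powR_ge0.
have [k kx] : exists k, normc (u x) <= thr D k.
  pose c := 2 * (Num.sqrt C1 * D); have c0 : 0 < c by rewrite !mulr_gt0 ?sqrtr_gt0.
  pose y := normc (u x) / c / (r - 1).
  have y0 : 0 <= y by rewrite !divr_ge0 ?normc_ge0 ?subr_ge0 ?ltW.
  exists (Num.bound y); have := archi_boundP y0; move: (Num.bound y) => k yk.
  rewrite /thr mulrA -/c mulrC -ler_pdivrMr//.
  have := @bernoulli_expr (r - 1) k; rewrite subr_ge0 ltW// addrCA subrr addr0 => /(_ isT).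
  apply: le_trans.
  apply: le_trans (_ : k%:R * (r - 1) <= _); last by rewrite lerDr.
  by rewrite -ler_pdivrMr ?subr_gt0//; exact: ltW.
(* [m] is the first level whose threshold dominates |u(x)|. The level j = m - 1 has a smaller
   threshold, so its tail carries half of |u(x)|, while |u(x)|^(p - 2) is bounded by the threshold
   of level j + 1. *)
pose m := ex_minn (ex_intro (fun k => normc (u x) <= thr D k) k kx).
have [m1 m2] : normc (u x) <= thr D m /\ forall j, normc (u x) <= thr D j -> (m <= j)%N.
  by rewrite /m; case: ex_minnP.
have : (0 < m)%N by rewrite lt0n; apply/eqP => m0; move: m1; rewrite m0 leNgt h.
case E : m m1 m2 => [//|j] m1 m2 _.
have hj : thr D j < normc (u x).
  by rewrite ltNge; apply/negP => /m2; rewrite ltnn.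
rewrite -[leLHS]add0e leeD ?lee_fin ?powR_ge0//.
apply: (@le_trans _ _ ((thr D j.+1 `^ (p - 2) * 4 * normc (cut (freqs (2 ^ j)) u x) ^+ 2)%:E)); last first.
  pose f k := (thr D k.+1 `^ (p - 2) * 4 * normc (cut (freqs (2 ^ k)) u x) ^+ 2)%:E.
  have f0 k' : (0 <= f k')%E by rewrite lee_fin mulr_ge0 ?sqr_ge0// mulr_ge0 ?powR_ge0.
  rewrite -/(f j) (@nneseries_split _ f 0 j.+1)// add0n big_nat_recr//=.
  rewrite -[leLHS]adde0 leeD//; last exact: nneseries_ge0.
  by rewrite -[leLHS]add0e leeD// sume_ge0.
rewrite lee_fin (_ : p = (p - 2) + 2); last by rewrite subrK.
have u0 : 0 <= normc (u x) by exact: normc_ge0.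
rewrite powRD; last by rewrite subrK gt_eqF// (lt_trans _ p2).
rewrite addrK powR_mulrn// -mulrA ler_pM ?powR_ge0 ?sqr_ge0//.
  by rewrite ge0_ler_powR ?nnegrE ?subr_ge0 ?u0 ?(ltW p2)// ltW// thr_ge0.
have S := partial_sum_le j x D0 uD.
rewrite cutE; move: hj; rewrite /thr; move: (\sum_(n <- _) _) S => z S hj.
have : normc (u x) <= 2 * normc (u x - z).
  have := le_normcD (u x - z) z; rewrite subrK; lra.
move=> hh; rewrite (_ : 4 = 2 ^+ 2 :> R); last by ring.
by rewrite -exprMn lerXn2r ?nnegrE ?mulr_ge0 ?normc_ge0.
Qed.

Lemma geometric_sum_le k : \sum_(j < k) theta ^+ j <= (1 - theta)^-1.
Proof.
have t1 : 0 < 1 - theta by rewrite subr_gt0.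
rewrite -(ler_pM2r t1) mulVf ?gt_eqF// mulrC -opprB mulNr -subrX1 opprB.
by rewrite gerBl exprn_ge0.
Qed.

Let Cs := (2 * Num.sqrt C1) `^ p + (2 * Num.sqrt C1) `^ (p - 2) * r `^ (p - 2) * 4 * (1 - theta)^-1.

(** After integration the k-th tail contributes a multiple of r^(k (p - 2)) rho^k = theta^k. *)
Lemma sobolev_bound u D : 0 < D ->
  (forall K, \sum_(n <- freqs K) w n * normc (fourier u n) ^+ 2 <= D ^+ 2) ->
  (Lp_int p u <= (Cs * D `^ p)%:E)%E.
Proof.
move=> D0 uD.
have mcut k : measurable_fun D01 (fun x => (thr D k.+1 `^ (p - 2) * 4 * normc (cut (freqs (2 ^ k)) u x) ^+ 2)%:E).
  apply/measurable_EFinP; apply: measurable_funTS; apply: measurable_funM => //.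
  by apply: measurable_normcX; exact: measurableC_Hs.
have cut0 k x : (0 <= (thr D k.+1 `^ (p - 2) * 4 * normc (cut (freqs (2 ^ k)) u x) ^+ 2)%:E)%E.
  by rewrite lee_fin mulr_ge0 ?sqr_ge0// mulr_ge0 ?powR_ge0.
apply: le_trans (_ : _ <= \int[leb]_(x in D01) ((thr D 0 `^ p)%:E +
    \sum_(0 <= k <oo) (thr D k.+1 `^ (p - 2) * 4 * normc (cut (freqs (2 ^ k)) u x) ^+ 2)%:E))%E _.
  apply: ge0_le_integral => //.
  - by move=> x _; rewrite lee_fin powR_ge0.
  - apply/measurable_EFinP; apply: (@measurableT_comp _ _ _ _ _ _ (fun z : R => z `^ p)) => //.
    by apply: measurable_funTS; apply: measurable_normc; exact: measurableC_Hs.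
  - apply: emeasurable_funD => //; apply: ge0_emeasurable_sum => // k _; exact: mcut.
  - by move=> x _; exact: sobolev_pointwise.
rewrite ge0_integralD//; last 3 first.
- by move=> x _; rewrite lee_fin powR_ge0.
- by move=> x _; apply: nneseries_ge0.
- by apply: ge0_emeasurable_sum => // k _; exact: mcut.
rewrite integral_cst//= integral_nneseries//.
have lebD : leb D01 = 1%E by rewrite lebesgue_measure_itv/= lte_fin ltr01 oppr0 adde0.
rewrite [X in (_ * X)%E]lebD mule1 mulrDl EFinD leeD//.
  by rewrite lee_fin /thr expr0 mulr1 mulrA powRM// ?mulr_ge0// ltW.
apply: lime_le; first by apply: is_cvg_nneseries => k _ _; apply: integral_ge0.
near=> N; rewrite big_mkord.
have T k : (\int[leb]_(x in D01) (thr D k.+1 `^ (p - 2) * 4 * normc (cut (freqs (2 ^ k)) u x) ^+ 2)%:E <=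
   ((2 * Num.sqrt C1) `^ (p - 2) * r `^ (p - 2) * 4 * D `^ p * theta ^+ k)%:E)%E.
  under eq_integral do rewrite EFinM.
  rewrite ge0_integralZl//; last 3 first.
  - apply/measurable_EFinP; apply: measurable_funTS.
    by apply: measurable_normcX; exact: measurableC_Hs.
  - by move=> x _; rewrite lee_fin sqr_ge0.
  - by rewrite lee_fin mulr_ge0 ?powR_ge0.
  rewrite -[X in (_ * X)%E]Lp_int2E Lp_int2_mass -EFinM lee_fin.
  apply: le_trans (_ : thr D k.+1 `^ (p - 2) * 4 * (D ^+ 2 * rho ^+ k) <= _).
    by rewrite ler_wpM2l ?mulr_ge0 ?powR_ge0//; exact: tail_mass_le.
  rewrite le_eqVlt; apply/orP; left; apply/eqP.
  rewrite /theta exprMn /thr exprS.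
  have -> : D `^ p = D `^ (p - 2) * D ^+ 2.
    by rewrite -powR_mulrn ?(ltW D0)// -powRD ?subrK// (gt_eqF D0) implybT.
  have -> : 2 * (Num.sqrt C1 * D * (r * r ^+ k)) = (2 * Num.sqrt C1) * D * r * r ^+ k by ring.
  have -> : (2 * Num.sqrt C1 * D * r * r ^+ k) `^ (p - 2) =
      (2 * Num.sqrt C1) `^ (p - 2) * D `^ (p - 2) * r `^ (p - 2) * r `^ (p - 2) ^+ k.
    have c0 : 0 <= 2 * Num.sqrt C1 by rewrite mulr_ge0.
    move: (2 * Num.sqrt C1) c0 => c c0.
    rewrite powRM ?exprn_ge0 ?mulr_ge0 ?(ltW D0) ?(ltW r0)//.
    rewrite powRM ?mulr_ge0 ?(ltW D0) ?(ltW r0)// powRM ?(ltW D0)//; congr (_ * _).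
    rewrite -(powR_mulrn k (ltW r0)) -(powR_mulrn k (powR_ge0 r (p - 2))).
    by rewrite -(powRrM r k%:R) -(powRrM r (p - 2)) mulrC.
  ring.
apply: le_trans (_ : _ <= \sum_(k < N) ((2 * Num.sqrt C1) `^ (p - 2) * r `^ (p - 2) * 4 * D `^ p * theta ^+ k)%:E)%E _.
  by apply: lee_sum => k _; exact: T.
rewrite sumEFin lee_fin -mulr_sumr [leRHS]mulrAC ler_wpM2l ?geometric_sum_le//.
by rewrite !mulr_ge0 ?powR_ge0.
Unshelve. all: by end_near. Qed.

Lemma sobolev : exists2 C, 0 < C & forall u D, 0 < D ->
  (forall K, \sum_(n <- freqs K) w n * normc (fourier u n) ^+ 2 <= D ^+ 2) ->
  (Lp_int p u <= (C * D `^ p)%:E)%E.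
Proof.
exists Cs; last exact: sobolev_bound.
have c0 : 0 < 2 * Num.sqrt C1 by rewrite mulr_gt0 ?sqrtr_gt0.
rewrite /Cs ltr_wpDr ?powR_gt0// !mulr_ge0 ?powR_ge0// invr_ge0 subr_ge0 ltW//.
Qed.

End sobolev.

(** * Resampling modes of the Wiener measure *)

Section resampling.
Variables (R : realType) (s : R).
Implicit Types (n k : int) (u v : Hs s) (z : R * R) (r p x : R) (L : seq int).
Local Notation leb := (@lebesgue_measure R).
Local Notation J n := (japanese R n).

Lemma Hs_eq u v : (forall x, u x = v x) -> u = v.
Proof.
case: u => f a b c d e; case: v => g a' b' c' d' e' /= fg.
have {}fg : f = g by apply/funext.
subst g; by congr MkHs; exact: Prop_irrelevance.
Qed.

(** The Gaussian variable g_n of the series, read off from u. *)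
Definition coef n u : R * R := (J n * complex.Re (fourier u n), J n * complex.Im (fourier u n)).

Definition mode_of n z : R[i] := (z.1 / J n) +i* (z.2 / J n).

Lemma mode_ofK n z : (J n * complex.Re (mode_of n z), J n * complex.Im (mode_of n z)) = z.
Proof.
have j0 : J n != 0 by rewrite gt_eqF ?japanese_gt0.
by case: z => a b; rewrite /mode_of /=; congr pair; rewrite mulrC divfK.
Qed.

Lemma coefK n u : mode_of n (coef n u) = fourier u n.
Proof.
have j0 : J n != 0 by rewrite gt_eqF ?japanese_gt0.
have h (a : R) : J n * a / J n = a by rewrite mulrC mulKf.
by rewrite /mode_of /coef; case: (fourier u n) => a b; rewrite /= !h.
Qed.

Lemma normc_mode_of n z : normc (mode_of n z) ^+ 2 = sqnorm z / J n ^+ 2.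
Proof. by rewrite normc_sqr /sqnorm /=; field; rewrite gt_eqF ?japanese_gt0. Qed.

Lemma normc_fourier_coef n u : normc (fourier u n) ^+ 2 = sqnorm (coef n u) / J n ^+ 2.
Proof. by rewrite -normc_mode_of coefK. Qed.

Definition set_mode n u z : Hs s := add_mode u n (mode_of n z - fourier u n).

Lemma fourier_set_mode n u z k :
  fourier (set_mode n u z) k = if n == k then mode_of n z else fourier u k.
Proof.
by rewrite /set_mode fourier_add_modeE; case: eqVneq => [->|]; rewrite ?addr0// addrC subrK.
Qed.

Lemma coef_set_mode n u z k : coef k (set_mode n u z) = if n == k then z else coef k u.
Proof.
by rewrite /coef fourier_set_mode; case: eqVneq => [->|//]; rewrite mode_ofK.
Qed.

Lemma set_mode_idem n u z z' : set_mode n (set_mode n u z) z' = set_mode n u z'.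
Proof.
apply: Hs_eq => x; rewrite /set_mode /= fourier_add_modeE eqxx.
by rewrite -addrA -mulrDl; congr (_ + _ * _); rewrite [fourier u n + _]addrC !subrK addrC addrA subrK.
Qed.

Lemma mass_set_mode n u z :
  mass (set_mode n u z) = mass u + (sqnorm z / J n ^+ 2 - normc (fourier u n) ^+ 2).
Proof. by rewrite mass_add_mode [fourier u n + _]addrC subrK normc_mode_of. Qed.

Lemma measurable_Re_set_mode n k : measurable_fun [set: borelHs s * (R * R)]
  (fun w => complex.Re (fourier (set_mode n (w.1 : Hs s) w.2) k)).
Proof.
under eq_fun do rewrite fourier_set_mode.
have [_|_] := eqVneq n k; last exact: (measurableT_comp (measurable_Re_fourier k)).
by apply: measurable_funM => //=; apply: measurableT_comp.
Qed.

Lemma measurable_Im_set_mode n k : measurable_fun [set: borelHs s * (R * R)]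
  (fun w => complex.Im (fourier (set_mode n (w.1 : Hs s) w.2) k)).
Proof.
under eq_fun do rewrite fourier_set_mode.
have [_|_] := eqVneq n k; last exact: (measurableT_comp (measurable_Im_fourier k)).
by apply: measurable_funM => //=; apply: measurableT_comp.
Qed.

Lemma measurable_set_mode n :
  measurable_fun [set: borelHs s * (R * R)] (fun w => set_mode n (w.1 : Hs s) w.2 : borelHs s).
Proof.
by apply: measurable_into_Hs => k; [exact: measurable_Re_set_mode|exact: measurable_Im_set_mode].
Qed.

Lemma measurable_coef n : measurable_fun [set: borelHs s] (coef n : borelHs s -> R * R).
Proof.
apply: measurable_fun_pair; apply: measurable_funM => //.
  exact: measurable_Re_fourier.
exact: measurable_Im_fourier.
Qed.

(** The form in which the Gaussian series enters the proof: finitely many distinct g_n are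
    independent, each of law [gaussian2]. *)
Definition wiener (P : probability (borelHs s) R) :=
  forall L (E : int -> set (R * R)), uniq L -> (forall n, measurable (E n)) ->
  P [set u : borelHs s | forall n, n \in L -> E n (coef n u)] =
  (\prod_(n <- L) gaussian2 R (E n))%E.

Definition box_of (B : seq (int * bool)) (t : int * bool -> R) n : set (R * R) :=
  [set z | ((n, true) \in B -> t (n, true) * J n <= z.1) /\
           ((n, false) \in B -> t (n, false) * J n <= z.2)].

Lemma measurable_box_of B t n : measurable (box_of B t n).
Proof.
have mh (b : bool) (c : R) (f : R * R -> R) : measurable_fun [set: R * R] f ->
    measurable [set z | b -> c <= f z].
  move=> mf; case: b.
    rewrite (_ : [set z | _] = f @^-1` `[c, +oo[); last first.
      by apply/seteqP; split => z /=; rewrite in_itv/= andbT; [apply|].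
    by rewrite -[X in measurable X]setTI; exact: mf.
  by rewrite (_ : [set z | _] = setT)//; apply/seteqP; split.
rewrite (_ : box_of B t n = [set z | (n, true) \in B -> t (n, true) * J n <= z.1] `&`
  [set z | (n, false) \in B -> t (n, false) * J n <= z.2])//.
by apply: measurableI; apply: mh.
Qed.

Lemma half_boxE B t : half_box B t =
  [set u : borelHs s | forall n, n \in undup [seq i.1 | i <- B] -> box_of B t n (coef n u)].
Proof.
apply/seteqP; split => u /= h.
  move=> n _; rewrite /box_of /coef /=; split => hB.
    by rewrite mulrC ler_pM2l ?japanese_gt0//; exact: (h _ hB).
  by rewrite mulrC ler_pM2l ?japanese_gt0//; exact: (h _ hB).
move=> [n b] hB; have nB : n \in undup [seq i.1 | i <- B].
  by rewrite mem_undup; apply/mapP; exists (n, b).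
have [h1 h2] := h n nB; case: b hB => hB; rewrite /fourier_coord /=.
  by move: (h1 hB); rewrite mulrC ler_pM2l ?japanese_gt0.
by move: (h2 hB); rewrite mulrC ler_pM2l ?japanese_gt0.
Qed.

(** [P] is unchanged when mode n is replaced by an independent Gaussian. It suffices to test half
    boxes, on which both sides factor over the modes. *)
Lemma wiener_set_mode (P : probability (borelHs s) R) n (E : set (borelHs s)) : wiener P ->
  measurable E -> P E = (P \x gaussian2 R)%E [set w | E (set_mode n (w.1 : Hs s) w.2)].
Proof.
move=> wP mE.
pose tau (w : borelHs s * (R * R)) : borelHs s := set_mode n (w.1 : Hs s) w.2.
have mtau : measurable_fun [set: borelHs s * (R * R)] tau by exact: measurable_set_mode.
have Z1 : (\int[P \x gaussian2 R]_w (cst 1 w)%:E = 1)%E.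
  rewrite (eq_integral (cst 1%E))// integral_cst// mul1e [LHS]probability_setT //.
have [Q QE] : exists Q : probability (borelHs s) R, forall E, measurable E ->
     Q E = (P \x gaussian2 R)%E (tau @^-1` E).
  have [||Q QE] := @density_probability _ _ _ _ R (P \x gaussian2 R)%E tau (cst 1) mtau
    (measurable_cst _) (fun=> ler01); rewrite ?Z1 ?ltry//.
  exists Q => F mF; rewrite QE// Z1 [fine _]/= invr1 mul1e.
  rewrite (eq_integral (fun w => (\1_(tau @^-1` F) w)%:E)); last first.
    by move=> w _; rewrite mul1r.
  rewrite integral_indic ?setIT//.
  by rewrite -[X in measurable X]setTI; exact: mtau.
rewrite -[RHS](QE E mE); apply: Hs_prob_eq mE => B t.
rewrite QE; last exact: measurable_half_box.
rewrite half_boxE; set L := undup _; have uL : uniq L by exact: undup_uniq.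
have mbox := measurable_box_of B t.
rewrite wP// (_ : tau @^-1` _ =
   [set u : borelHs s | forall k, k \in rem n L -> box_of B t k (coef k u)] `*`
   (if n \in L then box_of B t n else setT)); last first.
  apply/seteqP; split => -[u z] /=; rewrite /tau /=.
    move=> h; split.
      move=> k; rewrite mem_rem_uniq// inE => /andP[kn kL].
      by have := h k kL; rewrite coef_set_mode eq_sym (negbTE kn).
    case: ifPn => // nL; by have := h n nL; rewrite coef_set_mode eqxx.
  move=> [h1 h2] k kL; rewrite coef_set_mode; case: eqVneq => [nk|nk].
    by move: h2; rewrite nk kL.
  by apply: h1; rewrite mem_rem_uniq// inE eq_sym nk.
rewrite [RHS](product_measure1E _ _); last 2 first.
- rewrite (_ : [set u | _] = \bigcap_(k in [set` rem n L]) (coef k @^-1` (box_of B t k)))//.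
  apply: fin_bigcap_measurable => // k _.
  rewrite -[X in measurable X]setTI; exact: measurable_coef.
- by case: ifP.
transitivity ((\prod_(k <- rem n L) gaussian2 R (box_of B t k)) *
    gaussian2 R (if n \in L then box_of B t n else setT))%E; last first.
  by congr (_ * _)%E; rewrite -(wP (rem n L) _ (rem_uniq n uL) mbox).
case: ifPn => nL.
  by rewrite (perm_big _ (perm_to_rem nL)) big_cons muleC.
by rewrite [X in (_ * X)%E]probability_setT mule1 rem_id.
Qed.

Lemma resample (P : probability (borelHs s) R) n (Phi : borelHs s -> \bar R) : wiener P ->
  measurable_fun [set: borelHs s] Phi -> (forall u, 0 <= Phi u)%E ->
  (\int[P]_u Phi u = \int[P]_u \int[gaussian2 R]_z Phi (set_mode n (u : Hs s) z))%E.
Proof.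
move=> wP mPhi Phi0.
pose tau (w : borelHs s * (R * R)) : borelHs s := set_mode n (w.1 : Hs s) w.2.
have mtau : measurable_fun [set: borelHs s * (R * R)] tau by exact: measurable_set_mode.
rewrite (@ge0_integral_density _ _ _ _ R (P \x gaussian2 R)%E tau (cst 1) mtau _ _ P Phi)//; last first.
  move=> E mE; transitivity ((P \x gaussian2 R)%E (tau @^-1` E)); first exact: wiener_set_mode.
  rewrite (eq_integral (fun w => (\1_(tau @^-1` E) w)%:E)); last first.
    by move=> w _; rewrite mul1r.
  rewrite integral_indic ?setIT//.
  by rewrite -[X in measurable X]setTI; exact: mtau.
rewrite (@fubini_tonelli1 _ _ _ _ _ P (gaussian2 R))//; last 2 first.
- apply: emeasurable_funM => //; exact: measurableT_comp.
- by move=> w; rewrite mul1e.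
by apply: eq_integral => u _; rewrite /fubini_F; apply: eq_integral => z _; rewrite mul1e.
Qed.

(* Junk when the mode n of u vanishes (then u is unchanged); that event is null. *)
Definition set_mass n u p : Hs s :=
  set_mode n u (dilate (Num.sqrt (p / normc (fourier u n) ^+ 2)) (coef n u)).

Lemma measurable_set_mass n :
  measurable_fun [set: borelHs s * R] (fun w => set_mass n (w.1 : Hs s) w.2 : borelHs s).
Proof.
apply: (@measurableT_comp _ _ _ _ _ _ _ _ (fun w : borelHs s * R => (w.1,
  dilate (Num.sqrt (w.2 / normc (fourier (w.1 : Hs s) n) ^+ 2)) (coef n w.1))) (measurable_set_mode n)).
apply: measurable_fun_pair => //.
apply: (@measurableT_comp _ _ _ _ _ _ _ _ (fun w : borelHs s * R =>
  (Num.sqrt (w.2 / normc (fourier (w.1 : Hs s) n) ^+ 2), coef n w.1)) (@measurable_dilate R)).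
apply: measurable_fun_pair; last exact: (measurableT_comp (measurable_coef n)).
apply: (@measurableT_comp _ _ _ _ _ _ (@Num.sqrt R)).
  by apply: continuous_measurable_fun; exact: sqrt_continuous.
apply: measurable_funM => //; apply: measurable_funV.
exact: (measurableT_comp (measurable_normc_fourier2 n)).
Qed.

(** Only the modulus of mode n is resampled: |u_n|^2 = |g_n|^2 / <2 pi n>^2 is exponential,
    independently of the direction of g_n and of the other modes. *)
Lemma resample_mass (P : probability (borelHs s) R) n (Phi : borelHs s -> \bar R) : wiener P ->
  measurable_fun [set: borelHs s] Phi -> (forall u, 0 <= Phi u)%E ->
  (\int[P]_u Phi u = \int[P]_u \int[leb]_p
    ((expdens (J n ^- 2) p)%:E * Phi (set_mass n (u : Hs s) p)))%E.
Proof.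
move=> wP mPhi Phi0; have j0 : 0 < J n by exact: japanese_gt0.
pose Th (u : borelHs s) := (\int[leb]_p
    ((expdens (J n ^- 2) p)%:E * Phi (set_mass n (u : Hs s) p)))%E.
have mTh : measurable_fun [set: borelHs s] Th.
  apply: (@measurable_fun_fubini_tonelli_F _ _ _ _ _ leb (fun w : borelHs s * R =>
    (expdens (J n ^- 2) w.2)%:E * Phi (set_mass n (w.1 : Hs s) w.2))%E).
    apply: emeasurable_funM; last exact: (measurableT_comp mPhi (measurable_set_mass n)).
    by apply/measurable_EFinP; apply: (measurableT_comp (measurable_expdens _)).
  by move=> w; rewrite mule_ge0// lee_fin expdens_ge0// invr_gt0 exprn_gt0.
have Th0 u : (0 <= Th u)%E.
  by apply: integral_ge0 => p _; rewrite mule_ge0// lee_fin expdens_ge0// invr_gt0 exprn_gt0.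
(* A fresh Gaussian mode is inserted on both sides, after which [polar_resampling] applies for each
   fixed u. *)
rewrite -[RHS]/(\int[P]_u Th u)%E (resample n wP mPhi Phi0) (resample n wP mTh Th0).
apply: eq_integral => u _; rewrite (@polar_resampling R (fun z => Phi (set_mode n (u : Hs s) z))); last 2 first.
- apply: (@measurableT_comp _ _ _ _ _ _ _ _ (fun z : R * R => set_mode n (u : Hs s) z : borelHs s) mPhi).
  exact: (measurableT_comp (measurable_set_mode n) (measurable_pair1 u)).
- by move=> z.
apply: eq_integral => z _; rewrite /Th.
set v := set_mode n (u : Hs s) z.
have w0 : 0 < J n ^- 2 by rewrite invr_gt0 exprn_gt0.
have mhh : measurable_fun [set: R] (fun p : R => (expdens (J n ^- 2) p)%:E * Phi (set_mass n v p))%E.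
  apply: emeasurable_funM; first by apply/measurable_EFinP; exact: measurable_expdens.
  apply: (@measurableT_comp _ _ _ _ _ _ _ _ (fun p : R => set_mass n v p : borelHs s) mPhi).
  exact: (measurableT_comp (measurable_set_mass n) (measurable_pair1 (v : borelHs s))).
rewrite [RHS](@integral_affine R _ (J n ^- 2) 0 (lt0r_neq0 w0)); last 2 first.
- exact: mhh.
- by move=> r; rewrite mule_ge0// lee_fin expdens_ge0.
rewrite -ge0_integralZl//; last 2 first.
- exact: (measurableT_comp mhh (measurable_affine (J n ^- 2) 0)).
- by move=> r _; rewrite mule_ge0// lee_fin expdens_ge0.
apply: eq_integral => r _; rewrite muleA -EFinM addr0 gtr0_norm//; congr (_ * _)%E.
  congr EFin; rewrite /expdens !indicE.
  have -> : (J n ^- 2 * r \in `]0, +oo[%classic) = (r \in `]0, +oo[%classic).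
    by apply/idP/idP; rewrite !inE /= !in_itv /= !andbT pmulr_rgt0.
  have -> : J n ^- 2 * r / (2 * J n ^- 2) = r / (2 * 1) by field; rewrite gt_eqF.
  by field; rewrite gt_eqF.
congr Phi; rewrite /set_mass /v set_mode_idem fourier_set_mode eqxx coef_set_mode eqxx normc_mode_of.
congr (set_mode _ _ (dilate (Num.sqrt _) _)).
have [->|z0] := eqVneq (sqnorm z) 0; first by rewrite mul0r !invr0 !mulr0.
by field; rewrite z0 gt_eqF.
Qed.

End resampling.

(** * The law of the Gaussian Fourier series *)

Section wiener_law.
Variables (R : realType) (s : R) (d : measure_display) (Omega : measurableType d).
Variables (Pr : probability Omega R) (g : int -> {RV Pr >-> (R * R)%type}).
Variable u : {RV Pr >-> borelHs s}.
Hypotheses (gg : forall n, standard_complex_gaussian (g n)) (ig : independent_RVs g).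
Hypothesis gu : gauss_fourier_series g u.

Lemma standard_complex_gaussianE n (E : set (R * R)) : measurable E ->
  Pr (g n @^-1` E) = gaussian2 R E.
Proof.
move=> mE; have [g1 g2 g12] := gg n.
rewrite -[LHS]/(distribution Pr (g n) E); apply/esym.
apply: (@product_measure_unique _ _ _ _ R (@gaussian1 R) (@gaussian1 R)) => // A B mA mB.
by rewrite -[LHS]/(Pr [set w | A (g n w).1 /\ B (g n w).2]) g12// g1// g2.
Qed.

(** For K >= |n| the n-th term of the squared H^s norm of the remainder does not depend on K; the
    norm tends to 0, so this term vanishes. *)
Lemma gauss_coef : {ae Pr, forall w, forall n, coef n (u w : Hs s) = g n w}.
Proof.
apply: filterS gu => w hw n.
pose c n : R[i] := - (((g n w).1 +i* (g n w).2) / (japanese R n)%:C).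
have j0 : 0 < japanese R n by exact: japanese_gt0.
have E K : (fun x => (u w : Hs s) x - gauss_partial_sum (fun n => g n w) K x) =
    add_modes (u w : Hs s) (freqs K) c.
  apply/funext => x; rewrite add_modesE big_freqs /gauss_partial_sum -sumrN.
  by congr (_ + _); apply: eq_bigr => m _; rewrite mulNr.
pose t := japanese R n `^ (2 * s) * normc (fourier (u w : Hs s) n + c n) ^+ 2.
have t0 : 0 <= t by rewrite mulr_ge0 ?powR_ge0 ?sqr_ge0.
have tK : \forall K \near \oo, ((Num.sqrt t)%:E <=
   Hs_norm s (fun x => (u w : Hs s) x - gauss_partial_sum (fun n => g n w) K x)%R)%E.
  near=> K; rewrite E /Hs_norm.
  rewrite -[X in (X <= _)%E]/(sqrte t%:E) lee_sqrt ?lee_fin//; last first.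
    by apply: esum_ge0 => m _; rewrite lee_fin mulr_ge0 ?powR_ge0 ?sqr_ge0.
  have nK : n \in freqs K by rewrite mem_freqs; near: K; exact: nbhs_infty_ge.
  rewrite /t (_ : fourier (u w : Hs s) n + c n = fourier (add_modes (u w : Hs s) (freqs K) c) n).
    apply: esum_ge; exists [set n]; first by split; [exact: finite_set1|].
    by rewrite fsbig_set1.
  by rewrite fourier_add_modes ?freqs_uniq// nK.
have : ((Num.sqrt t)%:E <= 0)%E.
  rewrite -(cvg_lim _ hw)//; apply: lime_ge => //; by apply/cvg_ex; exists 0%E.
rewrite lee_fin => st; have {st}/eqP : Num.sqrt t = 0 by apply/eqP; rewrite eq_le st sqrtr_ge0.
rewrite sqrtr_eq0 => tle; have : t == 0 by rewrite eq_le tle t0.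
rewrite mulf_eq0 gt_eqF ?powR_gt0//= sqrf_eq0 => /eqP/eq0_normc/eqP.
rewrite addr_eq0 /c opprK => /eqP h.
rewrite /coef h; case: (g n w) => a b /=.
by rewrite expr0n /= addr0 mul0r oppr0 !mulr0 subr0 add0r; congr pair; field; rewrite gt_eqF.
Unshelve. all: by end_near. Qed.

Lemma wiener_distribution : wiener (distribution Pr u).
Proof.
move=> L E uL mE.
pose Jf := [fset x in L]%fset.
have mcL : measurable [set v : borelHs s | forall n, n \in L -> E n (coef n v)].
  rewrite (_ : [set v | _] = \bigcap_(k in [set` L]) (coef k @^-1` (E k)))//.
  apply: fin_bigcap_measurable => // k _.
  rewrite -[X in measurable X]setTI; exact: measurable_coef.
have mg : measurable (\bigcap_(i in [set` L]) (g i @^-1` E i)).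
  apply: fin_bigcap_measurable => // k _; exact: measurable_funPTI.
transitivity (Pr (\bigcap_(i in [set` L]) (g i @^-1` E i))).
  rewrite -[LHS]/(Pr (u @^-1` [set v : borelHs s | forall n, n \in L -> E n (coef n v)])).
  set A := u @^-1` _; set B := \bigcap_(i in _) _.
  have mA : measurable A by exact: measurable_funPTI.
  have : (\int[Pr]_w (\1_A w)%:E = \int[Pr]_w (\1_B w)%:E)%E.
    apply: ae_eq_integral => //; [exact/measurable_EFinP/measurable_indic|
      exact/measurable_EFinP/measurable_indic|].
    apply: filterS gauss_coef => w hw _; congr (_%:E); rewrite !indicE; congr ((nat_of_bool _)%:R).
    by apply/idP/idP; rewrite !inE /A /B /= => h n nL; have := h n nL; rewrite /= hw.
  by rewrite !integral_indic ?setIT.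
rewrite (_ : [set` L] = [set` Jf]); last by apply/seteqP; split => n /=; rewrite inE.
rewrite ig// (perm_big L); last by apply: uniq_perm; rewrite ?fset_uniq// => n; rewrite inE.
by apply: eq_bigr => n _; exact: standard_complex_gaussianE.
Qed.

End wiener_law.

Lemma powR_le_expR (R : realType) (t p : R) : 0 < t -> 0 < p -> (1 + t) `^ p <= expR (p * t).
Proof.
move=> t0 p0; rewrite /powR gt_eqF ?addr_gt0// ler_expR ler_wpM2l ?(ltW p0)//.
apply: le_ln1Dx; lra.
Qed.

(** Either y <= t x or x < y / t, and one summand absorbs the other. With t small the first constant
    is close to 1, which is what continuity of the L^p integral needs. *)
Lemma powR_add_le (R : realType) (t p x y : R) : 0 < t -> 0 < p -> 0 <= x -> 0 <= y ->
  (x + y) `^ p <= (1 + t) `^ p * x `^ p + (1 + t^-1) `^ p * y `^ p.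
Proof.
move=> t0 p0 x0 y0; have ti0 : 0 < t^-1 by rewrite invr_gt0.
have [yx|xy] := leP y (t * x).
  apply: (@le_trans _ _ (((1 + t) * x) `^ p)).
    by rewrite ge0_ler_powR ?nnegrE ?(ltW p0) ?addr_ge0 ?mulr_ge0 ?addr_ge0 ?(ltW t0)//; lra.
  by rewrite powRM ?addr_ge0 ?(ltW t0)// lerDl mulr_ge0 ?powR_ge0.
apply: (@le_trans _ _ (((1 + t^-1) * y) `^ p)).
  rewrite ge0_ler_powR ?nnegrE ?(ltW p0) ?addr_ge0 ?mulr_ge0 ?addr_ge0 ?(ltW ti0)//.
  have : x <= t^-1 * y by rewrite mulrC ler_pdivlMr// mulrC ltW.
  lra.
by rewrite powRM ?addr_ge0 ?(ltW ti0)// lerDr mulr_ge0 ?powR_ge0.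
Qed.

(** * Continuity of the L^p norm *)

Section Lp_continuity.
Variables (R : realType) (s p : R).
Hypotheses (s0 : 0 < s) (s12 : s < 2^-1) (p2 : 2 < p) (sp : (2^-1 - s) * p < 1).
Implicit Types (n : int) (u v w : Hs s) (k K : nat) (x D : R) (L : seq int).
Local Notation leb := (@lebesgue_measure R).
Local Notation D01 := (`[0%R, 1%R]%classic : set R).

Let p0 : 0 < p. Proof. exact: lt_trans p2. Qed.

Lemma measurable_Lp u : measurable_fun [set: R] (fun x => normc (u x) `^ p).
Proof.
apply: (@measurableT_comp _ _ _ _ _ _ (fun z : R => z `^ p)) => //.
by apply: measurable_normc; exact: measurableC_Hs.
Qed.

Lemma Lp_int_ge0 (f : R -> R[i]) : (0 <= Lp_int p f)%E.
Proof. by apply: integral_ge0 => x _; rewrite lee_fin powR_ge0. Qed.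

Lemma Lp_int_add_le (t : R) u v w : 0 < t -> (forall x, normc (u x) <= normc (v x) + normc (w x)) ->
  (Lp_int p u <= ((1 + t) `^ p)%:E * Lp_int p v + ((1 + t^-1) `^ p)%:E * Lp_int p w)%E.
Proof.
move=> t0 h.
have mE (f : Hs s) : measurable_fun D01 (fun x => (normc (f x) `^ p)%:E).
  by apply/measurable_EFinP; apply: measurable_funTS; exact: measurable_Lp.
have E0 (f : Hs s) x : (0 <= (normc (f x) `^ p)%:E)%E by rewrite lee_fin powR_ge0.
rewrite /Lp_int -!ge0_integralZl//; try exact: mE; try (by rewrite lee_fin powR_ge0).
rewrite -ge0_integralD//; try (by apply: emeasurable_funM; [exact: measurable_cst|exact: mE]);
  try (by move=> x _; rewrite mule_ge0// lee_fin powR_ge0).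
apply: ge0_le_integral => //.
- exact: mE.
- by apply: emeasurable_funD; apply: emeasurable_funM; [exact: measurable_cst|exact: mE|exact: measurable_cst|exact: mE].
move=> x _; rewrite -!EFinM -EFinD lee_fin.
apply: le_trans (powR_add_le t0 p0 (normc_ge0 _) (normc_ge0 _)).
by rewrite ge0_ler_powR ?nnegrE ?addr_ge0 ?normc_ge0// ltW.
Qed.

Lemma sum_freqs_le_esum (a : int -> \bar R) K : (forall n, 0 <= a n)%E ->
  (\sum_(n <- freqs K) a n <= \esum_(n in [set: int]) a n)%E.
Proof.
move=> a0; rewrite -esum_freqs// esum_mkcond; apply: le_esum => n _.
by case: ifP.
Qed.

Lemma sobolev_dist : exists2 C, 0 < C & forall u v D, 0 < D -> (Hs_dist2 u v <= (D ^+ 2)%:E)%E ->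
  (Lp_int p (Hs_sub u v) <= (C * D `^ p)%:E)%E.
Proof.
have [C C0 h] := sobolev s0 s12 p2 sp; exists C => // u v D D0 uv; apply: h => // K.
rewrite -lee_fin; apply: le_trans uv; rewrite -sumEFin.
under eq_bigr do rewrite fourier_Hs_sub.
by apply: sum_freqs_le_esum => n; rewrite lee_fin mulr_ge0 ?powR_ge0 ?sqr_ge0.
Qed.

Lemma Lp_int_fin u : (Lp_int p u < +oo)%E.
Proof.
have [C C0 h] := sobolev s0 s12 p2 sp.
have uF := Hs_dist20_fin u; set T := (\esum_(n in _) _)%E in uF.
have T0 : (0 <= T)%E by apply: esum_ge0 => n _; rewrite lee_fin mulr_ge0 ?powR_ge0 ?sqr_ge0.
pose D := fine T + 1; have D1 : 1 <= D by rewrite lerDr fine_ge0.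
have D0 : 0 < D by exact: lt_le_trans D1.
apply: le_lt_trans (h u D D0 _) (ltry _) => K.
apply: le_trans (_ : D <= _); last by rewrite expr2 ler_peMl// ltW.
rewrite -lee_fin -sumEFin; apply: le_trans (_ : T <= _)%E; last first.
  by rewrite /D EFinD fineK ?ge0_fin_numE// leeDl.
by apply: sum_freqs_le_esum => n; rewrite lee_fin mulr_ge0 ?powR_ge0 ?sqr_ge0.
Qed.

Definition Lp u : R := fine (Lp_int p u).

Lemma LpE u : Lp_int p u = (Lp u)%:E.
Proof. by rewrite fineK// ge0_fin_numE ?Lp_int_fin ?Lp_int_ge0. Qed.

Lemma Lp_ge0 u : 0 <= Lp u. Proof. by rewrite fine_ge0 ?Lp_int_ge0. Qed.

Lemma Lp_add_le (t : R) u v w : 0 < t -> (forall x, normc (u x) <= normc (v x) + normc (w x)) ->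
  Lp u <= (1 + t) `^ p * Lp v + (1 + t^-1) `^ p * Lp w.
Proof. by move=> t0 /(Lp_int_add_le t0); rewrite !LpE -!EFinM -EFinD lee_fin. Qed.

Lemma close_of_mutual_le (a b e eta zeta : R) : 0 <= a -> 0 <= b -> 0 < e -> 0 < eta -> eta <= 1 ->
  eta * (2 * a + 1) <= e / 2 -> 0 < zeta -> zeta <= 1 -> zeta <= e / 4 ->
  b <= (1 + eta) * a + zeta -> a <= (1 + eta) * b + zeta -> `|a - b| < e.
Proof.
move=> a0 b0 e0 h0 h1 h2 z0 z1 z2 ba ab; rewrite ltr_norml.
have : eta * b <= eta * (2 * a + 1) by rewrite ler_wpM2l ?(ltW h0)//; nra.
have : eta * a <= eta * (2 * a + 1) by rewrite ler_wpM2l ?(ltW h0)//; lra.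
by move=> h3 h4; apply/andP; split; nra.
Qed.

(** [Lp_add_le] is used in both directions: each of the two integrals is at most 1 + eta times the
    other, plus an error zeta controlled by the Sobolev bound on the difference. *)
Lemma continuous_Lp : continuous Lp.
Proof.
move=> u; apply: (@cvgrPdist_lt _ _ _ (nbhs u) (nbhs_filter u) _ _).2 => e e0.
have [C C0 hC] := sobolev_dist.
pose L := Lp u; have L0 : 0 <= L by exact: Lp_ge0.
pose eta := Num.min 1 (e / (2 * (2 * L + 1))).
have eta0 : 0 < eta by rewrite lt_min ltr01 divr_gt0// mulr_gt0//; lra.
have eta1 : eta <= 1 by rewrite ge_min lexx.
have eta2 : eta * (2 * L + 1) <= e / 2.
  have : eta <= e / (2 * (2 * L + 1)) by rewrite ge_min lexx orbT.
  rewrite ler_pdivlMr; last by rewrite mulr_gt0//; lra.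
  by rewrite ler_pdivlMr// => h; lra.
(* With this t, (1 + t)^p <= exp(p t) = 1 + eta. *)
pose t := ln (1 + eta) / p; have t0 : 0 < t by rewrite divr_gt0// ln_gt0// ltrDl.
have tM : (1 + t) `^ p <= 1 + eta.
  apply: le_trans (powR_le_expR t0 p0) _; rewrite /t mulrCA divff ?gt_eqF// mulr1 lnK//.
  by rewrite posrE addr_gt0.
pose zeta := Num.min 1 (e / 4).
have zeta0 : 0 < zeta by rewrite lt_min ltr01 divr_gt0.
have z1 : zeta <= 1 by rewrite ge_min lexx.
have z2 : zeta <= e / 4 by rewrite ge_min lexx orbT.
pose B := (1 + t^-1) `^ p * C; have B0 : 0 < B by rewrite mulr_gt0 ?powR_gt0 ?addr_gt0 ?invr_gt0.
(* The radius at which the error term B D^p equals zeta. *)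
pose D := (zeta / B) `^ p^-1; have D0 : 0 < D by apply: powR_gt0; rewrite divr_gt0.
have DB : B * D `^ p = zeta.
  rewrite /D -powRrM mulVf ?gt_eqF// powRr1 ?divr_ge0 ?ltW//.
  by rewrite mulrC divfK ?gt_eqF.
have nb : nbhs u (Hs_ball u D) by apply/nbhs_ballP; exists D.
apply: filterS nb => v /(Hs_ballE _ _ D0).1 /ltW uv.
have vu : (Hs_dist2 v u <= (D ^+ 2)%:E)%E.
  by apply: le_trans uv; apply: le_esum => n _; rewrite -[X in normc X]opprB normcN.
have h1 := hC _ _ _ D0 uv; have h2 := hC _ _ _ D0 vu.
have key (a b : Hs s) : (Lp_int p (Hs_sub b a) <= (C * D `^ p)%:E)%E -> Lp b <= (1 + eta) * Lp a + zeta.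
  rewrite LpE lee_fin => h.
  apply: le_trans (@Lp_add_le t b a (Hs_sub b a) t0 _) _.
    by move=> x; rewrite addrC; apply: le_trans (le_normcD _ _); rewrite /= subrK.
  apply: lerD; first by rewrite ler_wpM2r ?Lp_ge0.
  by rewrite -DB /B -mulrA ler_wpM2l ?powR_ge0.
by apply: (close_of_mutual_le L0 (Lp_ge0 v) e0 eta0 eta1 eta2 zeta0 z1 z2); exact: key.
Qed.

Definition trunc L u : Hs s := add_modes (@Hs0 R s) L (fourier u).

Lemma fourier_trunc L u n : uniq L -> fourier (trunc L u) n = if n \in L then fourier u n else 0.
Proof. by move=> uL; rewrite fourier_add_modes// fourier_Hs0 add0r. Qed.

Lemma truncE L u x : trunc L u x = \sum_(n <- L) fourier u n * expi n x.
Proof. by rewrite /trunc add_modesE add0r. Qed.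

Lemma trunc_cvg u : trunc (freqs K) u @[K --> \oo] --> u.
Proof.
apply/cvg_ballP => e e0.
pose a n := (japanese R n `^ (2 * s) * normc (fourier u n) ^+ 2)%:E.
have a0 n : (0 <= a n)%E by rewrite lee_fin mulr_ge0 ?powR_ge0 ?sqr_ge0.
have afin : (\esum_(n in [set: int]) a n < +oo)%E := Hs_dist20_fin u.
set T := (\esum_(n in _) _)%E in afin.
have T0 : (0 <= T)%E by exact: esum_ge0.
have Tf : T \is a fin_num by rewrite ge0_fin_numE.
have cT := esum_int_cvg a0; rewrite -/T in cT.
have : \forall K \near \oo, (T - (e ^+ 2)%:E < \sum_(n <- freqs K) a n)%E.
  move: cT; rewrite -{1}(fineK Tf) => cT.
  have TT : (T - (e ^+ 2)%:E < T)%E by rewrite lteBlDr// lteDl// lte_fin exprn_gt0.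
  by move: TT; rewrite -{2}(fineK Tf) => TT; exact: (cT _ (open_ereal_gt' TT)).
apply: filterS => K hK; apply/(Hs_ballE _ _ e0).
have E : (\sum_(n <- freqs K) a n + Hs_dist2 u (trunc (freqs K) u) = T)%E.
  rewrite -(esum_freqs _ a0) esum_mkcond -esumD//; last 2 first.
  - by move=> n _; case: ifP.
  - by move=> n _; rewrite lee_fin mulr_ge0 ?powR_ge0 ?sqr_ge0.
  apply: eq_esum => n _; rewrite fourier_trunc ?freqs_uniq// /a mem_setE.
  by case: ifPn => _; rewrite ?subrr ?normc0 ?expr0n ?mulr0 ?adde0 ?subr0 ?add0e.
have sf : (\sum_(n <- freqs K) a n)%E \is a fin_num.
  by rewrite ge0_fin_numE ?sume_ge0// (le_lt_trans _ afin)// -E leeDl// Hs_dist2_ge0.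
by move: hK; rewrite -E lteBlDr// lteD2lE.
Qed.

Lemma Lp_trunc_cvg u : Lp (trunc (freqs K) u) @[K --> \oo] --> Lp u.
Proof. apply: (cvg_comp _ _ (@trunc_cvg u)); exact: continuous_Lp. Qed.

End Lp_continuity.

(** * Disintegration along mass and momentum *)

Section mode_mass.
Variables (R : realType) (s : R).
Implicit Types (n k : int) (u v : Hs s) (z : R * R) (r p x : R) (L : seq int).
Local Notation leb := (@lebesgue_measure R).
Local Notation J n := (japanese R n).

Definition mode_mass n u : R := normc (fourier u n) ^+ 2.

Lemma mode_mass_ge0 n u : 0 <= mode_mass n u. Proof. exact: sqr_ge0. Qed.

Lemma measurable_mode_mass n : measurable_fun [set: borelHs s] (mode_mass n : borelHs s -> R).
Proof. exact: measurable_normc_fourier2. Qed.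

Lemma freq_inj m n : m != n -> freq R n - freq R m != 0.
Proof. by move=> mn; rewrite -freqN -freqD freq_eq0 subr_eq0 eq_sym. Qed.

Lemma fourier_set_mass_other n u p k : n != k -> fourier (set_mass n u p) k = fourier u k.
Proof. by move=> nk; rewrite /set_mass fourier_set_mode (negbTE nk). Qed.

Lemma mode_mass_set_mass_other n u p k : n != k -> mode_mass k (set_mass n u p) = mode_mass k u.
Proof. by move=> nk; rewrite /mode_mass fourier_set_mass_other. Qed.

Lemma sqnorm_set_mass n u p : mode_mass n u != 0 -> 0 <= p ->
  sqnorm (dilate (Num.sqrt (p / mode_mass n u)) (coef n u)) / J n ^+ 2 = p.
Proof.
move=> N0 p0; rewrite sqnorm_dilate sqr_sqrtr ?divr_ge0 ?mode_mass_ge0//.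
by rewrite -mulrA -normc_fourier_coef -/(mode_mass n u) divfK.
Qed.

Lemma mode_mass_set_mass n u p : mode_mass n u != 0 -> 0 <= p ->
  mode_mass n (set_mass n u p) = p.
Proof.
by move=> N0 p0; rewrite {1}/mode_mass fourier_set_mode eqxx normc_mode_of sqnorm_set_mass.
Qed.

Lemma mass_set_mass n u p : mode_mass n u != 0 -> 0 <= p ->
  mass (set_mass n u p) = mass u - mode_mass n u + p.
Proof. by move=> N0 p0; rewrite mass_set_mode sqnorm_set_mass// /mode_mass; ring. Qed.

Lemma momentum_partial_sum_set_mode n u z K : n \in freqs K ->
  momentum_partial_sum (set_mode n u z) K =
  momentum_partial_sum u K + freq R n * (sqnorm z / J n ^+ 2 - mode_mass n u).
Proof.
move=> nK; rewrite !momentum_partial_sumE !(bigD1_seq n) ?freqs_uniq//=.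
rewrite fourier_set_mode eqxx normc_mode_of /mode_mass.
rewrite (eq_bigr (fun k => freq R k * normc (fourier u k) ^+ 2)); last first.
  by move=> k kn; rewrite fourier_set_mode eq_sym (negbTE kn).
ring.
Qed.

Lemma momentum_set_mode_cvg n u z : momentum_cvg (u : borelHs s) ->
  momentum_partial_sum (set_mode n u z) @ \oo -->
  momentum (u : borelHs s) + freq R n * (sqnorm z / J n ^+ 2 - mode_mass n u).
Proof.
move=> cu; have h := momentum_lim cu.
have h2 : (fun K => momentum_partial_sum u K + freq R n * (sqnorm z / J n ^+ 2 - mode_mass n u)) @ \oo -->
    momentum (u : borelHs s) + freq R n * (sqnorm z / J n ^+ 2 - mode_mass n u).
  by apply: cvgD => //; exact: cvg_cst.
apply: cvg_trans h2; apply: near_eq_cvg; near=> K.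
rewrite momentum_partial_sum_set_mode// mem_freqs; near: K; exact: nbhs_infty_ge.
Unshelve. all: by end_near. Qed.

Lemma set_modeK n u z : set_mode n (set_mode n u z) (coef n u) = u.
Proof.
rewrite set_mode_idem; apply: Hs_eq => x; rewrite /set_mode /= coefK subrr mul0r addr0 //.
Qed.

Lemma momentum_cvg_set_mode n u z :
  momentum_cvg (set_mode n u z : borelHs s) <-> momentum_cvg (u : borelHs s).
Proof.
split => [h|h]; last by apply/cvg_ex; eexists; exact: momentum_set_mode_cvg h.
rewrite -(set_modeK n u z); apply/cvg_ex; eexists; exact: momentum_set_mode_cvg h.
Qed.

Lemma momentum_set_mode n u z : momentum_cvg (u : borelHs s) ->
  momentum (set_mode n u z : borelHs s) =
  momentum (u : borelHs s) + freq R n * (sqnorm z / J n ^+ 2 - mode_mass n u).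
Proof. by move=> /(momentum_set_mode_cvg (n := n) (z := z)) /momentumE. Qed.

Lemma momentum_set_mass n u p : mode_mass n u != 0 -> 0 <= p -> momentum_cvg (u : borelHs s) ->
  momentum (set_mass n u p : borelHs s) = momentum (u : borelHs s) + freq R n * (p - mode_mass n u).
Proof. by move=> N0 p0 cu; rewrite /set_mass momentum_set_mode// sqnorm_set_mass. Qed.

Lemma measurable_set_mass_comp d (T : measurableType d) n (f : T -> borelHs s) (g : T -> R) :
  measurable_fun [set: T] f -> measurable_fun [set: T] g ->
  measurable_fun [set: T] (fun t => set_mass n (f t : Hs s) (g t) : borelHs s).
Proof.
move=> mf mg; apply: (@measurableT_comp _ _ _ _ _ _ _ _ (fun t => (f t, g t)) (measurable_set_mass n)).
exact: measurable_fun_pair.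
Qed.

(** Excludes the default case of [set_mass]. *)
Lemma mode_mass_neq0 (P : probability (borelHs s) R) n : wiener P ->
  {ae P, forall u : borelHs s, mode_mass n (u : Hs s) != 0}.
Proof.
move=> wP; have [N [mN N0 hN]] := @gaussian2_sqnorm0 R.
have mE : measurable [set z : R * R | sqnorm z = 0].
  rewrite (_ : [set z | _] = @sqnorm R @^-1` [set 0])// -[X in measurable X]setTI.
  exact: measurable_sqnorm.
have E0 : gaussian2 R [set z | sqnorm z = 0] = 0%E.
  apply/eqP; rewrite eq_le measure_ge0 andbT -N0; apply: le_measure; rewrite ?inE//.
  by move=> z /= z0; apply: hN => /=; rewrite z0 eqxx.
have := wP [:: n] (fun=> [set z : R * R | sqnorm z = 0]) isT (fun=> mE).
rewrite big_seq1 E0 => PE; eexists; split; [|exact: PE|].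
- rewrite (_ : [set u | _] = (coef n : borelHs s -> R * R) @^-1` [set z | sqnorm z = 0]).
    by rewrite -[X in measurable X]setTI; exact: measurable_coef.
  by apply/seteqP; split => u /= => [|h k]; [apply; rewrite inE|rewrite inE => /eqP ->].
- move=> u /= /negP; rewrite negbK /mode_mass normc_fourier_coef => /eqP h k; rewrite inE => /eqP ->.
  by apply/eqP; move/eqP : h; rewrite mulf_eq0 invr_eq0 sqrf_eq0 (gt_eqF (japanese_gt0 _ _)) orbF.
Qed.

End mode_mass.

(** * Two modes determined by mass and momentum *)

Section two_modes.
Variables (R : realType) (s : R) (m n : int).
Hypothesis mn : m != n.
Implicit Types (u v : Hs s) (p q : R) (y : R * R).
Local Notation leb := (@lebesgue_measure R).
Local Notation alpha := (freq R m).
Local Notation beta := (freq R n).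

Definition mode_dens k (p : R) : R := expdens (japanese R k ^- 2) p.

Lemma mode_dens_ge0 k p : 0 <= mode_dens k p.
Proof. by apply: expdens_ge0; rewrite invr_gt0 exprn_gt0// japanese_gt0. Qed.

Lemma mode_dens0 k p : p <= 0 -> mode_dens k p = 0.
Proof.
by move=> p0; rewrite /mode_dens /expdens indicE memNset ?mulr0//= in_itv /= andbT; apply/negP; rewrite -leNgt.
Qed.

Lemma measurable_mode_dens k : measurable_fun [set: R] (mode_dens k).
Proof. exact: measurable_expdens. Qed.

Definition rest_mass u : R := mass u - mode_mass m u - mode_mass n u.
Definition rest_momentum u : R :=
  momentum (u : borelHs s) - alpha * mode_mass m u - beta * mode_mass n u.

(* mass1 and mass2 solve p1 + p2 = y.1 - rest_mass and
   freq m * p1 + freq n * p2 = y.2 - rest_momentum. *)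
Definition mass1 u y : R := (beta * (y.1 - rest_mass u) - (y.2 - rest_momentum u)) / (beta - alpha).
Definition mass2 u y : R := y.1 - rest_mass u - mass1 u y.

Definition pinned u y : Hs s := set_mass n (set_mass m u (mass1 u y)) (mass2 u y).

Definition pin_density (u : borelHs s) y : R :=
  mode_dens m (mass1 (u : Hs s) y) * mode_dens n (mass2 (u : Hs s) y) * \1_(@momentum_cvg R s) u.

Lemma pin_density_ge0 u y : 0 <= pin_density u y.
Proof. by rewrite /pin_density mulr_ge0// mulr_ge0 ?mode_dens_ge0. Qed.

Lemma measurable_rest_mass : measurable_fun [set: borelHs s] (rest_mass : borelHs s -> R).
Proof.
apply: measurable_funB; last exact: measurable_mode_mass.
by apply: measurable_funB; [exact: measurable_mass|exact: measurable_mode_mass].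
Qed.

Lemma measurable_rest_momentum : measurable_fun [set: borelHs s] (rest_momentum : borelHs s -> R).
Proof.
apply: measurable_funB; last by apply: measurable_funM => //; exact: measurable_mode_mass.
apply: measurable_funB; first exact: measurable_momentum.
by apply: measurable_funM => //; exact: measurable_mode_mass.
Qed.

Lemma measurable_mass1 d (T : measurableType d) (f : T -> borelHs s) (g : T -> R * R) :
  measurable_fun [set: T] f -> measurable_fun [set: T] g ->
  measurable_fun [set: T] (fun t => mass1 (f t : Hs s) (g t)).
Proof.
move=> mf mg; apply: measurable_funM => //; apply: measurable_funB.
  apply: measurable_funM => //; apply: measurable_funB; first exact: measurableT_comp.
  exact: (measurableT_comp measurable_rest_mass).
apply: measurable_funB; first exact: measurableT_comp.
exact: (measurableT_comp measurable_rest_momentum).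
Qed.

Lemma measurable_mass2 d (T : measurableType d) (f : T -> borelHs s) (g : T -> R * R) :
  measurable_fun [set: T] f -> measurable_fun [set: T] g ->
  measurable_fun [set: T] (fun t => mass2 (f t : Hs s) (g t)).
Proof.
move=> mf mg; apply: measurable_funB; last exact: measurable_mass1.
apply: measurable_funB; first exact: measurableT_comp.
exact: (measurableT_comp measurable_rest_mass).
Qed.

Lemma measurable_pinned d (T : measurableType d) (f : T -> borelHs s) (g : T -> R * R) :
  measurable_fun [set: T] f -> measurable_fun [set: T] g ->
  measurable_fun [set: T] (fun t => pinned (f t : Hs s) (g t) : borelHs s).
Proof.
move=> mf mg; apply: measurable_set_mass_comp; last exact: measurable_mass2.
by apply: measurable_set_mass_comp => //; exact: measurable_mass1.
Qed.

Lemma measurable_pin_density d (T : measurableType d) (f : T -> borelHs s) (g : T -> R * R) :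
  measurable_fun [set: T] f -> measurable_fun [set: T] g ->
  measurable_fun [set: T] (fun t => pin_density (f t) (g t)).
Proof.
move=> mf mg; apply: measurable_funM.
  apply: measurable_funM.
    by apply: (measurableT_comp (measurable_mode_dens m)); exact: measurable_mass1.
  by apply: (measurableT_comp (measurable_mode_dens n)); exact: measurable_mass2.
apply: (@measurableT_comp _ _ _ _ _ _ (\1_(@momentum_cvg R s) : borelHs s -> R)) => //.
by apply: measurable_indic; exact: measurable_momentum_cvg.
Qed.

Variable P : probability (borelHs s) R.
Hypothesis wP : wiener P.

(** The function G_Psi of the overview. The factor in front is the Jacobian of the passage from the
    two masses to mass and momentum. *)
Definition pinned_integral (Psi : borelHs s -> R) y : \bar R :=
  (`|beta - alpha|^-1%:E * \int[P]_u (pin_density u y * Psi (pinned (u : Hs s) y))%:E)%E.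

Lemma resample_two (Phi : borelHs s -> \bar R) :
  measurable_fun [set: borelHs s] Phi -> (forall u, 0 <= Phi u)%E ->
  (\int[P]_u Phi u = \int[P]_u \int[leb]_p \int[leb]_q
    ((mode_dens m p * mode_dens n q)%:E * Phi (set_mass n (set_mass m (u : Hs s) p) q)))%E.
Proof.
move=> mPhi Phi0; rewrite (resample_mass n wP mPhi Phi0).
pose F (w : borelHs s * R) := ((mode_dens n w.2)%:E * Phi (set_mass n (w.1 : Hs s) w.2))%E.
have mF : measurable_fun [set: borelHs s * R] F.
  apply: emeasurable_funM; last exact: (measurableT_comp mPhi (measurable_set_mass n)).
  by apply/measurable_EFinP; apply: (measurableT_comp (measurable_mode_dens _)).
have F0 w : (0 <= F w)%E by rewrite mule_ge0// lee_fin mode_dens_ge0.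
rewrite (@resample_mass _ _ P m (fun u => \int[leb]_q F (u, q))%E wP); last 2 first.
- exact: (@measurable_fun_fubini_tonelli_F _ _ _ _ _ leb F mF F0).
- by move=> u; apply: integral_ge0.
apply: eq_integral => u _; apply: eq_integral => p _; rewrite -ge0_integralZl//.
- by apply: eq_integral => q _; rewrite /F /= muleA -EFinM.
- exact: (measurableT_comp mF (measurable_pair1 (set_mass m (u : Hs s) p : borelHs s))).
- by rewrite lee_fin mode_dens_ge0.
Qed.

Lemma event_two_modes (A B : set R) u p q : mode_mass m u != 0 -> mode_mass n u != 0 -> 0 < p -> 0 < q ->
  \1_(mass_momentum_event A B) (set_mass n (set_mass m u p) q : borelHs s) =
  \1_A (rest_mass u + p + q) * \1_B (rest_momentum u + alpha * p + beta * q) *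
  \1_(@momentum_cvg R s) (u : borelHs s) :> R.
Proof.
move=> Nm Nn p0 q0; have Nn' : mode_mass n (set_mass m u p) != 0 by rewrite mode_mass_set_mass_other.
rewrite mass_momentum_eventE !indicE -!natrM !mulnb; congr ((nat_of_bool _)%:R).
have E1 : mass (set_mass n (set_mass m u p) q) = rest_mass u + p + q.
  by rewrite mass_set_mass ?(ltW q0)// mass_set_mass ?(ltW p0)// mode_mass_set_mass_other// /rest_mass; ring.
have C1 : momentum_cvg (set_mass n (set_mass m u p) q : borelHs s) <-> momentum_cvg (u : borelHs s).
  exact: (iff_trans (momentum_cvg_set_mode n _ _) (momentum_cvg_set_mode m _ _)).
have E2 : momentum_cvg (u : borelHs s) ->
    momentum (set_mass n (set_mass m u p) q : borelHs s) = rest_momentum u + alpha * p + beta * q.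
  move=> cu; have cu' := (momentum_cvg_set_mode m u _).2 cu : momentum_cvg (set_mass m u p : borelHs s).
  rewrite (momentum_set_mass Nn' (ltW q0) cu') (momentum_set_mass Nm (ltW p0) cu).
  by rewrite mode_mass_set_mass_other// /rest_momentum; ring.
apply/idP/idP.
  rewrite inE /= E1 => -[hA [/C1 hc]]; rewrite (E2 hc) => hB.
  by rewrite (mem_set hA) (mem_set hB) (mem_set hc).
move=> /andP[/andP[]]; rewrite 3!in_setE => hA hB hc; rewrite in_setE.
have hB' : B (momentum (set_mass n (set_mass m u p) q : borelHs s)) by rewrite (E2 hc).
have hA' : A (mass (set_mass n (set_mass m u p) q)) by rewrite E1.
exact: (conj hA' (conj (C1.2 hc) hB')).
Qed.

Lemma measurable_resample_two (Phi : borelHs s -> \bar R) :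
  measurable_fun [set: borelHs s] Phi -> (forall u, 0 <= Phi u)%E ->
  measurable_fun [set: borelHs s] (fun u : borelHs s => \int[leb]_p \int[leb]_q
    ((mode_dens m p * mode_dens n q)%:E * Phi (set_mass n (set_mass m (u : Hs s) p) q)))%E.
Proof.
move=> mPhi Phi0.
pose F (w : borelHs s * R * R) := ((mode_dens m w.1.2 * mode_dens n w.2)%:E *
  Phi (set_mass n (set_mass m (w.1.1 : Hs s) w.1.2) w.2))%E.
have m12 : measurable_fun [set: borelHs s * R * R] (fun w => w.1.2) by apply: measurableT_comp.
have mF : measurable_fun [set: borelHs s * R * R] F.
  apply: emeasurable_funM.
    apply/measurable_EFinP; apply: measurable_funM.
      exact: (measurableT_comp (measurable_mode_dens m)).
    by apply: (measurableT_comp (measurable_mode_dens n)).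
  apply: (measurableT_comp mPhi); apply: measurable_set_mass_comp => //.
  by apply: measurable_set_mass_comp => //; apply: measurableT_comp.
have F0 w : (0 <= F w)%E by rewrite mule_ge0// lee_fin mulr_ge0// mode_dens_ge0.
have mF1 := @measurable_fun_fubini_tonelli_F _ _ _ _ _ leb F mF F0.
apply: (@measurable_fun_fubini_tonelli_F _ _ _ _ _ leb (fun w => \int[leb]_q F (w, q))%E mF1) => w.
by apply: integral_ge0.
Qed.

(** For almost every u, the masses p, q of the two modes are exchanged for y1 = rest_mass + p + q
    and y2 = rest_momentum + alpha p + beta q. The planar substitution is done as two affine
    substitutions on the line, with Fubini in between. *)
Lemma disintegration (Psi : borelHs s -> R) (A B : set R) :
  measurable_fun [set: borelHs s] Psi -> (forall u, 0 <= Psi u) -> measurable A -> measurable B ->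
  (\int[P]_u (Psi u * \1_(mass_momentum_event A B) u)%:E =
   \int[leb]_y1 \int[leb]_y2 ((\1_A y1 * \1_B y2)%:E * pinned_integral Psi (y1, y2)))%E.
Proof.
move=> mPsi Psi0 mA mB.
have mev : measurable (@mass_momentum_event R s A B) by exact: measurable_mass_momentum_event.
have mPE : measurable_fun [set: borelHs s] (fun u => (Psi u * \1_(mass_momentum_event A B) u)%:E).
  by apply/measurable_EFinP; apply: measurable_funM => //; exact: measurable_indic.
rewrite resample_two; last 2 first.
- exact: mPE.
- by move=> u; rewrite lee_fin mulr_ge0.
pose c := `|beta - alpha|^-1; have c0 : 0 <= c by rewrite invr_ge0.
pose F (w : borelHs s * R * R) : R := \1_A w.1.2 * \1_B w.2 *
  (c * (pin_density w.1.1 (w.1.2, w.2) * Psi (pinned (w.1.1 : Hs s) (w.1.2, w.2)))).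
have F0 w : 0 <= F w by apply: mulr_ge0; [exact: mulr_ge0|apply: mulr_ge0 => //; apply: mulr_ge0 => //; exact: pin_density_ge0].
have mF : measurable_fun [set: borelHs s * R * R] F.
  have m11 : measurable_fun [set: borelHs s * R * R] (fun w => w.1.1) by apply: measurableT_comp.
  have m12 : measurable_fun [set: borelHs s * R * R] (fun w => w.1.2) by apply: measurableT_comp.
  have m122 : measurable_fun [set: borelHs s * R * R] (fun w => (w.1.2, w.2)) by exact: measurable_fun_pair.
  apply: measurable_funM.
    apply: measurable_funM.
      by apply: (@measurableT_comp _ _ _ _ _ _ (\1_A : R -> R)) => //; exact: measurable_indic.
    by apply: (@measurableT_comp _ _ _ _ _ _ (\1_B : R -> R)) => //; exact: measurable_indic.
  apply: measurable_funM => //; apply: measurable_funM; first exact: measurable_pin_density.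
  by apply: (measurableT_comp mPsi); exact: measurable_pinned.
have step u : mode_mass m u != 0 -> mode_mass n u != 0 ->
  (\int[leb]_p \int[leb]_q ((mode_dens m p * mode_dens n q)%:E *
     (Psi (set_mass n (set_mass m u p) q) *
      \1_(mass_momentum_event A B) (set_mass n (set_mass m u p) q : borelHs s))%:E) =
   \int[leb]_y1 \int[leb]_y2 (F ((u : borelHs s), y1, y2))%:E)%E.
  move=> Nm Nn; set X1 := rest_mass u; set X2 := rest_momentum u.
  set cv : R := \1_(@momentum_cvg R s) (u : borelHs s).
  pose g (w : R * R) : R := mode_dens m w.1 * mode_dens n w.2 *
    Psi (set_mass n (set_mass m u w.1) w.2 : borelHs s) *
    (\1_A (X1 + w.1 + w.2) * \1_B (X2 + alpha * w.1 + beta * w.2) * cv).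
  have g0 w : 0 <= g w.
    by apply: mulr_ge0; [apply: mulr_ge0 => //; apply: mulr_ge0; exact: mode_dens_ge0|exact: mulr_ge0].
  have mg : measurable_fun [set: R * R] g.
    apply: measurable_funM.
      apply: measurable_funM.
        apply: measurable_funM.
          by apply: (measurableT_comp (measurable_mode_dens m)).
        by apply: (measurableT_comp (measurable_mode_dens n)).
      apply: (measurableT_comp mPsi); apply: measurable_set_mass_comp => //.
      by apply: measurable_set_mass_comp => //; exact: measurable_cst.
    apply: measurable_funM => //; apply: measurable_funM.
      apply: (@measurableT_comp _ _ _ _ _ _ (\1_A : R -> R)); first exact: measurable_indic.
      by apply: measurable_funD => //; apply: measurable_funD.
    apply: (@measurableT_comp _ _ _ _ _ _ (\1_B : R -> R)); first exact: measurable_indic.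
    apply: measurable_funD; last exact: measurable_funM.
    by apply: measurable_funD => //; exact: measurable_funM.
  transitivity (\int[leb]_p \int[leb]_q (g (p, q))%:E)%E.
    apply: eq_integral => p _; apply: eq_integral => q _; rewrite -EFinM; congr EFin; rewrite /g /=.
    have [p0|p0] := leP p 0; first by rewrite (mode_dens0 m p0) !mul0r.
    have [q0|q0] := leP q 0; first by rewrite (mode_dens0 n q0) !(mulr0, mul0r).
    by rewrite event_two_modes// mulrA.
  (* First substitution, at fixed p: q = y1 - X1 - p, of Jacobian 1. *)
  pose g1 (w : R * R) : R := g (w.1, w.2 - X1 - w.1).
  have mg1 : measurable_fun [set: R * R] (EFin \o g1).
    apply/measurable_EFinP; apply: (measurableT_comp mg); apply: measurable_fun_pair => //.
    by apply: measurable_funB => //; exact: measurable_funB.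
  transitivity (\int[leb]_p \int[leb]_y1 (EFin \o g1) (p, y1))%E.
    apply: eq_integral => p _.
    rewrite (@integral_affine R _ 1 (- X1 - p) (oner_neq0 R)); last 2 first.
    - by apply/measurable_EFinP; exact: (measurableT_comp mg (measurable_pair1 p)).
    - by move=> q; rewrite lee_fin.
    rewrite normr1 mul1e; apply: eq_integral => y1 _; rewrite /= /g1 mul1r addrA //.
  rewrite (@fubini_tonelli _ _ _ _ _ leb leb (EFin \o g1) mg1); last by move=> w; rewrite /= lee_fin /g1; exact: g0.
  apply: eq_integral => y1 _.
  have ba0 := freq_inj R mn.
  (* Second substitution, at fixed y1: p is affine in y2 with slope - (beta - alpha)^-1, the source
     of the Jacobian factor. *)
  have d0 : - (beta - alpha)^-1 != 0 by rewrite oppr_eq0 invr_eq0.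
  rewrite [LHS](@integral_affine R _ _ ((beta * (y1 - X1) + X2) / (beta - alpha)) d0); last 2 first.
  - exact: (measurableT_comp mg1 (measurable_pair2 y1)).
  - by move=> p; rewrite /= lee_fin /g1; exact: g0.
  rewrite -[LHS]ge0_integralZl//; last 2 first.
  - exact: (measurableT_comp (measurableT_comp mg1 (measurable_pair2 y1)) (measurable_affine _ _)).
  - by move=> p _; rewrite /= lee_fin /g1; exact: g0.
  apply: eq_integral => y2 _; rewrite normrN normfV -/c /= -EFinM; congr EFin; rewrite /F /g1 /g /=.
  set pp := - _ * _ + _.
  have pE : pp = mass1 u (y1, y2) by rewrite /pp /mass1 /= -/X1 -/X2; field.
  have qE : y1 - X1 - pp = mass2 u (y1, y2) by rewrite /mass2 -pE.
  have -> : X1 + pp + (y1 - X1 - pp) = y1 by ring.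
  have -> : X2 + alpha * pp + beta * (y1 - X1 - pp) = y2 by rewrite /pp; field.
  by rewrite qE pE /pin_density /pinned -/cv; ring.
pose h1 (w : borelHs s * R) : \bar R := (\int[leb]_y2 (F (w, y2))%:E)%E.
have mFE : measurable_fun [set: borelHs s * R * R] (EFin \o F) by exact/measurable_EFinP.
have mh1 : measurable_fun [set: borelHs s * R] h1.
  apply: (@measurable_fun_fubini_tonelli_F _ _ _ _ _ leb (EFin \o F) mFE) => w.
  by rewrite lee_fin.
have h10 w : (0 <= h1 w)%E by apply: integral_ge0 => y _; rewrite lee_fin.
transitivity (\int[P]_u \int[leb]_y1 h1 (u, y1))%E.
  apply: ae_eq_integral => //.
  - have PE0 (u : borelHs s) : (0 <= (Psi u * \1_(mass_momentum_event A B) u)%:E)%E by rewrite lee_fin mulr_ge0.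
    exact: (measurable_resample_two mPE PE0).
  - exact: (@measurable_fun_fubini_tonelli_F _ _ _ _ _ leb h1 mh1 h10).
  apply: filterS2 (mode_mass_neq0 m wP) (mode_mass_neq0 n wP) => u Nm Nn _.
  exact: step.
rewrite (@fubini_tonelli _ _ _ _ _ P leb h1 mh1 h10).
apply: eq_integral => y1 _; rewrite /h1.
have my1 : measurable_fun [set: borelHs s * R] (fun w => (w.1, y1, w.2)).
  by apply: measurable_fun_pair => //; apply: measurable_fun_pair => //; exact: measurable_cst.
rewrite (@fubini_tonelli _ _ _ _ _ P leb (fun w => (F (w.1, y1, w.2))%:E)); last 2 first.
- exact: (measurableT_comp mFE my1).
- by move=> w; rewrite lee_fin.
apply: eq_integral => y2 _; rewrite /pinned_integral muleA -EFinM -ge0_integralZl//; [|apply/measurable_EFinP; apply: measurable_funM|by move=> u _; rewrite lee_fin; apply: mulr_ge0 => //; exact: pin_density_ge0].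
- by apply: eq_integral => u _; rewrite -EFinM /F /= mulrA.
- by apply: measurable_pin_density => //; exact: measurable_cst.
- by apply: (measurableT_comp mPsi); apply: measurable_pinned => //; exact: measurable_cst.
Qed.

End two_modes.

(** * Continuity of the density in mass and momentum *)

Section continuity_of_pinned_integral.
Variables (R : realType) (s : R) (m n : int).
Hypothesis mn : m != n.
Variable P : probability (borelHs s) R.
Hypothesis wP : wiener P.
Implicit Types (u v : Hs s) (y : R * R).
Local Notation leb := (@lebesgue_measure R).
Local Notation alpha := (freq R m).
Local Notation beta := (freq R n).
Local Notation rmass := (rest_mass m n).
Local Notation rmom := (rest_momentum m n).

Let ba0 : beta - alpha != 0. Proof. exact: freq_inj. Qed.

Lemma rest_mass_set_mass k u (r : R) : k != m -> k != n -> mode_mass k u != 0 -> 0 <= r ->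
  rmass (set_mass k u r) = rmass u - mode_mass k u + r.
Proof.
move=> km kn Nk r0; rewrite /rest_mass mass_set_mass// !mode_mass_set_mass_other//; ring.
Qed.

Lemma rest_momentum_set_mass k u (r : R) : k != m -> k != n -> mode_mass k u != 0 -> 0 <= r ->
  momentum_cvg (u : borelHs s) ->
  rmom (set_mass k u r) = rmom u + freq R k * (r - mode_mass k u).
Proof.
move=> km kn Nk r0 cu; rewrite /rest_momentum momentum_set_mass// !mode_mass_set_mass_other//; ring.
Qed.

(* rest_mass and rest_momentum are affine in the mass of a third mode k, which has a
   density. *)
Lemma affine_level_null k (A0 A1 A2 : R) : k != m -> k != n -> A1 + A2 * freq R k != 0 ->
  {ae P, forall u : borelHs s, momentum_cvg u -> A0 + A1 * rmass (u : Hs s) + A2 * rmom (u : Hs s) != 0}.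
Proof.
move=> km kn Ak.
pose l (u : borelHs s) : R := A0 + A1 * rmass (u : Hs s) + A2 * rmom (u : Hs s).
pose Z := @momentum_cvg R s `&` [set u | l u = 0].
have ml : measurable_fun [set: borelHs s] l.
  apply: measurable_funD; last by apply: measurable_funM => //; exact: measurable_rest_momentum.
  by apply: measurable_funD => //; apply: measurable_funM => //; exact: measurable_rest_mass.
have mZ : measurable Z.
  apply: measurableI; first exact: measurable_momentum_cvg.
  rewrite (_ : [set u | _] = l @^-1` [set 0])// -[X in measurable X]setTI; exact: ml.
exists Z; split => //; last first.
  move=> u /= h; split; first by apply: contrapT => nc; apply: h.
  by apply/eqP; apply: contrapT => /negP nl; apply: h.
have -> : P Z = (\int[P]_u (\1_Z u)%:E)%E by rewrite integral_indic ?setIT.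
have mZE : measurable_fun [set: borelHs s] (EFin \o (\1_Z : borelHs s -> R)).
  by apply/measurable_EFinP; exact: measurable_indic.
rewrite (@resample_mass _ _ P k (EFin \o \1_Z) wP mZE); last by move=> u; rewrite /= lee_fin.
have step u : mode_mass k u != 0 -> (\int[leb]_p ((expdens (japanese R k ^- 2) p)%:E *
    (EFin \o \1_Z) (set_mass k u p : borelHs s)) = 0)%E.
  move=> Nk.
  (* The only mass of mode k at which the affine form vanishes, the other modes being fixed. *)
  pose r0 := - (l (u : borelHs s) - (A1 + A2 * freq R k) * mode_mass k u) / (A1 + A2 * freq R k).
  rewrite (@ae_eq_integral _ _ _ leb setT (cst 0%E))//; first by rewrite integral0.
    apply: emeasurable_funM; first by apply/measurable_EFinP; exact: measurable_expdens.
    apply: (measurableT_comp mZE); apply: measurable_set_mass_comp => //; exact: measurable_cst.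
  exists [set r0]; split; [exact: measurable_set1|exact: lebesgue_measure_set1|].
  move=> r /= h; apply: contrapT => rr0; apply: h => _.
  have [r_le0|r_gt0] := leP r 0; first by rewrite -/(mode_dens k r) mode_dens0// mul0e.
  rewrite indicE memNset ?mule0//; rewrite /Z /= => -[cs ls]; apply: rr0.
  have cu : momentum_cvg (u : borelHs s) := (momentum_cvg_set_mode k u _).1 cs.
  move: ls; rewrite /l rest_mass_set_mass ?(ltW r_gt0)// rest_momentum_set_mass ?(ltW r_gt0)// => ls.
  apply: (mulfI Ak); rewrite /r0 [RHS]mulrC divfK//; apply/eqP.
  rewrite -subr_eq0 -[X in _ == X]ls /l; apply/eqP; ring.
rewrite (@ae_eq_integral _ _ _ P setT (cst 0%E))//; first by rewrite integral0.
  have mF : measurable_fun [set: borelHs s * R] (fun w => (expdens (japanese R k ^- 2) w.2)%:E *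
      (EFin \o \1_Z) (set_mass k (w.1 : Hs s) w.2 : borelHs s))%E.
    apply: emeasurable_funM; last by apply: (measurableT_comp mZE); exact: measurable_set_mass.
    by apply/measurable_EFinP; apply: (measurableT_comp (measurable_expdens _)).
  apply: (@measurable_fun_fubini_tonelli_F _ _ _ _ _ leb _ mF) => w.
  by rewrite mule_ge0 ?lee_fin// -/(mode_dens k w.2) mode_dens_ge0.
by apply: filterS (mode_mass_neq0 k wP) => u Nk _; exact: step.
Qed.

(** [mode_dens] is discontinuous at 0 only, so this is what pointwise convergence of [pin_density]
    requires. Both masses are affine in [rest_mass] and [rest_momentum], so a third mode moves
    them. *)
Lemma mass_neq0_ae y : {ae P, forall u : borelHs s, momentum_cvg u ->
  mass1 m n (u : Hs s) y != 0 /\ mass2 m n (u : Hs s) y != 0}.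
Proof.
(* Any frequency different from m and n would do: the slopes below are, up to sign, differences of
   two distinct frequencies. *)
pose k : int := Posz (`|m| + `|n| + 1)%N.
have km : k != m by apply/eqP => km; have := congr1 absz km; rewrite /k /=; lia.
have kn : k != n by apply/eqP => kn; have := congr1 absz kn; rewrite /k /=; lia.
have h1 := @affine_level_null k (beta * y.1 - y.2) (- beta) 1 km kn.
have h2 := @affine_level_null k (y.2 - alpha * y.1) alpha (- 1) km kn.
have k1 : - beta + 1 * freq R k != 0 by rewrite mul1r addrC freq_inj// eq_sym.
have k2 : alpha + - 1 * freq R k != 0 by rewrite mulN1r freq_inj.
apply: filterS2 (h1 k1) (h2 k2) => u g1 g2 cu.
have e1 : mass1 m n (u : Hs s) y =
    (beta * y.1 - y.2 + - beta * rmass (u : Hs s) + 1 * rmom (u : Hs s)) / (beta - alpha).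
  by rewrite /mass1; congr (_ / _); ring.
have e2 : mass2 m n (u : Hs s) y =
    (y.2 - alpha * y.1 + alpha * rmass (u : Hs s) + -1 * rmom (u : Hs s)) / (beta - alpha).
  by rewrite /mass2 /mass1; field.
by rewrite e1 e2; split; rewrite mulf_neq0 ?invr_eq0 ?g1 ?g2.
Qed.

Lemma mode_dens_cvg (T : Type) (F : set_system T) {FF : Filter F} k (f : T -> R) (p : R) : p != 0 ->
  f x @[x --> F] --> p -> mode_dens k (f x) @[x --> F] --> mode_dens k p.
Proof.
move=> p0 fp; have [pn|pp] := ltP p 0.
  rewrite mode_dens0 ?(ltW pn)//; apply: cvg_near_cst.
  have : \forall x \near F, f x < 0 by apply: (cvgr_lt p).
  by apply: filterS => x fx; rewrite mode_dens0// ltW.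
have {}pp : 0 < p by rewrite lt_neqAle eq_sym p0.
pose w := japanese R k ^- 2.
have E (q : R) : 0 < q -> mode_dens k q = (2 * w)^-1 * expR (- (q / (2 * w))).
  by move=> q0; rewrite /mode_dens /expdens indicE mem_set ?mulr1//= in_itv /= andbT.
rewrite (E _ pp); have : (2 * w)^-1 * expR (- (f x / (2 * w))) @[x --> F] --> (2 * w)^-1 * expR (- (p / (2 * w))).
  apply: cvgM; first exact: cvg_cst.
  apply: (@cvg_comp _ _ _ _ expR); last exact: continuous_expR.
  apply: cvgN; apply: cvgM => //; exact: cvg_cst.
apply: cvg_trans; apply: near_eq_cvg.
have : \forall x \near F, 0 < f x by apply: (cvgr_gt p).
by apply: filterS => x fx; rewrite E.
Qed.

Lemma mode_dens_le k (p : R) : mode_dens k p <= (2 * japanese R k ^- 2)^-1.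
Proof.
have w0 : 0 < japanese R k ^- 2 by rewrite invr_gt0 exprn_gt0// japanese_gt0.
have [p0|p0] := leP p 0; first by rewrite mode_dens0// invr_ge0 mulr_ge0// ltW.
rewrite /mode_dens /expdens indicE mem_set ?mulr1; last by rewrite /= in_itv /= andbT.
apply: ler_piMr; first by rewrite invr_ge0 mulr_ge0// ltW.
by rewrite -expR0 ler_expR oppr_le0 divr_ge0 ?mulr_ge0// ltW.
Qed.

Lemma mass1_cvg (T : Type) (F : set_system T) {FF : Filter F} u (f : T -> R * R) y :
  (f x).1 @[x --> F] --> y.1 -> (f x).2 @[x --> F] --> y.2 ->
  mass1 m n u (f x) @[x --> F] --> mass1 m n u y.
Proof.
move=> f1 f2; apply: cvgM; last exact: cvg_cst.
apply: cvgB; last by apply: cvgB => //; exact: cvg_cst.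
by apply: cvgM; [exact: cvg_cst|apply: cvgB => //; exact: cvg_cst].
Qed.

Lemma mass2_cvg (T : Type) (F : set_system T) {FF : Filter F} u (f : T -> R * R) y :
  (f x).1 @[x --> F] --> y.1 -> (f x).2 @[x --> F] --> y.2 ->
  mass2 m n u (f x) @[x --> F] --> mass2 m n u y.
Proof.
move=> f1 f2; apply: cvgB; last exact: mass1_cvg.
by apply: cvgB => //; exact: cvg_cst.
Qed.

(** Continuity and domination are required along pinned elements only, and the bound [dom] may
    depend on u but not on y. This is the shape in which the focusing weight can be controlled. *)
Variables (y0 : R * R) (Psi : borelHs s -> R).
Hypotheses (mPsi : measurable_fun [set: borelHs s] Psi) (Psi0 : forall u, 0 <= Psi u).
Hypothesis Psi_cvg : forall (f : nat -> R * R) u,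
  (f j).1 @[j --> \oo] --> y0.1 -> (f j).2 @[j --> \oo] --> y0.2 ->
  mode_mass m u != 0 -> mode_mass n u != 0 -> 0 < mass1 m n u y0 -> 0 < mass2 m n u y0 ->
  Psi (pinned m n u (f j) : borelHs s) @[j --> \oo] --> Psi (pinned m n u y0 : borelHs s).
Variables (dom : borelHs s -> R) (rad : R).
Hypotheses (rad0 : 0 < rad) (idom : P.-integrable setT (EFin \o dom)).
Hypothesis Psi_dom : forall u y, `|y.1 - y0.1| < rad -> `|y.2 - y0.2| < rad ->
  mode_mass m u != 0 -> mode_mass n u != 0 ->
  0 < mass1 m n u y -> 0 < mass2 m n u y -> Psi (pinned m n u y : borelHs s) <= dom u.

Let f y (u : borelHs s) : R := pin_density m n u y * Psi (pinned m n (u : Hs s) y : borelHs s).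

Let f0 y u : 0 <= f y u. Proof. by rewrite mulr_ge0// pin_density_ge0. Qed.

Let mf y : measurable_fun [set: borelHs s] (f y).
Proof.
apply: measurable_funM; first by apply: measurable_pin_density => //; exact: measurable_cst.
by apply: (measurableT_comp mPsi); apply: measurable_pinned => //; exact: measurable_cst.
Qed.

Lemma pin_density_support (u : borelHs s) y : pin_density m n u y != 0 ->
  [/\ 0 < mass1 m n (u : Hs s) y, 0 < mass2 m n (u : Hs s) y & momentum_cvg u].
Proof.
move=> h; have h1 : mode_dens m (mass1 m n (u : Hs s) y) != 0.
  by apply: contra h => /eqP h; rewrite /pin_density h !mul0r.
have h2 : mode_dens n (mass2 m n (u : Hs s) y) != 0.
  by apply: contra h => /eqP h; rewrite /pin_density h mulr0 mul0r.
split.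
- by rewrite ltNge; apply/negP => p0; rewrite mode_dens0// eqxx in h1.
- by rewrite ltNge; apply/negP => p0; rewrite mode_dens0// eqxx in h2.
- apply: contrapT => nc; move/eqP: h; apply.
  by rewrite /pin_density [X in _ * X](_ : _ = 0) ?mulr0// indicE memNset.
Qed.

Let Kc : R := (2 * japanese R m ^- 2)^-1 * (2 * japanese R n ^- 2)^-1.

Let f_le y u : `|y.1 - y0.1| < rad -> `|y.2 - y0.2| < rad ->
  mode_mass m (u : Hs s) != 0 -> mode_mass n (u : Hs s) != 0 -> f y u <= Kc * `|dom u|.
Proof.
move=> d1 d2 Nm Nn; have Kc0 : 0 <= Kc.
  by rewrite mulr_ge0// invr_ge0 mulr_ge0// invr_ge0 sqr_ge0.
have [h|h] := eqVneq (pin_density m n u y) 0; first by rewrite /f h mul0r mulr_ge0.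
have [p1 p2 _] := pin_density_support h.
have hd : pin_density m n u y <= Kc.
  rewrite /pin_density -[leRHS]mulr1; apply: ler_pM.
  - by apply: mulr_ge0; exact: mode_dens_ge0.
  - by [].
  - by apply: ler_pM; [exact: mode_dens_ge0|exact: mode_dens_ge0|exact: mode_dens_le|exact: mode_dens_le].
  - by rewrite indicE; case: (_ \in _).
rewrite /f; apply: ler_pM => //; first exact: pin_density_ge0.
by apply: le_trans (ler_norm _); exact: Psi_dom.
Qed.

Lemma pinned_integral_seq (yj : nat -> R * R) :
  (yj j).1 @[j --> \oo] --> y0.1 -> (yj j).2 @[j --> \oo] --> y0.2 ->
  (forall j, `|(yj j).1 - y0.1| < rad) -> (forall j, `|(yj j).2 - y0.2| < rad) ->
  pinned_integral m n P Psi (yj j) @[j --> \oo] --> pinned_integral m n P Psi y0 /\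
  (pinned_integral m n P Psi y0 < +oo)%E.
Proof.
move=> y1 y2 r1 r2.
have mfE y : measurable_fun [set: borelHs s] (EFin \o f y) by exact/measurable_EFinP.
have idom' : P.-integrable setT (fun u => (Kc * `|dom u|)%:E).
  rewrite (_ : (fun u => _) = (fun u => Kc%:E * `|(EFin \o dom) u|)%E)//.
  by apply: integrableZl => //; exact: integrable_abse.
have [|||||i _ c] := @dominated_convergence _ _ _ P setT measurableT (fun j => EFin \o f (yj j)) (EFin \o f y0)
    (fun u => (Kc * `|dom u|)%:E).
- by move=> j; exact: mfE.
- exact: mfE.
- have := mass_neq0_ae y0; have := mode_mass_neq0 n wP; have := mode_mass_neq0 m wP.
  apply: filterS3 => u Nm Nn hu _.
  apply: cvg_EFin; first by near=> j.
  rewrite /= /f; have [cu|cu] := pselect (momentum_cvg u); last first.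
    have z y : pin_density m n u y = 0.
      by rewrite /pin_density [X in _ * X](_ : _ = 0) ?mulr0// indicE memNset.
    rewrite z mul0r; under eq_fun do rewrite /= z mul0r; exact: cvg_cst.
  have [n1 n2] := hu cu.
  have c1 := mode_dens_cvg (k := m) n1 (mass1_cvg (u := (u : Hs s)) y1 y2).
  have c2 := mode_dens_cvg (k := n) n2 (mass2_cvg (u := (u : Hs s)) y1 y2).
  have cd : pin_density m n u (yj j) @[j --> \oo] --> pin_density m n u y0.
    by apply: cvgM; [apply: cvgM; [exact: c1|exact: c2]|exact: cvg_cst].
  have [h|h] := boolP ((0 < mass1 m n (u : Hs s) y0) && (0 < mass2 m n (u : Hs s) y0)).
    by case/andP: h => h1 h2; apply: cvgM => //; exact: Psi_cvg.
  (* A pinned mass that is not positive at y0 is negative there, hence also nearby, and the density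
     vanishes before the limit. *)
  have z : \forall j \near \oo, pin_density m n u (yj j) = 0.
    move: h; rewrite negb_and -!leNgt => /orP[h|h].
      have {}h : mass1 m n (u : Hs s) y0 < 0 by rewrite lt_neqAle n1.
      have : \forall j \near \oo, mass1 m n (u : Hs s) (yj j) < 0.
        by apply: (cvgr_lt (mass1 m n (u : Hs s) y0)) => //; exact: mass1_cvg.
      by apply: filterS => j hj; rewrite /pin_density mode_dens0 ?(ltW hj)// !mul0r.
    have {}h : mass2 m n (u : Hs s) y0 < 0 by rewrite lt_neqAle n2.
    have : \forall j \near \oo, mass2 m n (u : Hs s) (yj j) < 0.
      by apply: (cvgr_lt (mass2 m n (u : Hs s) y0)) => //; exact: mass2_cvg.
    by apply: filterS => j hj; rewrite /pin_density [X in _ * X * _]mode_dens0 ?(ltW hj)// mulr0 mul0r.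
  have z0 : pin_density m n u y0 = 0.
    have c0 : pin_density m n u (yj j) @[j --> \oo] --> (0 : R) by apply: cvg_near_cst; exact: z.
    by rewrite -(cvg_lim (@Rhausdorff R) cd) (cvg_lim (@Rhausdorff R) c0).
  rewrite z0 mul0r; apply: cvg_near_cst.
  by apply: filterS z => j /= ->; rewrite mul0r.
- exact: idom'.
- have := mode_mass_neq0 n wP; have := mode_mass_neq0 m wP.
  apply: filterS2 => u Nm Nn j _; rewrite /= ger0_norm// lee_fin; exact: f_le.
split.
  by apply: cvgeZl.
rewrite /pinned_integral lte_mul_pinfty// ?lee_fin ?invr_ge0//.
by have /integrable_lty := i; apply.
Unshelve. all: by end_near. Qed.

Definition pinned_value : R := fine (pinned_integral m n P Psi y0).

Lemma pinned_integral_ge0 y : (0 <= pinned_integral m n P Psi y)%E.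
Proof.
apply: mule_ge0; first by rewrite lee_fin invr_ge0.
by apply: integral_ge0 => u _; rewrite lee_fin; exact: f0.
Qed.

Lemma pinned_integralE : pinned_integral m n P Psi y0 = pinned_value%:E.
Proof.
rewrite fineK// ge0_fin_numE ?pinned_integral_ge0//.
have := @pinned_integral_seq (fun=> y0); case => //; try exact: cvg_cst; move=> j; rewrite subrr normr0//.
Qed.

(** Dominated convergence is sequential: if the claim failed, points at distance less than 1 / (j +
    1) from y0 would form a sequence contradicting it. *)
Lemma pinned_integral_near (e : R) : 0 < e -> exists2 del, 0 < del & forall y,
  `|y.1 - y0.1| < del -> `|y.2 - y0.2| < del ->
  ((pinned_value - e)%:E <= pinned_integral m n P Psi y <= (pinned_value + e)%:E)%E.
Proof.
move=> e0; apply: contrapT => h.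
have H (j : nat) : exists y : R * R, [/\ `|y.1 - y0.1| < Num.min rad j.+1%:R^-1,
   `|y.2 - y0.2| < Num.min rad j.+1%:R^-1 &
   ~ ((pinned_value - e)%:E <= pinned_integral m n P Psi y <= (pinned_value + e)%:E)%E].
  apply: contrapT => hj; apply: h; exists (Num.min rad j.+1%:R^-1).
    by rewrite lt_min rad0 invr_gt0 ltr0n.
  by move=> y h1 h2; apply: contrapT => h3; apply: hj; exists y.
have [yj hyj] := boolp.choice H.
have small (F : nat -> R) (l : R) : (forall j, `|F j - l| < Num.min rad j.+1%:R^-1) -> F j @[j --> \oo] --> l.
  move=> hF; apply/cvgrPdist_lt => t t0; near=> j; rewrite distrC.
  apply: lt_trans (hF j) _; rewrite gt_min; apply/orP; right.
  by near: j; exact: (near_infty_natSinv_lt (PosNum t0)).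
have y1 : (yj j).1 @[j --> \oo] --> y0.1 by apply: small => j; have [] := hyj j.
have y2 : (yj j).2 @[j --> \oo] --> y0.2 by apply: small => j; have [] := hyj j.
have [||c _] := pinned_integral_seq y1 y2.
- by move=> j; have [h1 _ _] := hyj j; apply: lt_le_trans h1 _; rewrite ge_min lexx.
- by move=> j; have [_ h1 _] := hyj j; apply: lt_le_trans h1 _; rewrite ge_min lexx.
rewrite pinned_integralE in c.
have [N _ hN] : \forall j \near \oo, ((pinned_value - e)%:E < pinned_integral m n P Psi (yj j))%E.
  by apply: (c _ (open_ereal_gt' _)); rewrite lte_fin ltrBlDr ltrDl.
have [N' _ hN'] : \forall j \near \oo, (pinned_integral m n P Psi (yj j) < (pinned_value + e)%:E)%E.
  by apply: (c _ (open_ereal_lt' _)); rewrite lte_fin ltrDl.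
have [_ _] := hyj (maxn N N'); apply; apply/andP; split; apply: ltW.
  by apply: hN; rewrite /= leq_maxl.
by apply: hN'; rewrite /= leq_maxr.
Unshelve. all: by end_near. Qed.

Lemma double_integral_cst (A B : set R) (c : R) : measurable A -> measurable B -> 0 <= c ->
  (\int[leb]_y1 \int[leb]_y2 ((\1_A y1 * \1_B y2)%:E * c%:E) = c%:E * (leb A * leb B))%E.
Proof.
move=> mA mB c0.
have mI (E : set R) : measurable E -> measurable_fun [set: R] (fun x => (\1_E x : R)%:E).
  by move=> mE; apply/measurable_EFinP; exact: measurable_indic.
transitivity (\int[leb]_y1 ((c%:E * leb B) * (\1_A y1)%:E))%E.
  apply: eq_integral => y1 _.
  transitivity (\int[leb]_y2 ((c * \1_A y1)%:E * (\1_B y2)%:E))%E.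
    by apply: eq_integral => y2 _; rewrite -!EFinM; congr EFin; ring.
  rewrite ge0_integralZl//; try exact: mI; try (by rewrite lee_fin mulr_ge0); try (by move=> y _; rewrite lee_fin).
  by rewrite integral_indic// setIT EFinM -!muleA; congr (_ * _)%E; rewrite muleC.
rewrite ge0_integralZl//; try exact: mI; try (by rewrite mule_ge0 ?lee_fin); try (by move=> y _; rewrite lee_fin).
by rewrite integral_indic// setIT -muleA [(leb B * _)%E]muleC.
Qed.

(** The local bounds on G_Psi are integrated over A x B. Only the areas of the windows enter, not
    their shape. *)
Lemma event_integral_bounds (e : R) : 0 < e -> exists2 del, 0 < del & forall A B : set R,
  measurable A -> measurable B -> (forall x, A x -> `|x - y0.1| < del) -> (forall x, B x -> `|x - y0.2| < del) ->
  ((pinned_value - e)%:E * (leb A * leb B) <=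
   \int[P]_u (Psi u * \1_(mass_momentum_event A B) u)%:E <=
   (pinned_value + e)%:E * (leb A * leb B))%E.
Proof.
move=> e0; have [del del0 hdel] := pinned_integral_near e0.
exists del => // A B mA mB hA hB; rewrite (disintegration mn wP mPsi Psi0 mA mB).
have mI (E : set R) : measurable E -> measurable_fun [set: R] (fun x => (\1_E x : R)%:E).
  by move=> mE; apply/measurable_EFinP; exact: measurable_indic.
have mff : measurable_fun [set: borelHs s * (R * R)] (fun w => (f w.2 w.1)%:E).
  apply/measurable_EFinP; apply: measurable_funM; first exact: measurable_pin_density.
  by apply: (measurableT_comp mPsi); exact: measurable_pinned.
have mG : measurable_fun [set: R * R] (fun y => pinned_integral m n P Psi y).
  apply: emeasurable_funM => //.
  apply: (@measurable_fun_fubini_tonelli_G _ _ _ _ _ P (fun w => (f w.2 w.1)%:E) mff) => w.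
  by rewrite lee_fin; exact: f0.
pose H (w : R * R) := ((\1_A w.1 * \1_B w.2)%:E * pinned_integral m n P Psi w)%E.
have mAB : measurable_fun [set: R * R] (fun w => (\1_A w.1 * \1_B w.2 : R)%:E).
  apply/measurable_EFinP; apply: measurable_funM.
    by apply: (@measurableT_comp _ _ _ _ _ _ (\1_A : R -> R)) => //; exact: measurable_indic.
  by apply: (@measurableT_comp _ _ _ _ _ _ (\1_B : R -> R)) => //; exact: measurable_indic.
have mH : measurable_fun [set: R * R] H by exact: emeasurable_funM.
have H0 w : (0 <= H w)%E by rewrite mule_ge0 ?lee_fin ?mulr_ge0 ?pinned_integral_ge0.
have mono (F1 F2 : R * R -> \bar R) : measurable_fun [set: R * R] F1 -> measurable_fun [set: R * R] F2 ->
    (forall w, 0 <= F1 w)%E -> (forall w, F1 w <= F2 w)%E ->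
    (\int[leb]_y1 \int[leb]_y2 F1 (y1, y2) <= \int[leb]_y1 \int[leb]_y2 F2 (y1, y2))%E.
  move=> m1 m2 g1 g12; have g2 w : (0 <= F2 w)%E by exact: le_trans (g12 w).
  apply: ge0_le_integral => //.
  - by move=> x _; apply: integral_ge0.
  - exact: (@measurable_fun_fubini_tonelli_F _ _ _ _ _ leb F1 m1 g1).
  - exact: (@measurable_fun_fubini_tonelli_F _ _ _ _ _ leb F2 m2 g2).
  - move=> x _; apply: ge0_le_integral => //.
    + exact: (measurableT_comp m1 (measurable_pair1 x)).
    + exact: (measurableT_comp m2 (measurable_pair1 x)).
have mC (c : R) : measurable_fun [set: R * R] (fun w => (\1_A w.1 * \1_B w.2 : R)%:E * c%:E)%E.
  exact: emeasurable_funM.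
have onAB (w : R * R) : \1_A w.1 * \1_B w.2 != 0 :> R -> A w.1 /\ B w.2.
  rewrite !indicE mulf_eq0 negb_or => /andP[].
  by case: (boolP (w.1 \in A)) => [|_]; rewrite ?eqxx// inE => a1 _; case: (boolP (w.2 \in B)) => [|_]; rewrite ?eqxx// inE.
have pv0 : 0 <= pinned_value by rewrite fine_ge0 ?pinned_integral_ge0.
have pve : 0 <= pinned_value + e by rewrite addr_ge0// ltW.
apply/andP; split; last first.
  rewrite -double_integral_cst//.
  apply: (mono H (fun w => (\1_A w.1 * \1_B w.2 : R)%:E * (pinned_value + e)%:E)%E) => // w.
  have [h|h] := eqVneq (\1_A w.1 * \1_B w.2 : R) 0; first by rewrite /H h !mul0e.
  have [h1 h2] := onAB w h.
  have /andP[_ hu] := hdel w (hA _ h1) (hB _ h2).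
  by rewrite lee_wpmul2l ?lee_fin ?mulr_ge0.
have [neg|pos] := leP (pinned_value - e) 0.
  apply: (@le_trans _ _ 0%E).
    by rewrite mule_le0_ge0 ?lee_fin// mule_ge0.
  by apply: integral_ge0 => y1 _; apply: integral_ge0 => y2 _; exact: (H0 (y1, y2)).
rewrite -double_integral_cst ?(ltW pos)//.
apply: (mono (fun w => (\1_A w.1 * \1_B w.2 : R)%:E * (pinned_value - e)%:E)%E H) => // w.
  by rewrite mule_ge0 ?lee_fin ?mulr_ge0// ltW.
have [h|h] := eqVneq (\1_A w.1 * \1_B w.2 : R) 0; first by rewrite /H h !mul0e.
have [h1 h2] := onAB w h.
have /andP[hu _] := hdel w (hA _ h1) (hB _ h2).
by rewrite lee_wpmul2l ?lee_fin ?mulr_ge0.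
Qed.

End continuity_of_pinned_integral.

Section pinned_cvg.
Variables (R : realType) (s : R).
Implicit Types (u v : Hs s) (y : R * R) (p : R).

Lemma Hs_cvg_finite (v_ : nat -> Hs s) v K :
  (forall j k, k \notin freqs K -> fourier (v_ j) k = fourier v k) ->
  (forall k, normc (fourier v k - fourier (v_ j) k) ^+ 2 @[j --> \oo] --> (0 : R)) ->
  v_ @ \oo --> v.
Proof.
move=> h1 h2; apply/cvg_ballP => e e0.
pose D j := \sum_(k <- freqs K) japanese R k `^ (2 * s) * normc (fourier v k - fourier (v_ j) k) ^+ 2.
have DE j : Hs_dist2 v (v_ j) = (D j)%:E.
  rewrite /D -sumEFin -esum_freqs; last by move=> k; rewrite lee_fin mulr_ge0 ?powR_ge0 ?sqr_ge0.
  rewrite [RHS]esum_mkcond; apply: eq_esum => k _; case: ifPn => // kK.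
  have {}kK : k \notin freqs K by apply: contra kK; rewrite mem_setE.
  by rewrite h1// subrr normc0 expr0n mulr0.
have D0 : D j @[j --> \oo] --> (0 : R).
  have Z : \sum_(k <- freqs K) (0 : R) = 0 by rewrite big1.
  rewrite -Z; apply: cvg_sumr => k.
  by rewrite -[X in _ --> X](mulr0 (japanese R k `^ (2 * s))); apply: cvgM; [exact: cvg_cst|exact: h2].
have e2 : (0 : R) < e ^+ 2 by rewrite exprn_gt0.
have : \forall j \near \oo, D j < e ^+ 2 by apply: (cvgr_lt (0 : R)).
apply: filterS => j hj; apply/(Hs_ballE _ _ e0).2; by rewrite DE lte_fin.
Qed.

Lemma mode_of_dilate n (r : R) u : mode_of n (dilate r (coef n u)) = r%:C * fourier u n.
Proof.
have j0 : japanese R n != 0 by rewrite gt_eqF ?japanese_gt0.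
rewrite /mode_of /coef /dilate; case: (fourier u n) => a b.
transitivity ((r * a - 0 * b) +i* (r * b + 0 * a)); last by [].
rewrite !mul0r subr0 addr0 /=.
by congr (_ +i* _); rewrite (mulrC (japanese R n)) mulrA mulfK.
Qed.

Lemma fourier_set_mass_self n u p :
  fourier (set_mass n u p) n = (Num.sqrt (p / mode_mass n u))%:C * fourier u n.
Proof. by rewrite /set_mass fourier_set_mode eqxx mode_of_dilate. Qed.

Lemma normc_sub_scale (r r' : R) (z : R[i]) : normc (r%:C * z - r'%:C * z) = `|r - r'| * normc z.
Proof.
rewrite -mulrBl normcM -rmorphB; congr (_ * _).
by rewrite /normc /= expr0n addr0 sqrtr_sqr.
Qed.

Lemma pinned_cvg m n u (f : nat -> R * R) y : m != n ->
  (f j).1 @[j --> \oo] --> y.1 -> (f j).2 @[j --> \oo] --> y.2 ->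
  pinned m n u (f j) @[j --> \oo] --> pinned m n u y.
Proof.
move=> mn f1 f2.
pose K := (`|m| + `|n|)%N.
have mK : m \in freqs K by rewrite mem_freqs leq_addr.
have nK : n \in freqs K by rewrite mem_freqs leq_addl.
have Fo z k : k != m -> k != n -> fourier (pinned m n u z) k = fourier u k.
  by move=> km kn; rewrite /pinned !fourier_set_mass_other// eq_sym.
have Fm z : fourier (pinned m n u z) m = (Num.sqrt (mass1 m n u z / mode_mass m u))%:C * fourier u m.
  by rewrite /pinned fourier_set_mass_other ?fourier_set_mass_self// eq_sym.
have Fn z : fourier (pinned m n u z) n = (Num.sqrt (mass2 m n u z / mode_mass n u))%:C * fourier u n.
  by rewrite /pinned fourier_set_mass_self mode_mass_set_mass_other// fourier_set_mass_other.
have key (g : nat -> R) (l N : R) (z : R[i]) : g j @[j --> \oo] --> l ->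
    normc ((Num.sqrt (l / N))%:C * z - (Num.sqrt (g j / N))%:C * z) ^+ 2 @[j --> \oo] --> (0 : R).
  move=> gl; rewrite (_ : (fun j => _) = (fun j => (Num.sqrt (l / N) - Num.sqrt (g j / N)) ^+ 2 * normc z ^+ 2)); last first.
    by apply/funext => j; rewrite normc_sub_scale exprMn real_normK ?num_real.
  rewrite -[X in _ --> X](mul0r (normc z ^+ 2)); apply: cvgM; last exact: cvg_cst.
  rewrite -[X in _ --> X](expr0n R 2); apply: cvg_sqr; rewrite -[X in _ --> X](subrr (Num.sqrt (l / N))).
  apply: cvgB; first exact: cvg_cst.
  apply: (@cvg_comp _ _ _ _ (@Num.sqrt R)); last exact: sqrt_continuous.
  by apply: cvgM => //; exact: cvg_cst.
apply: (@Hs_cvg_finite _ _ K) => [j k kK|k].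
  have km : k != m by apply: contra kK => /eqP ->.
  have kn : k != n by apply: contra kK => /eqP ->.
  by rewrite (Fo (f j) k km kn) (Fo y k km kn).
have [->|km] := eqVneq k m.
  under eq_fun do rewrite (Fm y) (Fm (f _)); apply: key; exact: mass1_cvg.
have [->|kn] := eqVneq k n.
  under eq_fun do rewrite (Fn y) (Fn (f _)); apply: key; exact: mass2_cvg.
under eq_fun do rewrite (Fo y k km kn) (Fo (f _) k km kn) subrr normc0 expr0n; exact: cvg_cst.
Qed.

End pinned_cvg.

(** * Almost sure convergence of the momentum *)

Section momentum_convergence.
Variables (R : realType) (s : R) (P : probability (borelHs s) R).
Hypothesis wP : wiener P.
Implicit Types (u v : Hs s) (j k K : nat) (L : seq nat).
Local Notation J n := (japanese R n).

(* Grouping j with -j makes the terms centred and independent. *)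
Definition mom_term j u : R := freq R j%:Z * (mode_mass j%:Z u - mode_mass (- j%:Z) u).

Lemma big_freqsS (V : nmodType) (F : int -> V) K :
  \sum_(n <- freqs K.+1) F n = F K.+1%:Z + (F (- K.+1%:Z) + \sum_(n <- freqs K) F n).
Proof.
rewrite (perm_big [:: K.+1%:Z, - K.+1%:Z & freqs K]) ?big_cons//=.
apply: uniq_perm; rewrite ?freqs_uniq//=.
  by rewrite inE negb_or !mem_freqs; apply/and3P; split => //; [apply/andP; split; lia|lia|exact: freqs_uniq].
move=> n; rewrite !inE !mem_freqs; apply/idP/idP; first by lia.
by move=> /orP[/eqP ->|/orP[/eqP ->|]]; lia.
Qed.

Lemma momentum_partial_sum_mom u K : momentum_partial_sum u K = \sum_(0 <= j < K) mom_term j.+1 u.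
Proof.
elim: K => [|K ih]; rewrite momentum_partial_sumE.
  rewrite big_geq// /freqs; rewrite (perm_big [:: 0]); last first.
    by apply: uniq_perm; rewrite ?freqs_uniq// => n; rewrite !inE mem_freqs; apply/idP/idP => [|/eqP ->]; lia.
  by rewrite big_seq1 freq0 mul0r.
rewrite big_freqsS -momentum_partial_sumE ih big_nat_recr//= /mom_term -!/(mode_mass _ u) freqN; ring.
Qed.

Lemma measurable_mom_term j : measurable_fun [set: borelHs s] (mom_term j : borelHs s -> R).
Proof.
by apply: measurable_funM => //; apply: measurable_funB; exact: measurable_mode_mass.
Qed.

Lemma expR_ge_sqr (x : R) : 0 <= x -> x ^+ 2 <= 4 * expR x.
Proof.
move=> x0; have h := expR_ge1Dx (x / 2).
have -> : expR x = expR (x / 2) ^+ 2 by rewrite -expRM_natl; congr expR; field.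
have : x / 2 <= expR (x / 2) by apply: le_trans h; rewrite lerDr.
nra.
Qed.

(** A crude bound from |z|^4 <= 64 exp(|z|^2 / 4), whose right side has expectation 64 sqrt 2 sqrt
    2. *)
Lemma gaussian2_fourth : (\int[gaussian2 R]_z (sqnorm z ^+ 2)%:E <= 128%:E)%E.
Proof.
have mS := @measurable_sqnorm R.
apply: (@le_trans _ _ (\int[gaussian2 R]_z (64 * expR (sqnorm z / 4))%:E)%E).
  apply: ge0_le_integral => //.
  - by move=> z _; rewrite lee_fin sqr_ge0.
  - by apply/measurable_EFinP; exact: measurable_funX.
  - apply/measurable_EFinP; apply: measurable_funM => //; apply: measurableT_comp => //.
    exact: measurable_funM.
  - move=> z _; rewrite lee_fin; have := @expR_ge_sqr (sqnorm z / 4).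
    rewrite divr_ge0 ?sqnorm_ge0// => /(_ isT); nra.
have mG (x : R) : measurable_fun [set: R] (fun x : R => (expR (x ^+ 2 / 4))%:E).
  by apply/measurable_EFinP; apply: measurableT_comp => //; apply: measurable_funM.
have g1 : (\int[@gaussian1 R]_x (expR (x ^+ 2 / 4))%:E = (Num.sqrt 2)%:E)%E.
  have h0 x : (0 <= (expR (x ^+ 2 / 4 : R))%:E)%E by rewrite lee_fin expR_ge0.
  by rewrite -(integral_expR_sqr_normal R) (integral_gaussian1 (mG 0) h0) (integral_normal_prob01 (mG 0) h0).
rewrite [X in (X <= _)%E](_ : _ = 128%:E)%E//.
have E (z : R * R) : (64 * expR (sqnorm z / 4))%:E = (64%:E * ((expR (z.1 ^+ 2 / 4))%:E * (expR (z.2 ^+ 2 / 4))%:E))%E.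
  rewrite -!EFinM; congr EFin; rewrite -expRD; congr (_ * expR _); rewrite /sqnorm; ring.
under eq_integral do rewrite E.
have mE2 : measurable_fun [set: R * R] (fun z => (expR (z.1 ^+ 2 / 4))%:E * (expR (z.2 ^+ 2 / 4))%:E : \bar R)%E.
  apply: emeasurable_funM.
    exact: (measurableT_comp (mG 0) measurable_fst).
  exact: (measurableT_comp (mG 0) measurable_snd).
rewrite ge0_integralZl//.
rewrite [X in (_ * X)%E](_ : _ = 2%:E)%E; first by rewrite -EFinM; congr EFin; ring.
rewrite [LHS](@fubini_tonelli1 _ _ _ _ _ (@gaussian1 R) (@gaussian1 R))//.
transitivity (\int[@gaussian1 R]_x ((Num.sqrt 2)%:E * (expR (x ^+ 2 / 4))%:E))%E.
  apply: eq_integral => x _; rewrite /fubini_F /= ge0_integralZl//; try exact: (mG 0); try (by move=> y _; rewrite lee_fin expR_ge0); try (by rewrite lee_fin expR_ge0).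
  by rewrite g1 muleC.
rewrite ge0_integralZl//; try exact: (mG 0); try (by move=> y _; rewrite lee_fin expR_ge0); try (by rewrite lee_fin sqrtr_ge0).
by rewrite g1 -EFinM -expr2 sqr_sqrtr.
Qed.

#[local] Opaque gaussian2.

Lemma gaussian2_quadratic_bound (h : R * R -> \bar R) (a c : R) : measurable_fun [set: R * R] h ->
  (forall z, 0 <= h z)%E -> 0 <= a -> 0 <= c -> (forall z, h z <= (a + c * sqnorm z ^+ 2)%:E)%E ->
  (\int[gaussian2 R]_z h z <= (a + 128 * c)%:E)%E.
Proof.
move=> mh h0 a0 c0 hle.
have mS2 : measurable_fun [set: R * R] (fun z => (sqnorm z ^+ 2)%:E : \bar R).
  by apply/measurable_EFinP; apply: measurable_funX; exact: measurable_sqnorm.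
have mcS2 : measurable_fun [set: R * R] (fun z => c%:E * (sqnorm z ^+ 2)%:E : \bar R)%E.
  by apply: emeasurable_funM => //; exact: measurable_cst.
apply: (@le_trans _ _ (\int[gaussian2 R]_z (a%:E + c%:E * (sqnorm z ^+ 2)%:E))%E).
  apply: ge0_le_integral => //.
  - by apply: emeasurable_funD => //; exact: measurable_cst.
rewrite (@ge0_integralD _ _ _ (gaussian2 R) setT measurableT (cst a%:E)); last 4 first.
- by move=> z _; rewrite lee_fin.
- exact: measurable_cst.
- by move=> z _; rewrite -EFinM lee_fin mulr_ge0// sqr_ge0.
- exact: mcS2.
rewrite (integral_cst (gaussian2 R) measurableT a%:E) [X in (_ * X)%E](probability_setT (gaussian2 R)) mule1.
rewrite (@ge0_integralZl _ _ _ (gaussian2 R) setT measurableT _ mS2); last 2 first.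
- by move=> z _; rewrite lee_fin sqr_ge0.
- by rewrite lee_fin.
rewrite EFinD mulrC EFinM leeD2l// lee_wpmul2l ?lee_fin//; exact: gaussian2_fourth.
Qed.

Lemma double_integralD (F G : (R * R) * (R * R) -> R) :
  measurable_fun setT F -> measurable_fun setT G -> (forall w, 0 <= F w) -> (forall w, 0 <= G w) ->
  (\int[gaussian2 R]_z \int[gaussian2 R]_z' (F (z, z'))%:E +
   \int[gaussian2 R]_z \int[gaussian2 R]_z' (G (z, z'))%:E =
   \int[gaussian2 R]_z \int[gaussian2 R]_z' (F (z, z') + G (z, z'))%:E)%E.
Proof.
move=> mF mG F0 G0.
have mFE : measurable_fun setT (EFin \o F) by exact/measurable_EFinP.
have mGE : measurable_fun setT (EFin \o G) by exact/measurable_EFinP.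
have F0E w : (0 <= (EFin \o F) w)%E by rewrite lee_fin.
have G0E w : (0 <= (EFin \o G) w)%E by rewrite lee_fin.
rewrite -[LHS](@ge0_integralD _ _ _ (gaussian2 R) setT measurableT); last 4 first.
- by move=> z _; apply: integral_ge0 => z' _; exact: (F0E (z, z')).
- exact: (@measurable_fun_fubini_tonelli_F _ _ _ _ _ (gaussian2 R) _ mFE F0E).
- by move=> z _; apply: integral_ge0 => z' _; exact: (G0E (z, z')).
- exact: (@measurable_fun_fubini_tonelli_F _ _ _ _ _ (gaussian2 R) _ mGE G0E).
apply: eq_integral => z _.
rewrite -[LHS](@ge0_integralD _ _ _ (gaussian2 R) setT measurableT); last 4 first.
- by move=> z' _; exact: (F0E (z, z')).
- exact: (measurableT_comp mFE (measurable_pair1 z)).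
- by move=> z' _; exact: (G0E (z, z')).
- exact: (measurableT_comp mGE (measurable_pair1 z)).
by apply: eq_integral => z' _; rewrite EFinD.
Qed.

Lemma parallelogram_bound (S f x y : R) : 0 <= x -> 0 <= y ->
  (S + f * (y - x)) ^+ 2 + (S + - f * (y - x)) ^+ 2 <=
  (2 * S ^+ 2 + (2 * f ^+ 2) * x ^+ 2) + (2 * f ^+ 2) * y ^+ 2.
Proof.
move=> x0 y0; have h : 0 <= f ^+ 2 * (x * y) by rewrite mulr_ge0 ?sqr_ge0// mulr_ge0.
nra.
Qed.

(** Exchanging z and z' changes the sign of f, and averaging the two integrals removes the cross
    term with S. So the centring of the momentum terms needs no first moment. *)
Lemma symmetric_square_integral (S f : R) :
  (\int[gaussian2 R]_z \int[gaussian2 R]_z' ((S + f * (sqnorm z' - sqnorm z)) ^+ 2)%:E <=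
   (S ^+ 2 + 256 * f ^+ 2)%:E)%E.
Proof.
pose F (c : R) (w : (R * R) * (R * R)) : R := (S + c * (sqnorm w.2 - sqnorm w.1)) ^+ 2.
have mF (c : R) : measurable_fun setT (F c).
  apply: measurable_funX; apply: measurable_funD; first exact: measurable_cst.
  apply: measurable_funM; first exact: measurable_cst.
  apply: measurable_funB; apply: (measurableT_comp (@measurable_sqnorm R)).
    exact: measurable_snd.
  exact: measurable_fst.
have mFE c : measurable_fun setT (EFin \o F c) by exact/measurable_EFinP.
have F0 c w : 0 <= F c w by exact: sqr_ge0.
have F0E c w : (0 <= (EFin \o F c) w)%E by rewrite lee_fin.
pose I c : \bar R := (\int[gaussian2 R]_z \int[gaussian2 R]_z' (F c (z, z'))%:E)%E.
have sym : I f = I (- f).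
  rewrite /I [LHS](@fubini_tonelli _ _ _ _ _ (gaussian2 R) (gaussian2 R) _ (mFE f) (F0E f)).
  apply: eq_integral => z _; apply: eq_integral => z' _; congr EFin; rewrite /F /=; congr (_ ^+ 2); ring.
have c0 : 0 <= 2 * f ^+ 2 by exact: mulr_ge0 (ler0n _ 2) (sqr_ge0 f).
have s0 : 0 <= 2 * S ^+ 2 by exact: mulr_ge0 (ler0n _ 2) (sqr_ge0 S).
have dbl : (I f + I f <= (2 * S ^+ 2 + 512 * f ^+ 2)%:E)%E.
  rewrite {2}sym /I (double_integralD (mF f) (mF (- f)) (F0 f) (F0 (- f))).
  have mFF : measurable_fun setT (fun w => (F f w + F (- f) w)%:E).
    by apply/measurable_EFinP; apply: measurable_funD; exact: mF.
  have FF0 w : (0 <= (F f w + F (- f) w)%:E)%E by rewrite lee_fin addr_ge0.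
  rewrite (_ : 2 * S ^+ 2 + 512 * f ^+ 2 = (2 * S ^+ 2 + 128 * (2 * f ^+ 2)) + 128 * (2 * f ^+ 2)); last by ring.
  apply: gaussian2_quadratic_bound.
  - exact: (@measurable_fun_fubini_tonelli_F _ _ _ _ _ (gaussian2 R) _ mFF FF0).
  - by move=> z; apply: integral_ge0 => z' _; exact: (FF0 (z, z')).
  - by rewrite addr_ge0// mulr_ge0.
  - exact: c0.
  move=> z; rewrite [X in (_ <= X%:E)%E](_ : _ = (2 * S ^+ 2 + (2 * f ^+ 2) * sqnorm z ^+ 2) + 128 * (2 * f ^+ 2)); last by ring.
  apply: gaussian2_quadratic_bound.
  - exact: (measurableT_comp mFF (measurable_pair1 z)).
  - by move=> z'; exact: (FF0 (z, z')).
  - by rewrite addr_ge0// mulr_ge0// sqr_ge0.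
  - exact: c0.
  - by move=> z'; rewrite lee_fin; apply: parallelogram_bound; exact: sqnorm_ge0.
have I0 : (0 <= I f)%E by apply: integral_ge0 => z _; apply: integral_ge0 => z' _; exact: (F0E f (z, z')).
have If : I f \is a fin_num.
  rewrite ge0_fin_numE//; apply: le_lt_trans (ltry (2 * S ^+ 2 + 512 * f ^+ 2)).
  by apply: le_trans dbl; rewrite leeDl.
rewrite -[X in (X <= _)%E]/(I f) -(fineK If) lee_fin.
by move: dbl; rewrite -(fineK If) -EFinD lee_fin; lra.
Qed.

(** Orthogonality by induction: resampling the modes j and -j leaves the other terms of the sum
    fixed. *)
Lemma mom_sum_sqr L : uniq L -> (forall j, j \in L -> (0 < j)%N) ->
  (\int[P]_u ((\sum_(j <- L) mom_term j (u : Hs s)) ^+ 2)%:E <= (256 * \sum_(j <- L) (j%:R ^+ 2)^-1)%:E)%E.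
Proof.
elim: L => [|j L ih] /=.
  move=> _ _; under eq_integral do rewrite big_nil expr0n.
  by rewrite integral0 big_nil mulr0.
move=> /andP[jL uL] hL.
have j0 : (0 < j)%N by apply: hL; rewrite mem_head.
have {}ih := ih uL (fun i iL => hL i (mem_behead (s := j :: L) iL)).
have mQ (L' : seq nat) : measurable_fun [set: borelHs s] (fun u : borelHs s => \sum_(i <- L') mom_term i (u : Hs s)).
  by apply: measurable_sum => i; exact: measurable_mom_term.
pose Phi (L' : seq nat) (u : borelHs s) : \bar R := ((\sum_(i <- L') mom_term i (u : Hs s)) ^+ 2)%:E.
have mPhi L' : measurable_fun [set: borelHs s] (Phi L').
  by apply/measurable_EFinP; exact: measurable_funX.
have Phi0 L' u : (0 <= Phi L' u)%E by rewrite lee_fin sqr_ge0.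
pose Th (u : borelHs s) := (\int[gaussian2 R]_z Phi (j :: L) (set_mode j%:Z (u : Hs s) z))%E.
have mTh : measurable_fun [set: borelHs s] Th.
  apply: (@measurable_fun_fubini_tonelli_F _ _ _ _ _ (gaussian2 R)
    (fun w : borelHs s * (R * R) => Phi (j :: L) (set_mode j%:Z (w.1 : Hs s) w.2))).
    exact: (measurableT_comp (mPhi _) (measurable_set_mode _)).
  by move=> w; exact: Phi0.
have Th0 u : (0 <= Th u)%E by apply: integral_ge0.
rewrite -[X in (X <= _)%E]/(\int[P]_u Phi (j :: L) u)%E (resample j%:Z wP (mPhi _) (Phi0 _)).
rewrite -[X in (X <= _)%E]/(\int[P]_u Th u)%E (resample (- j%:Z) wP mTh Th0).
(* The coefficient of |g_j|^2 - |g_(-j)|^2, which is x / (1 + x^2) at x = 2 pi j and hence at most 1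
   / j. *)
pose f : R := freq R j%:Z / J j%:Z ^+ 2.
have Jn : J (- j%:Z) = J j%:Z by rewrite /japanese freqN sqrrN.
apply: (@le_trans _ _ (\int[P]_u (Phi L u + (256 * f ^+ 2)%:E))%E).
  apply: ge0_le_integral => //.
  - by move=> u _; apply: integral_ge0.
  - apply: (@measurable_fun_fubini_tonelli_F _ _ _ _ _ (gaussian2 R)
      (fun w : borelHs s * (R * R) => Th (set_mode (- j%:Z) (w.1 : Hs s) w.2))).
      exact: (measurableT_comp mTh (measurable_set_mode _)).
    by move=> w; exact: Th0.
  - exact: emeasurable_funD.
  move=> u _; apply: le_trans (symmetric_square_integral (\sum_(i <- L) mom_term i (u : Hs s)) f).
  rewrite le_eqVlt; apply/orP; left; apply/eqP.
  apply: eq_integral => z _; apply: eq_integral => z' _; congr (EFin (_ ^+ 2)).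
  rewrite big_cons addrC; congr (_ + _).
    rewrite [LHS]big_seq [RHS]big_seq; apply: eq_bigr => i iL.
    have ij : i != j by apply: contraNneq jL => <-.
    rewrite /mom_term /mode_mass !fourier_set_mode.
    by rewrite !ifF//; apply/eqP; lia.
  rewrite /mom_term /mode_mass !fourier_set_mode eqxx ifF; last by apply/eqP; lia.
  by rewrite eqxx !normc_mode_of Jn /f; ring.
rewrite (@ge0_integralD _ _ _ P setT measurableT (Phi L) (fun=> (256 * f ^+ 2)%:E)); last 4 first.
- by move=> u _; exact: Phi0.
- exact: mPhi.
- by move=> u _; rewrite lee_fin mulr_ge0 ?sqr_ge0.
- exact: measurable_cst.
rewrite (integral_cst P measurableT (256 * f ^+ 2)%:E) [X in (_ * X)%E](probability_setT P) mule1 big_cons mulrDr EFinD [X in (_ <= X)%E]addeC.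
apply: leeD; first exact: ih.
rewrite lee_fin ler_wpM2l//.
have fj : (j%:R : R) <= freq R j%:Z.
  by rewrite /freq -[leLHS]mul1r -pmulrn ler_wpM2r//; have := @pi_ge2 R; lra.
have jj : (0 : R) < j%:R by rewrite ltr0n.
rewrite /f /japanese sqr_sqrtr; last by rewrite addr_ge0 ?sqr_ge0.
move: (freq R j%:Z) fj => x xj; have x0 : 0 < x by exact: lt_le_trans xj.
rewrite -exprVn lerXn2r ?nnegrE ?divr_ge0 ?invr_ge0 ?addr_ge0 ?sqr_ge0 ?(ltW x0)//.
rewrite ler_pdivrMr ?addr_gt0 ?exprn_gt0// ler_pdivlMl//; nra.
Qed.

End momentum_convergence.

#[local] Transparent gaussian2.

Lemma inv_sqr_sum_le (R : realType) n : \sum_(0 <= k < n) (k.+1%:R ^+ 2 : R)^-1 <= 2.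
Proof.
case: n => [|n]; first by rewrite big_geq.
apply: (@le_trans _ _ (2 - n.+1%:R^-1)); last by rewrite gerBl.
elim: n => [|n ih]; first by rewrite big_nat1 expr1n !invr1; lra.
rewrite big_nat_recr//=; apply: le_trans (lerD ih (lexx _)) _.
have n0 : (0 : R) < n.+1%:R by []. have n1 : (0 : R) < n.+2%:R by [].
have E : (n.+2%:R : R) = n.+1%:R + 1 by rewrite -natr1.
move: (n.+1%:R : R) (n.+2%:R : R) n0 n1 E => x y x0 y0 ->.
have y1 : 0 < x + 1 by rewrite addr_gt0.
rewrite -subr_ge0 [X in 0 <= X](_ : _ = ((x + 1) ^+ 2 * x)^-1).
  by rewrite invr_ge0 mulr_ge0 ?sqr_ge0 ?(ltW x0).
by field; rewrite !gt_eqF.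
Qed.

Lemma sum_sqr_le (R : realType) (T : Type) (r : seq T) (a : T -> R) :
  (\sum_(i <- r) a i) ^+ 2 <= (size r)%:R * \sum_(i <- r) a i ^+ 2.
Proof.
rewrite expr2 big_distrlr /=.
apply: (@le_trans _ _ (\sum_(i <- r) \sum_(j <- r) (2^-1 * a i ^+ 2 + 2^-1 * a j ^+ 2))).
  apply: ler_sum => i _; apply: ler_sum => j _; have := sqr_ge0 (a i - a j); nra.
have E i : \sum_(j <- r) (2^-1 * a i ^+ 2 + 2^-1 * a j ^+ 2) =
    (size r)%:R * (2^-1 * a i ^+ 2) + 2^-1 * \sum_(j <- r) a j ^+ 2.
  by rewrite big_split /= big_const_seq count_predT iter_addr addr0 -[X in X + _]mulr_natl mulr_sumr.
rewrite (eq_bigr _ (fun i _ => E i)) big_split /= -!mulr_sumr.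
rewrite big_const_seq count_predT iter_addr addr0 -[(\sum_(j <- r) a j ^+ 2) *+ _]mulr_natl.
by rewrite le_eqVlt; apply/orP; left; apply/eqP; field.
Qed.

(** * Almost sure convergence along cubic blocks *)

Section block_convergence.
Variables (R : realType) (X : nat -> R).
Local Notation S K := (\sum_(0 <= j < K) X j.+1).

(* Consecutive cubes: the block has O(k^2) terms of second moment O(k^-6), so both summands
   of block_weight have expectation O(k^-2).  The first controls the sums over blocks, the
   second the partial sums inside a block. *)
Definition block k : seq nat := index_iota (k.+1 ^ 3).+1 (k.+2 ^ 3).+1.
Definition block_weight k : R :=
  k.+1%:R ^+ 2 * (\sum_(j <- block k) X j) ^+ 2 + (\sum_(j <- block k) `|X j|) ^+ 2.

Lemma block_sumE a b : (a <= b)%N -> \sum_(j <- index_iota a.+1 b.+1) X j = S b - S a.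
Proof.
by move=> ab; rewrite big_add1 /= (big_cat_nat (leq0n a) ab) /= addrC addrK.
Qed.

Lemma block_abs_le k K : (k.+1 ^ 3 <= K < k.+2 ^ 3)%N ->
  `|S K - S (k.+1 ^ 3)%N| <= \sum_(j <- block k) `|X j|.
Proof.
move=> /andP[h1 h2]; rewrite -block_sumE// /block.
apply: le_trans (ler_norm_sum _ _ _) _.
rewrite (@big_cat_nat _ _ _ K.+1 (k.+1 ^ 3).+1 (k.+2 ^ 3).+1) ?ltnS ?(ltnW h2)//=.
by rewrite lerDl; apply: sumr_ge0.
Qed.

Lemma block_weight_ge0 k : 0 <= block_weight k.
Proof. by apply: addr_ge0; [apply: mulr_ge0|]; exact: sqr_ge0. Qed.

Lemma cube_bracket K : (0 < K)%N -> exists k, (k.+1 ^ 3 <= K < k.+2 ^ 3)%N.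
Proof.
elim: K => [//|K ih] _; have [->|K0] := posnP K; first by exists 0%N.
have [k /andP[h1 h2]] := ih K0; have [h|h] := ltnP K.+1 (k.+2 ^ 3).
  by exists k; rewrite h andbT (leq_trans h1).
exists k.+1; rewrite h (leq_ltn_trans h2)// ltn_exp2r//.
Qed.

(** Summability of the weights gives absolute convergence of the sum over blocks; weights tending to
    0 make the oscillation inside a block tend to 0. *)
Lemma block_cvg (B : R) : (forall n, \sum_(0 <= k < n) block_weight k <= B) -> cvgn (fun K => S K).
Proof.
move=> hB.
have cW : cvgn (series block_weight).
  apply: nondecreasing_is_cvgn.
    by apply: nondecreasing_series => n _ _; exact: block_weight_ge0.
  by exists B => _ [n _ <-]; exact: hB.
have W0 := cvg_series_cvg_0 cW.
pose Q k := \sum_(j <- block k) X j.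
have cQ : cvgn (series Q).
  apply: normed_cvg; apply: nondecreasing_is_cvgn.
    by apply: (@nondecreasing_series R (fun k => `|Q k|)) => n _ _.
  exists (2^-1 * (B + 2)) => _ [n _ <-].
  rewrite /series /=; apply: le_trans (_ : _ <= \sum_(0 <= k < n) (2^-1 * (block_weight k + (k.+1%:R ^+ 2)^-1))) _.
    apply: ler_sum => k _; rewrite /block_weight -/(Q k).
    have z0 := sqr_ge0 (\sum_(j <- block k) `|X j|); have k0 : (0 : R) < k.+1%:R by [].
    move: (_ ^+ 2) (Q k) (k.+1%:R : R) z0 k0 => z q x z0 x0.
    (* The factor (k + 1)^2 in [block_weight] is there for this inequality: it trades |q| for q^2 at
       the price of a summable term. *)
    have h : 2 * `|q| <= x ^+ 2 * q ^+ 2 + (x ^+ 2)^-1.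
      have -> : q ^+ 2 = `|q| ^+ 2 by rewrite real_normK ?num_real.
      rewrite -subr_ge0 (_ : _ - _ = (x * `|q| - x^-1) ^+ 2) ?sqr_ge0//.
      by field; rewrite gt_eqF.
    lra.
  rewrite -mulr_sumr ler_wpM2l ?invr_ge0// big_split /= lerD ?hB ?inv_sqr_sum_le//.
have SQ k : S (k.+1 ^ 3)%N = S 1 + series Q k.
  elim: k => [|k ih]; first by rewrite exp1n /series /= [X in _ = _ + X]big_geq ?addr0.
  have -> : series Q k.+1 = series Q k + Q k by rewrite /series /= big_nat_recr.
  by rewrite addrA -ih /Q block_sumE ?leq_exp2r// addrC subrK.
have [l cl] : exists l : R, (fun k => S (k.+1 ^ 3)%N) @ \oo --> l.
  exists (S 1 + limn (series Q)); rewrite (_ : (fun k => _) = (fun k => S 1 + series Q k)); last by apply/funext.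
  by apply: cvgD; [exact: cvg_cst|exact: cQ].
apply/cvg_ex; exists l; apply/cvgrPdist_lt => e e0.
have e2 : 0 < e / 2 by rewrite divr_gt0.
have [N1 _ h1] : \forall k \near \oo, `|l - S (k.+1 ^ 3)%N| < e / 2 by move/cvgrPdist_lt : cl => /(_ _ e2).
have e22 : 0 < (e / 2) ^+ 2 by rewrite exprn_gt0.
have [N2 _ h2] : \forall k \near \oo, `|0 - block_weight k| < (e / 2) ^+ 2 by move/cvgrPdist_lt : W0 => /(_ _ e22).
exists ((maxn N1 N2).+1 ^ 3)%N => // K /= hK.
have K0 : (0 < K)%N by apply: leq_trans hK; rewrite expn_gt0.
have [k hk] := cube_bracket K0; have /andP[hk1 hk2] := hk.
have Nk : (maxn N1 N2 <= k)%N.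
  by rewrite -ltnS -ltnS -(ltn_exp2r _ _ (isT : (0 < 3)%N)) (leq_ltn_trans hK).
have g1 := h1 k (leq_trans (leq_maxl _ _) Nk); have g2 := h2 k (leq_trans (leq_maxr _ _) Nk).
have g3 := block_abs_le hk.
have g4 : \sum_(j <- block k) `|X j| < e / 2.
  rewrite -(ltr_pXn2r (isT : (0 < 2)%N)) ?nnegrE ?sumr_ge0// ?(ltW e2)//.
  apply: le_lt_trans g2; rewrite sub0r normrN ger0_norm ?block_weight_ge0// /block_weight lerDr.
  by rewrite mulr_ge0 ?sqr_ge0.
have -> : l - S K = (l - S (k.+1 ^ 3)%N) - (S K - S (k.+1 ^ 3)%N) by ring.
by apply: le_lt_trans (ler_normB _ _) _; rewrite [ltRHS]splitr; apply: ltrD => //; exact: le_lt_trans g4.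
Qed.

End block_convergence.

Section momentum_ae.
Variables (R : realType) (s : R) (P : probability (borelHs s) R).
Hypothesis wP : wiener P.

(** The block has (k + 2)^3 - (k + 1)^3 <= 7 (k + 1)^2 elements, all larger than (k + 1)^3. *)
Lemma block_inv_sqr k : \sum_(j <- block k) (j%:R ^+ 2 : R)^-1 <= 7 * (k.+1%:R ^+ 4)^-1.
Proof.
have k0 : (0 : R) < k.+1%:R by [].
apply: (@le_trans _ _ (\sum_(j <- block k) (k.+1%:R ^+ 6)^-1)).
  rewrite big_seq [leRHS]big_seq; apply: ler_sum => j; rewrite mem_index_iota => /andP[h _].
  have hj : (k.+1%:R : R) ^+ 3 <= j%:R by rewrite -natrX ler_nat ltnW.
  rewrite lef_pV2 ?posrE ?exprn_gt0//; last by rewrite (lt_le_trans _ hj)// exprn_gt0.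
  by rewrite (_ : 6 = 3 * 2)%N// exprM lerXn2r ?nnegrE ?exprn_ge0// ltW.
rewrite big_const_seq count_predT iter_addr addr0 size_iota -[X in X <= _]mulr_natl.
have -> : (7 : R) * (k.+1%:R ^+ 4)^-1 = (7 * k.+1%:R ^+ 2) * (k.+1%:R ^+ 6)^-1 by field; rewrite gt_eqF.
rewrite ler_wpM2r ?invr_ge0 ?exprn_ge0// -natrX -natrM ler_nat subSS.
rewrite !expnS !expn0 ; nia.
Qed.

Lemma size_block k : ((size (block k))%:R : R) <= 7 * k.+1%:R ^+ 2.
Proof.
rewrite size_iota subSS -natrX -natrM ler_nat !expnS !expn0; nia.
Qed.

Lemma block_pos k j : j \in block k -> (0 < j)%N.
Proof. by rewrite mem_index_iota => /andP[h _]; exact: leq_trans h. Qed.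

Lemma measurable_block_weight k : measurable_fun [set: borelHs s]
  (fun u : borelHs s => block_weight (fun j => mom_term j (u : Hs s)) k).
Proof.
have mX j := @measurable_mom_term R s j.
apply: measurable_funD.
  apply: measurable_funM; first exact: measurable_cst.
  by apply: measurable_funX; apply: measurable_sum.
apply: measurable_funX; apply: measurable_sum => j; exact: measurableT_comp.
Qed.

(** Both summands give 256 * 7 / (k + 1)^2, the second with a further factor 7 from the size of the
    block in the Cauchy-Schwarz inequality; hence 56 = 7 * (1 + 7). *)
Lemma integral_block_weight k :
  (\int[P]_u (block_weight (fun j => mom_term j (u : Hs s)) k)%:E <= ((256 * 56) * (k.+1%:R ^+ 2)^-1)%:E)%E.
Proof.
have mX j := @measurable_mom_term R s j.
have k0 : (0 : R) < k.+1%:R by [].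
pose Q (L : seq nat) (u : borelHs s) : \bar R := ((\sum_(j <- L) mom_term j (u : Hs s)) ^+ 2)%:E.
have mQ L : measurable_fun [set: borelHs s] (Q L).
  by apply/measurable_EFinP; apply: measurable_funX; apply: measurable_sum.
have Q0 L u : (0 <= Q L u)%E by rewrite lee_fin sqr_ge0.
pose c : R := 7 * k.+1%:R ^+ 2.
have c0 : 0 <= c by rewrite mulr_ge0// exprn_ge0.
pose V (u : borelHs s) : \bar R := (c%:E * \sum_(j <- block k) Q [:: j] u)%E.
have mV0 : measurable_fun [set: borelHs s] (fun u => \sum_(j <- block k) Q [:: j] u)%E.
  by apply: emeasurable_sum => j; exact: mQ.
have mV : measurable_fun [set: borelHs s] V by apply: emeasurable_funM => //; exact: measurable_cst.
have S0 u : (0 <= \sum_(j <- block k) Q [:: j] u)%E by apply: sume_ge0 => j _; exact: Q0.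
have V0 u : (0 <= V u)%E by apply: mule_ge0 => //; rewrite lee_fin.
have mk : measurable_fun [set: borelHs s] (fun u => (k.+1%:R ^+ 2)%:E * Q (block k) u)%E.
  by apply: emeasurable_funM => //; exact: measurable_cst.
apply: (@le_trans _ _ (\int[P]_u ((k.+1%:R ^+ 2)%:E * Q (block k) u + V u))%E).
  apply: ge0_le_integral.
  - exact: measurableT.
  - by move=> u _; rewrite lee_fin block_weight_ge0.
  - by apply/measurable_EFinP; exact: measurable_block_weight.
  - exact: emeasurable_funD.
  - move=> u _; rewrite /block_weight /V /Q.
    rewrite (eq_bigr (fun j => (mom_term j (u : Hs s) ^+ 2)%:E)); last by move=> j _; rewrite big_seq1.
    rewrite sumEFin -!EFinM -EFinD lee_fin lerD2l.
    apply: le_trans (sum_sqr_le _ _) _.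
    under eq_bigr do rewrite real_normK ?num_real//.
    by apply: ler_wpM2r; [apply: sumr_ge0 => j _; exact: sqr_ge0|exact: size_block].
rewrite (@ge0_integralD _ _ _ P setT measurableT); last 4 first.
- by move=> u _; apply: mule_ge0 => //; rewrite lee_fin exprn_ge0.
- exact: mk.
- by move=> u _; exact: V0.
- exact: mV.
rewrite (@ge0_integralZl _ _ _ P setT measurableT _ (mQ (block k))); last 2 first.
- by move=> u _; exact: Q0.
- by rewrite lee_fin exprn_ge0.
rewrite (@ge0_integralZl _ _ _ P setT measurableT _ mV0); last 2 first.
- by move=> u _; exact: S0.
- by rewrite lee_fin.
rewrite ge0_integral_sum; last 3 first.
- exact: measurableT.
- by move=> j; exact: mQ.
- by move=> j u _; exact: Q0.
have bd (L : seq nat) (b : R) : uniq L -> (forall j, j \in L -> (0 < j)%N) ->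
    \sum_(j <- L) (j%:R ^+ 2)^-1 <= b -> (\int[P]_u Q L u <= (256 * b)%:E)%E.
  move=> uL pL hb; apply: le_trans (mom_sum_sqr wP uL pL) _.
  by rewrite lee_fin ler_wpM2l ?ler0n.
apply: (@le_trans _ _ ((k.+1%:R ^+ 2)%:E * (256 * (7 * (k.+1%:R ^+ 4)^-1))%:E +
   c%:E * (256 * (7 * (k.+1%:R ^+ 4)^-1))%:E)%E).
  apply: leeD; apply: lee_wpmul2l; rewrite ?lee_fin ?exprn_ge0//.
    by apply: bd; [exact: iota_uniq|exact: block_pos|exact: block_inv_sqr].
  apply: (@le_trans _ _ (\sum_(j <- block k) (256 * (j%:R ^+ 2)^-1)%:E)%E).
    rewrite big_seq [leRHS]big_seq; apply: lee_sum => j jb.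
    by apply: bd => // [i|]; [rewrite inE => /eqP ->; exact: block_pos jb|rewrite big_seq1].
  by rewrite sumEFin lee_fin -mulr_sumr ler_wpM2l ?ler0n ?block_inv_sqr.
rewrite -!EFinM -EFinD lee_fin /c le_eqVlt; apply/orP; left; apply/eqP.
by field; rewrite gt_eqF.
Qed.

Lemma momentum_cvg_ae : {ae P, forall u : borelHs s, momentum_cvg u}.
Proof.
pose W k (u : borelHs s) : \bar R := (block_weight (fun j => mom_term j (u : Hs s)) k)%:E.
have mW k : measurable_fun [set: borelHs s] (W k) by apply/measurable_EFinP; exact: measurable_block_weight.
have W0 k u : (0 <= W k u)%E by rewrite lee_fin block_weight_ge0.
pose T (u : borelHs s) : \bar R := (\sum_(0 <= k <oo) W k u)%E.
have mT : measurable_fun [set: borelHs s] T by apply: ge0_emeasurable_sum => // k _; exact: mW.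
have T0 u : (0 <= T u)%E by apply: nneseries_ge0.
have iT : (\int[P]_u T u <= (256 * 112)%:E)%E.
  rewrite integral_nneseries//; apply: lime_le.
    by apply: is_cvg_nneseries => k _ _; apply: integral_ge0.
  near=> n; apply: (@le_trans _ _ (\sum_(0 <= k < n) ((256 * 56) * (k.+1%:R ^+ 2)^-1)%:E)%E).
    by apply: lee_sum => k _; exact: integral_block_weight.
  rewrite sumEFin lee_fin -mulr_sumr.
  apply: (@le_trans _ _ ((256 * 56) * 2)); first by rewrite ler_wpM2l ?inv_sqr_sum_le ?mulr_ge0 ?ler0n.
  by rewrite le_eqVlt; apply/orP; left; apply/eqP; ring.
have iT' : P.-integrable setT T.
  apply/integrableP; split => //; apply: le_lt_trans (ltry (256 * 112)).
  by under eq_integral do rewrite gee0_abs//.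
apply: filterS (integrable_ae measurableT iT') => u /(_ I) Tf.
rewrite /momentum_cvg /= (_ : momentum_partial_sum (u : Hs s) =
  (fun K => \sum_(0 <= j < K) mom_term j.+1 (u : Hs s))); last first.
  by apply/funext => K; exact: momentum_partial_sum_mom.
apply: (@block_cvg R (fun j => mom_term j (u : Hs s)) (fine (T u))) => n.
rewrite -lee_fin fineK// -sumEFin.
rewrite /T (@nneseries_split _ (W^~ u) 0 n)// add0n leeDl// nneseries_ge0//.
Unshelve. all: by end_near. Qed.

End momentum_ae.

(** * Positivity of the density of mass and momentum *)

Lemma gaussian1_itv_gt0 (R : realType) (del : R) : 0 < del -> (0 < @gaussian1 R [set x | (- del < x < del)%R])%E.
Proof.
move=> d0; rewrite (_ : [set x | _] = `]- del, del[%classic); last by apply/seteqP; split => x /=; rewrite in_itv.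
set I : set R := `]- del, del[%classic.
have mI : measurable I by exact: measurable_itv.
have mh : measurable_fun [set: R] (fun x : R => (\1_I x : R)%:E).
  by apply/measurable_EFinP; exact: measurable_indic.
have -> : @gaussian1 R I = (\int[@gaussian1 R]_x (\1_I x)%:E)%E by rewrite integral_indic ?setIT.
rewrite integral_gaussian1//.
have [c c0 hc] : exists2 c : R, 0 < c & forall x, x ^+ 2 <= del ^+ 2 -> c <= normal_pdf (0 : R) 1 x.
  exists (normal_pdf (0 : R) 1 del) => [|x hx].
    by rewrite normal_pdf01E mulr_gt0 ?expR_gt0 ?normal_peak_gt0 ?oner_neq0.
  rewrite !normal_pdf01E ler_wpM2l ?normal_peak_ge0// ler_expR; lra.
apply: (@lt_le_trans _ _ (\int[lebesgue_measure]_x (c%:E * (\1_I x)%:E))%E).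
  rewrite ge0_integralZl ?lee_fin ?(ltW c0)//.
  rewrite integral_indic// setIT; apply: mule_gt0; first by rewrite lte_fin.
  rewrite [X in (_ < X)%E]lebesgue_measure_itv/= lte_fin.
  rewrite ifT; last by rewrite (lt_trans _ d0)// oppr_lt0.
  by rewrite lte_fin opprK addr_gt0.
apply: ge0_le_integral => //.
- by move=> x _; rewrite mule_ge0// lee_fin ltW.
- by apply: emeasurable_funM => //; exact: measurable_cst.
- apply: emeasurable_funM => //; apply/measurable_EFinP; exact: measurable_normal_pdf.
- move=> x _; rewrite -!EFinM lee_fin indicE; case: (boolP (x \in I)) => xI; last by rewrite mulr0 mul0r.
  rewrite mulr1 mul1r hc//; move: xI; rewrite inE /I /= in_itv /= => /andP[x1 x2]; nra.
Qed.

Lemma gaussian2_ball_gt0 (R : realType) (c : R) : 0 < c -> (0 < gaussian2 R [set z | (sqnorm z < c)%R])%E.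
Proof.
move=> c0; pose del := c / (2 + c).
have c2 : 0 < 2 + c by rewrite addr_gt0.
have d0 : 0 < del by rewrite divr_gt0.
have dc : 2 * del ^+ 2 <= c.
  rewrite /del expr_div_n mulrA ler_pdivrMr ?exprn_gt0//; nra.
set I : set R := `]- del, del[%classic.
have mI : measurable I by exact: measurable_itv.
apply: (@lt_le_trans _ _ (gaussian2 R (I `*` I))).
  rewrite [X in (_ < X)%E](product_measure1E _ _)//.
  have := gaussian1_itv_gt0 d0; rewrite (_ : [set x | _] = I) => [h|]; first exact: mule_gt0.
  by apply/seteqP; split => x; rewrite /I /= in_itv.
apply: le_measure; rewrite ?inE.
- exact: measurableX.
- rewrite -[X in measurable X]setTI; apply: (measurable_fun_ltr _ _) => //.
  exact: measurable_sqnorm.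
- move=> [x y] [/=]; rewrite /I /= !in_itv /= => /andP[x1 x2] /andP[y1 y2].
  rewrite /sqnorm /=; nra.
Qed.

Section positivity.
Variables (R : realType) (s : R) (P : probability (borelHs s) R).
Hypothesis wP : wiener P.
Implicit Types (u : Hs s) (L : seq int) (G : set (borelHs s)).
Local Notation J n := (japanese R n).

Let small L eta : set (borelHs s) := [set u : borelHs s | forall k, k \in L -> mode_mass k (u : Hs s) < eta].

Let measurable_small L eta : measurable (small L eta).
Proof.
rewrite (_ : small L eta = \bigcap_(k in [set` L]) [set u : borelHs s | (mode_mass k (u : Hs s) < eta)%R])//.
apply: fin_bigcap_measurable => // k _; rewrite -[X in measurable X]setTI.
by apply: measurable_fun_ltr => //; exact: measurable_mode_mass.
Qed.

(** [G] does not see the modes in [L]. Resampling them one by one turns the event into a product,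
    each new factor being a disc of positive Gaussian measure. *)
Lemma small_modes_gt0 L G (eta : R) : measurable G -> (0 < P G)%E -> uniq L -> 0 < eta ->
  (forall k u z, k \in L -> G (set_mode k u z : borelHs s) <-> G (u : borelHs s)) ->
  (0 < P (G `&` small L eta))%E.
Proof.
move=> mG PG + eta0; elim: L => [|l L ih] /=.
  by move=> _ _; rewrite (_ : _ `&` _ = G)//; apply/seteqP; split => [u []//|u Gu]; split.
move=> /andP[lL uL] GL.
have {}ih := ih uL (fun k u z kL => GL k u z (mem_behead (s := l :: L) kL)).
have mGL : measurable (G `&` small L eta) by apply: measurableI.
rewrite (@wiener_set_mode _ _ P l)//; last exact: measurableI.
have j0 : 0 < J l ^+ 2 by rewrite exprn_gt0// japanese_gt0.
rewrite (_ : [set w | _] = (G `&` small L eta) `*` [set z | (sqnorm z < eta * J l ^+ 2)%R]); last first.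
  apply/seteqP; split => -[u z] /=.
    move=> [h1 h2]; split; last first.
      have := h2 l (mem_head _ _); rewrite /mode_mass fourier_set_mode eqxx normc_mode_of.
      by rewrite ltr_pdivrMr.
    split; first by apply/(GL l u z (mem_head _ _)).
    move=> k kL; have := h2 k (mem_behead (s := l :: L) kL).
    rewrite /mode_mass fourier_set_mode; case: eqVneq => // lk; by rewrite lk kL in lL.
  move=> [[h1 h2] h3]; split; first by apply/(GL l u z (mem_head _ _)).
  move=> k; rewrite inE /mode_mass fourier_set_mode; case: (eqVneq k l) => [->|kl] /= kL.
    by rewrite normc_mode_of ltr_pdivrMr.
  exact: h2.
rewrite [X in (_ < X)%E](product_measure1E _ _)//.
  by rewrite mule_gt0// gaussian2_ball_gt0// mulr_gt0.
rewrite -[X in measurable X]setTI; apply: (measurable_fun_ltr _ _) => //.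
  exact: measurable_sqnorm.
Qed.

Lemma rest_energy_set_mode k u z K : k \in freqs K ->
  mass (set_mode k u z) - energy K (set_mode k u z) = mass u - energy K u.
Proof. exact: energy_add_mode. Qed.

Lemma rest_momentum_partial_set_mode k u z K : k \in freqs K -> momentum_cvg (u : borelHs s) ->
  momentum (set_mode k u z : borelHs s) - momentum_partial_sum (set_mode k u z) K =
  momentum (u : borelHs s) - momentum_partial_sum u K.
Proof. by move=> kK cu; rewrite momentum_set_mode// momentum_partial_sum_set_mode//; ring. Qed.

Let good (eps : R) K : set (borelHs s) := [set u : borelHs s | [/\ momentum_cvg u,
  `|mass (u : Hs s) - energy K (u : Hs s)| < eps &
  `|momentum u - momentum_partial_sum (u : Hs s) K| < eps]].

Let measurable_good eps K : measurable (good eps K).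
Proof.
rewrite (_ : good eps K = @momentum_cvg R s `&`
  ([set u : borelHs s | (`|mass (u : Hs s) - energy K (u : Hs s)| < eps)%R] `&`
  [set u : borelHs s | (`|momentum u - momentum_partial_sum (u : Hs s) K| < eps)%R])); last first.
  by apply/seteqP; split => u [h1]; [move=> h2 h3|move=> [h2 h3]]; split.
have mE (F : int -> R) : measurable_fun [set: borelHs s] (fun u : borelHs s =>
    \sum_(n <- freqs K) F n * normc (fourier (u : Hs s) n) ^+ 2).
  apply: measurable_sum => n; apply: measurable_funM; first exact: measurable_cst.
  exact: measurable_normc_fourier2.
apply: measurableI; first exact: measurable_momentum_cvg.
apply: measurableI; rewrite -[X in measurable X]setTI; apply: (measurable_fun_ltr _ _) => //.
- apply: measurableT_comp => //; apply: measurable_funB; first exact: measurable_mass.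
  have := mE (fun=> 1); rewrite /energy; congr (measurable_fun _ _); apply/funext => u.
  by apply: eq_bigr => n _; rewrite mul1r.
- apply: measurableT_comp => //; apply: measurable_funB; first exact: measurable_momentum.
  have := mE (fun n => freq R n); congr (measurable_fun _ _); apply/funext => u.
  by rewrite momentum_partial_sumE.
Qed.

(** Almost every u is good at some level K >= K0, so these countably many events cannot all be
    null. *)
Lemma good_gt0 (eps : R) K0 : 0 < eps -> exists2 K, (K0 <= K)%N & (0 < P (good eps K))%E.
Proof.
move=> e0; apply: contrapT => h.
have h0 K : P (good eps (K0 + K)%N) = 0%E.
  apply/eqP; rewrite eq_le measure_ge0 andbT leNgt; apply/negP => h1; apply: h.
  by exists (K0 + K)%N => //; exact: leq_addr.
have [N [mN N0 hN]] := momentum_cvg_ae wP.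
have : P.-negligible (\bigcup_K good eps (K0 + K)%N `|` N).
  apply: negligibleU; last by exists N; split.
  by apply: negligible_bigcup => K; exists (good eps (K0 + K)%N); split; [exact: measurable_good|exact: h0|].
rewrite (_ : _ `|` N = setT).
  move=> /(negligibleP _ measurableT) h1.
  by have /eqP := etrans (esym h1) (probability_setT P); rewrite eq_sym onee_eq0.
apply/seteqP; split => // u _.
have [cu|ncu] := pselect (momentum_cvg u); last by right; exact: hN.
left.
have [K1 _ h1] : \forall K \near \oo, `|mass (u : Hs s) - energy K (u : Hs s)| < eps.
  by move/cvgrPdist_lt : (energy_cvg (u := (u : Hs s))) => /(_ _ e0).
have [K2 _ h2] : \forall K \near \oo, `|momentum u - momentum_partial_sum (u : Hs s) K| < eps.
  by move/cvgrPdist_lt : (momentum_lim cu) => /(_ _ e0).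
exists (maxn K1 K2) => //; split => //.
  by apply: h1 => /=; rewrite (leq_trans (leq_maxl K1 K2))// leq_addl.
by apply: h2 => /=; rewrite (leq_trans (leq_maxr K1 K2))// leq_addl.
Qed.

Let rest_small m n (eps : R) : set (borelHs s) := [set u : borelHs s |
  [/\ momentum_cvg u, `|rest_mass m n (u : Hs s)| < eps & `|rest_momentum m n (u : Hs s)| < eps]].

Let measurable_rest_small m n eps : measurable (rest_small m n eps).
Proof.
rewrite (_ : rest_small m n eps = @momentum_cvg R s `&`
    ([set u : borelHs s | (`|rest_mass m n (u : Hs s)| < eps)%R] `&`
     [set u : borelHs s | (`|rest_momentum m n (u : Hs s)| < eps)%R])); last first.
    by apply/seteqP; split => u [h1]; [move=> h2 h3|move=> [h2 h3]]; split.
  apply: measurableI; first exact: measurable_momentum_cvg.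
  apply: measurableI; rewrite -[X in measurable X]setTI; apply: (measurable_fun_ltr _ _) => //.
- by apply: measurableT_comp => //; exact: measurable_rest_mass.
- by apply: measurableT_comp => //; exact: measurable_rest_momentum.
Qed.

(* With positive probability mass and momentum are close to their partial sums at some
   level K; the modes up to level K are then resampled to be small. *)
Lemma rest_small_gt0 m n (eps : R) : m != n -> 0 < eps ->
  (0 < P (rest_small m n eps))%E.
Proof.
move=> mn e0; have e2 : 0 < eps / 2 by rewrite divr_gt0.
have [K K0 PK] := @good_gt0 (eps / 2) (maxn (absz m) (absz n)) e2.
have mK : m \in freqs K by rewrite mem_freqs (leq_trans (leq_maxl _ _) K0).
have nK : n \in freqs K by rewrite mem_freqs (leq_trans (leq_maxr _ _) K0).
pose L := rem n (rem m (freqs K)).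
have um := rem_uniq m (freqs_uniq K).
have uL : uniq L by exact: rem_uniq.
have LK k : k \in L -> k \in freqs K by move=> /mem_rem/mem_rem.
pose W := \sum_(k <- L) (1 + `|freq R k|).
have W0 : 0 <= W by apply: sumr_ge0 => k _; rewrite addr_ge0.
(* Small enough for the modes of [L] to contribute at most eps / 2 to mass and to momentum alike; W
   + 1 avoids dividing by 0. *)
pose eta := eps / 2 / (W + 1).
have eta0 : 0 < eta by rewrite divr_gt0// ltr_pwDr.
have etaW : eta * W <= eps / 2.
  by rewrite /eta mulrAC ler_pdivrMr ?ltr_pwDr// ler_wpM2l ?(ltW e2)// lerDl.
have := @small_modes_gt0 L (good (eps / 2) K) eta (measurable_good _ _) PK uL eta0.
have gi k u z : k \in L -> good (eps / 2) K (set_mode k u z : borelHs s) <-> good (eps / 2) K (u : borelHs s).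
  move=> /LK kK; split => -[h1 h2 h3].
    have cu : momentum_cvg (u : borelHs s) by exact: (proj1 (@momentum_cvg_set_mode _ _ k u z) h1).
    by split => //; [rewrite -(rest_energy_set_mode u z kK)|rewrite -(rest_momentum_partial_set_mode z kK cu)].
  split; first by exact: (proj2 (@momentum_cvg_set_mode _ _ k u z) h1).
    by rewrite rest_energy_set_mode.
  by rewrite rest_momentum_partial_set_mode.
move=> /(_ gi) /lt_le_trans; apply.
have sumE (F : int -> R) : \sum_(k <- freqs K) F k = F m + (F n + \sum_(k <- L) F k).
  rewrite (perm_big _ (perm_to_rem mK)) big_cons; congr (_ + _).
  by rewrite (perm_big _ (perm_to_rem (_ : n \in rem m (freqs K)))) ?big_cons// mem_rem_uniq ?freqs_uniq// inE eq_sym mn.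
apply: le_measure; rewrite ?inE.
- by apply: measurableI => //; exact: measurable_good.
- exact: measurable_rest_small.
- move=> u [[h1 h2 h3] h4].
  have hF (F : int -> R) : (forall k, `|F k| <= 1 + `|freq R k|) ->
      `|\sum_(k <- L) F k * mode_mass k (u : Hs s)| <= eps / 2.
    move=> hF; apply: le_trans etaW; apply: le_trans (ler_norm_sum _ _ _) _.
    rewrite /W mulr_sumr big_seq [leRHS]big_seq; apply: ler_sum => k kL.
    rewrite normrM [X in _ * X]ger0_norm ?mode_mass_ge0// mulrC.
    by apply: ler_pM => //; [exact: mode_mass_ge0|rewrite ltW// h4].
  split => //.
  + rewrite (_ : rest_mass m n (u : Hs s) = (mass (u : Hs s) - energy K (u : Hs s)) +
      \sum_(k <- L) 1 * mode_mass k (u : Hs s)); last first.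
      have -> : energy K (u : Hs s) = mode_mass m (u : Hs s) + (mode_mass n (u : Hs s) +
        \sum_(k <- L) 1 * mode_mass k (u : Hs s)).
        under eq_bigr do rewrite mul1r; exact: sumE.
      by rewrite /rest_mass; ring.
    apply: le_lt_trans (ler_normD _ _) _; rewrite [ltRHS]splitr ltr_leD//.
    by apply: hF => k; rewrite normr1 lerDl.
  + rewrite (_ : rest_momentum m n (u : Hs s) = (momentum u - momentum_partial_sum (u : Hs s) K) +
      \sum_(k <- L) freq R k * mode_mass k (u : Hs s)); last first.
      have -> : momentum_partial_sum (u : Hs s) K = freq R m * mode_mass m (u : Hs s) +
        (freq R n * mode_mass n (u : Hs s) + \sum_(k <- L) freq R k * mode_mass k (u : Hs s)).
        by rewrite momentum_partial_sumE; exact: sumE.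
      by rewrite /rest_momentum; ring.
    apply: le_lt_trans (ler_normD _ _) _; rewrite [ltRHS]splitr ltr_leD//.
    by apply: hF => k; rewrite lerDr.
Qed.

(* For m = -k and n = k with k large, (a, b) lies inside the cone spanned by (1, freq m) and
   (1, freq n). *)
Lemma pin_density_integral_gt0 (a b : R) : 0 < a -> exists m n : int, m != n /\
  (0 < pinned_integral m n P (fun=> 1%R) (a, b))%E.
Proof.
move=> a0; pose k := (Num.truncn ((2 * (`|b| + 1)) / a)).+1.
have hk : 2 * (`|b| + 1) / a < k%:R by rewrite truncnS_gt.
have kp : (0 : R) < k%:R by [].
pose m : int := - (k%:Z); pose n : int := k%:Z.
have mn : m != n by rewrite /m /n; lia.
have bn : freq R n = 2 * pi * k%:R by rewrite /freq.
have bm : freq R m = - freq R n by rewrite /m freqN.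
have kn : (k%:R : R) <= freq R n.
  by rewrite bn ler_peMl// ?ltW//; have := @pi_ge2 R; lra.
have n0 : 0 < freq R n by exact: lt_le_trans kn.
have ab : 2 * (`|b| + 1) < a * freq R n.
  by rewrite [a * _]mulrC -ltr_pdivrMr// (lt_le_trans hk).
exists m, n; split => //.
(* Then freq n (a - rest_mass) > freq n a / 2 > |b| + 1 > |b - rest_momentum|, so both pinned masses
   are positive. *)
pose eps := Num.min (a / 2) 1.
have e0 : 0 < eps by rewrite lt_min divr_gt0/=.
have := rest_small_gt0 mn e0; set G := (X in P X) => PG.
rewrite /pinned_integral mule_gt0//; first by rewrite lte_fin invr_gt0 normr_gt0 freq_inj.
rewrite lt_neqAle integral_ge0 ?andbT; last first.
  by move=> u _; rewrite lee_fin mulr_ge0// pin_density_ge0.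
apply/negP => /eqP /esym h.
have mf : measurable_fun [set: borelHs s] (fun u : borelHs s =>
    (pin_density m n u (a, b) * 1)%:E).
  apply/measurable_EFinP; apply: measurable_funM; last exact: measurable_cst.
  by apply: (@measurable_pin_density R s m n _ (borelHs s) (fun u => u) (fun=> (a, b))) => //; exact: measurable_cst.
have := (ae_eq_integral_abs P measurableT mf).1.
rewrite (_ : (\int[P]_x `|_|)%E = 0%E); last first.
  rewrite -[RHS]h; apply: eq_integral => u _.
  by rewrite gee0_abs// lee_fin mulr_ge0// pin_density_ge0.
move=> /(_ erefl) hN.
have : P.-negligible G.
  case: hN => N [mN N0 hN]; exists N; split => // u [cu hm hp]; apply: hN => /= /(_ I).
  have hp1 : `|rest_momentum m n (u : Hs s)| < 1 by apply: lt_le_trans hp _; rewrite ge_min lexx orbT.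
  have hm1 : `|rest_mass m n (u : Hs s)| < a / 2 by apply: lt_le_trans hm _; rewrite ge_min lexx.
  have posd k' (p : R) : 0 < p -> 0 < mode_dens k' p.
    move=> p0; rewrite /mode_dens /expdens indicE mem_set ?mulr1; last by rewrite /= in_itv /= andbT.
    by rewrite mulr_gt0 ?expR_gt0// invr_gt0 mulr_gt0// invr_gt0 exprn_gt0// japanese_gt0.
  have m1 : 0 < mass1 m n (u : Hs s) (a, b).
    rewrite /mass1 bm /= divr_gt0//; last by rewrite opprK addr_gt0.
    move: hp1 hm1 ab n0; rewrite !ltr_norml => /andP[q1 q2] /andP[q3 q4] q5 q6.
    have := ler_norm b; have := ler_norm (- b); rewrite normrN; nra.
  have m2 : 0 < mass2 m n (u : Hs s) (a, b).
    rewrite /mass2 /mass1 bm /= (_ : _ - _ = (freq R n * (a - rest_mass m n (u : Hs s)) + (b - rest_momentum m n (u : Hs s))) / (freq R n - - freq R n)).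
      rewrite divr_gt0//; last by rewrite opprK addr_gt0.
      move: hp1 hm1 ab n0; rewrite !ltr_norml => /andP[q1 q2] /andP[q3 q4] q5 q6.
      have := ler_norm b; have := ler_norm (- b); rewrite normrN; nra.
    by field; rewrite opprK gt_eqF// addr_gt0.
  move=> /eqP; rewrite mulr1 eqe gt_eqF// /pin_density.
  apply: mulr_gt0; last by rewrite indicE mem_set.
  by apply: mulr_gt0; exact: posd.
by move=> /(negligibleP _ (measurable_rest_small _ _ _)) h0; rewrite -/G h0 ltxx in PG.
Qed.

End positivity.

(** * Exponential integrability of the L^p norm at bounded mass *)

Section dyadic_chaining.
Variables (R : realType) (f : R -> R[i]).
Implicit Types (d k m j N : nat) (x y : R).
Local Notation dy j k := (j%:R / 2 ^+ k : R).

Variables (q L : R).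
Hypotheses (q0 : 0 < q) (L0 : 0 <= L).
Hypothesis incr : forall k j, (j < 2 ^ k)%N ->
  normc (f (dy j.+1 k) - f (dy j k)) ^+ 2 <= q * 2 ^- k * (2 * k%:R + L).

(** A supersolution of the chaining recursion: (4/3) D(k + 1) + 4 q 2^-(k + 1) (2 (k + 1) + L) <=
    D(k). The constants 12 and 3 balance its k-terms and its constant terms exactly. *)
Let D k : R := 12 * q * 2 ^- k * (k%:R + 3 + L).

Let pow2_gt0 k : (0 : R) < 2 ^- k. Proof. by rewrite invr_gt0 exprn_gt0. Qed.

Let D_gt0 k : 0 < D k.
Proof.
apply: mulr_gt0; last by rewrite ltr_wpDr// ltr_wpDl.
by apply: mulr_gt0 => //; rewrite mulr_gt0.
Qed.

Let pow2S k : (2 : R) ^- k = 2 * 2 ^- k.+1.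
Proof. by rewrite exprS invfM mulrA divff// mul1r. Qed.

Let dyS j k : dy j.*2 k.+1 = dy j k.
Proof. by rewrite -muln2 natrM exprS; field; rewrite expf_neq0. Qed.

(** [j %/ 2 ^ d] is the ancestor of j at level k. The coarsest step is split off, with weights 4/3
    and 4 in the squared triangle inequality, so that the first factor is beaten by the halving of
    2^-k. *)
Lemma dyadic_chain d k j : (j < 2 ^ (k + d))%N ->
  normc (f (dy j (k + d)) - f (dy (j %/ 2 ^ d) k)) ^+ 2 <= D k.
Proof.
elim: d k j => [|d ih] k j; first by rewrite expn0 divn1 addn0 subrr normc0 expr0n ltW.
rewrite -addSnnS => jd; have := ih k.+1 j jd.
set i' := (j %/ 2 ^ d)%N; set x := dy j _ => h1.
have -> : (j %/ 2 ^ d.+1 = i' %/ 2)%N by rewrite expnSr divnMA.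
set i := (i' %/ 2)%N.
have i'lt : (i' < 2 ^ k.+1)%N by rewrite ltn_divLR ?expn_gt0// -expnD.
have h2 : normc (f (dy i' k.+1) - f (dy i k)) ^+ 2 <= q * 2 ^- k.+1 * (2 * k.+1%:R + L).
  have := divn_eq i' 2; rewrite -/i; have := ltn_pmod i' (isT : (0 < 2)%N).
  case: (i' %% 2)%N => [_ e|[_ e|//]].
    rewrite {1}e addn0 muln2 dyS subrr normc0 expr0n mulr_ge0 ?addr_ge0 ?mulr_ge0//.
    exact: ltW.
  (* An odd child lies one increment of level k + 1 to the right of its parent; an even child
     coincides with it. *)
  have := @incr k.+1 i.*2; rewrite -(dyS i) e addn1 muln2; apply.
  by apply: leq_ltn_trans i'lt; rewrite e muln2 leq_addr.
have t0 : (0 : R) < 1/3 by rewrite divr_gt0.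
have := @normc_sqrD R (f x - f (dy i' k.+1)) (f (dy i' k.+1) - f (dy i k)) (1/3) t0.
rewrite addrA subrK => h3; apply: (le_trans h3); move: h1 h2.
have kE : (k.+1%:R : R) = k%:R + 1 by rewrite natr1.
rewrite /D (pow2S k) kE; move: (normc _ ^+ 2) (normc (f x - f (dy i' k.+1)) ^+ 2) (pow2_gt0 k.+1) => B A.
move: (2 ^- k.+1) (k%:R : R) (ler0n R k) => e kk kk0 e0 hA hB.
have qe : 0 < q * e by rewrite mulr_gt0.
have -> : (1/3)^-1 = 3 :> R by field.
have h : (1 + 1/3) * A + (1 + 3) * B <= (1 + 1/3) * (12 * q * e * (kk + 1 + 3 + L)) + (1 + 3) * (q * e * (2 * (kk + 1) + L)).
  by apply: lerD; rewrite ler_wpM2l//; lra.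
apply: (le_trans h); rewrite -subr_ge0.
rewrite [X in 0 <= X](_ : _ = q * e * 4 * L); last by field.
by rewrite !mulr_ge0// ltW.
Qed.

(** The Lipschitz constant serves to reach non-dyadic points and drops out of the conclusions, which
    have to be uniform over truncations. *)
Variables (lip M : R).
Hypotheses (lip0 : 0 <= lip) (f_lip : forall x y, normc (f x - f y) <= lip * `|x - y|).

Let fl x k := Num.truncn (x * 2 ^+ k).

Let fl_itv x k : 0 <= x -> dy (fl x k) k <= x < dy (fl x k).+1 k.
Proof.
move=> x0; have := @truncn_itv _ (x * 2 ^+ k); rewrite mulr_ge0 ?exprn_ge0// => /(_ isT).
by rewrite -/(fl x k) ler_pdivrMr ?exprn_gt0// ltr_pdivlMr ?exprn_gt0.
Qed.

Let fl_lt x k : 0 <= x < 1 -> (fl x k < 2 ^ k)%N.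
Proof.
move=> /andP[x0 x1]; rewrite /fl truncn_lt_nat ?mulr_ge0 ?exprn_ge0//.
by rewrite natrX -[ltRHS]mul1r ltr_pM2r// exprn_gt0.
Qed.

Let fl_div x k d : 0 <= x -> (fl x (k + d) %/ 2 ^ d)%N = fl x k.
Proof.
move=> x0; apply/esym/eqP; rewrite truncn_eq ?mulr_ge0 ?exprn_ge0//.
have := @truncn_itv _ (x * 2 ^+ (k + d)); rewrite mulr_ge0 ?exprn_ge0// => /(_ isT).
rewrite -/(fl x (k + d)) exprD => /andP[h1 h2].
have p0 : (0 : R) < 2 ^+ d by rewrite exprn_gt0.
set n := fl x (k + d) in h1 h2 *.
apply/andP; split.
  rewrite -(ler_pM2r p0); apply: (@le_trans _ _ n%:R); last by rewrite -mulrA.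
  by rewrite -natrX -natrM ler_nat leq_trunc_div.
rewrite -(ltr_pM2r p0); apply: (@lt_le_trans _ _ n.+1%:R); first by rewrite -mulrA.
by rewrite -natrX -natrM ler_nat ltn_ceil// expn_gt0.
Qed.

Lemma dyadic_osc x m : 0 <= x < 1 -> normc (f x - f (dy (fl x m) m)) ^+ 2 <= 3 * D m.
Proof.
move=> x01; have /andP[x0 x1] := x01.
(* A level so fine that the Lipschitz error costs at most one more [D m] besides the 2 [D m] of the
   chain. *)
have [d hd] : exists d, 2 * (lip * 2 ^- (m + d)) ^+ 2 <= D m.
  pose d := (Num.truncn (2 * lip ^+ 2 / D m)).+1; exists d.
  have hd : 2 * lip ^+ 2 / D m < d%:R by exact: truncnS_gt.
  have d2 : (d%:R : R) <= 2 ^+ d by rewrite -natrX ler_nat ltnW// ltn_expl.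
  have e1 : (2 : R) ^- (m + d) ^+ 2 <= 2 ^- d.
    rewrite exprD invfM; have : (2 : R) ^- m <= 1 by rewrite invf_le1 ?exprn_gt0// exprn_ege1// ler1n.
    have : (2 : R) ^- d <= 1 by rewrite invf_le1 ?exprn_gt0// exprn_ege1// ler1n.
    move: (2 ^- m) (2 ^- d) (pow2_gt0 m) (pow2_gt0 d) => u v u0 v0 v1 u1.
    have uv : u * v <= v by rewrite ler_piMl// ltW.
    have uv0 : 0 < u * v by rewrite mulr_gt0.
    nra.
  rewrite exprMn mulrA; apply: (@le_trans _ _ (2 * lip ^+ 2 * 2 ^- d)).
    by rewrite ler_wpM2l// mulr_ge0 ?sqr_ge0.
  rewrite ler_pdivrMr ?exprn_gt0// [D m * _]mulrC -ler_pdivrMr ?D_gt0//.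
  by apply: le_trans d2; exact: ltW.
have h1 := @dyadic_chain d m (fl x (m + d)) (fl_lt _ x01).
rewrite fl_div// in h1.
have /andP[b1 b2] := fl_itv (m + d) x0; set z := dy (fl x (m + d)) (m + d) in h1 b1.
have h2 : normc (f x - f z) ^+ 2 <= (lip * 2 ^- (m + d)) ^+ 2.
  rewrite lerXn2r ?nnegrE ?normc_ge0 ?mulr_ge0 ?(ltW (pow2_gt0 _))//.
  apply: (le_trans (f_lip _ _)); rewrite ler_wpM2l// ger0_norm ?subr_ge0//.
  by rewrite lerBlDl; apply: (le_trans (ltW b2)); rewrite -natr1 mulrDl mul1r.
have := @normc_sqrD R (f x - f z) (f z - f (dy (fl x m) m)) 1 ltr01.
rewrite addrA subrK invr1 => h3; lra.
Qed.

Hypothesis mf : measurable_fun [set: R] (fun x => normc (f x) ^+ 2).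
Hypothesis fM : (\int[@lebesgue_measure R]_(x in `[0%R, 1%R]) (normc (f x) ^+ 2)%:E <= M%:E)%E.

(** On the dyadic interval of length 2^-m around x the oscillation is controlled by [D m], so |f|^2
    is at least (|f(x)|^2 - 24 D(m)) / 2 there, and its integral is at most M. *)
Lemma dyadic_sup_level x m : 0 <= x < 1 ->
  normc (f x) ^+ 2 <= 2 * 2 ^+ m * M + 24 * D m.
Proof.
move=> x01; have /andP[x0 x1] := x01.
pose i := fl x m; pose I : set R := `[dy i m, dy i.+1 m[%classic.
have i1 : dy i.+1 m <= 1.
  by rewrite ler_pdivrMr ?exprn_gt0// mul1r -natrX ler_nat fl_lt.
have i0 : 0 <= dy i m by rewrite divr_ge0 ?exprn_ge0.
have hy y : I y -> normc (f x) ^+ 2 <= 2 * normc (f y) ^+ 2 + 24 * D m.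
  rewrite /I /= in_itv /= => /andP[y1 y2].
  have y0 : 0 <= y by exact: le_trans y1.
  have y01 : 0 <= y < 1 by rewrite y0 (lt_le_trans y2).
  have fy : fl y m = i.
    apply/eqP; rewrite truncn_eq ?mulr_ge0 ?exprn_ge0//.
    by rewrite -ler_pdivrMr ?exprn_gt0// y1 -ltr_pdivlMr ?exprn_gt0.
  have h1 := dyadic_osc m x01; have h2 := dyadic_osc m y01; rewrite fy -/i in h1 h2.
  rewrite -/i in h1; set c := f (dy i m) in h1 h2.
  have h3 := @normc_sqrD R (f x - c) (c - f y) 1 ltr01.
  have h4 := @normc_sqrD R (f x - f y) (f y) 1 ltr01.
  have h5 : normc (c - f y) = normc (f y - c) by rewrite -normcN opprB.
  rewrite addrA subrK invr1 h5 in h3; rewrite subrK invr1 in h4; lra.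
pose r : R := (normc (f x) ^+ 2 - 24 * D m) / 2.
have [r0|r0] := leP r 0.
  have M0 : 0 <= M.
    by rewrite -lee_fin; apply: le_trans fM; apply: integral_ge0 => t _; rewrite lee_fin sqr_ge0.
  have : 0 <= 2 * 2 ^+ m * M by rewrite !mulr_ge0 ?exprn_ge0.
  rewrite /r in r0; lra.
have mI : measurable I by exact: measurable_itv.
have hI : ((r * 2 ^- m)%:E <= M%:E)%E.
  apply: (le_trans _ fM).
  apply: (@le_trans _ _ (\int[@lebesgue_measure R]_(t in I) (normc (f t) ^+ 2)%:E)%E); last first.
    apply: ge0_subset_integral => //.
    - by apply/measurable_EFinP; apply: measurable_funTS.
    - by move=> t _; rewrite lee_fin sqr_ge0.
    - move=> t; rewrite /I /= !in_itv /= => /andP[t1 t2].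
      by rewrite (le_trans i0 t1) (le_trans (ltW t2)).
  apply: (@le_trans _ _ (\int[@lebesgue_measure R]_(t in I) r%:E)%E).
    rewrite integral_cst// [X in (_ * X)%E]lebesgue_measure_itv /= lte_fin.
    rewrite ltr_pM2r ?invr_gt0 ?exprn_gt0// ltr_nat ltnSn -EFinB -EFinM lee_fin.
    by rewrite -mulrBl -natrB// subSnn mul1r.
  apply: ge0_le_integral => //.
  - by move=> t _; rewrite lee_fin ltW.
  - by apply/measurable_EFinP; apply: measurable_funTS.
  - move=> t It; rewrite lee_fin /r; have := hy t It; lra.
rewrite lee_fin ler_pdivrMr ?exprn_gt0// /r in hI; lra.
Qed.

End dyadic_chaining.

(* The level m is chosen with 4^m of the order of (1 + L) / M. *)
Lemma optimize_level (R : realType) (S c M L : R) : 0 <= S -> 0 <= c -> 0 < M -> 0 <= L ->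
  (forall m : nat, S <= 2 * 2 ^+ m * M + c * 2 ^- m * (m%:R + 3 + L)) ->
  S ^+ 2 <= (48 + 3 * c ^+ 2) * (M * L) + (((2 + 3 * c) * M) ^+ 2 + 48 * M + 27 * c ^+ 2).
Proof.
move=> S0 c0 M0 L0 hS.
have ex : exists m : nat, 1 + L <= (2 ^+ m) ^+ 2 * M.
  pose m := (Num.truncn ((1 + L) / M)).+1; exists m.
  have h1 : (1 + L) / M < m%:R by exact: truncnS_gt.
  have h2 : (m%:R : R) <= 2 ^+ m by rewrite -natrX ler_nat ltnW// ltn_expl.
  have h3 : (1 : R) <= 2 ^+ m by rewrite exprn_ege1// ler1n.
  rewrite -ler_pdivrMr//; apply: (le_trans (ltW h1)); apply: (le_trans h2).
  by rewrite expr2 ler_peMl// (le_trans _ h3).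
have : exists m : nat, 1 + L <= (2 ^+ m) ^+ 2 * M /\ (m = 0%N \/ (2 ^+ m) ^+ 2 * M <= 4 * (1 + L)).
  exists (ex_minn ex); case: ex_minnP => m hm hmin; split => //.
  case: m hm hmin => [|m] hm hmin; [by left|right].
  have : ~~ (1 + L <= (2 ^+ m) ^+ 2 * M) by apply/negP => /hmin; rewrite ltnn.
  rewrite -ltNge => h; have -> : (2 ^+ m.+1) ^+ 2 * M = 4 * ((2 ^+ m) ^+ 2 * M) by rewrite (exprS (2 : R) m); ring.
  by rewrite ler_wpM2l// ltW.
move=> [m [h1 h2]]; have := hS m => {hS}.
have m3 : (m%:R + 3 : R) <= 3 * 2 ^+ m.
  rewrite -natrX -natrD -natrM ler_nat; elim: (m) => [//|k ih].
  by rewrite expnS; move: ih; set p := (2 ^ k)%N => ih; lia.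
have v0 : (0 : R) < 2 ^+ m by rewrite exprn_gt0.
(* At level 0 the choice of m says 1 + L <= M, and S is bounded by a multiple of M. *)
case: h2 => [m0|h2].
  rewrite m0 !expr0 invr1 !mulr1 add0r => h; move: h1; rewrite m0 expr0 expr1n mul1r => h1.
  have hh : S <= (2 + 3 * c) * M.
    have : c * (3 + L) <= c * (3 * M) by rewrite ler_wpM2l//; lra.
    lra.
  have h4 : S ^+ 2 <= ((2 + 3 * c) * M) ^+ 2 by rewrite lerXn2r ?nnegrE// (le_trans S0).
  have h5 : 0 <= (48 + 3 * c ^+ 2) * (M * L) by apply: mulr_ge0; [have := sqr_ge0 c; lra|rewrite mulr_ge0// ltW].
  have h6 : 0 <= 27 * c ^+ 2 by rewrite mulr_ge0 ?sqr_ge0.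
  lra.
move: h1 h2 m3; move: (2 ^+ m : R) v0 (m%:R : R) => v v0 k h1 h2 h3 h4.
have h5 : S <= 2 * v * M + 3 * c + c * (L / v).
  apply: (le_trans h4); rewrite -[leRHS]addrA lerD2l.
  have -> : c / v * (k + 3 + L) = c * ((k + 3) / v) + c * (L / v) by ring.
  by rewrite lerD2r mulrC ler_wpM2r// ler_pdivrMr.
have h6 : (L / v) ^+ 2 <= M * L.
  rewrite expr_div_n ler_pdivrMr ?exprn_gt0// expr2 (_ : M * L * _ = (v ^+ 2 * M) * L); last by ring.
  by rewrite ler_wpM2r//; lra.
have h7 : (2 * v * M) ^+ 2 <= 16 * (1 + L) * M.
  rewrite (_ : _ ^+ 2 = 4 * (v ^+ 2 * M) * M); last by ring.
  by rewrite ler_wpM2r ?(ltW M0)//; lra.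
have w0 : 0 <= L / v by rewrite divr_ge0// ltW.
have h8 : S ^+ 2 <= 3 * ((2 * v * M) ^+ 2 + (3 * c) ^+ 2 + (c * (L / v)) ^+ 2).
  apply: (@le_trans _ _ ((2 * v * M + 3 * c + c * (L / v)) ^+ 2)).
    by rewrite lerXn2r ?nnegrE// (le_trans S0).
  have := sqr_ge0 (2 * v * M - 3 * c); have := sqr_ge0 (2 * v * M - c * (L / v)).
  have := sqr_ge0 (3 * c - c * (L / v)); lra.
have h9 : (c * (L / v)) ^+ 2 <= c ^+ 2 * (M * L) by rewrite exprMn ler_wpM2l ?sqr_ge0.
have h10 : 0 <= ((2 + 3 * c) * M) ^+ 2 by exact: sqr_ge0.
lra.
Qed.

(** For p < 6, t^(p - 2) is at most eta t^4 above the point T with T^(p - 6) = eta, and bounded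
    below it. At p = 6 the powers coincide and eta cannot be made small: the origin of the smallness
    of a. *)
Lemma powR_interpolate (R : realType) (p eta : R) : 2 < p -> p <= 6 -> 0 < eta -> (p = 6 -> 1 <= eta) ->
  exists2 C, 0 <= C & forall t, 0 <= t -> t `^ p <= t ^+ 2 * (eta * t ^+ 4 + C).
Proof.
move=> p2 p6 e0 he; have [p6'|np6] := eqVneq p 6.
  exists 0 => // t t0; rewrite addr0 mulrCA -exprD p6' powR_mulrn//.
  by rewrite ler_peMl ?exprn_ge0//; exact: he.
have {}p6 : p < 6 by rewrite lt_neqAle np6.
pose T : R := eta `^ (p - 6)^-1.
have T0 : 0 < T by rewrite powR_gt0.
have Te : T `^ (p - 6) = eta by rewrite -powRrM mulVf ?powRr1 ?ltW// lt_eqF// subr_lt0.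
exists (T `^ (p - 2)); first exact: powR_ge0.
move=> t; rewrite le_eqVlt => /orP[/eqP <-|t0].
  by rewrite powR0 ?expr0n ?mul0r// gt_eqF// (lt_trans _ p2).
have tD r1 r2 : t `^ r1 * t `^ r2 = t `^ (r1 + r2) by rewrite powRD// (gt_eqF t0) implybT.
have -> : t `^ p = t ^+ 2 * t `^ (p - 2).
  by rewrite -(powR_mulrn 2 (ltW t0)) tD addrC subrK.
rewrite ler_wpM2l ?sqr_ge0//; have [tT|Tt] := leP t T.
  apply: (@le_trans _ _ (T `^ (p - 2))).
    by apply: ge0_ler_powR => //; rewrite ?nnegrE ?ltW// subr_gt0.
  by rewrite lerDr mulr_ge0 ?exprn_ge0 ?ltW.
apply: ler_wpDr; first exact: powR_ge0.
have -> : t `^ (p - 2) = t `^ (p - 6) * t ^+ 4.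
  rewrite -(powR_mulrn 4 (ltW t0)) tD; congr (_ `^ _); ring.
rewrite ler_wpM2r ?exprn_ge0 ?(ltW t0)// -Te.
rewrite -[p - 6]opprK !(powRN _ (- (p - 6))) lef_pV2 ?posrE ?powR_gt0//.
by apply: ge0_ler_powR; rewrite ?nnegrE ?ltW// oppr_gt0 subr_lt0.
Qed.

Lemma integral_expR_gaussian1 (R : realType) (t : R) :
  (\int[@gaussian1 R]_x (expR (t * x))%:E = (expR (t ^+ 2 / 2))%:E)%E.
Proof.
have mE : measurable_fun [set: R] (fun x : R => (expR (t * x))%:E).
  by apply/measurable_EFinP; apply: measurableT_comp => //; exact: measurable_funM.
have E0 x : (0 <= (expR (t * x))%:E)%E by rewrite lee_fin expR_ge0.
by rewrite -integral_expR_normal (integral_normal_prob01 mE E0) (integral_gaussian1 mE E0).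
Qed.

Lemma integral_expR_sqr_gaussian1 (R : realType) :
  (\int[@gaussian1 R]_x (expR (x ^+ 2 / 4))%:E = (Num.sqrt 2)%:E)%E.
Proof.
have mE : measurable_fun [set: R] (fun x : R => (expR (x ^+ 2 / 4))%:E).
  by apply/measurable_EFinP; apply: measurableT_comp => //; apply: measurable_funM => //; exact: measurable_funX.
have E0 (x : R) : (0 <= (expR (x ^+ 2 / 4))%:E)%E by rewrite lee_fin expR_ge0.
by rewrite -integral_expR_sqr_normal (integral_normal_prob01 mE E0) (integral_gaussian1 mE E0).
Qed.

Lemma gaussian2_mgf (R : realType) (a b : R) :
  (\int[gaussian2 R]_z (expR (a * z.1 + b * z.2))%:E = (expR ((a ^+ 2 + b ^+ 2) / 2))%:E)%E.
Proof.
have mE (c : R) : measurable_fun [set: R] (fun x : R => (expR (c * x))%:E).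
  by apply/measurable_EFinP; apply: measurableT_comp => //; exact: measurable_funM.
pose F (z : R * R) : \bar R := (expR (a * z.1 + b * z.2))%:E.
have mF : measurable_fun [set: R * R] F.
  apply/measurable_EFinP; apply: measurableT_comp => //; apply: measurable_funD; apply: measurable_funM => //.
have F0 z : (0 <= F z)%E by rewrite lee_fin expR_ge0.
rewrite -[LHS]/(\int[(@gaussian1 R \x @gaussian1 R)%E]_z F z)%E.
rewrite (@fubini_tonelli1 _ _ _ _ _ (@gaussian1 R) (@gaussian1 R) F mF F0) /fubini_F.
transitivity (\int[@gaussian1 R]_x ((expR (b ^+ 2 / 2))%:E * (expR (a * x))%:E))%E.
  apply: eq_integral => x _; rewrite /F /=.
  transitivity (\int[@gaussian1 R]_y ((expR (a * x))%:E * (expR (b * y))%:E))%E.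
    by apply: eq_integral => y _; rewrite -EFinM -expRD.
  rewrite (@ge0_integralZl _ _ _ (@gaussian1 R) setT measurableT _ (mE b)); last 2 first.
  - by move=> y _; rewrite lee_fin expR_ge0.
  - by rewrite lee_fin expR_ge0.
  by rewrite integral_expR_gaussian1 muleC.
rewrite (@ge0_integralZl _ _ _ (@gaussian1 R) setT measurableT _ (mE a)); last 2 first.
- by move=> y _; rewrite lee_fin expR_ge0.
- by rewrite lee_fin expR_ge0.
rewrite integral_expR_gaussian1 -EFinM -expRD; congr (expR _)%:E; by field.
Qed.

(** * Exponential moments of Gaussian linear forms *)

Section gaussian_linear_forms.
Variables (R : realType) (s : R) (P : probability (borelHs s) R).
Hypothesis wP : wiener P.
Implicit Types (u : Hs s) (S : seq int) (al be : int -> R) (t c : R).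
Local Notation J n := (japanese R n).

Definition lin_form S al be u : R := \sum_(n <- S) (al n * (coef n u).1 + be n * (coef n u).2).
Definition form_var S al be : R := \sum_(n <- S) (al n ^+ 2 + be n ^+ 2).

Lemma measurable_lin_form S al be :
  measurable_fun [set: borelHs s] (lin_form S al be : borelHs s -> R).
Proof.
apply: measurable_sum => n; apply: measurable_funD; apply: measurable_funM; try exact: measurable_cst.
  exact: (measurableT_comp measurable_fst (measurable_coef n)).
exact: (measurableT_comp measurable_snd (measurable_coef n)).
Qed.

Lemma lin_form_mgf S al be t : uniq S ->
  (\int[P]_u (expR (t * lin_form S al be (u : Hs s)))%:E = (expR (t ^+ 2 * form_var S al be / 2))%:E)%E.
Proof.
have mE L : measurable_fun [set: borelHs s] (fun u : borelHs s => (expR (t * lin_form L al be (u : Hs s)))%:E).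
  apply/measurable_EFinP; apply: measurableT_comp => //; apply: measurable_funM; first exact: measurable_cst.
  exact: measurable_lin_form.
have E0 L (u : borelHs s) : (0 <= (expR (t * lin_form L al be (u : Hs s)))%:E)%E by rewrite lee_fin expR_ge0.
elim: S => [_|n S ih /= /andP[nS uS]].
  rewrite /form_var big_nil mulr0 mul0r expR0.
  under eq_integral do rewrite /lin_form big_nil mulr0 expR0.
  by rewrite (integral_cst P measurableT 1) mul1e [LHS]probability_setT.
rewrite (resample n wP (mE (n :: S)) (E0 (n :: S))).
transitivity (\int[P]_u ((expR (((t * al n) ^+ 2 + (t * be n) ^+ 2) / 2))%:E *
   (expR (t * lin_form S al be (u : Hs s)))%:E))%E.
  apply: eq_integral => u _.
  have mG : measurable_fun [set: R * R] (fun z : R * R => (expR (t * al n * z.1 + t * be n * z.2))%:E).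
    apply/measurable_EFinP; apply: measurableT_comp => //; apply: measurable_funD; apply: measurable_funM => //.
  rewrite -gaussian2_mgf muleC -(@ge0_integralZl _ _ _ (gaussian2 R) setT measurableT _ mG); last 2 first.
  - by move=> z _; rewrite lee_fin expR_ge0.
  - by rewrite lee_fin expR_ge0.
  apply: eq_integral => z _; rewrite -EFinM -expRD; congr (expR _)%:E.
  rewrite /lin_form big_cons coef_set_mode eqxx (eq_big_seq (fun k => al k * (coef k u).1 + be k * (coef k u).2)).
    by ring.
  move=> k kS; rewrite coef_set_mode; case: eqVneq => // nk; by rewrite nk kS in nS.
rewrite (@ge0_integralZl _ _ _ P setT measurableT _ (mE S)); last 2 first.
- by move=> u _; exact: E0.
- by rewrite lee_fin expR_ge0.
rewrite ih// -EFinM -expRD /form_var big_cons; congr (expR _)%:E.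
by move: (\sum_(j <- S) _) => X; field.
Qed.

(* exp(c l^2) is the average of exp(sqrt(2c) x l) over a standard normal x *)
Lemma lin_form_exp_sqr S al be c : uniq S -> 0 <= c -> 4 * (c * form_var S al be) <= 1 ->
  (\int[P]_u (expR (c * lin_form S al be (u : Hs s) ^+ 2))%:E <= 2%:E)%E.
Proof.
move=> uS c0 hc.
pose r : R := Num.sqrt (2 * c).
have r2 : r ^+ 2 = 2 * c by rewrite sqr_sqrtr// mulr_ge0.
pose F (w : borelHs s * R) : \bar R := (expR ((r * w.2) * lin_form S al be (w.1 : Hs s)))%:E.
have mF : measurable_fun [set: borelHs s * R] F.
  apply/measurable_EFinP; apply: measurableT_comp => //; apply: measurable_funM.
    by apply: measurable_funM; [exact: measurable_cst|exact: measurable_snd].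
  exact: (measurableT_comp (measurable_lin_form S al be) measurable_fst).
have F0 w : (0 <= F w)%E by rewrite lee_fin expR_ge0.
have -> : (\int[P]_u (expR (c * lin_form S al be (u : Hs s) ^+ 2))%:E =
    \int[P]_u \int[@gaussian1 R]_x F (u, x))%E.
  apply: eq_integral => u _; rewrite /F /=.
  under eq_integral do rewrite mulrAC.
  rewrite integral_expR_gaussian1; congr (expR _)%:E.
  by rewrite exprMn r2; field.
have := (@fubini_tonelli _ _ _ _ _ P (@gaussian1 R) F mF F0) => ->.
apply: (@le_trans _ _ (\int[@gaussian1 R]_x (expR (x ^+ 2 / 4))%:E)%E).
  apply: ge0_le_integral => //.
  - by move=> x _; apply: integral_ge0 => u _; exact: F0.
  - exact: (@measurable_fun_fubini_tonelli_G _ _ _ _ _ P F mF F0).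
  - by apply/measurable_EFinP; apply: measurableT_comp => //; apply: measurable_funM => //; exact: measurable_funX.
  - move=> x _; rewrite /F /= lin_form_mgf// lee_fin ler_expR exprMn r2.
    have := sqr_ge0 x; move: (form_var S al be) hc (x ^+ 2) => v hv y y0.
    by have : y * (4 * (c * v)) <= y * 1; [rewrite ler_wpM2l|lra].
rewrite integral_expR_sqr_gaussian1 lee_fin.
by rewrite -(ler_pXn2r (isT : (0 < 2)%N)) ?nnegrE ?sqrtr_ge0// sqr_sqrtr//; lra.
Qed.

(** The real and imaginary parts of the sum are real linear forms in the Gaussian coefficients, of
    equal variance. *)
Lemma fourier_sum_forms S (dl : int -> R[i]) : exists a1 b1 a2 b2,
  [/\ forall u, normc (\sum_(n <- S) fourier u n * dl n) ^+ 2 =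
         lin_form S a1 b1 u ^+ 2 + lin_form S a2 b2 u ^+ 2,
      form_var S a1 b1 = \sum_(n <- S) normc (dl n) ^+ 2 / J n ^+ 2 &
      form_var S a2 b2 = \sum_(n <- S) normc (dl n) ^+ 2 / J n ^+ 2].
Proof.
pose a1 n := complex.Re (dl n) / J n; pose b1 n := - complex.Im (dl n) / J n.
pose a2 n := complex.Im (dl n) / J n; pose b2 n := complex.Re (dl n) / J n.
have reE (T : seq int) (F : int -> R[i]) : complex.Re (\sum_(n <- T) F n) = \sum_(n <- T) complex.Re (F n).
  by elim: T => [|n T ih]; rewrite ?big_nil// !big_cons -ih; case: (F n) (\sum_(j <- T) F j) => [? ?] [? ?].
have imE (T : seq int) (F : int -> R[i]) : complex.Im (\sum_(n <- T) F n) = \sum_(n <- T) complex.Im (F n).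
  by elim: T => [|n T ih]; rewrite ?big_nil// !big_cons -ih; case: (F n) (\sum_(j <- T) F j) => [? ?] [? ?].
have E u : normc (\sum_(n <- S) fourier u n * dl n) ^+ 2 =
    lin_form S a1 b1 u ^+ 2 + lin_form S a2 b2 u ^+ 2.
  rewrite normc_sqr reE imE; congr (_ ^+ 2 + _ ^+ 2); apply: eq_bigr => n _.
    rewrite -{1}(coefK n u) /mode_of /a1 /b1; case: (coef n u) (dl n) => [x y] [x' y'].
    by rewrite /=; ring.
  rewrite -{1}(coefK n u) /mode_of /a2 /b2; case: (coef n u) (dl n) => [x y] [x' y'].
  by rewrite /=; ring.
have v1 : form_var S a1 b1 = \sum_(n <- S) normc (dl n) ^+ 2 / J n ^+ 2.
  by apply: eq_bigr => n _; rewrite normc_sqr /a1 /b1; field; rewrite gt_eqF ?japanese_gt0.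
have v2 : form_var S a2 b2 = \sum_(n <- S) normc (dl n) ^+ 2 / J n ^+ 2.
  by apply: eq_bigr => n _; rewrite normc_sqr /a2 /b2; field; rewrite gt_eqF ?japanese_gt0.
by exists a1, b1, a2, b2; split.
Qed.

Lemma measurable_fourier_sum S (dl : int -> R[i]) : measurable_fun [set: borelHs s]
  (fun u : borelHs s => normc (\sum_(n <- S) fourier (u : Hs s) n * dl n) ^+ 2).
Proof.
have [a1 [b1 [a2 [b2 [E _ _]]]]] := fourier_sum_forms S dl.
rewrite (_ : (fun u : borelHs s => _) = (fun u : borelHs s =>
  lin_form S a1 b1 (u : Hs s) ^+ 2 + lin_form S a2 b2 (u : Hs s) ^+ 2)); last by apply/funext => u; exact: E.
by apply: measurable_funD; apply: measurable_funX; exact: measurable_lin_form.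
Qed.

(** exp(c (x + y)) <= (exp(2 c x) + exp(2 c y)) / 2 separates the two linear forms without using
    their independence; doubling c turns the 4 of [lin_form_exp_sqr] into 8. *)
Lemma trunc_increment_exp S (dl : int -> R[i]) c : uniq S -> 0 <= c ->
  8 * (c * \sum_(n <- S) normc (dl n) ^+ 2 / J n ^+ 2) <= 1 ->
  (\int[P]_u (expR (c * normc (\sum_(n <- S) fourier (u : Hs s) n * dl n) ^+ 2))%:E <= 2%:E)%E.
Proof.
move=> uS c0 hc.
have [a1 [b1 [a2 [b2 [E v1 v2]]]]] := fourier_sum_forms S dl.
pose G a b (u : borelHs s) : \bar R := (expR (2 * c * lin_form S a b (u : Hs s) ^+ 2))%:E.
have mG a b : measurable_fun [set: borelHs s] (G a b).
  apply/measurable_EFinP; apply: measurableT_comp => //; apply: measurable_funM; first exact: measurable_cst.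
  by apply: measurable_funX; exact: measurable_lin_form.
have G0 a b u : (0 <= G a b u)%E by rewrite lee_fin expR_ge0.
have c2 : 0 <= 2 * c by rewrite mulr_ge0.
apply: (@le_trans _ _ (\int[P]_u (2^-1%:E * (G a1 b1 u + G a2 b2 u)))%E).
  apply: ge0_le_integral.
  - exact: measurableT.
  - by move=> u _; rewrite lee_fin expR_ge0.
  - apply/measurable_EFinP; apply: measurableT_comp => //; apply: measurable_funM; first exact: measurable_cst.
    exact: measurable_fourier_sum.
  - apply: emeasurable_funM; first exact: measurable_cst.
    exact: emeasurable_funD.
  - move=> u _; rewrite E /G -EFinD -EFinM lee_fin.
    move: (lin_form S a1 b1 _ ^+ 2) (lin_form S a2 b2 _ ^+ 2) => x y.
    have -> : 2 * c * x = c * x + c * x by ring.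
    have -> : 2 * c * y = c * y + c * y by ring.
    rewrite mulrDr !expRD; have := sqr_ge0 (expR (c * x) - expR (c * y)); lra.
rewrite (@ge0_integralZl _ _ _ P setT measurableT); last 3 first.
- exact: emeasurable_funD.
- by move=> u _; apply: adde_ge0; exact: G0.
- by rewrite lee_fin invr_ge0.
rewrite (@ge0_integralD _ _ _ P setT measurableT (G a1 b1) (G a2 b2)); last 4 first.
- by move=> u _; exact: G0.
- exact: mG.
- by move=> u _; exact: G0.
- exact: mG.
apply: (@le_trans _ _ (2^-1%:E * (2%:E + 2%:E))%E).
  apply: lee_wpmul2l; first by rewrite lee_fin invr_ge0.
  by apply: leeD; apply: lin_form_exp_sqr => //; rewrite ?v1 ?v2; lra.
by rewrite -EFinD -EFinM lee_fin; lra.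
Qed.

End gaussian_linear_forms.

(** * Variance of the increments of the Gaussian series *)

Section exponential_increments.
Variable R : realType.
Implicit Types (n : int) (x y h : R) (S : seq int).
Local Notation J n := (japanese R n).

Lemma sin_cos_lipschitz (a b : R) : (sin a - sin b) ^+ 2 <= (a - b) ^+ 2 /\ (cos a - cos b) ^+ 2 <= (a - b) ^+ 2.
Proof.
wlog ba : a b / b <= a.
  move=> H; have [|/ltW ab] := leP b a; first exact: H.
  have [h1 h2] := H _ _ ab; split.
    by rewrite -[leLHS]sqrrN -[leRHS]sqrrN !opprB.
  by rewrite -[leLHS]sqrrN -[leRHS]sqrrN !opprB.
have key (f df : R -> R) : (forall t : R, is_derive t 1 f (df t)) -> (forall t, `|df t| <= 1) ->
    (f a - f b) ^+ 2 <= (a - b) ^+ 2.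
  move=> fd d1; have [|c _ ->] := @MVT_segment R f df b a ba (fun t _ => fd t).
  - apply: continuous_subspaceT => t; apply: differentiable_continuous; apply/derivable1_diffP.
    by case: (fd t).
  - rewrite exprMn ler_piMl ?sqr_ge0// -(real_normK (num_real (df c))).
    by rewrite expr_le1.
split; first by apply: (key _ cos) => t; exact: cos_max.
by apply: (key _ (fun t => - sin t)) => t; rewrite normrN sin_max.
Qed.

Lemma expi_sqrB_le n x y : normc (expi n x - expi n y) ^+ 2 <= 2 * (freq R n * (x - y)) ^+ 2.
Proof.
rewrite normc_sqr /=; have [] := sin_cos_lipschitz (freq R n * x) (freq R n * y).
rewrite -mulrBr; lra.
Qed.

Lemma increment_term_le n x y :
  normc (expi n x - expi n y) ^+ 2 / J n ^+ 2 <= 2 * (x - y) ^+ 2 /\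
  (n != 0 -> normc (expi n x - expi n y) ^+ 2 / J n ^+ 2 <= (`|n|%N%:R ^+ 2)^-1).
Proof.
have J2 : J n ^+ 2 = 1 + freq R n ^+ 2 by rewrite /japanese sqr_sqrtr// addr_ge0 ?sqr_ge0.
have J0 : 0 < J n ^+ 2 by rewrite J2 ltr_pwDl ?sqr_ge0.
have h := expi_sqrB_le n x y; have f0 := sqr_ge0 (freq R n).
split.
  rewrite ler_pdivrMr// (le_trans h)// exprMn J2; have := sqr_ge0 (x - y); lra.
move=> n0; have h4 : normc (expi n x - expi n y) ^+ 2 <= 4.
  have := @normc_sqrD R (expi n x) (- expi n y) 1 ltr01.
  rewrite invr1 normcN !normc_expi expr1n; lra.
have nn : (0 : R) < `|n|%N%:R ^+ 2 by rewrite exprn_gt0// ltr0n absz_gt0.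
rewrite ler_pdivrMr// ler_pdivlMl// J2 (le_trans (ler_wpM2l (ltW nn) h4))//.
have -> : freq R n ^+ 2 = 4 * pi ^+ 2 * (`|n|%N%:R ^+ 2).
  have -> : (`|n|%N%:R ^+ 2 : R) = n%:~R ^+ 2 by rewrite -[RHS]real_normK ?num_real// -intr_norm -abszE -pmulrn.
  by rewrite /freq; ring.
have p1 : (1 : R) <= pi ^+ 2 by rewrite exprn_ege1//; have := @pi_ge2 R; lra.
have : 4 * `|n|%N%:R ^+ 2 * 1 <= 4 * `|n|%N%:R ^+ 2 * (pi ^+ 2) :> R by rewrite ler_wpM2l// mulr_ge0// ltW.
lra.
Qed.

(** Up to |n| = H the constant bound gives at most (2H + 1) 2 / H^2 <= 6 / H; beyond H the sum of 1
    / n^2 telescopes to at most 2 / H. *)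
Lemma sum_freqs_min_le (F : int -> R) (H K : nat) : (0 < H)%N ->
  (forall n, 0 <= F n) -> (forall n, F n <= 2 * (H%:R^-1) ^+ 2) ->
  (forall n, n != 0 -> F n <= (`|n|%N%:R ^+ 2)^-1) ->
  \sum_(n <- freqs K) F n <= 8 * H%:R^-1.
Proof.
move=> H0 F0 F1 F2; have h0 : (0 : R) < H%:R by rewrite ltr0n.
have hA k : \sum_(n <- freqs k) F n <= (2 * k%:R + 1) * (2 * (H%:R^-1) ^+ 2).
  elim: k => [|k ih].
    rewrite (_ : freqs 0 = [:: 0]) ?big_seq1 ?mulr0 ?add0r ?mul1r//.
    by rewrite /freqs enum_ordSl /= enum_ord0.
  rewrite big_freqsS -natr1; have := F1 k.+1%:Z; have := F1 (- k.+1%:Z); lra.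
have hH : \sum_(n <- freqs H) F n <= 6 * H%:R^-1.
  apply: (le_trans (hA H)); have h1 : (1 : R) <= H%:R by rewrite ler1n.
  rewrite -(ler_pM2r h0) divfK ?gt_eqF// (_ : _ * _ * _ = 4 + 2 * H%:R^-1); last by field; rewrite gt_eqF.
  have : (H%:R : R)^-1 <= 1 by rewrite invf_le1. lra.
have hB d : \sum_(n <- freqs (H + d)) F n <= 6 * H%:R^-1 + 2 * (H%:R^-1 - (H + d)%:R^-1).
  elim: d => [|d ih]; first by rewrite addn0 subrr mulr0 addr0.
  rewrite addnS big_freqsS; set k := (H + d)%N in ih *.
  have k0 : (0 : R) < k%:R by rewrite ltr0n /k; lia.
  have g1 := F2 k.+1%:Z isT; have g2 := F2 (- k.+1%:Z) isT.
  rewrite abszN in g2; have E : (k.+1%:R : R) = k%:R + 1 by rewrite natr1.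
  rewrite absz_nat in g1 g2.
  have g3 : (k.+1%:R ^+ 2 : R)^-1 <= k%:R^-1 - k.+1%:R^-1.
    rewrite E; move: (k%:R : R) k0 => z z0; have z1 : 0 < z + 1 by rewrite addr_gt0.
    rewrite -subr_ge0 [X in 0 <= X](_ : _ = ((z + 1) ^+ 2 * z)^-1).
      by rewrite invr_ge0 mulr_ge0 ?sqr_ge0// ltW.
    by field; rewrite !gt_eqF.
  apply: (le_trans (lerD g1 (lerD g2 ih))); move: g3.
  move: (k.+1%:R ^- 2 : R) (k.+1%:R^-1 : R) (k%:R^-1 : R) (H%:R^-1 : R) => a b c e; lra.
have [KH|HK] := leqP K H.
  apply: (@le_trans _ _ (\sum_(n <- freqs H) F n)).
    rewrite [leRHS](sum_sub_uniq F (freqs_uniq K) (freqs_uniq H) (freqs_sub KH)) lerDl.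
    by apply: sumr_ge0 => n _.
  have : (0 : R) < H%:R^-1 by rewrite invr_gt0. lra.
have := hB (K - H)%N; rewrite subnKC ?(ltnW HK)//.
have : (0 : R) <= K%:R^-1 by rewrite invr_ge0. lra.
Qed.

Lemma increment_var_le K S k x y : uniq S -> {subset S <= freqs K} -> (x - y) ^+ 2 = (2 ^- k) ^+ 2 ->
  \sum_(n <- S) normc (expi n x - expi n y) ^+ 2 / J n ^+ 2 <= 8 * 2 ^- k.
Proof.
move=> uS SK xy; pose F n := normc (expi n x - expi n y) ^+ 2 / J n ^+ 2.
have F0 n : 0 <= F n by rewrite divr_ge0 ?sqr_ge0.
have := @sum_freqs_min_le F (2 ^ k) K; rewrite expn_gt0 natrX => /(_ isT F0) h.
apply: (@le_trans _ _ (\sum_(n <- freqs K) F n)).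
  rewrite [leRHS](sum_sub_uniq F uS (freqs_uniq K) SK) lerDl.
  by apply: sumr_ge0 => n _.
apply: h => n; first by have := (increment_term_le n x y).1; rewrite xy.
exact: (increment_term_le n x y).2.
Qed.

End exponential_increments.

(** * The random weight that controls all dyadic increments *)

Section chain_weight.
Variables (R : realType) (s : R).
Implicit Types (u : Hs s) (S : seq int) (k j K : nat) (x y : R).

Definition dyadic_increment S k j u : R :=
  normc (\sum_(n <- S) fourier u n * (expi n (j.+1%:R / 2 ^+ k) - expi n (j%:R / 2 ^+ k))) ^+ 2.

(** The variance bound of [increment_var_le] is 8 * 2^-k, and [trunc_increment_exp] loses another 8:
    this is the 64, for which each exponential has expectation at most 2. The 2^k intervals then
    give 2 * 2^-k, summable in k. *)
Definition chain_term S u k : R :=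
  (4 ^+ k)^-1 * \sum_(0 <= j < 2 ^ k) expR (2 ^+ k / 64 * dyadic_increment S k j u).

Definition chain_weight S u : \bar R := \sum_(0 <= k <oo) (chain_term S u k)%:E.

Lemma chain_term_ge0 S u k : 0 <= chain_term S u k.
Proof. by rewrite mulr_ge0 ?invr_ge0 ?exprn_ge0// sumr_ge0// => j _; exact: expR_ge0. Qed.

Lemma measurable_chain_exp S k j : measurable_fun [set: borelHs s]
  (fun u : borelHs s => expR (2 ^+ k / 64 * dyadic_increment S k j (u : Hs s))).
Proof.
apply: measurableT_comp => //; apply: measurable_funM; first exact: measurable_cst.
exact: measurable_fourier_sum.
Qed.

Lemma measurable_chain_term S k :
  measurable_fun [set: borelHs s] (fun u : borelHs s => (chain_term S (u : Hs s) k)%:E).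
Proof.
apply/measurable_EFinP; apply: measurable_funM; first exact: measurable_cst.
by apply: measurable_sum => j; exact: measurable_chain_exp.
Qed.

Lemma measurable_chain_weight S :
  measurable_fun [set: borelHs s] (fun u : borelHs s => chain_weight S (u : Hs s)).
Proof.
apply: ge0_emeasurable_sum => [k u _ _|k _]; first by rewrite lee_fin chain_term_ge0.
exact: measurable_chain_term.
Qed.

Lemma chain_weight_ge0 S u : (0 <= chain_weight S u)%E.
Proof. by apply: nneseries_ge0 => k _ _; rewrite lee_fin chain_term_ge0. Qed.

Lemma integral_chain_term (P : probability (borelHs s) R) S K k : wiener P -> uniq S -> {subset S <= freqs K} ->
  (\int[P]_u (chain_term S (u : Hs s) k)%:E <= (2 * 2 ^- k)%:E)%E.
Proof.
move=> wP uS SK; have k0 : (0 : R) < 2 ^+ k by rewrite exprn_gt0.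
have mE j : measurable_fun [set: borelHs s] (fun u : borelHs s =>
    (expR (2 ^+ k / 64 * dyadic_increment S k j (u : Hs s)))%:E).
  by apply/measurable_EFinP; exact: measurable_chain_exp.
have hE j : (\int[P]_u (expR (2 ^+ k / 64 * dyadic_increment S k j (u : Hs s)))%:E <= 2%:E)%E.
  apply: (trunc_increment_exp wP uS); first by rewrite divr_ge0// ltW.
  have := @increment_var_le R K S k (j.+1%:R / 2 ^+ k) (j%:R / 2 ^+ k) uS SK.
  rewrite -mulrBl -natrB// subSnn mul1r => /(_ erefl) h.
  rewrite (_ : 8 * _ = 2 ^+ k * (\sum_(n <- S) normc (expi n (j.+1%:R / 2 ^+ k) - expi n (j%:R / 2 ^+ k)) ^+ 2 / japanese R n ^+ 2) / 8); last by field.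
  by rewrite ler_pdivrMr// mul1r mulrC -ler_pdivlMr.
have -> : (\int[P]_u (chain_term S (u : Hs s) k)%:E = (4 ^+ k)^-1%:E *
    \sum_(0 <= j < 2 ^ k) \int[P]_u (expR (2 ^+ k / 64 * dyadic_increment S k j (u : Hs s)))%:E)%E.
  rewrite -ge0_integral_sum; last 3 first.
  - exact: measurableT.
  - by move=> j; exact: mE.
  - by move=> j u _; rewrite lee_fin expR_ge0.
  rewrite -(@ge0_integralZl _ _ _ P setT measurableT); last 3 first.
  - by apply: emeasurable_sum => j; exact: mE.
  - by move=> u _; apply: sume_ge0 => j _; rewrite lee_fin expR_ge0.
  - by rewrite lee_fin invr_ge0 exprn_ge0.
  by apply: eq_integral => u _; rewrite sumEFin -EFinM.
apply: (@le_trans _ _ ((4 ^+ k)^-1%:E * \sum_(0 <= j < 2 ^ k) 2%:E)%E).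
  apply: lee_wpmul2l; first by rewrite lee_fin invr_ge0 exprn_ge0.
  by apply: lee_sum => j _; exact: hE.
rewrite sumEFin -EFinM lee_fin sumr_const_nat subn0 -[X in _ * X <= _]mulr_natl natrX.
have -> : (4 : R) ^+ k = 2 ^+ k * 2 ^+ k by rewrite -exprMn; congr (_ ^+ _); ring.
by rewrite le_eqVlt; apply/orP; left; apply/eqP; field; rewrite gt_eqF.
Qed.

Lemma integral_chain_weight (P : probability (borelHs s) R) S K : wiener P -> uniq S -> {subset S <= freqs K} ->
  (\int[P]_u chain_weight S (u : Hs s) <= 4%:E)%E.
Proof.
move=> wP uS SK; rewrite (@integral_nneseries _ _ _ P setT measurableT
  (fun k (u : borelHs s) => (chain_term S (u : Hs s) k)%:E)); last 2 first.
- by move=> k; exact: measurable_chain_term.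
- by move=> k u _; rewrite lee_fin chain_term_ge0.
apply: lime_le.
  by apply: is_cvg_nneseries => k _ _; apply: integral_ge0 => u _; rewrite lee_fin chain_term_ge0.
near=> N; apply: (@le_trans _ _ (\sum_(0 <= k < N) (2 * 2 ^- k)%:E)%E).
  by apply: lee_sum => k _; exact: (integral_chain_term k wP uS SK).
rewrite sumEFin lee_fin.
have : \sum_(0 <= k < N) (2 * 2 ^- k : R) = 4 - 4 * 2 ^- N.
  elim: (N) => [|n ih]; first by rewrite big_geq// expr0 invr1; ring.
  rewrite big_nat_recr//= ih exprS invfM; have : (2 : R) ^+ n != 0 by rewrite expf_neq0.
  by move: (2 ^+ n) => z z0; field.
by move=> ->; rewrite gerBl mulr_ge0// invr_ge0 exprn_ge0.
Unshelve. all: by end_near. Qed.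

(** A single exponential is at most 4^k B, and its logarithm at most 2 k + ln B because ln 4 <= 2. B
    >= 1 comes from the term at level 0. *)
Lemma chain_weight_increments S u (B : R) : chain_weight S u = B%:E -> 1 <= B /\
  forall k j, (j < 2 ^ k)%N -> dyadic_increment S k j u <= 64 * 2 ^- k * (2 * k%:R + ln B).
Proof.
move=> hB.
have hk k : chain_term S u k <= B.
  rewrite -lee_fin -hB /chain_weight; apply: (le_trans _ (nneseries_lim_ge k.+1 _)).
    rewrite big_nat_recr//=; apply: leeDr; apply: sume_ge0 => i _; rewrite lee_fin chain_term_ge0//.
  by move=> i _ _; rewrite lee_fin chain_term_ge0.
have hkj k j : (j < 2 ^ k)%N -> expR (2 ^+ k / 64 * dyadic_increment S k j u) <= 4 ^+ k * B.
  move=> jk; rewrite -ler_pdivrMl ?exprn_gt0//; apply: le_trans (hk k).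
  rewrite ler_wpM2l ?invr_ge0 ?exprn_ge0// (big_cat_nat (leq0n j) (ltnW jk)) /=.
  rewrite [X in _ + X]big_ltn//= addrCA lerDl.
  by rewrite addr_ge0// sumr_ge0// => i _; exact: expR_ge0.
have B1 : 1 <= B.
  apply: le_trans (hk 0%N); rewrite /chain_term expr0 invr1 mul1r expn0 big_nat1.
  by rewrite -[leLHS]expR0 ler_expR mulr_ge0 ?divr_ge0 ?sqr_ge0.
split=> // k j jk.
have B0 : 0 < B by exact: lt_le_trans B1.
have h4 : (4 : R) ^+ k <= expR (2 * k%:R).
  rewrite expRM_natr lerXn2r ?nnegrE ?expR_ge0//.
  rewrite (_ : 2 = 1 * 2%:R :> R); last by ring.
  rewrite expRM_natr; have := @expR_ge1Dx R 1; move: (expR 1) => e he.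
  have : (1 + 1) ^+ 2 <= e ^+ 2 by rewrite lerXn2r ?nnegrE//; lra.
  lra.
have := hkj k j jk => h.
have : expR (2 ^+ k / 64 * dyadic_increment S k j u) <= expR (2 * k%:R + ln B).
  apply: (le_trans h); rewrite expRD lnK ?posrE// ler_wpM2r// ltW//.
rewrite ler_expR => {}h; have k0 : (0 : R) < 2 ^+ k by rewrite exprn_gt0.
rewrite (_ : 64 * 2 ^- k * _ = (2 * k%:R + ln B) / (2 ^+ k / 64)); last by field; rewrite gt_eqF.
by rewrite ler_pdivlMr ?divr_gt0// mulrC.
Qed.

Lemma trunc_lipschitz S u x y :
  normc (trunc S u x - trunc S u y) <= (\sum_(n <- S) normc (fourier u n) * (2 * `|freq R n|)) * `|x - y|.
Proof.
have -> : trunc S u x - trunc S u y = \sum_(n <- S) fourier u n * (expi n x - expi n y).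
  by rewrite !truncE -sumrB; apply: eq_bigr => n _; rewrite mulrBr.
elim: S => [|n S ih]; first by rewrite !big_nil normc0 mul0r.
rewrite !big_cons mulrDl; apply: le_trans (le_normcD _ _) _; apply: lerD => //.
rewrite normcM -mulrA ler_wpM2l ?normc_ge0//.
have h0 : 0 <= 2 * `|freq R n| * `|x - y| by rewrite !mulr_ge0.
rewrite -(ler_pXn2r (isT : (0 < 2)%N)) ?nnegrE ?normc_ge0//; apply: (le_trans (expi_sqrB_le _ _ _)).
move: (freq R n) => w; rewrite !exprMn !real_normK ?num_real//.
have := sqr_ge0 (w * (x - y)); rewrite exprMn; lra.
Qed.

End chain_weight.

(** * Exponential integrability, uniformly over truncations *)

Section exponential_integrability.
Variables (R : realType) (s p : R).
Hypotheses (s0 : 0 < s) (s12 : s < 2^-1) (p2 : 2 < p) (sp : (2^-1 - s) * p < 1) (p6 : p <= 6).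
Implicit Types (u : Hs s) (S J : seq int) (k j K : nat) (x y B M kap : R).

(* The constants come from optimize_level with c = 24 * 12 * 64. *)
Definition chain_slope : R := 48 + 3 * (24 * (12 * 64)) ^+ 2.
Definition chain_shift M : R := ((2 + 3 * (24 * (12 * 64))) * M) ^+ 2 + 48 * M + 27 * (24 * (12 * 64)) ^+ 2.

Lemma chain_slope_gt0 : 0 < chain_slope.
Proof. by rewrite /chain_slope ltr_pwDl// mulr_ge0 ?sqr_ge0. Qed.

Lemma chain_shift_ge0 M : 0 < M -> 0 <= chain_shift M.
Proof.
move=> M0; rewrite /chain_shift; apply: addr_ge0; last by rewrite mulr_ge0 ?sqr_ge0.
by apply: addr_ge0; [exact: sqr_ge0|rewrite mulr_ge0// ltW].
Qed.

(** The chaining is run with q = 64 and L = ln B. The constant 24 * (12 * 64) collects the 24 of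
    [dyadic_sup_level], the 12 of its [D], and q. *)
Lemma chain_weight_sup S u B M x : 0 < M -> mass (trunc S u) <= M -> chain_weight S u = B%:E ->
  0 <= x <= 1 -> normc (trunc S u x) ^+ 4 <= chain_slope * (M * ln B) + chain_shift M.
Proof.
move=> M0 uM hB x01; have [B1 hinc] := chain_weight_increments hB.
(* Dyadic cells are half-open; the point 1 is moved to 0 by periodicity. *)
wlog x1 : x x01 / x < 1.
  move=> H; have /andP[x0 x1] := x01; move: x1; rewrite le_eqVlt => /orP[/eqP ->|x1].
    by have := Hs_periodic (trunc S u) 0; rewrite add0r => ->; apply: H; rewrite ?lexx ?ler01 ?ltr01.
  exact: H.
have {}x01 : 0 <= x < 1 by rewrite x1 andbT; case/andP: x01.
have q0 : (0 : R) < 64 by [].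
have L0 : 0 <= ln B by exact: ln_ge0.
have inc k j : (j < 2 ^ k)%N ->
    normc (trunc S u (j.+1%:R / 2 ^+ k) - trunc S u (j%:R / 2 ^+ k)) ^+ 2 <= 64 * 2 ^- k * (2 * k%:R + ln B).
  move=> jk; rewrite !truncE -sumrB; under eq_bigr do rewrite -mulrBr.
  exact: hinc.
have lip0 : 0 <= \sum_(n <- S) normc (fourier u n) * (2 * `|freq R n|).
  by apply: sumr_ge0 => n _; rewrite !mulr_ge0 ?normc_ge0.
have mf : measurable_fun [set: R] (fun x => normc (trunc S u x) ^+ 2).
  by apply: measurable_normcX; exact: measurableC_Hs.
have fM : (\int[@lebesgue_measure R]_(x in `[0%R, 1%R]) (normc (trunc S u x) ^+ 2)%:E <= M%:E)%E.
  by have := Lp_int2_mass (trunc S u); rewrite Lp_int2E => ->; rewrite lee_fin.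
have h m := dyadic_sup_level q0 L0 inc lip0 (trunc_lipschitz S u) mf fM m x01.
rewrite (_ : 4 = 2 * 2)%N// exprM.
apply: (@optimize_level R _ (24 * (12 * 64)) M (ln B)) => //; first exact: sqr_ge0.
by move=> m; apply: (le_trans (h m)); rewrite !mulrA.
Qed.

(** The L^p integral is at most M (eta sup|u|^4 + C0), and sup|u|^4 is affine in ln B with slope
    [chain_slope * M]. The choice of eta makes the total coefficient of ln B equal to 1, so the
    exponential is a constant times B. *)
Lemma exp_Lp_le_chain_weight kap M : 0 < kap -> 0 < M -> (p = 6 -> kap * chain_slope * M ^+ 2 <= 1) ->
  exists2 C, 0 < C & forall S u, mass (trunc S u) <= M ->
    ((expR (kap * Lp p (trunc S u)))%:E <= C%:E * chain_weight S u)%E.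
Proof.
move=> k0 M0 hk; have cS := chain_slope_gt0; have cM := chain_shift_ge0 M0.
pose eta := (kap * chain_slope * M ^+ 2)^-1.
have K0 : 0 < kap * chain_slope * M ^+ 2 by rewrite mulr_gt0 ?exprn_gt0// mulr_gt0.
have eta0 : 0 < eta by rewrite invr_gt0.
have [|C0 C00 hC] := powR_interpolate p2 p6 eta0.
  by move=> /hk h; rewrite /eta invf_ge1.
exists (expR (kap * M * (eta * chain_shift M + C0))); first exact: expR_gt0.
move=> S u uM; have [hB|[B hB]] : chain_weight S u = +oo%E \/ exists B, chain_weight S u = B%:E.
  by have := chain_weight_ge0 S u; case: (chain_weight S u) => [B _|_|//]; [right; exists B|left].
  by rewrite hB gt0_muley ?leey// lte_fin expR_gt0.
have [B1 _] := chain_weight_increments hB; have B0 : 0 < B by exact: lt_le_trans B1.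
have L0 : 0 <= ln B by exact: ln_ge0.
pose a := eta * (chain_slope * (M * ln B) + chain_shift M) + C0.
have a0 : 0 <= a by rewrite addr_ge0// mulr_ge0 ?(ltW eta0)// addr_ge0// mulr_ge0 ?(ltW cS)// mulr_ge0// ltW.
have hL : Lp p (trunc S u) <= a * M.
  have m2 := measurable_normcX 2 (measurableC_Hs (trunc S u)).
  have m2' : measurable_fun (`[0%R, 1%R]%classic : set R) (fun x => (normc (trunc S u x) ^+ 2)%:E).
    by apply/measurable_EFinP; exact: measurable_funTS.
  rewrite -lee_fin -(LpE s0 s12 p2 sp).
  apply: (@le_trans _ _ (\int[@lebesgue_measure R]_(x in `[0%R, 1%R]) (a%:E * (normc (trunc S u x) ^+ 2)%:E))%E).
    apply: ge0_le_integral.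
    - exact: measurable_itv.
    - by move=> x _; rewrite lee_fin powR_ge0.
    - by apply/measurable_EFinP; apply: measurable_funTS; exact: measurable_Lp.
    - by apply: emeasurable_funM => //; exact: measurable_cst.
    - move=> x /=; rewrite in_itv /= => x01; rewrite -EFinM lee_fin mulrC.
      apply: (le_trans (hC _ (normc_ge0 _))); rewrite ler_wpM2l ?sqr_ge0// /a lerD2r.
      by rewrite ler_wpM2l ?(ltW eta0)//; exact: chain_weight_sup.
  rewrite ge0_integralZl//; last by move=> x _; rewrite lee_fin sqr_ge0.
  by have := Lp_int2_mass (trunc S u); rewrite Lp_int2E => ->; rewrite -EFinM lee_fin ler_wpM2l.
rewrite hB -EFinM lee_fin -[X in _ <= _ * X](lnK B0) -expRD ler_expR.
apply: (@le_trans _ _ (kap * (a * M))); first by rewrite ler_wpM2l ?(ltW k0).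
rewrite le_eqVlt; apply/orP; left; apply/eqP; rewrite /a.
have {2}-> : ln B = kap * chain_slope * M ^+ 2 * eta * ln B by rewrite /eta divff ?mul1r// gt_eqF.
by ring.
Qed.

Lemma mass_Hs0 : mass (@Hs0 R s) = 0.
Proof. by rewrite /mass /Rintegral integral0_eq// => x _; rewrite normc0 expr0n. Qed.

Lemma mass_trunc S u : uniq S -> mass (trunc S u) = \sum_(n <- S) normc (fourier u n) ^+ 2.
Proof.
move=> uS; rewrite mass_add_modes// mass_Hs0 add0r; apply: eq_bigr => n _.
by rewrite fourier_Hs0 add0r normc0 expr0n subr0.
Qed.

Lemma trunc_cut J K u : uniq J ->
  trunc (freqs K) (cut J u) = trunc [seq n <- freqs K | n \notin J] u.
Proof.
move=> uJ; apply: Hs_eq => x; rewrite !truncE big_filter [RHS]big_mkcond; apply: eq_bigr => n _.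
by rewrite fourier_cut//; case: ifP; rewrite //= mul0r.
Qed.

Lemma measurable_trunc_cut J K : uniq J ->
  measurable_fun [set: borelHs s] (fun u : borelHs s => trunc (freqs K) (cut J (u : Hs s)) : borelHs s).
Proof.
move=> uJ; apply: measurable_into_Hs => n.
  under eq_fun do rewrite fourier_trunc ?freqs_uniq// fourier_cut//.
  case: (n \in freqs K); last exact: measurable_cst.
  by case: (n \in J); [exact: measurable_cst|exact: measurable_Re_fourier].
under eq_fun do rewrite fourier_trunc ?freqs_uniq// fourier_cut//.
case: (n \in freqs K); last exact: measurable_cst.
by case: (n \in J); [exact: measurable_cst|exact: measurable_Im_fourier].
Qed.

Lemma measurable_mass_cut J : uniq J ->
  measurable_fun [set: borelHs s] (fun u : borelHs s => mass (cut J (u : Hs s))).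
Proof.
move=> uJ; under eq_fun do rewrite mass_cut//.
apply: measurable_funB; first exact: measurable_mass.
by apply: measurable_sum => n; exact: measurable_normc_fourier2.
Qed.

(** Stated with the modes in [J] removed, because the dominating function must not depend on the
    pinned modes. The bound is uniform over truncations of u and passes to the limit by Fatou's
    lemma. *)
Lemma exp_Lp_integrable (P : probability (borelHs s) R) J kap M : wiener P -> uniq J ->
  0 < kap -> 0 < M -> (p = 6 -> kap * chain_slope * M ^+ 2 <= 1) ->
  P.-integrable setT (EFin \o (fun u : borelHs s =>
    \1_[set u : borelHs s | mass (cut J (u : Hs s)) <= M] u * expR (kap * Lp p (cut J (u : Hs s))))).
Proof.
move=> wP uJ k0 M0 hk; have [C C0 hC] := exp_Lp_le_chain_weight k0 M0 hk.
pose A : set (borelHs s) := [set u : borelHs s | mass (cut J (u : Hs s)) <= M].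
have mA : measurable A.
  rewrite -[X in measurable X]setTI; apply: (measurable_fun_ler _ _) => //.
  exact: measurable_mass_cut.
pose g K (u : borelHs s) : \bar R :=
  (\1_A u * expR (kap * Lp p (trunc (freqs K) (cut J (u : Hs s)))))%:E.
pose G (u : borelHs s) : \bar R := (\1_A u * expR (kap * Lp p (cut J (u : Hs s))))%:E.
have mLp := continuous_measurable_Hs (continuous_Lp s0 s12 p2 sp).
have mg K : measurable_fun [set: borelHs s] (g K).
  apply/measurable_EFinP; apply: measurable_funM; first exact: measurable_indic.
  apply: measurableT_comp => //; apply: measurable_funM; first exact: measurable_cst.
  exact: (measurableT_comp mLp (measurable_trunc_cut K uJ)).
have g0 K u : (0 <= g K u)%E by rewrite lee_fin mulr_ge0// expR_ge0.
have gG u : g K u @[K --> \oo] --> G u.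
  apply: cvg_EFin; first by near=> K.
  apply: cvgM; first exact: cvg_cst.
  apply: (@continuous_cvg _ _ _ _ _ _ expR); first exact: continuous_expR.
  by apply: cvgM; [exact: cvg_cst|exact: (Lp_trunc_cvg s0 s12 p2 sp)].
have mG : measurable_fun [set: borelHs s] G.
  exact: (@emeasurable_fun_cvg _ _ _ _ g G mg (fun u _ => gG u)).
have hg K : (\int[P]_u g K u <= (C * 4)%:E)%E.
  pose S := [seq n <- freqs K | n \notin J].
  have uS : uniq S by rewrite filter_uniq// freqs_uniq.
  have SK : {subset S <= freqs K} by move=> n; rewrite mem_filter => /andP[].
  apply: (@le_trans _ _ (\int[P]_u (C%:E * chain_weight S (u : Hs s)))%E).
    apply: ge0_le_integral.
    - exact: measurableT.
    - by move=> u _; exact: g0.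
    - exact: mg.
    - by apply: emeasurable_funM; [exact: measurable_cst|exact: measurable_chain_weight].
    - move=> u _; rewrite /g trunc_cut// -/S indicE; case: (boolP (u \in A)) => uA; last first.
        by rewrite mul0r mule_ge0// ?chain_weight_ge0// lee_fin ltW.
      rewrite mul1r; apply: hC; rewrite -trunc_cut// mass_trunc ?freqs_uniq//.
      by apply: (le_trans (bessel K _)); move: uA; rewrite inE.
  rewrite (@ge0_integralZl _ _ _ P setT measurableT _ (measurable_chain_weight S)); last 2 first.
  - by move=> u _; exact: chain_weight_ge0.
  - by rewrite lee_fin ltW.
  rewrite EFinM; apply: lee_wpmul2l; first by rewrite lee_fin ltW.
  exact: (integral_chain_weight wP uS SK).
apply/integrableP; split; first exact: mG.
rewrite (eq_integral G); last first.
  by move=> u _; rewrite gee0_abs// lee_fin mulr_ge0// expR_ge0.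
apply: (@le_lt_trans _ _ (C * 4)%:E); last exact: ltry.
have -> : (\int[P]_u G u = \int[P]_u limn_einf (g^~ u))%E.
  by apply: eq_integral => u _; rewrite (cvg_limn_einf_sup (gG u)).1.
apply: (le_trans (fatou P measurableT mg (fun K u _ => g0 K u))).
apply: (@le_trans _ _ (limn_esup (fun K => \int[P]_u g K u)%E)); first exact: limn_einf_sup.
apply: (@le_trans _ _ (ereal_sup (range (fun K => \int[P]_u g K u)%E))).
  by apply: ereal_inf_lbound; exists setT => //; exact: filterT.
by apply: ge_ereal_sup => _ [K _ <-]; exact: hg.
Unshelve. all: by end_near. Qed.

End exponential_integrability.

(** * Conditioned measures *)

Section densities.
Context d1 d2 (T1 : measurableType d1) (T2 : measurableType d2) (R : realType).
Variables (mu : {measure set T1 -> \bar R}) (tau : T1 -> T2) (f : T1 -> R).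
Hypotheses (mtau : measurable_fun [set: T1] tau) (mf : measurable_fun [set: T1] f) (f0 : forall x, 0 <= f x).

Lemma integral_scaled_density (Q : {measure set T2 -> \bar R}) (c : R) (h : T2 -> R) : 0 <= c ->
  (forall E, measurable E -> Q E = (c%:E * \int[mu]_x (f x * \1_E (tau x))%:E)%E) ->
  measurable_fun [set: T2] h -> (forall y, 0 <= h y) ->
  (\int[Q]_y (h y)%:E = c%:E * \int[mu]_x (f x * h (tau x))%:E)%E.
Proof.
move=> c0 hQ mh h0.
have mfh (g : T2 -> R) : measurable_fun [set: T2] g ->
    measurable_fun [set: T1] (fun x => (f x * g (tau x))%:E).
  by move=> mg; apply/measurable_EFinP; apply: measurable_funM => //; exact: (measurableT_comp mg mtau).
have scale (g : T2 -> R) : measurable_fun [set: T2] g -> (forall y, 0 <= g y) ->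
    (c%:E * \int[mu]_x (f x * g (tau x))%:E = \int[mu]_x ((c * f x) * g (tau x))%:E)%E.
  move=> mg g0; rewrite -(@ge0_integralZl _ _ _ mu setT measurableT _ (mfh g mg)); last 2 first.
  - by move=> x _; rewrite lee_fin mulr_ge0.
  - by rewrite lee_fin.
  by apply: eq_integral => x _; rewrite -EFinM mulrA.
rewrite (@ge0_integral_density _ _ _ _ R mu tau (fun x => c * f x) mtau _ _ Q (fun y => (h y)%:E)).
- by rewrite scale//; apply: eq_integral => x _; rewrite -EFinM.
- by apply: measurable_funM => //; exact: measurable_cst.
- by move=> x; rewrite mulr_ge0.
- by move=> E mE; rewrite hQ// scale//; exact: measurable_indic.
- exact/measurable_EFinP.
- by move=> y; rewrite lee_fin.
Qed.

End densities.

Section conditioning.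
Variables (R : realType) (s : R).
Implicit Types (P Q mu : probability (borelHs s) R) (C E : set (borelHs s)) (h : borelHs s -> R).

Let mid : measurable_fun [set: borelHs s] (fun u : borelHs s => u).
Proof. exact: measurable_id. Qed.

(** The condition on C stands under the existential so that a family indexed by every e can be
    chosen; where it fails, [P] is the default. [tilt_exists] has the same form. *)
Lemma conditional_exists P C : measurable C -> exists Q, (0 < P C)%E ->
  elementary_conditional P C Q /\
  forall h, measurable_fun [set: borelHs s] h -> (forall u, 0 <= h u) ->
    (\int[Q]_u (h u)%:E = (fine (P C))^-1%:E * \int[P]_u (h u * \1_C u)%:E)%E.
Proof.
move=> mC; have [PC|PC] := pselect (0 < P C)%E; last by exists P.
have IC E : measurable E -> (\int[P]_u (\1_C u * \1_E u)%:E = P (E `&` C))%E.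
  move=> mE; rewrite (_ : (\int[P]_u _)%E = \int[P]_u (\1_(E `&` C) u)%:E)%E.
    by rewrite integral_indic ?setIT//; exact: measurableI.
  by apply: eq_integral => u _; rewrite indicI/= mulrC.
have mI : measurable_fun [set: borelHs s] (\1_C : borelHs s -> R) by exact: measurable_indic.
have I0 u : 0 <= (\1_C u : R) by [].
have ZE : (\int[P]_u (\1_C u)%:E = P C)%E by rewrite integral_indic ?setIT.
have [||Q hQ] := @density_probability _ _ _ _ R P (fun u => u) (\1_C) mid mI I0.
- by rewrite ZE.
- by rewrite ZE; apply: le_lt_trans (probability_le1 P mC) _; exact: ltry.
rewrite ZE in hQ.
exists Q => _; split; first split => //.
  move=> E mE; rewrite hQ// IC// mulrC EFinM fineK//.
  rewrite ge0_fin_numE//; apply: le_lt_trans (probability_le1 P _) _; [exact: measurableI|exact: ltry].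
move=> h mh h0.
have c0 : 0 <= (fine (P C))^-1 by rewrite invr_ge0 fine_ge0.
rewrite (integral_scaled_density mid mI I0 c0 hQ mh h0).
by congr (_ * _)%E; apply: eq_integral => u _; rewrite mulrC.
Qed.

Lemma integral_pos_gt0 Q h : measurable_fun [set: borelHs s] h -> (forall u, 0 < h u) ->
  (0 < \int[Q]_u (h u)%:E)%E.
Proof.
move=> mh h0; rewrite lt_neqAle integral_ge0 ?andbT; last by move=> u _; rewrite lee_fin ltW.
apply/negP => /eqP /esym hz.
have mE : measurable_fun [set: borelHs s] (fun u => (h u)%:E) by exact/measurable_EFinP.
have := (ae_eq_integral_abs Q measurableT mE).1.
rewrite (_ : (\int[Q]_u `|_|)%E = 0%E); last first.
  by rewrite -[RHS]hz; apply: eq_integral => u _; rewrite gee0_abs// lee_fin ltW.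
move=> /(_ erefl) [N [mN N0 hN]].
have NT : N = setT.
  apply/seteqP; split => // u _; apply: hN => /= /(_ I) /eqP; rewrite eqe gt_eqF//.
by have /eqP := etrans (esym N0) (etrans (congr1 Q NT) (probability_setT Q)); rewrite eq_sym onee_eq0.
Qed.

Lemma tilt_exists Q h : measurable_fun [set: borelHs s] h -> (forall u, 0 < h u) ->
  exists mu, (\int[Q]_u (h u)%:E < +oo)%E ->
  [/\ forall E, measurable E -> mu E = ((fine (\int[Q]_u (h u)%:E))^-1%:E * \int[Q]_(u in E) (h u)%:E)%E,
      mu `<< Q &
      forall f : borelHs s -> R, measurable_fun [set: borelHs s] f -> (forall u, 0 <= f u) ->
       (\int[mu]_u (f u)%:E = (fine (\int[Q]_u (h u)%:E))^-1%:E * \int[Q]_u (h u * f u)%:E)%E].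
Proof.
move=> mh h0; have [Zf|] := pselect (\int[Q]_u (h u)%:E < +oo)%E; last by exists Q.
have h0' u : 0 <= h u by exact: ltW.
have [mu hmu] := density_probability mid mh h0' (integral_pos_gt0 Q mh h0) Zf.
have mE E : measurable E -> measurable_fun E (fun u => (h u)%:E).
  by move=> mE; apply/measurable_EFinP; exact: measurable_funTS.
have hmu' E : measurable E -> mu E = ((fine (\int[Q]_u (h u)%:E))^-1%:E * \int[Q]_(u in E) (h u)%:E)%E.
  move=> mE'; rewrite hmu//; congr (_ * _)%E; rewrite [RHS]integral_mkcond; apply: eq_integral => u _.
  by rewrite patchE indicE; case: ifPn => _; rewrite ?mulr1 ?mulr0.
exists mu => _; split => //.
  move=> N QN A mA AN; rewrite hmu'//.
  by rewrite [X in (_ * X)%E]null_set_integral ?mule0//; [exact: mE|exact: QN].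
move=> f mf f0; apply: (integral_scaled_density mid mh h0') => //.
by rewrite invr_ge0; apply: fine_ge0; apply: integral_ge0 => u _; rewrite lee_fin.
Qed.

End conditioning.

(** * Limits over shrinking windows of mass and momentum *)

Section windows.
Variables (R : realType) (s : R) (P : probability (borelHs s) R) (a b : R) (A B : R -> set R).
Hypotheses (wP : wiener P) (a0 : 0 < a) (shA : shrinks_nicely A a) (shB : shrinks_nicely B b).
Implicit Types (m n : int) (u : Hs s) (e : R) (Psi h : borelHs s -> R) (Q : probability (borelHs s) R).
Local Notation leb := (@lebesgue_measure R).
Local Notation C e := (@mass_momentum_event R s (A e) (B e)).

(** The test functions Psi for which G_Psi, formed with the pair (m, n), is continuous at (a, b). *)
Definition pinnable m n Psi := [/\ measurable_fun [set: borelHs s] Psi, forall u, 0 <= Psi u,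
  forall (f : nat -> R * R) u, (f j).1 @[j --> \oo] --> a -> (f j).2 @[j --> \oo] --> b ->
    mode_mass m u != 0 -> mode_mass n u != 0 ->
    0 < mass1 m n u (a, b) -> 0 < mass2 m n u (a, b) ->
    Psi (pinned m n u (f j) : borelHs s) @[j --> \oo] --> Psi (pinned m n u (a, b) : borelHs s) &
  exists (dom : borelHs s -> R) (rad : R), [/\ 0 < rad, P.-integrable setT (EFin \o dom) &
    forall u y, `|y.1 - a| < rad -> `|y.2 - b| < rad -> mode_mass m u != 0 -> mode_mass n u != 0 ->
      0 < mass1 m n u y -> 0 < mass2 m n u y -> Psi (pinned m n u y : borelHs s) <= dom u]].

Lemma integrable_cst_prob (c : R) : P.-integrable setT (EFin \o (fun=> c)).
Proof. exact: finite_measure_integrable_cst. Qed.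

Lemma pinnable_bounded m n Psi M : measurable_fun [set: borelHs s] Psi -> (forall u, 0 <= Psi u <= M) ->
  (forall u y, Psi (pinned m n u y : borelHs s) = Psi (u : borelHs s)) -> pinnable m n Psi.
Proof.
move=> mPsi PM inv; split => //.
- by move=> u; case/andP: (PM u).
- by move=> f u _ _ _ _ _ _; rewrite inv; under eq_fun do rewrite inv; exact: cvg_cst.
- exists (fun=> M), 1; split => //; first exact: integrable_cst_prob.
  by move=> u y _ _ _ _ _ _; case/andP: (PM (pinned m n u y)).
Qed.

Lemma pinnable_continuous m n (f : Hs s -> R) M : m != n -> continuous f -> (forall u, 0 <= f u <= M) ->
  pinnable m n (f : borelHs s -> R).
Proof.
move=> mn cf fM; split.
- exact: continuous_measurable_Hs.
- by move=> u; case/andP: (fM u).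
- move=> g u g1 g2 _ _ _ _; exact: (@cvg_comp _ _ _ (fun j => pinned m n u (g j)) f _ _ _ (@pinned_cvg _ _ _ _ u g (a, b) mn g1 g2) (cf _)).
- exists (fun=> M), 1; split => //; first exact: integrable_cst_prob.
  by move=> u y _ _ _ _ _ _; case/andP: (fM (pinned m n u y)).
Qed.

Lemma pinnable_cst1 m n : m != n -> pinnable m n (fun=> 1).
Proof.
move=> mn; apply: (@pinnable_bounded m n (fun=> 1) 1); [exact: measurable_cst| |by []].
by move=> u; rewrite ler01 lexx.
Qed.

Definition window_area e : R := fine (leb (A e)) * fine (leb (B e)).

Let fine_leb (D : R -> set R) (d : R) : shrinks_nicely D d -> forall e, 0 < e ->
  leb (D e) = (fine (leb (D e)))%:E /\ 0 < fine (leb (D e)).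
Proof.
move=> [al al0 sh] e e0; have [mD De lD] := sh e e0.
have l0 : (0 < leb (D e))%E by apply: lt_trans lD; rewrite lte_fin mulr_gt0.
have lf : (leb (D e) < +oo)%E.
  apply: (@le_lt_trans _ _ (leb (`]d - e, d + e[%classic : set R))).
    by apply: le_measure; rewrite ?inE//; exact: measurable_itv.
  by rewrite lebesgue_measure_itv /=; case: ifP => _; rewrite ?ltry// -EFinB ltry.
have E : leb (D e) = (fine (leb (D e)))%:E by rewrite fineK// ge0_fin_numE ?ltW.
by split => //; rewrite -lte_fin -E.
Qed.

Let W_gt0 e : 0 < e -> 0 < window_area e.
Proof. by move=> e0; rewrite mulr_gt0// ?(fine_leb shA e0).2 ?(fine_leb shB e0).2. Qed.

Definition event_integral Psi e : \bar R := (\int[P]_u (Psi u * \1_(C e) u)%:E)%E.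
Definition window_integral Psi e : R := fine (event_integral Psi e).
Local Notation X := window_integral.
Local Notation W := window_area.
Local Notation V m n Psi := (pinned_value m n P (a, b) Psi).

Let event_near m n Psi (eps : R) : m != n -> pinnable m n Psi -> 0 < eps ->
  \forall e \near 0^'+, (((V m n Psi - eps) * W e)%:E <= event_integral Psi e)%E /\
    (event_integral Psi e <= ((V m n Psi + eps) * W e)%:E)%E.
Proof.
move=> mn [mPsi Psi0 Psi_cvg [dom [rad [rad0 idom Psi_dom]]]] eps0.
have [del del0 hdel] := event_integral_bounds mn wP (y0 := (a, b)) mPsi Psi0 Psi_cvg rad0 idom Psi_dom eps0.
near=> e; have e0 : 0 < e by near: e; exact: nbhs_right_gt.
have ed : e < del by near: e; exact: nbhs_right_lt.
have [al _ sh1] := shA; have [be _ sh2] := shB.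
have [mA Ae _] := sh1 e e0; have [mB Be _] := sh2 e e0.
have close (D : set R) (d : R) : D `<=` `]d - e, d + e[ -> forall x, D x -> `|x - d| < del.
  move=> hD x /hD /=; rewrite in_itv /= => /andP[x1 x2].
  by apply: lt_trans ed; rewrite ltr_norml; apply/andP; split; lra.
have := hdel (A e) (B e) mA mB (close _ _ Ae) (close _ _ Be).
rewrite -/(event_integral Psi e) (fine_leb shA e0).1 (fine_leb shB e0).1 -!EFinM.
by move=> /andP[].
Unshelve. all: by end_near. Qed.

Lemma window_fin m n Psi : m != n -> pinnable m n Psi ->
  \forall e \near 0^'+, event_integral Psi e = (X Psi e)%:E.
Proof.
move=> mn pin; have [_ Psi0 _ _] := pin; apply: filterS (event_near mn pin ltr01) => e [_ h].
rewrite /X fineK// ge0_fin_numE; first by apply: le_lt_trans h _; exact: ltry.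
by apply: integral_ge0 => u _; rewrite lee_fin mulr_ge0.
Qed.

(** The quotient on the left does not mention (m, n): every comparison between different pairs rests
    on this. *)
Lemma window_limit m n Psi : m != n -> pinnable m n Psi -> X Psi e / W e @[e --> 0^'+] --> V m n Psi.
Proof.
move=> mn pin; apply/cvgrPdist_le => eps eps0; near=> e.
have e0 : 0 < e by near: e; exact: nbhs_right_gt.
have w0 := W_gt0 e0.
have XE : event_integral Psi e = (X Psi e)%:E by near: e; exact: (window_fin mn pin).
have [] : (((V m n Psi - eps) * W e)%:E <= event_integral Psi e)%E /\
    (event_integral Psi e <= ((V m n Psi + eps) * W e)%:E)%E by near: e; exact: (event_near mn pin eps0).
rewrite XE lee_fin => h1; rewrite lee_fin => h2.
rewrite distrC ler_distl ler_pdivlMr// ler_pdivrMr// h2 andbT.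
exact: h1.
Unshelve. all: by end_near. Qed.

Lemma window_cst m n m' n' : m != n -> m' != n' -> V m n (fun=> 1) = V m' n' (fun=> 1).
Proof.
move=> mn mn'; apply: (cvg_unique (@Rhausdorff R) (window_limit mn (pinnable_cst1 mn))).
exact: (window_limit mn' (pinnable_cst1 mn')).
Qed.

Let pinnedE m n Psi : m != n -> pinnable m n Psi -> pinned_integral m n P Psi (a, b) = (V m n Psi)%:E.
Proof.
move=> mn [mPsi Psi0 Psi_cvg [dom [rad [rad0 idom Psi_dom]]]].
exact: (pinned_integralE mn wP (y0 := (a, b)) mPsi Psi0 Psi_cvg rad0 idom Psi_dom).
Qed.

(** Positivity is known for one well chosen pair and passes to all others by [window_cst]. *)
Lemma pinned_mass_gt0 m n : m != n -> 0 < V m n (fun=> 1).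
Proof.
move=> mn; have [m' [n' [mn' h]]] := pin_density_integral_gt0 wP b a0.
by rewrite (window_cst mn mn') -lte_fin -pinnedE//; exact: pinnable_cst1.
Qed.

Lemma event_integral_cst1 e : 0 < e -> event_integral (fun=> 1) e = P (C e).
Proof.
move=> e0; have [al _ /(_ e e0)[mA _ _]] := shA; have [be _ /(_ e e0)[mB _ _]] := shB.
rewrite /event_integral (eq_integral (fun u : borelHs s => (\1_(C e) u)%:E)) => [|u _]; last by rewrite mul1r.
by rewrite integral_indic ?setIT//; exact: measurable_mass_momentum_event.
Qed.

(** The candidate for P_0: the normalised image of [pin_density] at (a, b) under [pinned]. That it
    does not depend on the pair is [pinned_law_unique]. *)
Lemma pinned_law m n : m != n -> exists Q, forall h, measurable_fun [set: borelHs s] h -> (forall u, 0 <= h u) ->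
  (\int[Q]_u (h u)%:E = (V m n (fun=> 1))^-1%:E * pinned_integral m n P h (a, b))%E.
Proof.
move=> mn; have v0 := pinned_mass_gt0 mn.
pose c : R := `|freq R n - freq R m|^-1.
have c0 : 0 <= c by rewrite invr_ge0.
pose f (u : borelHs s) : R := c * pin_density m n u (a, b).
have mpin : measurable_fun [set: borelHs s] (fun u : borelHs s => pinned m n (u : Hs s) (a, b) : borelHs s).
  by apply: (@measurable_pinned R s m n _ (borelHs s) (fun u => u) (fun=> (a, b))) => //; exact: measurable_cst.
have mden : measurable_fun [set: borelHs s] (fun u : borelHs s => pin_density m n u (a, b)).
  by apply: (@measurable_pin_density R s m n _ (borelHs s) (fun u => u) (fun=> (a, b))) => //; exact: measurable_cst.
have mf : measurable_fun [set: borelHs s] f by apply: measurable_funM => //; exact: measurable_cst.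
have f0 u : 0 <= f u by rewrite mulr_ge0// pin_density_ge0.
have fE h : measurable_fun [set: borelHs s] h -> (forall u, 0 <= h u) ->
    (\int[P]_u (f u * h (pinned m n (u : Hs s) (a, b) : borelHs s))%:E = pinned_integral m n P h (a, b))%E.
  move=> mh h0; rewrite /pinned_integral -(@ge0_integralZl _ _ _ P setT measurableT); last 3 first.
  - by apply/measurable_EFinP; apply: measurable_funM => //; exact: (measurableT_comp mh mpin).
  - by move=> u _; rewrite lee_fin mulr_ge0// pin_density_ge0.
  - by rewrite lee_fin.
  by apply: eq_integral => u _; rewrite -EFinM mulrA.
have ZE : (\int[P]_u (f u)%:E = (V m n (fun=> 1))%:E)%E.
  rewrite -(pinnedE mn (pinnable_cst1 mn)) -(fE (fun=> 1))//.
  by apply: eq_integral => u _; rewrite mulr1.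
have [||Q hQ] := @density_probability _ _ _ _ R P _ f mpin mf f0; first by rewrite ZE lte_fin.
  by rewrite ZE ltry.
rewrite ZE /= in hQ; exists Q => h mh h0; rewrite -fE//.
by apply: (integral_scaled_density mpin mf f0) => //; rewrite invr_ge0 ltW.
Qed.

Lemma event_gt0_near : \forall e \near 0^'+, (0 < P (C e))%E.
Proof.
have mn : (0 : int) != 1 by [].
have lim := window_limit mn (pinnable_cst1 mn).
have v0 := pinned_mass_gt0 mn.
near=> e; have e0 : 0 < e by near: e; exact: nbhs_right_gt.
rewrite -event_integral_cst1//.
have -> : event_integral (fun=> 1) e = (X (fun=> 1) e)%:E.
  by near: e; exact: (window_fin mn (pinnable_cst1 mn)).
have h : 0 < X (fun=> 1) e / W e by near: e; exact: (cvgr_gt _ lim).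
by rewrite lte_fin; move: h; rewrite pmulr_lgt0// invr_gt0 W_gt0.
Unshelve. all: by end_near. Qed.

Definition conditional_at e Q := elementary_conditional P (C e) Q /\
  forall h, measurable_fun [set: borelHs s] h -> (forall u, 0 <= h u) ->
    (\int[Q]_u (h u)%:E = (fine (P (C e)))^-1%:E * \int[P]_u (h u * \1_(C e) u)%:E)%E.

Lemma conditional_family : exists Pe : R -> probability (borelHs s) R,
  \forall e \near 0^'+, conditional_at e (Pe e).
Proof.
have H e : exists Q, 0 < e -> (0 < P (C e))%E -> conditional_at e Q.
  have [e0|e0] := ltP 0 e; last by exists P.
  have [al _ /(_ e e0)[mA _ _]] := shA; have [be _ /(_ e e0)[mB _ _]] := shB.
  by have [Q hQ] := conditional_exists P (measurable_mass_momentum_event mA mB); exists Q => _.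
have [Pe hPe] := boolp.choice H; exists Pe.
near=> e; apply: hPe; first by near: e; exact: nbhs_right_gt.
by near: e; exact: event_gt0_near.
Unshelve. all: by end_near. Qed.

(** The conditional expectation is a quotient of two window integrals; the area of the window
    cancels and [window_limit] applies to both. *)
Lemma conditional_limit m n (Pe : R -> probability (borelHs s) R) Q Psi : m != n -> pinnable m n Psi ->
  (\forall e \near 0^'+, conditional_at e (Pe e)) ->
  (forall h, measurable_fun [set: borelHs s] h -> (forall u, 0 <= h u) ->
    (\int[Q]_u (h u)%:E = (V m n (fun=> 1))^-1%:E * pinned_integral m n P h (a, b))%E) ->
  [/\ \forall e \near 0^'+, (\int[Pe e]_u (Psi u)%:E = (fine (\int[Pe e]_u (Psi u)%:E))%:E)%E,
      (\int[Q]_u (Psi u)%:E = (fine (\int[Q]_u (Psi u)%:E))%:E)%E &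
      fine (\int[Pe e]_u (Psi u)%:E)%E @[e --> 0^'+] --> fine (\int[Q]_u (Psi u)%:E)%E].
Proof.
move=> mn pin cond hQ; have [mPsi Psi0 _ _] := pin.
have v0 := pinned_mass_gt0 mn.
have QE : (\int[Q]_u (Psi u)%:E = ((V m n (fun=> 1))^-1 * V m n Psi)%:E)%E by rewrite hQ// pinnedE.
have nearE : \forall e \near 0^'+, (\int[Pe e]_u (Psi u)%:E)%E = ((X (fun=> 1) e / W e)^-1 * (X Psi e / W e))%:E.
  near=> e; have e0 : 0 < e by near: e; exact: nbhs_right_gt.
  have [_ ->] // : conditional_at e (Pe e) by near: e; exact: cond.
  have E1 : P (C e) = (X (fun=> 1) e)%:E.
    by rewrite -event_integral_cst1//; near: e; exact: (window_fin mn (pinnable_cst1 mn)).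
  have -> : (\int[P]_u (Psi u * \1_(C e) u)%:E)%E = (X Psi e)%:E by near: e; exact: (window_fin mn pin).
  rewrite E1 -EFinM /=; congr EFin.
  have w0 := W_gt0 e0; have P0 : (0 < P (C e))%E by near: e; exact: event_gt0_near.
  rewrite E1 lte_fin in P0; by field; rewrite !gt_eqF.
split.
- by apply: filterS nearE => e ->.
- by rewrite QE.
- rewrite QE /=; apply: (@cvg_trans _ ((X (fun=> 1) e / W e)^-1 * (X Psi e / W e) @[e --> 0^'+])).
    by apply: near_eq_cvg; apply: filterS nearE => e ->.
  apply: cvgM; last exact: window_limit.
  by apply: cvgV; [rewrite gt_eqF|exact: window_limit (pinnable_cst1 mn)].
Unshelve. all: by end_near. Qed.

End windows.

Section laws_on_Hs.
Variables (R : realType) (s : R).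
Implicit Types (u : Hs s) (m n k : int) (N : nat) (Q : probability (borelHs s) R).

(** The indicator of a half box is the limit of exp(- d)^j, where d is a continuous function that
    vanishes exactly on the box. *)
Lemma Hs_prob_eq_continuous Q Q' : (forall f : Hs s -> R, continuous f -> (forall u, 0 <= f u <= 1) ->
    (\int[Q]_u (f u)%:E = \int[Q']_u (f u)%:E)%E) ->
  forall E, measurable E -> Q E = Q' E.
Proof.
move=> h; apply: Hs_prob_eq => J t.
(* Twice the positive part, so that continuity is that of a sum and an absolute value. *)
pose gap (i : int * bool) u : R := (t i - fourier_coord i u) + `|t i - fourier_coord i u|.
pose d u : R := \sum_(i <- J) gap i u.
have gap0 i u : 0 <= gap i u by rewrite /gap; have := ler_norm (- (t i - fourier_coord i u)); rewrite normrN; lra.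
have d0 u : 0 <= d u by apply: sumr_ge0 => i _.
have cc i : continuous (fun u => t i - fourier_coord i u).
  move=> u; apply: continuousB; first exact: cst_continuous.
  rewrite /fourier_coord; case: (i.2); [exact: continuous_Re_fourier|exact: continuous_Im_fourier].
have cn i : continuous (fun u => `|t i - fourier_coord i u|).
  by move=> u; apply: (continuous_comp (cc i u)); exact: norm_continuous.
have cgap i : continuous (gap i) by move=> u; exact: (@continuousD R R (Hs s) _ _ u (cc i u) (cn i u)).
have cd : continuous d.
  rewrite /d; elim: (J) => [|i L ih] u.
    by under eq_fun do rewrite big_nil; exact: cst_continuous.
  by under eq_fun do rewrite big_cons; exact: (@continuousD R R (Hs s) _ _ u (cgap i u) (ih u)).
pose g (j : nat) u : R := expR (- d u) ^+ j.
have e1 u : 0 <= expR (- d u) <= 1 by rewrite expR_ge0 -expR0 ler_expR oppr_le0 d0.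
have g01 j u : 0 <= g j u <= 1.
  by have /andP[x0 x1] := e1 u; rewrite exprn_ge0//= exprn_ile1.
have cg j : continuous (g j).
  have ce : continuous (fun u => expR (- d u)).
    move=> u; apply: (continuous_comp (@continuousN R R (Hs s) _ u (cd u))); exact: continuous_expR.
  rewrite /g; elim: j => [|j ih] u; first exact: cst_continuous.
  by under eq_fun do rewrite exprS; exact: (@continuousM R (Hs s) _ _ u (ce u) (ih u)).
have boxE u : half_box J t (u : borelHs s) <-> d u = 0.
  split => [hu|du].
    rewrite /d big_seq big1// => i iJ; have := hu i iJ => ti.
    by rewrite /gap ler0_norm ?subr_le0// addrN.
  move=> i iJ; have /eqP gi : gap i u == 0.
    by move/eqP: du; rewrite /d psumr_eq0// => /allP /(_ i iJ).
  by rewrite -subr_le0; move: gi; rewrite /gap; have := normr_ge0 (t i - fourier_coord i u); lra.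
have lim (Q0 : probability (borelHs s) R) : (\int[Q0]_u (g j u)%:E)%E @[j --> \oo] --> Q0 (half_box J t).
  have -> : Q0 (half_box J t) = (\int[Q0]_u (\1_(half_box J t) u)%:E)%E.
    by rewrite integral_indic ?setIT//; exact: measurable_half_box.
  apply: (@dominated_cvg _ _ _ Q0 setT measurableT (fun j (u : borelHs s) => (g j u)%:E)
     (fun u => (\1_(half_box J t) u)%:E) (fun=> 1%E)).
  - by move=> j; apply/measurable_EFinP; exact: continuous_measurable_Hs.
  - move=> u _; apply: cvg_EFin; first by near=> j.
    rewrite indicE; case: (boolP (u \in half_box J t)) => [|uJ].
      rewrite inE => /boxE du; rewrite /g du oppr0 expR0.
      by under eq_fun do rewrite expr1n; exact: cvg_cst.
    apply: cvg_expr; rewrite ger0_norm ?expR_ge0// -expR0 ltr_expR oppr_lt0 lt_neqAle d0 andbT eq_sym.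
    by apply/eqP => du; move: uJ; rewrite notin_setE; apply; exact/boxE.
  - by [].
  - exact: (finite_measure_integrable_cst Q0 1).
  - by move=> j u _; have /andP[x0 x1] := g01 j u; rewrite /= lee_fin ger0_norm.
have := lim Q; under eq_fun do rewrite (h _ (cg _) (g01 _)).
by move=> l1; exact: (cvg_unique (@ereal_hausdorff R) l1 (lim Q')).
Unshelve. all: by end_near. Qed.

Lemma measurable_cylinder N (F : set ((N.*2.+1).-tuple (R * R))) : measurable F -> measurable (@cylinder R s N F).
Proof.
move=> mF.
pose T (u : borelHs s) : (N.*2.+1).-tuple (R * R) := [tuple
     let z := (japanese R (symfreq i))%:C * fourier (u : Hs s) (symfreq i) in
     (complex.Re z, complex.Im z) | i < N.*2.+1].
have mT : measurable_fun [set: borelHs s] T.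
  apply/measurable_fun_tnthP => i.
  rewrite (_ : _ \o _ = (fun u : borelHs s => coef (symfreq i) (u : Hs s))); first exact: measurable_coef.
  apply/funext => u; rewrite /= /T tnth_mktuple /coef.
  by case: (fourier (u : Hs s) (symfreq i)) => x y /=; rewrite !mul0r subr0 addr0.
by rewrite -[X in measurable X]setTI; exact: mT.
Qed.

Lemma cylinder_coef N (F : set ((N.*2.+1).-tuple (R * R))) (u v : Hs s) :
  (forall k, (`|k| <= N)%N -> fourier u k = fourier v k) ->
  cylinder F (u : borelHs s) -> cylinder F (v : borelHs s).
Proof.
move=> uv; pose T (w : Hs s) : (N.*2.+1).-tuple (R * R) := [tuple
     let z := (japanese R (symfreq i))%:C * fourier w (symfreq i) in
     (complex.Re z, complex.Im z) | i < N.*2.+1].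
have E : T u = T v.
  apply: eq_from_tnth => i; rewrite !tnth_mktuple uv// /symfreq; have := ltn_ord i; lia.
by move=> h; change (F (T v)); rewrite -E.
Qed.

Lemma half_box_cylinder (J : seq (int * bool)) (t : int * bool -> R) : exists N F,
  measurable F /\ half_box J t = @cylinder R s N F.
Proof.
pose N := \max_(i <- J) absz i.1.
pose idx k : 'I_(N.*2.+1) := inord (absz (k + N%:Z)).
have iN i : i \in J -> symfreq (idx i.1) = i.1.
  move=> iJ; have iN : (`|i.1| <= N)%N by exact: (@leq_bigmax_seq _ _ _ (fun i => absz i.1)).
  by rewrite /symfreq /idx inordK; lia.
pose F : set ((N.*2.+1).-tuple (R * R)) := [set T | forall i, i \in J ->
  t i * japanese R i.1 <= if i.2 then (tnth T (idx i.1)).1 else (tnth T (idx i.1)).2].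
exists N, F; split.
  rewrite (_ : F = \bigcap_(i in [set` J]) [set T |
     (t i * japanese R i.1 <= if i.2 then (tnth T (idx i.1)).1 else (tnth T (idx i.1)).2)%R])//.
  apply: fin_bigcap_measurable => // i _; rewrite -[X in measurable X]setTI.
  apply: (measurable_fun_ler _ _) => //; case: (i.2).
    exact: (measurableT_comp measurable_fst (measurable_tnth _)).
  exact: (measurableT_comp measurable_snd (measurable_tnth _)).
apply/seteqP; split => u /= hu i iJ; have := hu i iJ; rewrite tnth_mktuple iN// /fourier_coord;
  have j0 := japanese_gt0 R i.1; case: (fourier (u : Hs s) i.1) => x y /=.
  by rewrite !mul0r subr0 addr0 mulrC; case: (i.2); rewrite ler_pM2l.
by rewrite !mul0r subr0 addr0 mulrC; case: (i.2); rewrite ler_pM2l.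
Qed.

Lemma fourier_pinned m n u y k : k != m -> k != n -> fourier (pinned m n u y) k = fourier u k.
Proof. by move=> km kn; rewrite !fourier_set_mass_other// eq_sym. Qed.

Lemma set_massE k u (r x : R) :
  set_mass k u r x = u x + (fourier (set_mass k u r) k - fourier u k) * expi k x.
Proof. by rewrite /set_mass fourier_set_mode eqxx. Qed.

(** What makes a dominating function uniform in y possible. *)
Lemma cut_pinned m n u y : m != n -> cut [:: m; n] (pinned m n u y) = cut [:: m; n] u.
Proof.
move=> mn; apply: Hs_eq => x; rewrite !cutE !big_cons !big_nil !addr0 /pinned.
set v := set_mass m u _; set w := set_mass n v _.
have wE := set_massE n v (mass2 m n u y) x; have vE := set_massE m u (mass1 m n u y) x.
rewrite -/v in vE; rewrite -/w in wE.
have wm : fourier w m = fourier v m by rewrite fourier_set_mass_other// eq_sym.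
have vn : fourier v n = fourier u n by rewrite fourier_set_mass_other.
by rewrite wE vE wm vn; ring.
Qed.

End laws_on_Hs.

(** * Gibbs weights *)

Section gibbs_weights.
Variables (R : realType) (s p : R).
Hypotheses (s0 : 0 < s) (s12 : s < 2^-1) (p2 : 2 < p) (sp : (2^-1 - s) * p < 1).
Implicit Types (u v : Hs s) (m n : int) (y : R * R) (focusing : bool).

Lemma rest_mass_cut m n u : m != n -> rest_mass m n u = mass (cut [:: m; n] u).
Proof.
move=> mn; rewrite mass_cut /= ?inE ?mn//.
by rewrite !big_cons big_nil addr0 /rest_mass /mode_mass opprD addrA.
Qed.

Lemma Lp_le_sup u (r : R) : 0 <= r -> (forall x, normc (u x) <= r) -> Lp p u <= r `^ p.
Proof.
move=> r0 h; rewrite -lee_fin -(LpE s0 s12 p2 sp).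
apply: (@le_trans _ _ (\int[@lebesgue_measure R]_(x in `[0%R, 1%R]) (r `^ p)%:E)%E).
  apply: ge0_le_integral.
  - exact: measurable_itv.
  - by move=> x _; rewrite lee_fin powR_ge0.
  - by apply/measurable_EFinP; apply: measurable_funTS; exact: measurable_Lp.
  - exact: measurable_cst.
  - move=> x _; rewrite lee_fin; apply: ge0_ler_powR; rewrite ?nnegrE ?normc_ge0//.
    by rewrite ltW// (lt_trans _ p2).
rewrite integral_cst//.
rewrite [X in (_ * X)%E]lebesgue_measure_itv /=.
by rewrite lte_fin ltr01 -EFinB subr0 mule1.
Qed.

Lemma mode_mass_pinned m n u y : m != n -> mode_mass m u != 0 -> mode_mass n u != 0 ->
  0 < mass1 m n u y -> 0 < mass2 m n u y ->
  mode_mass m (pinned m n u y) = mass1 m n u y /\ mode_mass n (pinned m n u y) = mass2 m n u y.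
Proof.
move=> mn um un h1 h2; split.
  by rewrite mode_mass_set_mass_other 1?eq_sym// mode_mass_set_mass ?ltW.
by rewrite mode_mass_set_mass ?ltW// mode_mass_set_mass_other.
Qed.

(** The pinned element is its cut, which is that of u, plus two modes of total mass at most y.1; by
    t <= 1 + t^2 their sum is bounded by 2 + y.1. *)
Lemma Lp_pinned_le m n u y : m != n -> mode_mass m u != 0 -> mode_mass n u != 0 ->
  0 < mass1 m n u y -> 0 < mass2 m n u y ->
  Lp p (pinned m n u y) <= 2 `^ p * Lp p (cut [:: m; n] u) + 2 `^ p * (2 + y.1) `^ p.
Proof.
move=> mn um un h1 h2; set v := pinned m n u y.
have [e1 e2] := mode_mass_pinned mn um un h1 h2; rewrite -/v in e1 e2.
have r0 : 0 <= rest_mass m n u by rewrite rest_mass_cut// mass_ge0.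
have yE : mass1 m n u y + mass2 m n u y = y.1 - rest_mass m n u by rewrite /mass2; ring.
have uJ : uniq [:: m; n] by rewrite /= inE mn.
have hw x : normc (trunc [:: m; n] v x) <= 2 + y.1.
  rewrite truncE; apply: (le_trans (normc_le1sum _ _ _)); rewrite !big_cons big_nil addr0.
  have h k : normc (fourier v k) <= 1 + mode_mass k v.
    by rewrite /mode_mass; have := sqr_ge0 (normc (fourier v k) - 1); have := sqr_ge0 (normc (fourier v k)); lra.
  by have := h m; have := h n; rewrite e1 e2; lra.
have y0 : 0 <= 2 + y.1 by apply: le_trans (normc_ge0 _) (hw 0).
have h x : normc (v x) <= normc (cut [:: m; n] v x) + normc (trunc [:: m; n] v x).
  by apply: le_trans (le_normcD _ _); rewrite cutE truncE subrK.
have := Lp_add_le s0 s12 p2 sp ltr01 h; rewrite invr1 (_ : 1 + 1 = 2 :> R)// => h3.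
apply: (le_trans h3); rewrite /v cut_pinned//; apply: lerD => //.
by rewrite ler_wpM2l ?powR_ge0//; exact: Lp_le_sup.
Qed.

Definition weight focusing u : R := expR ((if focusing then 1 else -1) / p * Lp p u).

Lemma gibbs_weightE focusing u : gibbs_weight focusing p (u : borelHs s) = (weight focusing u)%:E.
Proof. by rewrite /gibbs_weight (LpE s0 s12 p2 sp). Qed.

Lemma weight_gt0 focusing u : 0 < weight focusing u. Proof. exact: expR_gt0. Qed.

Lemma continuous_weight focusing : continuous (weight focusing).
Proof.
move=> u; rewrite /weight.
have cc : continuous (fun _ : Hs s => (if focusing then 1 else -1) / p : R) by move=> v; exact: cst_continuous.
have cL := continuous_Lp s0 s12 p2 sp.
apply: (continuous_comp (@continuousM R (Hs s) _ _ u (cc u) (cL u))); exact: continuous_expR.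
Qed.

Variables (P : probability (borelHs s) R) (a b : R).
Hypotheses (wP : wiener P) (a0 : 0 < a).

(** The defocusing weight is at most 1. In the focusing case [Lp_pinned_le] costs a factor 2^p in
    the exponent, whence kap = 2^p / p; for y.1 within a of a, the cut of u has mass at most a + a,
    whence the mass bound. *)
Lemma pinnable_weight m n focusing (f : Hs s -> R) (M : R) : m != n ->
  (focusing -> p <= 6) -> (focusing -> p = 6 -> 2 `^ p / p * chain_slope R * (a + a) ^+ 2 <= 1) ->
  continuous f -> (forall u, 0 <= f u <= M) ->
  pinnable P a b m n ((fun u => weight focusing u * f u) : borelHs s -> R).
Proof.
move=> mn fp6 fa cf fM.
have cw := @continuous_weight focusing.
have cwf : continuous (fun u => weight focusing u * f u).
  by move=> u; exact: (@continuousM R (Hs s) _ _ u (cw u) (cf u)).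
have M0 : 0 <= M by have /andP[x0 x1] := fM (@Hs0 R s); exact: le_trans x1.
have p0 : 0 < p by exact: lt_trans p2.
split.
- exact: continuous_measurable_Hs.
- by move=> u; have /andP[x0 _] := fM u; rewrite mulr_ge0// ltW// weight_gt0.
- move=> g u g1 g2 _ _ _ _.
  exact: (@cvg_comp _ _ _ (fun j => pinned m n u (g j)) _ _ _ _ (@pinned_cvg _ _ _ _ u g (a, b) mn g1 g2) (cwf _)).
case: focusing fp6 fa cw cwf => fp6 fa _ _; last first.
  exists (fun=> M), 1; split => //; first exact: integrable_cst_prob.
  move=> u y _ _ _ _ _ _; have /andP[x0 x1] := fM (pinned m n u y); apply: (le_trans _ x1).
  rewrite ler_piMl// /weight -[X in _ <= X]expR0 ler_expR !mulNr oppr_le0 div1r mulr_ge0 ?invr_ge0 ?(ltW p0)//.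
  exact: Lp_ge0.
pose kap := 2 `^ p / p; have kap0 : 0 < kap by rewrite divr_gt0// powR_gt0.
pose cc := M * expR (kap * (2 + (a + a)) `^ p).
have cc0 : 0 <= cc by rewrite mulr_ge0// expR_ge0.
have aa0 : 0 < a + a by rewrite addr_gt0.
have uJ : uniq [:: m; n] by rewrite /= inE mn.
have int := exp_Lp_integrable s0 s12 p2 sp (fp6 isT) wP uJ kap0 aa0 (fa isT).
exists (fun u : borelHs s => cc * (\1_[set u : borelHs s | mass (cut [:: m; n] (u : Hs s)) <= a + a] u *
   expR (kap * Lp p (cut [:: m; n] (u : Hs s))))), a; split => //.
  have := integrableZl measurableT cc int; congr (P.-integrable _ _).
move=> u y y1 _ um un h1 h2.
have r0 : 0 <= rest_mass m n u by rewrite rest_mass_cut// mass_ge0.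
have yE : mass1 m n u y + mass2 m n u y = y.1 - rest_mass m n u by rewrite /mass2; ring.
have ya : y.1 < a + a by move: y1; rewrite ltr_distl => /andP[].
have uA : mass (cut [:: m; n] u) <= a + a by rewrite -rest_mass_cut//; lra.
rewrite indicE mem_set// mul1r /cc.
have /andP[x0 x1] := fM (pinned m n u y).
have hw : weight true (pinned m n u y) <= expR (kap * (2 + (a + a)) `^ p) * expR (kap * Lp p (cut [:: m; n] u)).
  rewrite /weight -expRD ler_expR div1r -mulrDr /kap [2 `^ p / p]mulrC -mulrA.
  rewrite ler_wpM2l ?invr_ge0 ?(ltW p0)//; apply: (le_trans (Lp_pinned_le mn um un h1 h2)).
  rewrite mulrDr addrC lerD2r ler_wpM2l ?powR_ge0//.
  by apply: ge0_ler_powR; rewrite ?nnegrE ?(ltW p0)//; lra.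
rewrite -mulrA mulrC; apply: ler_pM => //.
by rewrite ltW// weight_gt0.
Qed.

End gibbs_weights.

(** * Convergence of the conditioned and of the Gibbs measures *)

Section conditioned_limits.
Variables (R : realType) (s : R) (P : probability (borelHs s) R) (a b : R) (A B : R -> set R).
Hypotheses (wP : wiener P) (a0 : 0 < a) (shA : shrinks_nicely A a) (shB : shrinks_nicely B b).
Variable Pe : R -> probability (borelHs s) R.
Hypothesis cond : \forall e \near 0^'+, conditional_at P A B e (Pe e).
Implicit Types (m n : int) (Q mu : probability (borelHs s) R) (Psi h : borelHs s -> R).

Let law m n Q := forall h, measurable_fun [set: borelHs s] h -> (forall u : Hs s, 0 <= h u) ->
  (\int[Q]_u (h u)%:E = (pinned_value m n P (a, b) (fun=> 1))^-1%:E * pinned_integral m n P h (a, b))%E.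

(** Bounded continuous functions are pinnable for every pair, so both laws are limits of the same
    family [Pe] against them. *)
Lemma pinned_law_unique m n m' n' Q Q' : m != n -> m' != n' -> law m n Q -> law m' n' Q' ->
  forall E, measurable E -> Q E = Q' E.
Proof.
move=> mn mn' hQ hQ'; apply: Hs_prob_eq_continuous => f cf f01.
have [_ -> l] := conditional_limit wP a0 shA shB mn (pinnable_continuous P a b mn cf f01) cond hQ.
have [_ -> l'] := conditional_limit wP a0 shA shB mn' (pinnable_continuous P a b mn' cf f01) cond hQ'.
by congr EFin; exact: (cvg_unique (@Rhausdorff R) l l').
Qed.

Lemma pinned_cylinder_limit m n Q : m != n -> law m n Q -> cylinder_limit Pe Q.
Proof.
move=> mn hQ N F mF; have mC : measurable (@cylinder R s N F) by exact: measurable_cylinder.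
(* Modes outside the range of the cylinder, whose indicator is then invariant under pinning. *)
pose m' : int := N.+1; pose n' : int := N.+2.
have mn' : m' != n' by rewrite /m' /n'; lia.
have [Q' hQ'] := pinned_law wP a0 shA shB mn'.
have pin : pinnable P a b m' n' (\1_(@cylinder R s N F)).
  apply: (@pinnable_bounded _ _ _ _ _ _ _ _ 1); first exact: measurable_indic.
    by move=> u; rewrite indicE; case: (_ \in _); rewrite /= ?lexx ?ler01.
  move=> u y; rewrite !indicE; congr (_%:R); congr nat_of_bool.
  have same k : (`|k| <= N)%N -> fourier (pinned m' n' u y) k = fourier u k.
    by move=> kN; rewrite fourier_pinned//; apply/eqP => kE; move: kN; rewrite kE /m' /n'; lia.
  apply/idP/idP; rewrite !inE; apply: cylinder_coef => k kN; rewrite same//.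
have IE Q0 : (\int[Q0]_u (\1_(@cylinder R s N F) u)%:E = Q0 (cylinder F))%E.
  by rewrite integral_indic ?setIT.
have [nearE QE l] := conditional_limit wP a0 shA shB mn' pin cond hQ'.
rewrite (pinned_law_unique mn mn' hQ hQ' mC) -IE QE.
apply: cvg_EFin.
  by apply: filterS nearE => e; rewrite IE => ->.
by apply: cvg_trans l; apply: near_eq_cvg; apply: nearW => e; rewrite /= IE.
Qed.

Lemma cylinder_limit_unique Q Q' : cylinder_limit Pe Q -> cylinder_limit Pe Q' ->
  forall E, measurable E -> Q E = Q' E.
Proof.
move=> hQ hQ'; apply: Hs_prob_eq => J t; have [N [F [mF ->]]] := half_box_cylinder s J t.
exact: (cvg_unique (@ereal_hausdorff R) (hQ N F mF) (hQ' N F mF)).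
Qed.

(** Reduces weak convergence to nonnegative test functions, for which the limits above are
    stated. *)
Lemma integral_shift mu (f : borelHs s -> R) (M : R) : measurable_fun [set: borelHs s] f ->
  (forall u, `|f u| <= M) -> (\int[mu]_u (f u)%:E = \int[mu]_u (f u + M)%:E - M%:E)%E.
Proof.
move=> mf fM.
have M1 : (\int[mu]_u M%:E = M%:E)%E.
  by rewrite (integral_cst mu measurableT M%:E) [X in (_ * X)%E](probability_setT mu) mule1.
have iM : mu.-integrable setT (EFin \o (fun=> M)) by exact: integrable_cst_prob.
have i1 : mu.-integrable setT (EFin \o f).
  apply: (le_integrable measurableT _ _ iM); first exact/measurable_EFinP.
  by move=> u _ /=; rewrite lee_fin (le_trans (fM u))// ler_norm.
under [in RHS]eq_integral do rewrite EFinD.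
rewrite (integralD measurableT i1 iM) M1 addeK//.
Qed.

Variables (p : R) (focusing : bool).
Hypotheses (s0 : 0 < s) (s12 : s < 2^-1) (p2 : 2 < p) (sp : (2^-1 - s) * p < 1).
Hypotheses (fp6 : focusing -> p <= 6)
  (fa : focusing -> p = 6 -> 2 `^ p / p * chain_slope R * (a + a) ^+ 2 <= 1).
Local Notation w := (weight p focusing : borelHs s -> R).

Lemma measurable_weight : measurable_fun [set: borelHs s] w.
Proof. exact: continuous_measurable_Hs (@continuous_weight _ _ _ s0 s12 p2 sp focusing). Qed.

Lemma partition_functionE Q : partition_function focusing p Q = (\int[Q]_u (w u)%:E)%E.
Proof. by apply: eq_integral => u _; rewrite (gibbs_weightE s0 s12 p2 sp). Qed.

(** A Gibbs expectation is the quotient of the integrals of w g and of w. Both converge because w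
    times a bounded nonnegative continuous function is pinnable, and the limit of the denominator is
    positive. *)
Lemma conditioned_gibbs m n Q : m != n -> law m n Q ->
  exists (mue : R -> probability (borelHs s) R) mu,
  [/\ gibbs focusing p Q mu, mu `<< Q, \forall e \near 0^'+, gibbs focusing p (Pe e) (mue e) &
      weak_limit mue mu].
Proof.
move=> mn hQ.
have mw := measurable_weight.
have w0 u : 0 < w u by exact: weight_gt0.
have pinw (f : Hs s -> R) (M : R) : continuous f -> (forall u, 0 <= f u <= M) ->
    pinnable P a b m n (fun u : borelHs s => w u * f (u : Hs s)).
  by move=> cf fM; exact: (pinnable_weight s0 s12 p2 sp b wP a0 mn fp6 fa cf fM).
have c1 : continuous (fun _ : Hs s => 1 : R) by move=> u; exact: cst_continuous.
have w1 : (fun u : borelHs s => w u * 1) = w by apply/funext => u; rewrite mulr1.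
have pin1 : pinnable P a b m n w.
  by rewrite -w1; apply: (@pinw (fun=> 1) 1 c1) => u; rewrite ler01 lexx.
have [near1 Q1 l1] := conditional_limit wP a0 shA shB mn pin1 cond hQ.
have gibbsP Q0 mu0 : (\int[Q0]_u (w u)%:E < +oo)%E ->
    (forall E, measurable E -> mu0 E = ((fine (\int[Q0]_u (w u)%:E))^-1%:E * \int[Q0]_(u in E) (w u)%:E)%E) ->
    gibbs focusing p Q0 mu0.
  move=> fin0 h0; split; rewrite partition_functionE//; first exact: integral_pos_gt0.
  move=> E mE; rewrite h0//; congr (_ * _)%E.
  by apply: eq_integral => u _; rewrite (gibbs_weightE s0 s12 p2 sp).
have Qfin : (\int[Q]_u (w u)%:E < +oo)%E by rewrite Q1 ltry.
have [mu hmu] := tilt_exists Q mw w0; have [hmu1 hmu2 hmu3] := hmu Qfin.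
have [mue hmue] := boolp.choice (fun e => tilt_exists (Pe e) mw w0).
have nearfin : \forall e \near 0^'+, (\int[Pe e]_u (w u)%:E < +oo)%E.
  by apply: filterS near1 => e ->; rewrite ltry.
exists mue, mu; split => //.
- exact: gibbsP.
- by apply: filterS nearfin => e fe; apply: gibbsP => //; have [] := hmue e fe.
move=> f cf [M fM].
have mf := continuous_measurable_Hs cf.
pose g u : R := f u + M.
have cM : continuous (fun _ : Hs s => M) by move=> u; exact: cst_continuous.
have cg : continuous g by move=> u; exact: (@continuousD R R (Hs s) _ _ u (cf u) (cM u)).
have g0 u : 0 <= g u <= M + M.
  have := fM u; rewrite ler_norml /g; by rewrite -lerBlDr sub0r lerD2r => /andP[-> ->].
have g0' u : 0 <= g u by case/andP: (g0 u).
have mg := continuous_measurable_Hs cg.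
have [near2 Q2 l2] := conditional_limit wP a0 shA shB mn (pinw g _ cg g0) cond hQ.
have muE : (\int[mu]_u (f u)%:E = ((fine (\int[Q]_u (w u)%:E))^-1 * fine (\int[Q]_u (w u * g u)%:E) - M)%:E)%E.
  by rewrite (integral_shift _ mf fM) (hmu3 _ mg g0') Q2 EFinB EFinM.
have mueE : \forall e \near 0^'+, (\int[mue e]_u (f u)%:E)%E =
    ((fine (\int[Pe e]_u (w u)%:E))^-1 * fine (\int[Pe e]_u (w u * g u)%:E) - M)%:E.
  apply: filterS2 nearfin near2 => e fe e2; have [_ _ h3] := hmue e fe.
  by rewrite (integral_shift _ mf fM) (h3 _ mg g0') e2 EFinB EFinM.
rewrite muE; apply: cvg_EFin; first by apply: filterS mueE => e ->.
apply: (@cvg_trans _ (((fine (\int[Pe e]_u (w u)%:E))^-1 * fine (\int[Pe e]_u (w u * g u)%:E) - M)%R @[e --> 0^'+])).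
  by apply: near_eq_cvg; apply: filterS mueE => e /= ->.
apply: cvgB; last exact: cvg_cst.
apply: cvgM => //; apply: cvgV => //.
have := integral_pos_gt0 Q mw w0; rewrite Q1 lte_fin => h; by rewrite gt_eqF.
Qed.

End conditioned_limits.

(** At p = 6 the left side is (2/3) (64 [chain_slope] a) a, and a <= 1 because [chain_slope] is at
    least 1. *)
Lemma small_mass_condition (R : realType) (a p : R) : 0 < a -> p = 6 -> a < (64 * chain_slope R)^-1 ->
  2 `^ p / p * chain_slope R * (a + a) ^+ 2 <= 1.
Proof.
move=> a0 -> ha; have c0 := @chain_slope_gt0 R.
have c1 : 1 <= chain_slope R by rewrite /chain_slope; have := sqr_ge0 (24 * (12 * 64) : R); lra.
have ca : a * (64 * chain_slope R) < 1 by rewrite -ltr_pdivlMr ?mulr_gt0// div1r.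
rewrite powR_mulrn//.
have a1 : a <= 1 by nra.
move: (chain_slope R) c0 c1 ca => c c0 c1 ca.
rewrite (_ : 2 ^+ 6 / 6 * c * (a + a) ^+ 2 = (2 / 3) * (a * (64 * c) * a)); last by field.
have : a * (64 * c) * a <= 1 * 1 by apply: ler_pM => //; rewrite ?mulr_ge0 ?ltW// mulr_gt0.
lra.
Qed.

Theorem theorem1 (R : realType) :
  exists a0 : R, 0 < a0 /\
  forall (a b p : R) (focusing : bool), 0 < a -> 2 < p ->
    (focusing -> p <= 6) -> (focusing -> p = 6 -> a < a0) ->
  forall gamma : R, 0 < gamma -> gamma < p^-1 ->
  forall A B : R -> set R, shrinks_nicely A a -> shrinks_nicely B b ->
  forall (d : measure_display) (Omega : measurableType d)
    (Pr : probability Omega R) (g : int -> {RV Pr >-> (R * R)%type})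
    (u : {RV Pr >-> borelHs (2^-1 - gamma)}),
    (forall n, standard_complex_gaussian (g n)) -> independent_RVs g ->
    gauss_fourier_series g u ->
  exists (P_ mu_ : R -> probability (borelHs (2^-1 - gamma)) R)
    (P0 mu0 : probability (borelHs (2^-1 - gamma)) R),
    [/\ \forall e \near 0^'+, elementary_conditional (distribution Pr u)
          (mass_momentum_event (A e) (B e)) (P_ e),
        cylinder_limit P_ P0 /\
        (forall Q : probability (borelHs (2^-1 - gamma)) R,
          cylinder_limit P_ Q -> forall E, measurable E -> Q E = P0 E),
        gibbs focusing p P0 mu0 /\ mu0 `<< P0,
        \forall e \near 0^'+, gibbs focusing p (P_ e) (mu_ e) &
        weak_limit mu_ mu0].
Proof.
exists (64 * chain_slope R)^-1; split; first by rewrite invr_gt0 mulr_gt0// chain_slope_gt0.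
move=> a b p focusing a0 p2 fp6 fpa gamma g0 gp A B shA shB d Omega Pr g u gg ig gu.
have wP := wiener_distribution gg ig gu.
have p0 : 0 < p by exact: lt_trans p2.
have pV : p^-1 < 2^-1 by rewrite ltf_pV2 ?posrE.
have s0 : 0 < 2^-1 - gamma by rewrite subr_gt0 (lt_trans gp).
have s12 : 2^-1 - gamma < 2^-1 by rewrite gtrBl.
have sp : (2^-1 - (2^-1 - gamma)) * p < 1 by rewrite subKr -ltr_pdivlMr// div1r.
have fa : focusing -> p = 6 -> 2 `^ p / p * chain_slope R * (a + a) ^+ 2 <= 1.
  by move=> fo p6; exact: small_mass_condition (fpa fo p6).
(* An arbitrary pair; the law obtained is the same for all pairs. *)
have mn : (0 : int) != 1 by [].
have [Pe cond] := conditional_family wP a0 shA shB.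
have [P0 hP0] := pinned_law wP a0 shA shB mn.
have [mue [mu [h1 h2 h3 h4]]] := conditioned_gibbs wP a0 shA shB cond s0 s12 p2 sp fp6 fa mn hP0.
have cyl := pinned_cylinder_limit wP a0 shA shB cond mn hP0.
exists Pe, mue, P0, mu; split => //.
- by apply: filterS cond => e [].
- by split => // Q hQ; exact: cylinder_limit_unique hQ cyl.
Qed.
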